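(* For $u\in U_{\mathbb{F}}$ there are $k_\alpha\in\Lambda\cup\{-\infty\}$ for $\alpha\in\Sigma_{>0}$ such that $$\{p\in\mathbb{A}:u.p\in\mathbb{A}\}=\{a.o\in\mathbb{A}:k_\alpha\le(-v)(\chi_\alpha(a))\text{ for all }\alpha\in\Sigma_{>0}\},$$ and therefore the set of fixed points is a finite intersection of half-apartments. If $u=u_1\cdot\ldots\cdot u_k$ for $u_i\in(U_{\alpha_i})_{\mathbb{F}}$ with $\Sigma_{>0}=\{\alpha_1,\ldots,\alpha_k\}$ such that $\alpha_1>\ldots>\alpha_k$, then $k_{\alpha_i}=\varphi_{\alpha_i}(u_i)$. If $u$ fixes all of $\mathbb{A}$, then $u=\operatorname{Id}$.
   Context: Let $\mathbb{K},\mathbb{F}$ be real closed fields with $\mathbb{K}\subseteq\mathbb{R}\cap\mathbb{F}$ and $\mathbb{F}$ non-Archimedean. Let $O\subsetneq\mathbb{F}$ be an order convex subring ($a,b\in O$ and $a\le c\le b$ imply $c\in O$); it is a valuation ring. Let $\Lambda=\mathbb{F}^\times/O^\times$, written additively, and let $v:\mathbb{F}\to\Lambda\cup\{\infty\}$ be the associated valuation, with $\Lambda$ ordered so that $(-v)(a)\ge(-v)(b)$ whenever $a\ge b>0$; thus $O=\{a:(-v)(a)\le 0\}$ and $(-v)(0)=-\infty$. The ordered abelian group $\Lambda$ is divisible, hence a $\mathbb{Q}$-vector space. For a semialgebraic set $V$ defined over $\mathbb{K}$, $V_{\mathbb{F}}$ denotes its $\mathbb{F}$-extension. $G<\operatorname{SL}_n$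 is a connected semisimple algebraic group over $\mathbb{K}$, self-adjoint ($g\in G$ implies $g^{\mathsf T}\in G$). $S<G$ is a maximal $\mathbb{K}$-split torus with $s=s^{\mathsf T}$ for all $s\in S$; $A_{\mathbb{F}}$ is the $\mathbb{F}$-extension of the semialgebraic connected component of $S_{\mathbb{K}}$ containing $\operatorname{Id}$; $K_{\mathbb{F}}=G_{\mathbb{F}}\cap\operatorname{SO}_n(\mathbb{F})$. Let $\mathfrak{g}=\operatorname{Lie}(G_{\mathbb{R}})$, $\mathfrak{a}=\operatorname{Lie}(A_{\mathbb{R}})$; $\Sigma\subseteq\mathfrak{a}^\star$ is the (possibly non-reduced) root system of $\mathfrak{g}$ with respect to $\mathfrak{a}$, with root spaces $\mathfrak{g}_\alpha$ ($\mathfrak{g}_{2\alpha}=0$ if $2\alpha\notin\Sigma$). For $\alpha\in\Sigma$, $\chi_\alpha:A_{\mathbb{F}}\to\mathbb{F}_{>0}$ is the restriction of the algebraic character of $S$ over $\mathbb{K}$ which over $\mathbb{R}$ satisfies $\chi_\alpha(\exp H)=e^{\alpha(H)}$, $H\in\mathfrak{a}$. Fix a basis $\Delta$ of $\Sigma$ with positive roots $\Sigma_{>0}$, and let $>$ be a total order on $\Sigma$ with positive elements $\Sigma_{>0}$, obtained by ordering $\Delta$ and extending lexicographically. Let $A^+_{\mathbb{F}}=\{a\in A_{\mathbb{F}}:\chi_\alpha(a)\ge1\ \forall\alpha\in\Delta\}$, $U_{\mathbb{F}}=\exp(\bigoplus_{\alpha\in\Sigma_{>0}}(\mathfrak{g}_\alpha)_{\mathbb{F}})$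 and, for $\alpha\in\Sigma$, $(U_\alpha)_{\mathbb{F}}=\exp((\mathfrak{g}_\alpha)_{\mathbb{F}}\oplus(\mathfrak{g}_{2\alpha})_{\mathbb{F}})$. The root group valuation $\varphi_\alpha:(U_\alpha)_{\mathbb{F}}\to\Lambda\cup\{-\infty\}$ is defined for $X\in(\mathfrak{g}_\alpha)_{\mathbb{F}}$, $X'\in(\mathfrak{g}_{2\alpha})_{\mathbb{F}}$ (viewed as $n\times n$ matrices over $\mathbb{F}$) by $$\varphi_\alpha(\exp(X+X'))=\max\Big\{\max_{i,j}\{(-v)(X_{ij})\},\ \tfrac12\max_{i,j}\{(-v)(X'_{ij})\}\Big\}.$$ $G_{\mathbb{F}}$ acts on symmetric positive definite matrices of determinant $1$ over $\mathbb{F}$ by $g.x=gxg^{\mathsf T}$, and $\mathcal{X}_{\mathbb{F}}=G_{\mathbb{F}}.\operatorname{Id}$. For $x=g.\operatorname{Id}$, $y=h.\operatorname{Id}$, $\delta_{\mathbb{F}}(x,y)$ is the unique $a\in A^+_{\mathbb{F}}$ with $g^{-1}h\in K_{\mathbb{F}}aK_{\mathbb{F}}$. For $a\in A_{\mathbb{F}}$, $N_{\mathbb{F}}(a)=\prod_{\alpha\in\Sigma}\max\{\chi_\alpha(a),\chi_\alpha(a)^{-1}\}$, and $d(x,y)=(-v)(N_{\mathbb{F}}(\delta_{\mathbb{F}}(x,y)))\in\Lambda$, a $G_{\mathbb{F}}$-invariant pseudo-distance. $\mathcal{B}=\mathcal{X}_{\mathbb{F}}/\!\sim$ with $x\sim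 y$ iff $d(x,y)=0$, with the induced $G_{\mathbb{F}}$-action; $o\in\mathcal{B}$ is the class of $\operatorname{Id}$; $\mathbb{A}=A_{\mathbb{F}}.o\subseteq\mathcal{B}$. Half-apartments of $\mathbb{A}$ are the sets $\{a.o\in\mathbb{A}:(-v)(\chi_\beta(a))\ge\ell\}$ with $\beta\in\Sigma$, $\ell\in\Lambda$ (a condition with $k_\alpha=-\infty$ is empty). For $u\in U_{\mathbb{F}}$ and $p\in\mathbb{A}$, $u.p\in\mathbb{A}$ holds iff $u.p=p$.
   Formalization: In the sentence giving k_{α_i}=φ_{α_i}(u_i), it is additionally assumed that when α and 2α are both roots, either the factor in U_{2α} is Id or the factor in U_α lies in exp(g_α); otherwise exp(−X')·exp(X')=Id with X' in g_{2α} is a counterexample. *)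

(* Defs.v *)
From HB Require Import structures.
From mathcomp Require Import all_boot all_order all_algebra generic_quotient.
From mathcomp Require Import boolp classical_sets functions fsbigop reals.
From mathcomp Require Import topology normedtype sequences exp.
From mathcomp Require Import complex.
From mathcomp Require mpoly.

Set Implicit Arguments.
Unset Strict Implicit.
Unset Printing Implicit Defensive.

Import Order.TTheory GRing.Theory Num.Theory numFieldNormedType.Exports.

Local Open Scope classical_set_scope.
Local Open Scope ring_scope.
Local Open Scope quotient_scope.

Record convexSubring (F : rcfType) := ConvexSubring {
  csr_mem :> {pred F};
  csr_subring : GRing.subring_closed csr_mem;
  csr_convex : forall a b c : F,
    a \in csr_mem -> b \in csr_mem -> a <= c <= b -> c \in csr_mem;
  csr_proper : exists x : F, x \notin csr_mem }.

Section ValueGroup.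
Variables (F : rcfType) (O : convexSubring F).

Let nzF := {x : F | x != 0}.

Let O1 : 1 \in O. Proof. by case: (csr_subring O). Qed.
Let OM : {in O &, forall x y, x * y \in O}.
Proof. by case: (csr_subring O). Qed.
Let ON1 : -1 \in O.
Proof.
have [_ OB _] := csr_subring O.
by rewrite -[-1]add0r -[0](subrr (1 : F)) !OB ?O1.
Qed.

Lemma csr_total (x : F) : x != 0 -> (x \in O) || (x^-1 \in O).
Proof.
move=> x0; case: (leP `|x| 1) => [|/ltW x1].
  by rewrite ler_norml => /(csr_convex ON1 O1) ->.
apply/orP; right; apply: (csr_convex ON1 O1).
by rewrite -ler_norml normfV invf_le1 // normr_gt0.
Qed.

(* [x] and [y] differ by a unit of [O] *)
Definition nz_eqv (x y : nzF) : bool :=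
  (val x / val y \in O) && (val y / val x \in O).

Let div_trans (y x z : F) : y != 0 -> x / y \in O -> y / z \in O -> x / z \in O.
Proof. by move=> y0 xy yz; have := OM xy yz; rewrite mulrA divfK. Qed.

Let eqv_refl : reflexive nz_eqv.
Proof. by move=> x; rewrite /nz_eqv divff ?O1 //; case: x. Qed.
Let eqv_sym : symmetric nz_eqv.
Proof. by move=> x y; rewrite /nz_eqv andbC. Qed.
Let eqv_trans : transitive nz_eqv.
Proof.
move=> y x z /andP[xy yx] /andP[yz zy].
by apply/andP; split; apply: (@div_trans (val y)) => //; case: (y).
Qed.

Canonical nz_equiv := EquivRel nz_eqv eqv_refl eqv_sym eqv_trans.

(* The multiplicative group F^* / O^*, written additively. *)
Definition Lambda := {eq_quot nz_equiv}.

HB.instance Definition _ := Choice.on Lambda.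

Let nz1 : nzF := exist _ 1 (oner_neq0 F).
Let nzM (x y : nzF) : nzF := exist _ (val x * val y) (mulf_neq0 (valP x) (valP y)).
Let nzV_subproof (x : nzF) : (val x)^-1 != 0.
Proof. by rewrite invr_eq0; exact: valP x. Qed.
Let nzV (x : nzF) : nzF := exist _ (val x)^-1 (nzV_subproof x).

Let cl (x : nzF) : Lambda := \pi_Lambda x.

Let clP (x y : nzF) : reflect (cl x = cl y) (nz_eqv x y).
Proof. by apply: (iffP idP) => [h|/eqmodP //]; apply/eqmodP. Qed.
Let clK (l : Lambda) : cl (repr l) = l. Proof. exact: reprK. Qed.
Let eqvK (x : nzF) : nz_eqv (repr (cl x)) x. Proof. by apply/clP; rewrite clK. Qed.

Definition Lambda0 : Lambda := cl nz1.
Definition Lambda_add (l m : Lambda) : Lambda := cl (nzM (repr l) (repr m)).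
Definition Lambda_opp (l : Lambda) : Lambda := cl (nzV (repr l)).
(* [x] <= [y] iff y / x lies in O: larger elements of F have smaller value [v]. *)
Definition Lambda_le (l m : Lambda) : bool := val (repr m) / val (repr l) \in O.

Let clM (x y : nzF) : Lambda_add (cl x) (cl y) = cl (nzM x y).
Proof.
apply/clP; have /andP[a b] := eqvK x; have /andP[c d] := eqvK y.
by apply/andP; split; rewrite /= invfM mulrACA OM.
Qed.
Let clV (x : nzF) : Lambda_opp (cl x) = cl (nzV x).
Proof.
apply/clP; have /andP[a b] := eqvK x.
by apply/andP; split; rewrite /= invrK mulrC.
Qed.
Let cl_le (x y : nzF) : Lambda_le (cl x) (cl y) = (val y / val x \in O).
Proof.
move: (eqvK x) (eqvK y); rewrite /Lambda_le /nz_eqv => /andP[a b] /andP[c d].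
have nz (z : nzF) : val z != 0 by case: z.
apply/idP/idP => h.
  by apply: (div_trans (nz (repr (cl y)))) => //; apply: (div_trans (nz (repr (cl x)))).
by apply: (div_trans (nz y)) => //; apply: (div_trans (nz x)).
Qed.

Let eq_cl (x y : nzF) : val x = val y -> cl x = cl y.
Proof. by move=> /val_inj ->. Qed.

Fact Lambda_addA : associative Lambda_add.
Proof.
move=> l m p; rewrite -[l]clK -[m]clK -[p]clK !clM.
by apply: eq_cl; rewrite /= mulrA.
Qed.
Fact Lambda_addC : commutative Lambda_add.
Proof.
by move=> l m; rewrite -[l]clK -[m]clK !clM; apply: eq_cl; rewrite /= mulrC.
Qed.
Fact Lambda_add0 : left_id Lambda0 Lambda_add.
Proof. by move=> l; rewrite -[l]clK clM; apply: eq_cl; rewrite /= mul1r. Qed.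
Fact Lambda_addN : left_inverse Lambda0 Lambda_opp Lambda_add.
Proof.
move=> l; rewrite -[l]clK clV clM; apply: eq_cl; rewrite /= mulVf //.
exact: valP (repr l).
Qed.

HB.instance Definition _ :=
  GRing.isZmodule.Build Lambda Lambda_addA Lambda_addC Lambda_add0 Lambda_addN.

Fact Lambda_le_refl : reflexive Lambda_le.
Proof. by move=> l; rewrite /Lambda_le divff ?O1 //; exact: valP (repr l). Qed.
Fact Lambda_le_anti : antisymmetric Lambda_le.
Proof.
move=> l m; rewrite -[l]clK -[m]clK !cl_le => /andP[a b].
by apply/clP; rewrite /nz_eqv b.
Qed.
Fact Lambda_le_trans : transitive Lambda_le.
Proof.
by move=> m l p lm mp; apply: div_trans mp lm; exact: valP (repr m).
Qed.
Fact Lambda_le_total : total Lambda_le.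
Proof.
move=> l m; rewrite /Lambda_le -[X in _ || (X \in _)]invrK invf_div.
apply: csr_total; apply: mulf_neq0; last by apply: nzV_subproof.
exact: valP (repr m).
Qed.

HB.instance Definition _ := Order.Le_isPOrder.Build ring_display Lambda
  Lambda_le_refl Lambda_le_anti Lambda_le_trans.
HB.instance Definition _ :=
  Order.POrder_isTotal.Build ring_display Lambda Lambda_le_total.


Let oppcl_le (x y : nzF) : (- cl x <= - cl y) = (val x / val y \in O).
Proof.
transitivity (Lambda_le (Lambda_opp (cl x)) (Lambda_opp (cl y))); first by [].
by rewrite !clV; apply: etrans (cl_le _ _) _; rewrite /= invrK mulrC.
Qed.
Let oppcl_le0 (x : nzF) : (- cl x <= 0) = (val x \in O).
Proof.
transitivity (Lambda_le (Lambda_opp (cl x)) (cl nz1)); first by [].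
by rewrite clV; apply: etrans (cl_le _ _) _; rewrite /= invrK mul1r.
Qed.

(* [option Lambda] is Lambda extended by a least element [None] = -oo. *)
Definition LambdaN := option Lambda.

(* The map -v; in additive notation -v(a) is the opposite of the class of a. *)
Definition negv (a : F) : LambdaN :=
  if insub a is Some x then Some (- cl x) else None.

Definition leN (k l : LambdaN) : bool :=
  match k, l with
  | None, _ => true
  | Some _, None => false
  | Some x, Some y => x <= y
  end.

Definition maxN (k l : LambdaN) : LambdaN := if leN k l then l else k.

(* Lambda is divisible and torsion-free, so exactly one m satisfies m *+ 2 = x. *)
Definition halfN (k : LambdaN) : LambdaN :=
  omap (fun x : Lambda => xget 0 [set m : Lambda | m *+ 2 = x]) k.

Definition mx_negv (n : nat) (X : 'M[F]_n) : LambdaN :=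
  \big[maxN/None]_(i < n) \big[maxN/None]_(j < n) negv (X i j).

Lemma mem_csrE (a : F) : (a \in O) = leN (negv a) (Some 0).
Proof.
rewrite /negv; case: insubP => [x _ <-|]; last first.
  rewrite negbK => /eqP ->; rewrite -(subrr (1 : F)).
  by case: (csr_subring O) => ? -> //.
by rewrite /leN oppcl_le0.
Qed.

Lemma negv_homo (a b : F) : 0 < b -> b <= a -> leN (negv b) (negv a).
Proof.
move=> b0 ba; have a0 := lt_le_trans b0 ba.
rewrite /negv; case: insubP => [x _ xb|]; last by rewrite gt_eqF.
case: insubP => [y _ ya|]; last by rewrite gt_eqF.
rewrite /leN oppcl_le xb ya.
apply: (csr_convex ON1 O1); rewrite ler_pdivrMr // mul1r ba andbT.
by rewrite (le_trans (lerN10 _)) // divr_ge0 // ltW.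
Qed.

End ValueGroup.

Definition non_archimedean (F : rcfType) : Prop := ~ Num.archimedean_axiom F.

(* Sets defined by polynomials in the entries of n x n matrices, with
   coefficients in K; the (i, j)-entry is the variable [mxvec_index i j]. *)

Definition mxpoly (K : rcfType) (n : nat) := mpoly.mpoly (n * n) K.

Definition ev (K L : comNzRingType) (iota : K -> L) (n : nat)
    (p : mpoly.mpoly (n * n) K) (x : 'M[L]_n) : L :=
  mpoly.mmap iota (fun k => mxvec x 0 k) p.

Definition zeros (K L : comNzRingType) (iota : K -> L) (n : nat)
    (I : set (mpoly.mpoly (n * n) K)) : set 'M[L]_n :=
  [set x | forall p, I p -> ev iota p x = 0].

Section LinearAlgebraicGroups.
Variables (C : fieldType) (n : nat).
Implicit Types H Z : set 'M[C]_n.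

Definition zariski_closed Z : Prop := exists I, Z = zeros idfun I.

Definition zariski_connected H : Prop := forall Z1 Z2,
  zariski_closed Z1 -> zariski_closed Z2 -> H `<=` Z1 `|` Z2 ->
  H `&` Z1 `&` Z2 = set0 -> H `&` Z1 = set0 \/ H `&` Z2 = set0.

Definition mx_group H : Prop :=
  [/\ H `<=` [set x | x \in unitmx], H 1%:M,
      forall x y, H x -> H y -> H (x *m y) &
      forall x, H x -> H (invmx x)].

Definition derived_group H : set 'M[C]_n :=
  \bigcap_(H' in [set H' | mx_group H' /\ forall x y, H x -> H y ->
      H' (invmx x *m invmx y *m x *m y)]) H'.

Definition solvable_mx_group H : Prop :=
  exists m, iter m derived_group H = [set 1%:M].

(* The radical of H is trivial. *)
Definition semisimple H : Prop := forall Z,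
  Z `<=` H -> zariski_closed Z -> mx_group Z -> zariski_connected Z ->
  (forall h z, H h -> Z z -> Z (h *m z *m invmx h)) ->
  solvable_mx_group Z -> Z = [set 1%:M].

End LinearAlgebraicGroups.

Section AlgebraicGroupsOverK.
Variables (K : rcfType) (n : nat).
Implicit Types G S : set (mxpoly K n).

(* Points over the algebraic closure K[i] of K. Algebraic groups over K are
   given by defining equations over K, not assumed to generate a radical ideal. *)
Definition geom G : set 'M[K[i]]_n := zeros (real_complex K) G.

Definition algebraic_subgroup_SL G : Prop :=
  mx_group (geom G) /\ geom G `<=` [set x | \det x = 1].

Definition self_adjoint G : Prop := forall g, geom G g -> geom G g^T.

(* Connected and diagonalizable over K. *)
Definition split_torus S : Prop :=
  [/\ algebraic_subgroup_SL S, zariski_connected (geom S) &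
      exists2 P : 'M[K]_n, P \in unitmx & forall s, geom S s ->
        is_diag_mx (map_mx (real_complex K) P *m s
                    *m map_mx (real_complex K) (invmx P))].

Definition maximal_split_torus G S : Prop :=
  [/\ split_torus S, geom S `<=` geom G &
      forall S', split_torus S' -> geom S' `<=` geom G ->
        geom S `<=` geom S' -> geom S' = geom S].

Definition algebraic_character S (p : mxpoly K n) : Prop :=
  ev (real_complex K) p 1%:M = 1 /\
  forall s t, geom S s -> geom S t ->
    ev (real_complex K) p (s *m t) =
    ev (real_complex K) p s * ev (real_complex K) p t.

End AlgebraicGroupsOverK.

Section Semialgebraic.
Variables (K : rcfType) (n : nat).

(* Boolean combinations of conditions p > 0 with p over K. *)
Inductive sa_formula :=
  | SaPos of mxpoly K n
  | SaNot of sa_formula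
  | SaAnd of sa_formula & sa_formula
  | SaOr of sa_formula & sa_formula.

Fixpoint sa_set (L : rcfType) (iota : K -> L) (D : sa_formula) : set 'M[L]_n :=
  match D with
  | SaPos p => [set x | 0 < ev iota p x]
  | SaNot D1 => ~` sa_set iota D1
  | SaAnd D1 D2 => sa_set iota D1 `&` sa_set iota D2
  | SaOr D1 D2 => sa_set iota D1 `|` sa_set iota D2
  end.

(* M-extension of a semialgebraic subset V of L^(n x n) defined over K. By the
   Tarski-Seidenberg principle it does not depend on the formula defining V. *)
Definition sa_extension (L M : rcfType) (iL : K -> L) (iM : K -> M)
    (V : set 'M[L]_n) : set 'M[M]_n :=
  [set x | exists D, sa_set iL D = V /\ sa_set iM D x].

Definition semialgebraic (V : set 'M[K]_n) : Prop :=
  exists D, V = sa_set idfun D.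

Definition rel_open (V U : set 'M[K]_n) : Prop :=
  forall x, V x -> U x -> exists2 e : K, 0 < e &
    forall y, V y -> (forall i j, `|y i j - x i j| < e) -> U y.

Definition sa_connected (V : set 'M[K]_n) : Prop := forall U1 U2,
  semialgebraic U1 -> semialgebraic U2 -> rel_open V U1 -> rel_open V U2 ->
  U1 `|` U2 = V -> U1 `&` U2 = set0 -> U1 = V \/ U2 = V.

Definition sa_component (V : set 'M[K]_n) (x : 'M[K]_n) : set 'M[K]_n :=
  \bigcup_(C in [set C | [/\ semialgebraic C, sa_connected C, C `<=` V & C x]]) C.

End Semialgebraic.

Definition mx_exp (R : realType) (n : nat) (X : 'M[R]_n) : 'M[R]_n :=
  \matrix_(i, j) limn (fun m => (\sum_(k < m) k`!%:R^-1 *: X ^+ k) i j).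

(* Exponential of a nilpotent n x n matrix. *)
Definition nilp_exp (F : fieldType) (n : nat) (X : 'M[F]_n) : 'M[F]_n :=
  \sum_(k < n) k`!%:R^-1 *: X ^+ k.

Definition Lie (R : realType) (n : nat) (H : set 'M[R]_n) : set 'M[R]_n :=
  [set X | forall t : R, H (mx_exp (t *: X))].

Section Building.
Variables (K : rcfType) (R : realType) (F : rcfType).
Variables (iR : {rmorphism K -> R}) (iF : {rmorphism K -> F}).
Variables (n : nat) (G S : set (mxpoly K n)).

Definition identity_component : set 'M[K]_n :=
  sa_component (zeros idfun S) 1%:M.

Definition A_ext (L : rcfType) (iL : K -> L) : set 'M[L]_n :=
  sa_extension idfun iL identity_component.

Definition gR : set 'M[R]_n := Lie (zeros iR G).
Definition aR : set 'M[R]_n := Lie (A_ext iR).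

(* The dual of [aR]. A functional is encoded by its extension by 0 outside
   [aR], so that equality of functionals is equality of functions. *)
Definition functional := 'M[R]_n -> R.
Definition is_functional (f : functional) : Prop :=
  (forall (c : R) X Y, aR X -> aR Y -> f (c *: X + Y) = c * f X + f Y) /\
  (forall X, ~ aR X -> f X = 0).

Definition root_space (al : functional) : set 'M[R]_n :=
  [set X | gR X /\ forall H, aR H -> H *m X - X *m H = al H *: X].

Definition root_system : set functional :=
  [set al | [/\ is_functional al, al <> (fun=> 0) &
                exists2 X, root_space al X & X <> 0]].

Definition twice (al : functional) : functional := fun H => al H *+ 2.

Section Basis.
(* A basis of the root system, listed in an order that determines the
   lexicographic order on the roots. *)
Variables (r : nat) (Delta : 'I_r -> functional).

Definition comb (c : 'I_r -> R) : functional := fun H => \sum_i c i * Delta i H.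

Definition root_basis : Prop :=
  [/\ forall i, root_system (Delta i),
      forall c, comb c = (fun=> 0) -> forall i, c i = 0 &
      forall al, root_system al -> exists m : 'I_r -> nat,
        al = comb (fun i => (m i)%:R) \/ al = comb (fun i => - (m i)%:R)].

Definition pos_roots : set functional :=
  [set al | root_system al /\ exists m : 'I_r -> nat, al = comb (fun i => (m i)%:R)].

Definition root_gt (al be : functional) : Prop :=
  exists c, (fun H => al H - be H) = comb c /\
    exists2 i, 0 < c i & forall j : 'I_r, (j < i)%N -> c j = 0.

End Basis.

Definition GF : set 'M[F]_n := zeros iF G.
Definition AF : set 'M[F]_n := A_ext iF.
Definition KF : set 'M[F]_n := [set k | [/\ GF k, k *m k^T = 1%:M & \det k = 1]].

(* The F-extension of the root space of [al]. *)
Definition gF (al : functional) : set 'M[F]_n := sa_extension iR iF (root_space al).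

(* The value at a of the algebraic character of S over K that satisfies
   chi (exp H) = e ^ (al H) for all H in the Lie algebra of A. Polynomials
   representing this character agree on A. *)
Definition chi (al : functional) (a : 'M[F]_n) : F :=
  xget 0 [set y | exists p, [/\ algebraic_character S p,
    forall H, aR H -> ev iR p (mx_exp H) = expR (al H) & y = ev iF p a]].

Definition NF (a : 'M[F]_n) : F :=
  \big[*%R/1]_(al \in root_system) Num.max (chi al a) (chi al a)^-1.

Definition U_root (al : functional) : set 'M[F]_n :=
  [set u | exists X X', [/\ gF al X, gF (twice al) X' & u = nilp_exp (X + X')]].

Section WithBasis.
Variables (r : nat) (Delta : 'I_r -> functional).

Definition AF_pos : set 'M[F]_n :=
  [set a | AF a /\ forall i, 1 <= chi (Delta i) a].

Definition UF : set 'M[F]_n :=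
  [set u | exists X : functional -> 'M[F]_n,
    (forall al, pos_roots Delta al -> gF al (X al)) /\
    u = nilp_exp (\sum_(al \in pos_roots Delta) X al)].

Definition act (g x : 'M[F]_n) : 'M[F]_n := g *m x *m g^T.

Definition XF : set 'M[F]_n := [set x | exists2 g, GF g & x = act g 1%:M].

Definition delta (x y : 'M[F]_n) : 'M[F]_n :=
  xget 1%:M [set a | AF_pos a /\ exists g h, [/\ GF g, GF h,
    x = act g 1%:M, y = act h 1%:M &
    exists k k', [/\ KF k, KF k' & invmx g *m h = k *m a *m k']]].

Variable O : convexSubring F.

Definition dist (x y : 'M[F]_n) : LambdaN O := negv O (NF (delta x y)).

(* Points of the quotient of [XF] are equivalence classes, as subsets of [XF]. *)
Definition bpoint := set 'M[F]_n.
Definition class_of (x : 'M[F]_n) : bpoint :=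
  [set y | XF y /\ dist x y = Some 0].
Definition actB (g : 'M[F]_n) (p : bpoint) : bpoint := act g @` p.

Definition base_point : bpoint := class_of 1%:M.

Definition apartment : set bpoint := 
  [set p | exists2 a, AF a & p = actB a base_point].

Definition half_apartment (be : functional) (l : Lambda O) : set bpoint :=
  [set p | exists a, [/\ AF a, p = actB a base_point &
    leN (Some l) (negv O (chi be a))]].

(* The points a.o with k al <= (-v)(chi al a) for all positive roots al. *)
Definition root_locus (k : functional -> LambdaN O) : set bpoint :=
  [set p | exists a, [/\ AF a, p = actB a base_point &
    forall al, pos_roots Delta al -> leN (k al) (negv O (chi al a))]].

End WithBasis.

Definition phi (O : convexSubring F) (al : functional) (u : 'M[F]_n) : LambdaN O :=
  xget None [set k | exists X X', [/\ gF al X, gF (twice al) X',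
    u = nilp_exp (X + X') & k = maxN (mx_negv O X) (halfN (mx_negv O X'))]].

(* Product decomposition of u along the positive roots in decreasing order.
   If al and 2 al are both roots, then [U_root al] contains [U_root (twice al)]
   and the factors for al and 2 al may cancel: for X' in [gF (twice al)] the
   product nilp_exp (- X') * nilp_exp X' is 1, although each factor has finite
   valuation. The last condition excludes this: the root space of 2 al
   contributes to one of the two factors only. It is void for reduced root
   systems. *)
Definition root_decomposition (r : nat) (Delta : 'I_r -> functional)
    (u : 'M[F]_n) (m : nat) (al : 'I_m -> functional) (us : 'I_m -> 'M[F]_n) :
    Prop :=
  [/\ pos_roots Delta = range al,
      forall i j : 'I_m, (i < j)%N -> root_gt Delta (al i) (al j),
      forall i, U_root (al i) (us i),
      u = \prod_(i < m) us i &
      forall i j, al j = twice (al i) ->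
        us j = 1%:M \/ exists2 X, gF (al i) X & us i = nilp_exp X].

End Building.

(* Main.v *)
(* The torus S is diagonalized by some P over K, so that roots become weights
   (k, l) of matrix coordinates and a in A becomes a positive vector t, with
   chi a = t_k / t_l. By the Cartan decomposition, first proved over R by
   maximizing a trace over the compact group K and then transferred to F by
   quantifier elimination, the stabilizer of o consists of the elements of G
   with entries in O: a product of roots evaluated at a is a unit only if all
   t_i are, because the roots separate the cocharacters of S (G is semisimple).
   Hence u.a.o lies in the apartment iff a^-1 u a has entries in O. For
   u = exp (sum of X_al) this is the condition t_l / t_k * X_kl in O for all
   k, l, by induction on a grading of the coordinates by a regular element;
   for a product of root group elements one peels off the factor of lowest
   grade. *)

Require Import Defs.
From HB Require Import structures.
From mathcomp Require Import all_boot all_order all_algebra.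
From mathcomp Require Import boolp classical_sets functions cardinality fsbigop reals.
From mathcomp Require Import topology normedtype sequences derive exp.
From mathcomp Require Import complex zify ring lra.
From mathcomp Require mpoly qe_rcf_th qe_rcf.
Import -(notations) mpoly.

Set Implicit Arguments.
Unset Strict Implicit.
Unset Printing Implicit Defensive.

Import Order.TTheory GRing.Theory Num.Theory numFieldNormedType.Exports.
Local Open Scope classical_set_scope.
Local Open Scope ring_scope.

(** * Tarski transfer for formulas in matrix variables *)

(** The equations of [G] need not generate a radical ideal, and its Lie algebra is only the set of
    [X] whose one-parameter group stays in the group. Linearity is therefore an analytic fact: a
    closed matrix group contains the exponential of every velocity at 1 of a curve in it, and
    velocities add. Applied to complex points, seen as real matrices of double size, the same
    argument puts real and imaginary parts of complex velocities into the real Lie algebra. Tori are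
    handled through the lattice of exponents trivial on them. Connectedness makes this lattice
    saturated, hence equal to its double orthogonal, so statements on characters are tested on
    integral cocharacters. Semisimplicity serves to separate cocharacters: if all roots kill [la],
    then [4 ^ la] commutes with [g g^*] for every complex point [g], then with all of G by
    connectedness, and lies in a central torus, which is trivial. Transfer needs one formula for all
    real closed extensions of K, so quantifier elimination is shown to commute with extension of
    constants. Elements of K are bounded by integers because K embeds in R; hence the coordinates
    [P] are integral over O. *)

Section TermMap.
Variables (K L : rcfType) (iota : {rmorphism K -> L}).
Import qe_rcf.

Fixpoint tmap (t : term K) : term L :=
  match t with
  | Var i => Var _ i
  | Const x => Const (iota x)
  | NatConst m => NatConst _ m
  | Add t1 t2 => Add (tmap t1) (tmap t2)
  | Opp t1 => Opp (tmap t1)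
  | NatMul t1 m => NatMul (tmap t1) m
  | Mul t1 t2 => Mul (tmap t1) (tmap t2)
  | Exp t1 m => Exp (tmap t1) m
  end.

Fixpoint fmap (f : formula K) : formula L :=
  match f with
  | Bool b => Bool b
  | Equal t1 t2 => Equal (tmap t1) (tmap t2)
  | Lt t1 t2 => Lt (tmap t1) (tmap t2)
  | Le t1 t2 => Le (tmap t1) (tmap t2)
  | And f1 f2 => And (fmap f1) (fmap f2)
  | Or f1 f2 => Or (fmap f1) (fmap f2)
  | Implies f1 f2 => Implies (fmap f1) (fmap f2)
  | Not f1 => Not (fmap f1)
  end.

Notation pmap := (map tmap).

(** The elimination procedure is written in continuation-passing style, so commutation with [fmap]
    is stated for two continuations that already correspond. *)
Lemma fmap_Size p k k' : (forall m, fmap (k m) = k' m) ->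
  fmap (Size p k) = Size (pmap p) k'.
Proof.
elim: p k k' => [|c p IH] k k' kk' //=.
by apply: IH => -[|m]; rewrite /= ?kk'.
Qed.

Lemma fmap_Isnull p k k' : (forall b, fmap (k b) = k' b) ->
  fmap (Isnull p k) = Isnull (pmap p) k'.
Proof. by move=> kk'; apply: fmap_Size. Qed.

Lemma fmap_LtSize p q k k' : (forall b, fmap (k b) = k' b) ->
  fmap (LtSize p q k) = LtSize (pmap p) (pmap q) k'.
Proof. by move=> kk'; do 2!(apply: fmap_Size => ?). Qed.

Lemma fmap_LeadCoef p k k' : (forall t, fmap (k t) = k' (tmap t)) ->
  fmap (LeadCoef p k) = LeadCoef (pmap p) k'.
Proof.
elim: p k k' => [|c p IH] k k' kk' /=; first by rewrite kk' /= rmorph0.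
by apply: IH => t; rewrite /= !kk'.
Qed.

Lemma pmap_AmulXn a m : pmap (AmulXn a m) = AmulXn (tmap a) m.
Proof. by elim: m => //= m ->; rewrite rmorph0. Qed.

Lemma pmap_AddPoly p q : pmap (AddPoly p q) = AddPoly (pmap p) (pmap q).
Proof. by elim: p q => [|a p IH] [|b q] //=; rewrite IH. Qed.

Lemma pmap_ScalPoly c p : pmap (ScalPoly c p) = ScalPoly (tmap c) (pmap p).
Proof. by rewrite /ScalPoly -!map_comp. Qed.

Lemma pmap_MulPoly p q : pmap (MulPoly p q) = MulPoly (pmap p) (pmap q).
Proof. by elim: p => //= a p IH; rewrite pmap_AddPoly pmap_ScalPoly /= IH. Qed.

Lemma pmap_ExpPoly p m : pmap (ExpPoly p m) = ExpPoly (pmap p) m.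
Proof.
case: m => // m; rewrite /ExpPoly !iteropS.
by elim: m => //= m IH; rewrite pmap_MulPoly IH.
Qed.

Lemma pmap_OppPoly p : pmap (OppPoly p) = OppPoly (pmap p).
Proof. by rewrite /OppPoly pmap_ScalPoly /= rmorphN rmorph1. Qed.

Lemma pmap_NatMulPoly m p : pmap (NatMulPoly m p) = NatMulPoly m (pmap p).
Proof. by rewrite /NatMulPoly pmap_ScalPoly. Qed.

Lemma pmap_Deriv p : pmap (Deriv p) = Deriv (pmap p).
Proof. by elim: p => //= a p IH; rewrite pmap_AddPoly /= IH. Qed.

Definition pmapE := (pmap_AmulXn, pmap_AddPoly, pmap_ScalPoly, pmap_MulPoly,
  pmap_ExpPoly, pmap_OppPoly, pmap_NatMulPoly, pmap_Deriv).

Lemma fmap_Rediv_rec_loop q sq cq c qq r m k k' :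
  (forall d, fmap (k d) = k' (d.1.1, pmap d.1.2, pmap d.2)) ->
  fmap (Rediv_rec_loop q sq cq c qq r m k) =
  Rediv_rec_loop (pmap q) sq (tmap cq) c (pmap qq) (pmap r) m k'.
Proof.
move=> kk'; elim: m c qq r => [|m IH] c qq r /=; apply: fmap_Size => sr;
  case: ifP => _; rewrite ?kk' //; apply: fmap_LeadCoef => t; rewrite ?kk' ?IH /=;
  by rewrite !pmapE.
Qed.

Lemma fmap_Rediv p q k k' :
  (forall d, fmap (k d) = k' (d.1.1, pmap d.1.2, pmap d.2)) ->
  fmap (Rediv p q k) = Rediv (pmap p) (pmap q) k'.
Proof.
move=> kk'; apply: fmap_Isnull => -[]; first by rewrite kk' /= rmorph0.
do 2!(apply: fmap_Size => ?); apply: fmap_LeadCoef => t.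
by rewrite (fmap_Rediv_rec_loop _ _ _ _ _ _ _ kk') /= rmorph0.
Qed.

Lemma fmap_Rmod p q k k' : (forall r, fmap (k r) = k' (pmap r)) ->
  fmap (Rmod p q k) = Rmod (pmap p) (pmap q) k'.
Proof. by move=> kk'; apply: fmap_Rediv => d; rewrite kk'. Qed.

Lemma fmap_Rscal p q k k' : (forall m, fmap (k m) = k' m) ->
  fmap (Rscal p q k) = Rscal (pmap p) (pmap q) k'.
Proof. by move=> kk'; apply: fmap_Rediv => d; rewrite kk'. Qed.

Lemma fmap_Rgcd_loop m p q k k' : (forall r, fmap (k r) = k' (pmap r)) ->
  fmap (Rgcd_loop m p q k) = Rgcd_loop m (pmap p) (pmap q) k'.
Proof.
move=> kk'; elim: m p q => [|m IH] p q /=; apply: fmap_Rmod => r;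
  by apply: fmap_Isnull => -[].
Qed.

Lemma fmap_Rgcd p q k k' : (forall r, fmap (k r) = k' (pmap r)) ->
  fmap (Rgcd p q k) = Rgcd (pmap p) (pmap q) k'.
Proof.
move=> kk'; rewrite /Rgcd; apply: fmap_LtSize => -[]; apply: fmap_Isnull => -[] //;
  by apply: fmap_Size => m; apply: fmap_Rgcd_loop.
Qed.

Lemma fmap_BigRgcd ps k k' : (forall r, fmap (k r) = k' (pmap r)) ->
  fmap (BigRgcd ps k) = BigRgcd (map pmap ps) k'.
Proof.
elim: ps k k' => [|p ps IH] k k' kk' /=; first by rewrite kk' /= rmorph0.
by apply: IH => r; apply: fmap_Rgcd.
Qed.

Lemma tmap_head s : tmap (head (NatConst _ 0) s) = head (NatConst _ 0) (pmap s).
Proof. by case: s. Qed.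

Lemma fmap_Changes s k k' : (forall m, fmap (k m) = k' m) ->
  fmap (Changes s k) = Changes (pmap s) k'.
Proof.
elim: s k k' => [|a s IH] k k' kk' /=; first exact: kk'.
by apply: IH => m; rewrite /= !kk' tmap_head.
Qed.

Lemma fmap_SeqPInfty ps k k' : (forall s, fmap (k s) = k' (pmap s)) ->
  fmap (SeqPInfty ps k) = SeqPInfty (map pmap ps) k'.
Proof.
elim: ps k k' => [|p ps IH] k k' kk' /=; first by rewrite kk'.
by apply: fmap_LeadCoef => t; apply: IH => s; rewrite kk'.
Qed.

Lemma fmap_SeqMInfty ps k k' : (forall s, fmap (k s) = k' (pmap s)) ->
  fmap (SeqMInfty ps k) = SeqMInfty (map pmap ps) k'.
Proof.
elim: ps k k' => [|p ps IH] k k' kk' /=; first by rewrite kk'.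
apply: fmap_LeadCoef => t; apply: fmap_Size => m; apply: IH => s.
by rewrite kk' /= rmorphN rmorph1.
Qed.

Lemma fmap_ChangesPoly ps k k' : (forall m, fmap (k m) = k' m) ->
  fmap (ChangesPoly ps k) = ChangesPoly (map pmap ps) k'.
Proof.
move=> kk'; apply: fmap_SeqMInfty => s; apply: fmap_SeqPInfty => s'.
by do 2!(apply: fmap_Changes => ?).
Qed.

Lemma fmap_NextMod p q k k' : (forall s, fmap (k s) = k' (pmap s)) ->
  fmap (NextMod p q k) = NextMod (pmap p) (pmap q) k'.
Proof.
move=> kk'; apply: fmap_LeadCoef => t; apply: fmap_Rscal => m.
by apply: fmap_Rmod => r; rewrite kk' pmapE.
Qed.

Lemma fmap_ModsAux p q m k k' : (forall s, fmap (k s) = k' (map pmap s)) ->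
  fmap (ModsAux p q m k) = ModsAux (pmap p) (pmap q) m k'.
Proof.
elim: m p q k k' => [|m IH] p q k k' kk' /=; first exact: kk'.
apply: fmap_Isnull => -[]; first exact: kk'.
by apply: fmap_NextMod => r; apply: IH => s; rewrite kk'.
Qed.

Lemma fmap_TaqR p q k k' : (forall m, fmap (k m) = k' m) ->
  fmap (TaqR p q k) = TaqR (pmap p) (pmap q) k'.
Proof.
move=> kk'; rewrite /TaqR /Mods -pmap_Deriv -pmap_MulPoly.
do 2!(apply: fmap_Size => ?); apply: fmap_ModsAux => s.
exact: fmap_ChangesPoly.
Qed.

Lemma pmap_PolyComb sq sc : pmap (PolyComb sq sc) = PolyComb (map pmap sq) sc.
Proof.
rewrite /PolyComb size_map; elim: (seq.iota 0 _) => //= i s IH.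
rewrite pmap_MulPoly IH pmap_ExpPoly; congr (MulPoly (ExpPoly _ _) _).
by elim: sq i {IH} => [|q sq IH] [|i] /=.
Qed.

Lemma pmap_Pcq sq i : pmap (Pcq sq i) = Pcq (map pmap sq) i.
Proof.
rewrite /Pcq size_map; elim: (qe_rcf_th.sg_tab _) i => [|sc s IH] [|i] //=.
exact: pmap_PolyComb.
Qed.

Lemma fmap_TaqsR p sq i k k' : (forall t, fmap (k t) = k' (tmap t)) ->
  fmap (TaqsR p sq i k) = TaqsR (pmap p) (map pmap sq) i k'.
Proof.
move=> kk'; rewrite /TaqsR -pmap_Pcq; apply: fmap_TaqR => m.
by rewrite kk' /= rmorph_int.
Qed.

(** The coefficients come from the inverse of a matrix with integer entries, which every field
    morphism respects. *)
Lemma rmorph_coefs m i : iota (qe_rcf_th.coefs K m i) = qe_rcf_th.coefs L m i.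
Proof.
rewrite /qe_rcf_th.coefs; set M := castmx _ _; set M' := castmx _ _.
have -> : M' = map_mx iota M.
  rewrite /M /M' map_castmx map_invmx -map_mx_comp; congr (castmx _ (invmx _)).
  by apply/matrixP=> a b; rewrite !mxE /= rmorph_int.
elim: (enum _) i => [|j s IH] [|i] /=; rewrite ?rmorph0 //.
by rewrite mxE.
Qed.

Lemma tmap_Coefs m i : tmap (Coefs K m i) = Coefs L m i.
Proof.
case: m => [|[|m]] /=; first by rewrite rmorph_nat.
  by case: i => [|[|[|i]]]; rewrite /Coefs /= ?nth_nil ?fmorphV ?rmorph_nat ?rmorph0.
by rewrite rmorph_coefs.
Qed.

Lemma fmap_CcountWeak p sq k k' : (forall t, fmap (k t) = k' (tmap t)) ->
  fmap (CcountWeak p sq k) = CcountWeak (pmap p) (map pmap sq) k'.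
Proof.
rewrite /CcountWeak size_map => kk'.
have -> : NatConst L 0 = tmap (NatConst K 0) by [].
elim: (3 ^ _)%N (NatConst K 0) k k' kk' => [|m IH] s k k' kk' /=; first exact: kk'.
by apply: fmap_TaqsR => t; rewrite -tmap_Coefs; apply: IH.
Qed.

Lemma pmap_BoundingPoly sq : pmap (BoundingPoly sq) = BoundingPoly (map pmap sq).
Proof.
rewrite /BoundingPoly pmap_Deriv; congr Deriv.
by elim: sq => //= q sq IH; rewrite pmap_MulPoly IH.
Qed.

(** The goal of this section: the formula that eliminates a variable over K turns, once its
    constants are mapped, into the one produced over L. *)
Lemma fmap_CcountGt0 sp sq :
  fmap (CcountGt0 sp sq) = CcountGt0 (map pmap sp) (map pmap sq).
Proof.
apply: fmap_BigRgcd => r; apply: fmap_Isnull => -[] /=; last first.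
  exact: fmap_CcountWeak.
rewrite -pmap_BoundingPoly.
apply: fmap_CcountWeak => t /=; congr (Or _ (Or _ _)).
  elim: sq => //= q sq ->; congr And.
  exact: fmap_LeadCoef.
elim: sq => //= q sq ->; congr And.
by apply: fmap_Size => m; apply: fmap_LeadCoef.
Qed.

End TermMap.

Section RcfMorph.
Variables (K L : rcfType) (iota : {rmorphism K -> L}).

(* Positivity in a real closed field is algebraic: being a nonzero square. *)
Lemma rcf_morph_le : {mono iota : x y / x <= y}.
Proof.
move=> x y; rewrite -subr_ge0 -rmorphB -[RHS]subr_ge0.
have [h|h] := ler0P (y - x).
  rewrite le_eqVlt eq_sym fmorph_eq0 [RHS]le_eqVlt eq_sym; congr orb.
  rewrite [RHS]ltNge h; apply: negbTE; rewrite -leNgt -oppr_ge0 -rmorphN.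
  by rewrite -[- _]sqr_sqrtr ?oppr_ge0 // rmorphXn sqr_ge0.
by rewrite -[y - x]sqr_sqrtr ?(ltW h) // rmorphXn !sqr_ge0.
Qed.

Lemma rcf_morph_lt : {mono iota : x y / x < y}.
Proof. by move=> x y; rewrite !ltNge rcf_morph_le. Qed.

Lemma rcf_morph_gt0 x : (0 < iota x) = (0 < x).
Proof. by rewrite -(rmorph0 iota) rcf_morph_lt. Qed.

End RcfMorph.

Section Definability.
Variable K : rcfType.
Import qe_rcf.

Fixpoint teval (L : rcfType) (iota : {rmorphism K -> L}) (e : nat -> L)
    (t : term K) : L :=
  match t with
  | Var i => e i
  | Const x => iota x
  | NatConst m => m%:R
  | Add t1 t2 => teval iota e t1 + teval iota e t2
  | Opp t1 => - teval iota e t1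
  | NatMul t1 m => teval iota e t1 *+ m
  | Mul t1 t2 => teval iota e t1 * teval iota e t2
  | Exp t1 m => teval iota e t1 ^+ m
  end.

Fixpoint feval (L : rcfType) (iota : {rmorphism K -> L}) (e : nat -> L)
    (f : formula K) : bool :=
  match f with
  | Bool b => b
  | Equal t1 t2 => teval iota e t1 == teval iota e t2
  | Lt t1 t2 => teval iota e t1 < teval iota e t2
  | Le t1 t2 => teval iota e t1 <= teval iota e t2
  | And f1 f2 => feval iota e f1 && feval iota e f2
  | Or f1 f2 => feval iota e f1 || feval iota e f2
  | Implies f1 f2 => feval iota e f1 ==> feval iota e f2
  | Not f1 => ~~ feval iota e f1
  end.

(** Environments are total functions; this bound tells which finite prefix has to be handed to the
    elimination procedure, which evaluates lists. *)
Fixpoint tbound (t : term K) : nat :=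
  match t with
  | Var i => i.+1
  | Add t1 t2 | Mul t1 t2 => maxn (tbound t1) (tbound t2)
  | Opp t1 | NatMul t1 _ | Exp t1 _ => tbound t1
  | _ => 0%N
  end.

Fixpoint fbound (f : formula K) : nat :=
  match f with
  | Bool _ => 0%N
  | Equal t1 t2 | Lt t1 t2 | Le t1 t2 => maxn (tbound t1) (tbound t2)
  | And f1 f2 | Or f1 f2 | Implies f1 f2 => maxn (fbound f1) (fbound f2)
  | Not f1 => fbound f1
  end.

Lemma eval_tmap (L : rcfType) (iota : {rmorphism K -> L}) (s : seq L) (e : nat -> L) t :
  (forall j, (j < tbound t)%N -> s`_j = e j) ->
  eval s (tmap iota t) = teval iota e t.
Proof.
elim: t => //= [j|t1 IH1 t2 IH2|t1 IH1|t1 IH1 m|t1 IH1 t2 IH2|t1 IH1 m] h;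
  rewrite ?h ?IH1 ?IH2 // => j jt; apply: h; rewrite leq_max jt ?orbT //.
Qed.

Lemma qf_eval_fmap (L : rcfType) (iota : {rmorphism K -> L}) (s : seq L) (e : nat -> L) f :
  (forall j, (j < fbound f)%N -> s`_j = e j) ->
  qf_eval s (fmap iota f) = feval iota e f.
Proof.
elim: f => //= [t1 t2|t1 t2|t1 t2|f1 IH1 f2 IH2|f1 IH1 f2 IH2|f1 IH1 f2 IH2|f1 IH1] h;
  rewrite ?(@eval_tmap _ _ _ e) ?IH1 ?IH2 // => j jt; apply: h;
  by rewrite leq_max jt ?orbT.
Qed.

Lemma pmap_abstrX (L : rcfType) (iota : {rmorphism K -> L}) i t :
  map (tmap iota) (abstrX i t) = abstrX i (tmap iota t).
Proof.
elim: t => //= [j|t1 IH1 t2 IH2|t1 IH1|t1 IH1 m|t1 IH1 t2 IH2|t1 IH1 m];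
  rewrite ?pmapE ?IH1 ?IH2 //.
by case: ifP.
Qed.

Definition upd (T : Type) (e : nat -> T) (i : nat) (x : T) : nat -> T :=
  fun j => if j == i then x else e j.

(** Equations [= 0] in the first component, strict inequalities [> 0] in the second: the shape whose
    solvability in one variable is decided by counting roots. *)
Definition clause := (seq (term K) * seq (term K))%type.

Definition csat (L : rcfType) (iota : {rmorphism K -> L}) (e : nat -> L) (c : clause) : bool :=
  all (fun t => teval iota e t == 0) c.1 && all (fun t => 0 < teval iota e t) c.2.

Lemma eq_all_tbound (P Q : pred (term K)) (ts : seq (term K)) N :
  (\max_(t <- ts) tbound t <= N)%N ->
  (forall t, (tbound t <= N)%N -> P t = Q t) -> all P ts = all Q ts.
Proof.
move=> + PQ; elim: ts => //= t ts IH; rewrite big_cons geq_max => /andP[tN /IH ->].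
by rewrite PQ.
Qed.

(** Since [CcountGt0] commutes with extension of constants, a single formula over K eliminates the
    variable in all extensions at once. *)
Lemma csat_proj (i : nat) (c : clause) : exists f : formula K,
  forall (L : rcfType) (iota : {rmorphism K -> L}) (e : nat -> L),
    (exists x, csat iota (upd e i x) c) <-> feval iota e f.
Proof.
pose f := CcountGt0 (map (abstrX i) c.1) (map (abstrX i) c.2).
exists f => L iota e.
(* The prefix must cover the eliminated formula as well as every term of the clause. *)
pose N := maxn (fbound f) (maxn (\max_(t <- c.1) tbound t) (\max_(t <- c.2) tbound t)).
pose s := mkseq e N.
have se j : (j < N)%N -> s`_j = e j by move=> jN; rewrite nth_mkseq.
rewrite -(@qf_eval_fmap _ _ s) => [|j jf]; last by rewrite se // leq_max jf.
rewrite fmap_CcountGt0 eval_CcountGt0.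
have ups x t : (tbound t <= N)%N ->
    (eval_poly s (map (tmap iota) (abstrX i t))).[x] = teval iota (upd e i x) t.
  move=> tc; rewrite pmap_abstrX abstrXP; apply: eval_tmap => j jt.
  rewrite nth_set_nth /= /upd; case: eqP => // _; apply: se.
  exact: leq_trans jt tc.
have key x : csat iota (upd e i x) c =
    \big[andb/true]_(p <- map (eval_poly s) (map (map (tmap iota)) (map (abstrX i) c.1))) (p.[x] == 0)
    && \big[andb/true]_(q <- map (eval_poly s) (map (map (tmap iota)) (map (abstrX i) c.2))) (0 < q.[x]).
  by rewrite !big_map !big_all; congr andb; apply: (@eq_all_tbound _ _ _ N);
    rewrite ?leq_max ?leqnn ?orbT // => t tN; rewrite ups.
split=> [[x]|/qe_rcf_th.ccount_gt0P [x]]; last by rewrite -key => h; exists x.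
by rewrite key => h; apply/qe_rcf_th.ccount_gt0P; exists x.
Qed.

Definition dnf_and (d1 d2 : seq clause) : seq clause :=
  [seq (c1.1 ++ c2.1, c1.2 ++ c2.2) | c1 <- d1, c2 <- d2].

Lemma has_dnf_and (L : rcfType) (iota : {rmorphism K -> L}) e d1 d2 :
  has (csat iota e) (dnf_and d1 d2) = has (csat iota e) d1 && has (csat iota e) d2.
Proof.
elim: d1 => //= c1 d1 IH; rewrite has_cat IH andb_orl; congr orb.
rewrite has_map; elim: d2 {IH} => [|c2 d2 IH] /=; first by rewrite andbF.
by rewrite IH andb_orr /csat /= !all_cat andbACA.
Qed.

(** The normal forms of a formula and of its negation are built together, so that a negation merely
    exchanges them. *)
Lemma dnfP (f : formula K) : (exists d, forall (L : rcfType) (iota : {rmorphism K -> L}) e,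
    feval iota e f = has (csat iota e) d) /\
  (exists d, forall (L : rcfType) (iota : {rmorphism K -> L}) e,
    ~~ feval iota e f = has (csat iota e) d).
Proof.
elim: f => [b|t1 t2|t1 t2|t1 t2|f1 [[p1 P1] [n1 N1]] f2 [[p2 P2] [n2 N2]]
  |f1 [[p1 P1] [n1 N1]] f2 [[p2 P2] [n2 N2]]|f1 [[p1 P1] [n1 N1]] f2 [[p2 P2] [n2 N2]]
  |f1 [P1 N1]] /=.
- split; [exists (if b then [:: ([::], [::])] else [::])
         |exists (if b then [::] else [:: ([::], [::])])] => L iota e; by case: b.
- split; [exists [:: ([:: Add t1 (Opp t2)], [::])]
         |exists [:: ([::], [:: Add t1 (Opp t2)]); ([::], [:: Add t2 (Opp t1)])]] => L iota e;
  rewrite /= /csat /= ?andbT ?orbF ?subr_gt0 ?subr_eq0 //.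
  by rewrite orbC neq_lt.
- split; [exists [:: ([::], [:: Add t2 (Opp t1)])]
         |exists [:: ([:: Add t1 (Opp t2)], [::]); ([::], [:: Add t1 (Opp t2)])]] => L iota e;
  rewrite /= /csat /= ?andbT ?orbF ?subr_gt0 ?subr_eq0 //.
  by rewrite -leNgt le_eqVlt eq_sym.
- split; [exists [:: ([:: Add t1 (Opp t2)], [::]); ([::], [:: Add t2 (Opp t1)])]
         |exists [:: ([::], [:: Add t1 (Opp t2)])]] => L iota e;
  rewrite /= /csat /= ?andbT ?orbF ?subr_gt0 ?subr_eq0 //.
    by rewrite le_eqVlt.
  by rewrite -ltNge.
- split; [exists (dnf_and p1 p2)|exists (n1 ++ n2)] => L iota e.
    by rewrite has_dnf_and P1 P2.
  by rewrite has_cat negb_and N1 N2.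
- split; [exists (p1 ++ p2)|exists (dnf_and n1 n2)] => L iota e.
    by rewrite has_cat P1 P2.
  by rewrite has_dnf_and negb_or N1 N2.
- split; [exists (n1 ++ p2)|exists (dnf_and p1 n2)] => L iota e.
    by rewrite has_cat -N1 P2 implybE.
  by rewrite has_dnf_and negb_imply P1 N2.
- by split=> //; case: P1 => d P1; exists d => L iota e; rewrite negbK.
Qed.

(** Definability has to be uniform, one formula over K for all extensions; hence predicates are
    indexed by the extensions. *)
Definition family := forall L : rcfType, {rmorphism K -> L} -> (nat -> L) -> Prop.

Definition qfdef (Q : family) : Prop := exists f : formula K,
  forall (L : rcfType) (iota : {rmorphism K -> L}) e, Q L iota e <-> feval iota e f.

Lemma qfdef_ext (Q Q' : family) :
  (forall L iota e, Q L iota e <-> Q' L iota e) -> qfdef Q -> qfdef Q'.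
Proof. by move=> QQ' [f fP]; exists f => L iota e; rewrite -QQ'. Qed.

Lemma qfdef_not (Q : family) : qfdef Q -> qfdef (fun L iota e => ~ Q L iota e).
Proof.
move=> [f fP]; exists (Not f) => L iota e; rewrite fP /=.
by split=> [/negP|/negP].
Qed.

Lemma qfdef_and (Q1 Q2 : family) : qfdef Q1 -> qfdef Q2 ->
  qfdef (fun L iota e => Q1 L iota e /\ Q2 L iota e).
Proof.
move=> [f1 P1] [f2 P2]; exists (And f1 f2) => L iota e; rewrite P1 P2 /=.
by split=> [/andP|/andP].
Qed.

Lemma qfdef_ex i (Q : family) : qfdef Q ->
  qfdef (fun L iota e => exists x, Q L iota (upd e i x)).
Proof.
move=> [f fP]; have [[d dP] _] := dnfP f.
have {}fP (L : rcfType) (iota : {rmorphism K -> L}) e : Q L iota e <-> has (csat iota e) d.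
  by rewrite fP dP.
elim: d Q fP {f dP} => [|c d IH] Q fP.
  by exists (Bool false) => L iota e; split=> // -[x] /fP.
have [g gP] := csat_proj i c.
have [h hP] := IH (fun L iota e => has (csat iota e) d) (fun _ _ _ => iff_refl _).
exists (Or g h) => L iota e; split=> /= [[x /fP /= /orP [a|a]]|/orP [/gP|/hP] [x xP]].
- by apply/orP; left; apply/gP; exists x.
- by apply/orP; right; apply/hP; exists x.
- by exists x; apply/fP; rewrite /= xP.
- by exists x; apply/fP; rewrite /= xP orbT.
Qed.

Definition upds (T : Type) (e : nat -> T) (s : seq nat) (x : nat -> T) : nat -> T :=
  fun j => if j \in s then x j else e j.

Lemma qfdef_exs s (Q : family) : qfdef Q ->
  qfdef (fun L iota e => exists x, Q L iota (upds e s x)).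
Proof.
elim: s Q => [|i s IH] Q Qd.
  apply: qfdef_ext Qd => L iota e; have e0 x : upds e [::] x = e by [].
  by split=> [h|[x]]; [exists e|]; rewrite e0.
apply: qfdef_ext (qfdef_ex i (IH Q Qd)) => L iota e.
split=> [[y [x h]]|[x h]].
- exists (fun j => if j \in s then x j else y).
  congr (Q L iota _): h; apply/funext => j; rewrite /upds /upd inE.
  by case: (j \in s); rewrite ?orbT ?orbF.
- exists (x i), x; congr (Q L iota _): h; apply/funext => j; rewrite /upds /upd inE.
  by case: (j \in s); rewrite ?orbT ?orbF //; case: eqP => [->|].
Qed.

(** Quantifier-free formulas keep their truth value under field morphisms, and quantifiers have
    already been eliminated uniformly. *)
Lemma qfdef_transfer (Q : family) : qfdef Q ->
  forall (L : rcfType) (iota : {rmorphism K -> L}) e,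
    Q K idfun e <-> Q L iota (iota \o e).
Proof.
move=> [f fP] L iota e; rewrite !fP.
have te t : teval iota (iota \o e) t = iota (teval idfun e t).
  elim: t => //= [m|t1 -> t2 ->|t1 ->|t1 -> m|t1 -> t2 ->|t1 -> m];
  by rewrite ?rmorph_nat ?rmorphD ?rmorphN ?rmorphMn ?rmorphM ?rmorphXn.
suff -> : feval iota (iota \o e) f = feval idfun e f by [].
elim: f {fP} => //= [t1 t2|t1 t2|t1 t2|f1 -> f2 ->|f1 -> f2 ->|f1 -> f2 ->|f1 ->] //;
rewrite !te.
- by rewrite (inj_eq (fmorph_inj iota)).
- by rewrite rcf_morph_lt.
- by rewrite rcf_morph_le.
Qed.

End Definability.

Definition cmx (L : rcfType) (n : nat) (X Y : 'M[L]_n) : 'M[L[i]]_n :=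
  \matrix_(i, j) (X i j +i* Y i j)%C.

Section MatrixFormulas.
Variables (K : rcfType) (n : nat).

Inductive mterm :=
  | MVar of nat
  | MConst of 'M[K]_n
  | MAdd of mterm & mterm
  | MMul of mterm & mterm
  | MTr of mterm.

(** The atom [FCZero] evaluates a polynomial at the complex matrix with the two given real and
    imaginary parts; through it, formulas over a real closed field speak of points over its
    algebraic closure. *)
Inductive mform :=
  | FPos of mxpoly K n & mterm
  | FCZero of mxpoly K n & mterm & mterm
  | FNot of mform
  | FAnd of mform & mform
  | FEx of nat & mform.

Fixpoint meval (L : rcfType) (iota : {rmorphism K -> L}) (e : nat -> 'M[L]_n)
    (t : mterm) : 'M[L]_n :=
  match t with
  | MVar j => e j
  | MConst A => map_mx iota A
  | MAdd t1 t2 => meval iota e t1 + meval iota e t2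
  | MMul t1 t2 => meval iota e t1 *m meval iota e t2
  | MTr t1 => (meval iota e t1)^T
  end.

Fixpoint msat (L : rcfType) (iota : {rmorphism K -> L}) (e : nat -> 'M[L]_n)
    (f : mform) : Prop :=
  match f with
  | FPos p t => 0 < ev iota p (meval iota e t)
  | FCZero p t1 t2 => ev (real_complex L \o iota) p
                        (cmx (meval iota e t1) (meval iota e t2)) = 0
  | FNot f1 => ~ msat iota e f1
  | FAnd f1 f2 => msat iota e f1 /\ msat iota e f2
  | FEx j f1 => exists X, msat iota (upd e j X) f1
  end.

Definition tdef (P : forall L : rcfType, {rmorphism K -> L} -> (nat -> L) -> L) :=
  exists t, forall (L : rcfType) (iota : {rmorphism K -> L}) e,
    P L iota e = teval iota e t.

Lemma tdef_ext P Q : (forall (L : rcfType) (iota : {rmorphism K -> L}) e,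
  P L iota e = Q L iota e) -> tdef P -> tdef Q.
Proof. by move=> PQ [t tP]; exists t => L iota e; rewrite -PQ. Qed.

Lemma tdef_const c : tdef (fun L iota e => iota c).
Proof. by exists (qe_rcf.Const c). Qed.

Lemma tdef_add P Q : tdef P -> tdef Q -> tdef (fun L iota e => P L iota e + Q L iota e).
Proof. by move=> [t tP] [s sP]; exists (qe_rcf.Add t s) => L iota e; rewrite tP sP. Qed.

Lemma tdef_opp P : tdef P -> tdef (fun L iota e => - P L iota e).
Proof. by move=> [t tP]; exists (qe_rcf.Opp t) => L iota e; rewrite tP. Qed.

Lemma tdef_mul P Q : tdef P -> tdef Q -> tdef (fun L iota e => P L iota e * Q L iota e).
Proof. by move=> [t tP] [s sP]; exists (qe_rcf.Mul t s) => L iota e; rewrite tP sP. Qed.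

Lemma tdef_exp P m : tdef P -> tdef (fun L iota e => P L iota e ^+ m).
Proof. by move=> [t tP]; exists (qe_rcf.Exp t m) => L iota e; rewrite tP. Qed.

Lemma tdef_sum (I : Type) (r : seq I) P : (forall i, tdef (P i)) ->
  tdef (fun L iota e => \sum_(i <- r) P i L iota e).
Proof.
move=> Pd; elim: r => [|i r IH].
  apply: tdef_ext (tdef_const 0) => L iota e; by rewrite big_nil rmorph0.
by apply: tdef_ext (tdef_add (Pd i) IH) => L iota e; rewrite big_cons.
Qed.

Lemma tdef_prod (I : Type) (r : seq I) P : (forall i, tdef (P i)) ->
  tdef (fun L iota e => \prod_(i <- r) P i L iota e).
Proof.
move=> Pd; elim: r => [|i r IH].
  apply: tdef_ext (tdef_const 1) => L iota e; by rewrite big_nil rmorph1.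
by apply: tdef_ext (tdef_mul (Pd i) IH) => L iota e; rewrite big_cons.
Qed.

Definition cdef (P : forall L : rcfType, {rmorphism K -> L} -> (nat -> L) -> L[i]) :=
  tdef (fun L iota e => complex.Re (P L iota e)) /\
  tdef (fun L iota e => complex.Im (P L iota e)).

Lemma cdef_ext P Q : (forall (L : rcfType) (iota : {rmorphism K -> L}) e,
  P L iota e = Q L iota e) -> cdef P -> cdef Q.
Proof.
by move=> PQ [h1 h2]; split; [apply: tdef_ext h1|apply: tdef_ext h2] => L iota e;
  rewrite PQ.
Qed.

Lemma cdef_const c : cdef (fun L iota e => real_complex L (iota c)).
Proof.
split; first exact: tdef_const.
by apply: tdef_ext (tdef_const 0) => L iota e; rewrite rmorph0.
Qed.

Lemma cdef_add P Q : cdef P -> cdef Q -> cdef (fun L iota e => P L iota e + Q L iota e).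
Proof.
move=> [P1 P2] [Q1 Q2]; split; [apply: tdef_ext (tdef_add P1 Q1)
  |apply: tdef_ext (tdef_add P2 Q2)] => L iota e;
by case: (P L iota e) (Q L iota e) => a b [c d].
Qed.

Lemma cdef_mul P Q : cdef P -> cdef Q -> cdef (fun L iota e => P L iota e * Q L iota e).
Proof.
move=> [P1 P2] [Q1 Q2]; split.
  apply: tdef_ext (tdef_add (tdef_mul P1 Q1) (tdef_opp (tdef_mul P2 Q2))) => L iota e.
  by case: (P L iota e) (Q L iota e) => a b [c d].
apply: tdef_ext (tdef_add (tdef_mul P1 Q2) (tdef_mul P2 Q1)) => L iota e.
by case: (P L iota e) (Q L iota e) => a b [c d].
Qed.

Lemma cdef_exp P m : cdef P -> cdef (fun L iota e => P L iota e ^+ m).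
Proof.
move=> Pd; elim: m => [|m IH].
  by apply: cdef_ext (cdef_const 1) => L iota e; rewrite expr0 !rmorph1.
by apply: cdef_ext (cdef_mul Pd IH) => L iota e; rewrite exprS.
Qed.

Lemma cdef_sum (I : Type) (r : seq I) P : (forall i, cdef (P i)) ->
  cdef (fun L iota e => \sum_(i <- r) P i L iota e).
Proof.
move=> Pd; elim: r => [|i r IH].
  by apply: cdef_ext (cdef_const 0) => L iota e; rewrite big_nil !rmorph0.
by apply: cdef_ext (cdef_add (Pd i) IH) => L iota e; rewrite big_cons.
Qed.

Lemma cdef_prod (I : Type) (r : seq I) P : (forall i, cdef (P i)) ->
  cdef (fun L iota e => \prod_(i <- r) P i L iota e).
Proof.
move=> Pd; elim: r => [|i r IH].
  by apply: cdef_ext (cdef_const 1) => L iota e; rewrite big_nil !rmorph1.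
by apply: cdef_ext (cdef_mul (Pd i) IH) => L iota e; rewrite big_cons.
Qed.

(* The scalar variable holding the (i, j) entry of the k-th matrix variable. *)
Definition entry_code (k : nat) (i j : 'I_n) : nat := pickle (k, (i, j)).

Definition env_mx (L : rcfType) (e : nat -> L) (k : nat) : 'M[L]_n :=
  \matrix_(i, j) e (entry_code k i j).

Lemma tdef_meval t i j : tdef (fun L iota e => meval iota (env_mx e) t i j).
Proof.
elim: t i j => [k|A|t1 IH1 t2 IH2|t1 IH1 t2 IH2|t1 IH1] i j /=.
- by exists (qe_rcf.Var _ (entry_code k i j)) => L iota e; rewrite mxE.
- by apply: tdef_ext (tdef_const (A i j)) => L iota e; rewrite mxE.
- by apply: tdef_ext (tdef_add (IH1 i j) (IH2 i j)) => L iota e; rewrite mxE.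
- have IH k := tdef_mul (IH1 i k) (IH2 k j).
  by apply: tdef_ext (tdef_sum (index_enum _) IH) => L iota e; rewrite mxE.
- by apply: tdef_ext (IH1 j i) => L iota e; rewrite mxE.
Qed.

Lemma tdef_ev p t : tdef (fun L iota e => ev iota p (meval iota (env_mx e) t)).
Proof.
apply: tdef_sum => m; apply: tdef_mul; first exact: tdef_const.
apply: tdef_prod => k; apply: tdef_exp.
case/mxvec_indexP: k => i j.
by apply: tdef_ext (tdef_meval t i j) => L iota e; rewrite mxvecE.
Qed.

Lemma cdef_ev p t1 t2 : cdef (fun L iota e => ev (real_complex L \o iota) p
  (cmx (meval iota (env_mx e) t1) (meval iota (env_mx e) t2))).
Proof.
apply: cdef_sum => m; apply: cdef_mul; first exact: cdef_const.
apply: cdef_prod => k; apply: cdef_exp.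
case/mxvec_indexP: k => i j; split.
  by apply: tdef_ext (tdef_meval t1 i j) => L iota e; rewrite mxvecE mxE.
by apply: tdef_ext (tdef_meval t2 i j) => L iota e; rewrite mxvecE mxE.
Qed.

Lemma qfdef_lt P : tdef P -> qfdef (fun L iota e => 0 < P L iota e).
Proof.
by move=> [t tP]; exists (qe_rcf.Lt (qe_rcf.NatConst _ 0) t) => L iota e; rewrite tP.
Qed.

Lemma qfdef_eq0 P : tdef P -> qfdef (fun L iota e => P L iota e = 0).
Proof.
move=> [t tP]; exists (qe_rcf.Equal t (qe_rcf.NatConst _ 0)) => L iota e; rewrite tP.
by split=> /eqP.
Qed.

Lemma qfdef_msat f : qfdef (fun L iota e => msat iota (env_mx e) f).
Proof.
elim: f => [p t|p t1 t2|f IH|f1 IH1 f2 IH2|k f IH] /=.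
- exact: qfdef_lt (tdef_ev p t).
- have [h1 h2] := cdef_ev p t1 t2.
  apply: qfdef_ext (qfdef_and (qfdef_eq0 h1) (qfdef_eq0 h2)) => L iota e.
  by case: (ev _ _ _) => a b /=; split=> [[-> ->]|[-> ->]].
- exact: qfdef_not.
- exact: qfdef_and.
(* A matrix quantifier is a block of scalar quantifiers, one per entry. *)
pose s := [seq entry_code k ij.1 ij.2 | ij : 'I_n * 'I_n].
apply: qfdef_ext (qfdef_exs s IH) => L iota e.
have inj k' i j k2 i2 j2 : entry_code k' i j = entry_code k2 i2 j2 ->
    [/\ k' = k2, i = i2 & j = j2].
  by move=> /(pcan_inj pickleK) [-> -> ->].
have ins k' i j : (entry_code k' i j \in s) = (k' == k).
  apply/mapP/eqP => [[[i' j'] _ /inj[]] //|->].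
  by exists (i, j); rewrite ?mem_enum.
split=> [[x h]|[X h]].
- exists (env_mx x k); congr (msat iota _ f): h; apply/funext => k'.
  apply/matrixP => i j; rewrite !mxE /upds ins /upd; case: eqP => [->|_];
  by rewrite !mxE.
- pose x m := if (unpickle m : option (nat * ('I_n * 'I_n))) is Some (_, (i, j)) then X i j else 0.
  exists x; congr (msat iota _ f): h; apply/funext => k'.
  apply/matrixP => i j; rewrite !mxE /upds ins /upd; case: eqP => [->|_];
  by rewrite ?mxE // /x pickleK.
Qed.

Theorem msat_transfer (L : rcfType) (iota : {rmorphism K -> L}) e f :
  msat (idfun : {rmorphism K -> K}) e f <-> msat iota (fun k => map_mx iota (e k)) f.
Proof.
pose e' m := if (unpickle m : option (nat * ('I_n * 'I_n))) is Some (k, (i, j)) then e k i j else 0.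
have := qfdef_transfer (qfdef_msat f) iota e'.
have -> : env_mx e' = e.
  by apply/funext => k; apply/matrixP => i j; rewrite mxE /e' pickleK.
have -> // : env_mx (iota \o e') = (fun k => map_mx iota (e k)).
by apply/funext => k; apply/matrixP => i j; rewrite !mxE /= /e' pickleK.
Qed.

End MatrixFormulas.

(** * Hilbert's basis theorem and finite systems of equations *)

Section HilbertBasis.

Definition idl (A : comNzRingType) (S : A -> Prop) (x : A) : Prop :=
  exists2 s : seq (A * A), (forall p, p \in s -> S p.2) &
    x = \sum_(p <- s) p.1 * p.2.

Section Ideal.
Variable A : comNzRingType.
Implicit Types S T : A -> Prop.

Lemma idl_mem S x : S x -> idl S x.
Proof.
by move=> Sx; exists [:: (1, x)] => [p|]; rewrite ?inE ?big_seq1 ?mul1r // => /eqP ->.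
Qed.

Lemma idl0 S : idl S 0.
Proof. by exists [::]; rewrite ?big_nil. Qed.

Lemma idlD S x y : idl S x -> idl S y -> idl S (x + y).
Proof.
move=> [s sS ->] [t tS ->]; exists (s ++ t); rewrite ?big_cat // => p.
by rewrite mem_cat => /orP [/sS|/tS].
Qed.

Lemma idlM S a x : idl S x -> idl S (a * x).
Proof.
move=> [s sS ->]; exists [seq (a * p.1, p.2) | p <- s] => [p /mapP [q /sS qS ->] //|].
by rewrite big_map mulr_sumr; apply: eq_bigr => p _; rewrite mulrA.
Qed.

Lemma idlB S x y : idl S x -> idl S y -> idl S (x - y).
Proof. by move=> Sx Sy; apply: idlD => //; rewrite -mulN1r; apply: idlM. Qed.

Lemma idl_sum S (I : eqType) (r : seq I) F :
  (forall i, i \in r -> idl S (F i)) -> idl S (\sum_(i <- r) F i).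
Proof.
elim: r => [|i r IH] h; first by rewrite big_nil; apply: idl0.
rewrite big_cons; apply: idlD; first by apply: h; rewrite inE eqxx.
by apply: IH => j jr; apply: h; rewrite inE jr orbT.
Qed.

Lemma idl_trans S T x : (forall y, S y -> idl T y) -> idl S x -> idl T x.
Proof. by move=> ST [s sS ->]; apply: idl_sum => p /sS/ST; apply: idlM. Qed.

Lemma idl_mono S T x : (forall y, S y -> T y) -> idl S x -> idl T x.
Proof. by move=> ST; apply: idl_trans => y /ST; apply: idl_mem. Qed.

Lemma idl_finite S (s : seq A) : (forall x, x \in s -> idl S x) ->
  exists2 t : seq A, (forall x, x \in t -> S x) &
    forall x, x \in s -> idl (fun y => y \in t) x.
Proof.
elim: s => [|x s IH] h; first by exists [::].
have [y ys|t tS th] := IH; first by apply: h; rewrite inE ys orbT.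
have [u uS ux] : idl S x by apply: h; rewrite inE eqxx.
exists ([seq p.2 | p <- u] ++ t) => [y|y].
  by rewrite mem_cat => /orP [/mapP [p /uS ? ->] //|/tS].
rewrite inE => /orP [/eqP -> {y}|/th]; last first.
  by apply: idl_mono => z zt; rewrite mem_cat zt orbT.
by exists u => // p pu; rewrite mem_cat (map_f snd pu).
Qed.

End Ideal.

(** Generators are taken in [S] itself, so that finitely many of the given equations cut out the
    same points over every K-algebra. *)
Definition noetherian (A : comNzRingType) : Prop := forall S : A -> Prop,
  exists2 s : seq A, (forall x, x \in s -> S x) &
    forall x, S x -> idl (fun y => y \in s) x.

Lemma noetherian_field (A : fieldType) : noetherian A.
Proof.
move=> S; have [[a Sa a0]|h] := pselect (exists2 a, S a & a != 0).
  exists [:: a] => x; first by rewrite inE => /eqP ->.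
  move=> _; rewrite -[x](divfK a0); apply: idlM; apply: idl_mem.
  by rewrite inE.
exists [::] => // x Sx; have [->|x0] := eqVneq x 0; first exact: idl0.
by case: h; exists x.
Qed.

Lemma noetherian_surj (A B : comNzRingType) (f : {rmorphism A -> B}) :
  (forall b, exists a, b = f a) -> noetherian A -> noetherian B.
Proof.
move=> fs NA S; have [s sS h] := NA (fun a => S (f a)).
exists (map f s) => [x /mapP [a /sS ? ->] //|b]; have [a ->] := fs b.
move=> /h [t ts ->]; exists [seq (f p.1, f p.2) | p <- t].
  by move=> p /mapP [q /ts qs ->] /=; apply: map_f.
by rewrite big_map rmorph_sum; apply: eq_bigr => p _; rewrite rmorphM.
Qed.

(** Hilbert's argument by contradiction: choose successively elements of least degree outside the
    ideal generated by the previous choices; a relation between their leading coefficients then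
    lowers a degree. *)
Lemma noetherian_poly (A : comNzRingType) : noetherian A -> noetherian {poly A}.
Proof.
move=> NA S; apply: contrapT => nfg.
have step (s : seq {poly A}) : exists g : {poly A},
    (forall x, x \in s -> idl S x) ->
    [/\ idl S g, ~ idl (fun y => y \in s) g &
      forall f, idl S f -> ~ idl (fun y => y \in s) f -> (size g <= size f)%N].
  have [sS|nsS] := pselect (forall x, x \in s -> idl S x); last by exists 0.
  have [f Sf nf] : exists2 f, idl S f & ~ idl (fun y => y \in s) f.
    apply: contrapT => h; apply: nfg; have [t tS st] := idl_finite sS.
    exists t => // x Sx; apply: idl_trans st _.
    by apply: contrapT => nx; apply: h; exists x => //; apply: idl_mem.
  pose P m := `[< exists g, [/\ idl S g, ~ idl (fun y => y \in s) g & size g = m] >].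
  have exP : exists m, P m by exists (size f); apply/asboolP; exists f.
  case: (ex_minnP exP) => m /asboolP [g [Sg ng gm]] minm.
  exists g => _; split=> // f' Sf' nf'; rewrite gm; apply: minm.
  by apply/asboolP; exists f'.
have [nxt nxtP] := choice step.
pose fix ss k : seq {poly A} := if k is k'.+1 then rcons (ss k') (nxt (ss k')) else [::].
pose g k := nxt (ss k).
have ssS k : forall x, x \in ss k -> idl S x.
  elim: k => //= k IH x; rewrite mem_rcons inE => /orP [/eqP ->|/IH //].
  by have [] := nxtP _ IH.
have gP k := nxtP _ (ssS k).
have ssE k x : x \in ss k <-> exists2 j, (j < k)%N & x = g j.
  elim: k => [|k IH]; first by split=> // -[].
  rewrite /= mem_rcons inE; split=> [/orP [/eqP ->|/IH [j jk ->]]|[j]].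
  - by exists k.
  - by exists j => //; apply: ltnW.
  - rewrite ltnS leq_eqVlt => /orP [/eqP -> ->|jk xj]; first by rewrite eqxx.
    by apply/orP; right; apply/IH; exists j.
have gmono j k : (j <= k)%N -> (size (g j) <= size (g k))%N.
  move=> jk; have [_ _ h] := gP j; have [Sgk ngk _] := gP k; apply: h => // h.
  apply: ngk; apply: idl_mono h => y /ssE [i ij ->].
  by apply/ssE; exists i => //; apply: leq_trans ij jk.
have [s sJ h] := NA (fun a => exists k, a = lead_coef (g k)).
have [N hN] : exists N, forall a, a \in s -> exists2 k, (k < N)%N & a = lead_coef (g k).
  elim: s sJ {h} => [|a s IH] sJ; first by exists 0%N.
  have [x xs|N hN] := IH; first by apply: sJ; rewrite inE xs orbT.
  have [k ak] : exists k, a = lead_coef (g k) by apply: sJ; rewrite inE eqxx.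
  exists (maxn k.+1 N) => x; rewrite inE => /orP [/eqP ->|/hN [j jN ->]].
    by exists k => //; rewrite leq_max leqnn.
  by exists j => //; rewrite leq_max jN orbT.
have [t ts lt] : idl (fun a => a \in s) (lead_coef (g N)) by apply: h; exists N.
have [Sg ng gmin] := gP N.
have tN (p : A * A) : exists k, p \in t -> (k < N)%N /\ p.2 = lead_coef (g k).
  have [pt|] := boolP (p \in t); last by exists 0%N.
  by have [k kN e] := hN _ (ts _ pt); exists k.
have [kk kkP] := choice tN.
(* A combination of earlier choices, shifted by powers of ['X], with the same leading term as
   [g N]. *)
pose q : {poly A} := \sum_(p <- t) (p.1 *: 'X^(size (g N) - size (g (kk p)))) * g (kk p).
have qs : idl (fun y => y \in ss N) q.
  apply: idl_sum => p /kkP [kN _]; apply: idlM; apply: idl_mem; apply/ssE.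
  by exists (kk p).
have g0 : g N != 0 by apply/eqP => g0; apply: ng; rewrite -/(g N) g0; apply: idl0.
have ltsz : (size (g N - q)%R < size (g N))%N.
  have szq : (size q <= size (g N))%N.
    rewrite /q big_seq; apply: (leq_trans (size_sum _ _ _)).
    apply/bigmax_leqP_seq => p pt _; have [kN _] := kkP _ pt.
    rewrite -scalerAl (leq_trans (size_scale_leq _ _)) // mulrC.
    have [->|gk0] := eqVneq (g (kk p)) 0; first by rewrite mul0r size_poly0.
    by rewrite size_mulXn // subnK // gmono // ltnW.
  rewrite -(prednK (n := size (g N))) ?size_poly_gt0 // ltnS.
  apply/leq_sizeP => j; rewrite leq_eqVlt => /orP [/eqP <-|jN].
    rewrite coefB -/(lead_coef (g N)) lt; apply/eqP; rewrite subr_eq0; apply/eqP.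
    rewrite coef_sum big_seq [RHS]big_seq; apply: eq_bigr => p pt.
    have [kN ->] := kkP _ pt; rewrite -scalerAl coefZ coefXnM /lead_coef; congr (_ * _).
    have gk0 : g (kk p) != 0.
      apply/eqP => gk0; have [_ + _] := gP (kk p); apply.
      by rewrite -/(g _) gk0; apply: idl0.
    have := gmono _ _ (ltnW kN); move: gk0 g0; rewrite -!size_poly_gt0.
    case: (size (g (kk p))) => // a; case: (size (g N)) => // b _ _ /=; rewrite ltnS => ab.
    by rewrite subSS ltnNge leq_subr /= subKn.
  rewrite prednK ?size_poly_gt0 // in jN.
  by rewrite coefB !nth_default ?subr0 // (leq_trans szq).
have := gmin (g N - q); rewrite leqNgt ltsz => /(_ _ _)/negP; apply => //.
  apply: idlB => //; apply: idl_trans qs; exact: ssS.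
by move=> hh; apply: ng; rewrite -/(g N) -(subrK q (g N)); apply: idlD.
Qed.

Lemma mpoly_ring_ind (A : comNzRingType) m (P : mpoly.mpoly m A -> Prop) :
  (forall c, P (mpoly.mpolyC m c)) -> (forall i, P (mpoly.mpolyX A (mpoly.mnm1 i))) ->
  (forall p q, P p -> P q -> P (p + q)) -> (forall p q, P p -> P q -> P (p * q)) ->
  forall p, P p.
Proof.
move=> PC PX PD PM p; rewrite [p]mpoly.mpolyE.
apply: (big_ind P) => [|//|mu _]; first by rewrite -(mpoly.mpolyC0 m); apply: PC.
rewrite -mpoly.mul_mpolyC; apply: (PM _ _ (PC _)); rewrite mpoly.mpolyXE_id.
apply: (big_ind P) => [|//|i _]; first by rewrite -mpoly.mpolyC1; apply: PC.
elim: (mu i) => [|k IH]; first by rewrite expr0 -mpoly.mpolyC1; apply: PC.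
by rewrite exprS; apply: PM.
Qed.

Lemma noetherian_mpoly (A : fieldType) m : noetherian (mpoly.mpoly m A).
Proof.
elim: m => [|m IH].
  apply: (noetherian_surj (f := mpoly.mpolyC 0 (R:=A))) (@noetherian_field A).
  apply: mpoly_ring_ind => [c|[] //|p q [a ->] [b ->]|p q [a ->] [b ->]].
  - by exists c.
  - by exists (a + b); rewrite rmorphD.
  - by exists (a * b); rewrite rmorphM.
(* The outer variable is sent to the last of the [m.+1] variables, the coefficients are widened. *)
pose f : {poly mpoly.mpoly m A} -> mpoly.mpoly m.+1 A :=
  horner_eval (mpoly.mpolyX A (mpoly.mnm1 ord_max)) \o map_poly (@mpoly.mwiden m A).
apply: (noetherian_surj (f := f)) (noetherian_poly IH).
apply: mpoly_ring_ind => [c|i|p q [a ->] [b ->]|p q [a ->] [b ->]].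
- exists (mpoly.mpolyC m c)%:P.
  by rewrite /f /= map_polyC /= /horner_eval hornerC mpoly.mwidenC.
- have [j ->|->] := unliftP ord_max i; last first.
    by exists 'X; rewrite /f /= map_polyX /horner_eval hornerX.
  exists (mpoly.mpolyX A (mpoly.mnm1 j))%:P.
  rewrite /f /= map_polyC /= /horner_eval hornerC mpoly.mwidenX mpoly.mnmwiden1.
  by congr (mpoly.mpolyX A (mpoly.mnm1 _)); apply: val_inj; rewrite /= /bump leqNgt ltn_ord.
- by exists (a + b); rewrite rmorphD.
- by exists (a * b); rewrite rmorphM.
Qed.

End HilbertBasis.

Section Ev.
Variables (K A : comNzRingType) (iota : {rmorphism K -> A}) (n : nat).
Implicit Types (p q : mpoly.mpoly (n * n) K) (x : 'M[A]_n).

Lemma evD p q x : ev iota (p + q) x = ev iota p x + ev iota q x.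
Proof. exact: (rmorphD (mpoly.mmap iota _)). Qed.

Lemma evN p x : ev iota (- p) x = - ev iota p x.
Proof. exact: (rmorphN (mpoly.mmap iota _)). Qed.

Lemma evM p q x : ev iota (p * q) x = ev iota p x * ev iota q x.
Proof. exact: (rmorphM (mpoly.mmap iota _)). Qed.

Lemma evC c x : ev iota (mpoly.mpolyC _ c) x = iota c.
Proof. exact: mpoly.mmapC. Qed.

Lemma ev0 x : ev iota 0 x = 0.
Proof. exact: (rmorph0 (mpoly.mmap iota _)). Qed.

Lemma ev1 x : ev iota 1 x = 1.
Proof. exact: (rmorph1 (mpoly.mmap iota _)). Qed.

Lemma evXn p m x : ev iota (p ^+ m) x = ev iota p x ^+ m.
Proof. exact: (rmorphXn (mpoly.mmap iota _)). Qed.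

Lemma ev_sum (I : Type) (r : seq I) (P : pred I) F x :
  ev iota (\sum_(i <- r | P i) F i) x = \sum_(i <- r | P i) ev iota (F i) x.
Proof. exact: (rmorph_sum (mpoly.mmap iota _)). Qed.

Lemma ev_prod (I : Type) (r : seq I) (P : pred I) F x :
  ev iota (\prod_(i <- r | P i) F i) x = \prod_(i <- r | P i) ev iota (F i) x.
Proof. exact: (rmorph_prod (mpoly.mmap iota _)). Qed.

Definition genmx : 'M[mpoly.mpoly (n * n) K]_n :=
  \matrix_(i, j) mpoly.mpolyX K (mpoly.mnm1 (mxvec_index i j)).

Lemma ev_genmx i j x : ev iota (genmx i j) x = x i j.
Proof. by rewrite mxE /ev mpoly.mmapX mpoly.mmap1U mxvecE. Qed.

Lemma map_genmx x : map_mx (fun p => ev iota p x) genmx = x.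
Proof. by apply/matrixP => i j; rewrite mxE ev_genmx. Qed.

Lemma map_mpolyC_mx (B : 'M[K]_n) x :
  map_mx (fun p => ev iota p x) (map_mx (@mpoly.mpolyC (n * n) K) B) = map_mx iota B.
Proof. by apply/matrixP => i j; rewrite !mxE evC. Qed.

Lemma map_ev_mulmx m1 m2 m3 (B : 'M[mpoly.mpoly (n * n) K]_(m1, m2))
    (C : 'M_(m2, m3)) x :
  map_mx (fun p => ev iota p x) (B *m C) = map_mx (fun p => ev iota p x) B *m map_mx (fun p => ev iota p x) C.
Proof. exact: (map_mxM (mpoly.mmap iota _)). Qed.

Lemma ev_det m (B : 'M[mpoly.mpoly (n * n) K]_m) x :
  ev iota (\det B) x = \det (map_mx (fun p => ev iota p x) B).
Proof. by rewrite (det_map_mx (mpoly.mmap iota _)). Qed.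

Lemma map_ev_adj m (B : 'M[mpoly.mpoly (n * n) K]_m) x :
  map_mx (fun p => ev iota p x) (\adj B) = \adj (map_mx (fun p => ev iota p x) B).
Proof. by rewrite (map_mx_adj (mpoly.mmap iota _)). Qed.

End Ev.

Lemma ev_comp (K A B : comNzRingType) (f : {rmorphism K -> A})
    (g : {rmorphism A -> B}) n (p : mpoly.mpoly (n * n) K) (x : 'M[A]_n) :
  ev (g \o f) p (map_mx g x) = g (ev f p x).
Proof.
rewrite /ev /mpoly.mmap rmorph_sum; apply: eq_bigr => m _.
rewrite rmorphM /= /mpoly.mmap1 rmorph_prod; congr (_ * _).
by apply: eq_bigr => k _; rewrite rmorphXn -map_mxvec mxE.
Qed.

Lemma zeros_finite (K : rcfType) n (G : set (mxpoly K n)) :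
  exists Gf : seq (mxpoly K n), forall (A : comNzRingType) (iota : {rmorphism K -> A}) x,
    zeros iota G x <-> (forall p, p \in Gf -> ev iota p x = 0).
Proof.
have [Gf GfG h] := @noetherian_mpoly K (n * n) G.
exists Gf => A iota x; split=> [Gx p /GfG /Gx //|Gfx p /h [s sG ->]].
rewrite ev_sum big_seq big1 //= => q qs.
by rewrite evM (Gfx q.2) ?mulr0 //; apply: sG.
Qed.

(** * Characters, lattices of exponents and connected tori *)

Section Dedekind.
Variables (L : fieldType) (X : Type) (mul : X -> X -> X) (D : X -> Prop) (x0 : X).
Hypotheses (DM : forall x y, D x -> D y -> D (mul x y)) (D0 : D x0).
Variables (I : Type) (chi : I -> X -> L).
Hypothesis chiM : forall i x y, D x -> D y -> chi i (mul x y) = chi i x * chi i y.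
Hypothesis chi0 : forall i, chi i x0 != 0.

Let sim i j : bool := `[< forall x, D x -> chi i x = chi j x >].

(** Dedekind's independence of characters for lists with repetitions: the coefficients of characters
    that agree on [D] add up to zero, so any [psi] constant on such classes satisfies the same
    relation. As usual, the difference with a translate shortens the list. *)
Lemma dedekind_repeated (s : seq I) (c psi : I -> L) :
  (forall i j, (forall x, D x -> chi i x = chi j x) -> psi i = psi j) ->
  (forall x, D x -> \sum_(i <- s) c i * chi i x = 0) ->
  \sum_(i <- s) c i * psi i = 0.
Proof.
have [m] := ubnP (size s); elim: m => // m IH in s c psi *.
case: s => [|i0 s'] sm psiP h; first by rewrite big_nil.
set s := i0 :: s' in h *.
(* Either every character of the list agrees with that of [i0], and [x0] is plugged in, or one that
   does not is eliminated by translating with a separating [g]. *)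
have class0 : \sum_(i <- s | sim i i0) c i = 0.
  have [alls|] := boolP (all (fun j => sim j i0) s).
    have := h _ D0.
    have -> : \sum_(i <- s) c i * chi i x0 = (\sum_(i <- s | sim i i0) c i) * chi i0 x0.
      elim: s alls {h} => [|i t IHt] /=; first by rewrite !big_nil mul0r.
      move=> /andP[ii0 /IHt IHt']; rewrite !big_cons ii0 mulrDl IHt'.
      by move/asboolP: ii0 => ->.
    by move=> /eqP; rewrite mulf_eq0 (negbTE (chi0 i0)) orbF => /eqP.
  rewrite -has_predC => /(has_nthP i0) [k ks nji0]; set j := nth i0 s k in nji0.
  have [g Dg gj] : exists2 g, D g & chi j g != chi i0 g.
    apply: contrapT => no; move/negP: nji0; apply; apply/asboolP => x Dx.
    by apply/eqP; apply: contrapT => /negP ne; apply: no; exists x.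
  pose s1 := [seq i <- s | ~~ sim i j].
  have s1m : (size s1 < m)%N.
    rewrite -ltnS; apply: leq_trans sm; rewrite ltnS size_filter.
    rewrite -[X in (_ < X)%N](count_predC (fun i => sim i j)) -[X in (X < _)%N]add0n ltn_add2r.
    rewrite -has_count; apply/(has_nthP i0); exists k => //.
    by apply/asboolP.
  have psim i i' : (forall x, D x -> chi i x = chi i' x) -> sim i i0 = sim i' i0.
    by move=> e; apply/asboolP/asboolP => h' x Dx; rewrite -?h' ?e // -e.
  have e : \sum_(i <- s1) c i * (chi i g - chi j g) * (sim i i0)%:R = 0.
    apply: IH => // [i i' /psim -> //|x Dx].
    rewrite big_filter.
    transitivity (\sum_(i <- s) c i * (chi i g - chi j g) * chi i x).
      rewrite [RHS](bigID (fun i => sim i j)) /= [X in _ = X + _]big1 ?add0r //.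
      by move=> i /asboolP -> //; rewrite subrr mulr0 mul0r.
    transitivity (\sum_(i <- s) c i * chi i (mul g x)
                   - chi j g * \sum_(i <- s) c i * chi i x).
      rewrite mulr_sumr -sumrB; apply: eq_bigr => i _.
      by rewrite chiM // mulrBr mulrBl [chi j g * _]mulrCA !mulrA.
    by rewrite !h ?mulr0 ?subr0 //; apply: DM.
  have dg : chi i0 g - chi j g != 0 by rewrite subr_eq0 eq_sym.
  apply: (mulIf dg); rewrite mul0r -[RHS]e big_filter mulr_suml big_mkcond [RHS]big_mkcond.
  apply: eq_bigr => i _ /=; case: (boolP (sim i i0)) => [/asboolP si|_]; last first.
    by rewrite mulr0 if_same.
  rewrite mulr1 si // ifT //; apply/negP => /asboolP sj.
  by move: gj; rewrite -si // sj // eqxx.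
have class1 x : D x -> \sum_(i <- [seq i <- s | ~~ sim i i0]) c i * chi i x = 0.
  rewrite big_filter => Dx; have := h x Dx; rewrite (bigID (fun i => sim i i0)) /=.
  rewrite (eq_bigr (fun i => c i * chi i0 x)) => [|i /asboolP -> //].
  by rewrite -mulr_suml class0 mul0r add0r.
rewrite (bigID (fun i => sim i i0)) /=.
rewrite (eq_bigr (fun i => c i * psi i0)) => [|i /asboolP si]; last by rewrite (psiP i i0).
rewrite -mulr_suml class0 mul0r add0r -big_filter; apply: IH class1 => //.
rewrite -ltnS; apply: leq_trans sm; rewrite ltnS /s /= ifF; last first.
  by apply/negbTE; rewrite negbK; apply/asboolP.
by rewrite ltnS size_filter count_size.
Qed.

End Dedekind.

Section CharacterSums.
Variables (K A : comNzRingType) (iota : {rmorphism K -> A}) (n : nat).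

Definition mono (m : 'I_n -> nat) (t : 'rV[A]_n) : A := \prod_i t 0 i ^+ m i.

Definition charsum (s : seq (A * ('I_n -> nat))) (t : 'rV[A]_n) : A :=
  \sum_(x <- s) x.1 * mono x.2 t.

Lemma mono0 t : mono (fun=> 0%N) t = 1.
Proof. by rewrite /mono big1. Qed.

Lemma mono1 t k : mono (fun i => nat_of_bool (i == k)) t = t 0 k.
Proof.
rewrite /mono (bigD1 k) //= eqxx expr1 big1 ?mulr1 // => i /negbTE ->.
by rewrite expr0.
Qed.

Lemma monoD m1 m2 t : mono (fun i => m1 i + m2 i)%N t = mono m1 t * mono m2 t.
Proof. by rewrite /mono -big_split; apply: eq_bigr => i _; rewrite exprD. Qed.

Lemma charsum_ev (P Q : 'M[A]_n) (p : mpoly.mpoly (n * n) K) :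
  exists s, forall t, ev iota p (P *m diag_mx t *m Q) = charsum s t.
Proof.
elim/mpoly_ring_ind: p => [c|k|p q [s sP] [t tP]|p q [s sP] [t tP]].
- by exists [:: (iota c, fun=> 0%N)] => t; rewrite evC /charsum big_seq1 mono0 mulr1.
- case/mxvec_indexP: k => i j.
  exists [seq (P i k * Q k j, fun l => nat_of_bool (l == k)) | k <- enum 'I_n] => t.
  have -> : mpoly.mpolyX K (mpoly.mnm1 (mxvec_index i j)) = genmx K n i j by rewrite mxE.
  rewrite ev_genmx mxE /charsum big_map big_enum; apply: eq_bigr => k _ /=.
  by rewrite mono1 mul_mx_diag mxE mulrAC.
- by exists (s ++ t) => u; rewrite evD sP tP /charsum big_cat.
- exists [seq (x.1 * y.1, fun i => (x.2 i + y.2 i)%N) | x <- s, y <- t] => u.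
  rewrite evM sP tP /charsum big_allpairs_dep mulr_suml; apply: eq_bigr => x _.
  by rewrite mulr_sumr; apply: eq_bigr => y _ /=; rewrite monoD mulrACA.
Qed.

End CharacterSums.

Section IntegerCharacters.
Variables (C : fieldType) (n : nat).
Implicit Types (t u : 'rV[C]_n) (l m : 'I_n -> int).

Definition zmono m t : C := \prod_i t 0 i ^ m i.
Definition hadamard t u : 'rV[C]_n := \row_i (t 0 i * u 0 i).
Definition unit_row t : Prop := forall i, t 0 i != 0.

Lemma zmonoM m t u : zmono m (hadamard t u) = zmono m t * zmono m u.
Proof. by rewrite /zmono -big_split; apply: eq_bigr => i _; rewrite mxE expfzMl. Qed.

Lemma monoM (m : 'I_n -> nat) t u : mono m (hadamard t u) = mono m t * mono m u.
Proof. by rewrite /mono -big_split; apply: eq_bigr => i _; rewrite mxE exprMn. Qed.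

Lemma mono_neq0 (m : 'I_n -> nat) t : unit_row t -> mono m t != 0.
Proof. by move=> ut; apply/prodf_neq0 => i _; rewrite expf_neq0. Qed.

Lemma zmonoB m l t : unit_row t -> zmono (fun i => m i - l i) t = zmono m t / zmono l t.
Proof.
move=> ut; rewrite /zmono -prodfV -big_split; apply: eq_bigr => i _ /=.
by rewrite expfzDr // -invr_expz.
Qed.

Lemma zmono_nat (m : 'I_n -> nat) t : zmono (fun i => (m i)%:Z) t = mono m t.
Proof. by []. Qed.

Lemma zmonoX m t k : zmono (fun i => m i * k%:Z) t = zmono m t ^+ k.
Proof. by rewrite /zmono -prodrXl; apply: eq_bigr => i _; rewrite -exprz_exp. Qed.

Lemma zmono1 m : zmono m (const_mx 1) = 1.
Proof. by rewrite /zmono big1 // => i _; rewrite mxE exp1rz. Qed.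

(* The Zariski closure of a set of points of the torus closed under
   products is cut out by the characters that are trivial on it. *)
Lemma torus_closure (D : 'rV[C]_n -> Prop) (s : seq (C * ('I_n -> nat))) t0 :
  (forall t u, D t -> D u -> D (hadamard t u)) -> D (const_mx 1) ->
  (forall t, D t -> unit_row t) -> unit_row t0 ->
  (forall m, (forall t, D t -> zmono m t = 1) -> zmono m t0 = 1) ->
  (forall t, D t -> charsum s t = 0) -> charsum s t0 = 0.
Proof.
move=> DM D1 Du ut0 h0 hs; rewrite /charsum.
apply: (@dedekind_repeated C _ hadamard D (const_mx 1) DM D1 _ (fun x t => mono x.2 t)
  _ _ s (fun x => x.1) (fun x => mono x.2 t0)) => //.
- by move=> x t u _ _; rewrite monoM.
- by move=> x; apply: mono_neq0 => i; rewrite mxE oner_neq0.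
move=> x y xy; have : zmono (fun i => (x.2 i)%:Z - (y.2 i)%:Z) t0 = 1.
  apply: h0 => t Dt; rewrite zmonoB; last exact: Du.
  by rewrite !zmono_nat xy // divff // mono_neq0 //; apply: Du.
rewrite zmonoB // !zmono_nat => /eqP; rewrite -(inj_eq (mulIf (mono_neq0 y.2 ut0))).
by rewrite divfK ?mono_neq0 // mul1r => /eqP.
Qed.

End IntegerCharacters.

Section SpanFinite.
Variables (F : fieldType) (n : nat).

(** Rows are taken from [V] with the largest possible rank; a further vector of [V] cannot raise
    it. *)
Lemma span_finite (V : 'rV[F]_n -> Prop) : exists k (B : 'M[F]_(k, n)),
  (forall i, V (row i B)) /\ forall v, V v -> (v <= B)%MS.
Proof.
pose P (r : nat) := `[< exists k (B : 'M[F]_(k, n)), (forall i, V (row i B)) /\ \rank B = r >].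
have P0 : P 0%N.
  by apply/asboolP; exists 0%N, 0; split=> [[]//|]; rewrite mxrank0.
have Pn r : P r -> (r <= n)%N by move=> /asboolP [k [B [_ <-]]]; apply: rank_leq_col.
have exP : exists r, P r by exists 0%N.
case: (ex_maxnP exP Pn) => r /asboolP [k [B [VB rB]]] maxr.
exists k, B; split=> // v Vv.
have /maxr : P (\rank (col_mx v B)).
  apply/asboolP; exists (1 + k)%N, (col_mx v B); split=> // i.
  rewrite -(splitK i); case: (fintype.split i) => j /=; last by rewrite rowKd.
  by rewrite rowKu row_id.
rewrite -addsmxE -rB => le_r.
have := mxrank_leqif_sup (addsmxSr v B); case=> le_r' /esym.
by rewrite eqn_leq le_r' le_r addsmx_sub => /andP[].
Qed.

End SpanFinite.

Section Lattices.
Variable n : nat.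
Implicit Types (l m : 'I_n -> int) (M : ('I_n -> int) -> Prop).

Definition zdot l m : int := \sum_i l i * m i.

(** The last clause says that the quotient is torsion-free; for the characters trivial on a
    diagonalizable group this is the counterpart of connectedness. *)
Definition saturated_lattice M : Prop :=
  [/\ M (fun=> 0), forall l m, M l -> M m -> M (fun i => l i - m i) &
      forall m (k : nat), M (fun i => m i * k.+1%:Z) -> M m].

Lemma clear_denominators r (v : 'I_r -> rat) :
  exists (N : nat) (c : 'I_r -> int), forall k, v k * N.+1%:R = (c k)%:~R.
Proof.
pose N : int := \prod_j denq (v j).
have N0 : 0 < N by apply: prodr_gt0 => j _; apply: denq_gt0.
exists `|N|%N.-1, (fun k => numq (v k) * \prod_(j | j != k) denq (v j)) => k.
rewrite prednK ?absz_gt0 ?gt_eqF // pmulrn gtz0_abs // intrM.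
have -> : N = denq (v k) * \prod_(j | j != k) denq (v j) by rewrite /N (bigD1 k).
by rewrite intrM mulrA numqE.
Qed.

Lemma lattice_opp M m : saturated_lattice M -> M m -> M (fun i => - m i).
Proof.
move=> [M0 MB _] Mm; have := MB _ _ M0 Mm.
by congr M; apply/funext => i; rewrite sub0r.
Qed.

Lemma lattice_add M l m : saturated_lattice M -> M l -> M m -> M (fun i => l i + m i).
Proof.
move=> LM Ml Mm; have [_ MB _] := LM; have := MB _ _ Ml (lattice_opp LM Mm).
by congr M; apply/funext => i; rewrite opprK.
Qed.

Lemma lattice_scale M m (c : int) : saturated_lattice M -> M m -> M (fun i => c * m i).
Proof.
move=> LM Mm; have [M0 _ _] := LM.
have pos k : M (fun i => k%:Z * m i).
  elim: k => [|k IH]; first by move: M0; congr M; apply/funext => i; rewrite mul0r.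
  have := lattice_add LM Mm IH; congr M; apply/funext => i.
  by rewrite intS mulrDl mul1r.
case: c => k; first exact: pos.
have := lattice_opp LM (pos k.+1); congr M; apply/funext => i.
by rewrite NegzE mulNr.
Qed.

Lemma lattice_sum M (I : Type) (r : seq I) (B : I -> 'I_n -> int) (c : I -> int) :
  saturated_lattice M -> (forall k, M (B k)) -> M (fun i => \sum_(k <- r) c k * B k i).
Proof.
move=> LM MB; elim: r => [|k r IH].
  by have [M0 _ _] := LM; move: M0; congr M; apply/funext => i; rewrite big_nil.
have := lattice_add LM (lattice_scale (c k) LM (MB k)) IH.
by congr M; apply/funext => i; rewrite big_cons.
Qed.

(** A saturated subgroup of [Z^n] consists of the integral points of its rational span, and a vector
    outside a rational subspace is detected by the cokernel. Clearing denominators makes both facts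
    integral. *)
Lemma lattice_perp_perp M m : saturated_lattice M ->
  (forall l, (forall m', M m' -> zdot m' l = 0) -> zdot m l = 0) -> M m.
Proof.
move=> LM h; have [_ _ Msat] := LM.
pose rowq (m : 'I_n -> int) : 'rV[rat]_n := \row_i (m i)%:~R.
have [k [B [VB spB]]] := span_finite (fun v => exists2 m, M m & v = rowq m).
have VB' i : exists m, M m /\ row i B = rowq m by have [m' ? ?] := VB i; exists m'.
have [b bP] := choice VB'.
have BE i j : B i j = (b i j)%:~R.
  have [_ /(congr1 (fun v : 'rV_n => v 0 j))] := bP i.
  by rewrite !mxE.
have [/submxP [c cB]|] := boolP (rowq m <= B)%MS.
  have [N [c' c'P]] := clear_denominators (fun i => c 0 i).
  apply: (Msat _ N).
  have Mb i : M (b i) by have [] := bP i.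
  have := lattice_sum (index_enum _) c' LM Mb; congr M; apply/funext => j; apply/eqP; rewrite -(@eqr_int rat); apply/eqP.
  rewrite rmorph_sum /= intrM -pmulrn.
  move: cB => /(congr1 (fun v : 'rV_n => v 0 j)); rewrite !mxE => ->.
  by rewrite mulr_suml; apply: eq_bigr => i _; rewrite intrM -c'P BE mulrAC.
rewrite submxE => /eqP nz; exfalso; apply: nz; apply/rowP => j; rewrite [RHS]mxE.
have [N [c cP]] := clear_denominators (fun i => cokermx B i j).
have dotq m' : (zdot m' c)%:~R = (rowq m' *m cokermx B) 0 j * N.+1%:R.
  rewrite mxE mulr_suml /zdot rmorph_sum; apply: eq_bigr => i _ /=.
  by rewrite intrM -cP [rowq _ 0 i]mxE mulrA.
have N0 : N.+1%:R != 0 :> rat by rewrite pnatr_eq0.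
apply: (mulIf N0); rewrite -dotq mul0r h // => m' Mm'.
apply/eqP; rewrite -(@eqr_int rat) dotq.
have /submxP [d ->] : (rowq m' <= B)%MS by apply: spB; exists m'.
by rewrite -mulmxA mulmx_coker mulmx0 mxE mul0r.
Qed.

End Lattices.

Section TorusConnected.
Variables (C : numFieldType) (n : nat) (P : 'M[C]_n).
Implicit Types (l m : 'I_n -> int) (M : ('I_n -> int) -> Prop) (t : 'rV[C]_n).

Definition in_torus M t : Prop :=
  unit_row t /\ forall m, M m -> zmono m t = 1.

Definition torus_mx M : set 'M[C]_n :=
  [set invmx P *m diag_mx t *m P | t in in_torus M].

Definition cochar l (c : C) : 'rV[C]_n := \row_i (c ^ l i).

Lemma cochar_unit l c : c != 0 -> unit_row (cochar l c).
Proof. by move=> c0 i; rewrite mxE expfz_neq0. Qed.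

Lemma zmono_cochar m l c : c != 0 -> zmono m (cochar l c) = c ^ zdot m l.
Proof.
move=> c0; rewrite /zmono /zdot.
rewrite (big_morph (fun k => c ^ k) (id1 := 1) (op1 := *%R)) //; last first.
  by move=> a b; rewrite expfzDr.
by apply: eq_bigr => i _; rewrite mxE exprz_exp mulrC.
Qed.

Lemma cochar_in_torus M l c : c != 0 -> (forall m, M m -> zdot m l = 0) ->
  in_torus M (cochar l c).
Proof.
move=> c0 h; split=> [|m Mm]; first exact: cochar_unit.
by rewrite zmono_cochar // h.
Qed.

Lemma in_torusM M t u : in_torus M t -> in_torus M u -> in_torus M (hadamard t u).
Proof.
move=> [ut ht] [uu hu]; split=> [i|m Mm]; first by rewrite mxE mulf_neq0.
by rewrite zmonoM ht ?hu ?mulr1.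
Qed.

Lemma in_torus1 M : in_torus M (const_mx 1).
Proof. by split=> [i|m _]; rewrite ?mxE ?oner_neq0 // zmono1. Qed.

Lemma poly_eq0_infinite (p : {poly C}) : (forall c, c != 0 -> p.[c] = 0) -> p = 0.
Proof.
move=> h; apply/eqP; apply: contraT => p0.
have := @max_poly_roots _ p [seq k.+1%:R | k <- iota 0 (size p)] p0.
rewrite size_map size_iota ltnn; apply.
  by apply/allP => x /mapP [k _ ->]; apply/rootP/h; rewrite pnatr_eq0.
rewrite map_inj_uniq ?iota_uniq // => i j /eqP.
by rewrite eqr_nat => /eqP [].
Qed.

(** Along a cocharacter a combination of characters is a Laurent polynomial in [c]; the factor
    [c ^+ N] clears negative exponents. *)
Lemma charsum_cochar (s : seq (C * ('I_n -> nat))) t l :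
  exists (q : {poly C}) (N : nat), forall c, c != 0 ->
    q.[c] = c ^+ N * charsum s (hadamard t (cochar l c)).
Proof.
elim: s => [|x s [q [N qP]]].
  by exists 0, 0%N => c c0; rewrite horner0 /charsum big_nil mulr0.
pose k := zdot (fun i => (x.2 i)%:Z) l.
pose a := absz k; pose e := absz (k + a%:Z)%R.
exists ((x.1 * mono x.2 t) *: 'X^(e + N)%N + 'X^a * q), (a + N)%N => c c0.
rewrite hornerD hornerZ hornerXn hornerM hornerXn qP // /charsum big_cons mulrDr.
rewrite monoM -(zmono_nat _ (cochar l c)) zmono_cochar // -/k; congr (_ + _); last first.
  by rewrite exprD mulrA.
have -> : c ^+ (e + N) = c ^+ (a + N) * c ^ k.
  rewrite !exprD mulrAC; congr (_ * _); rewrite -[c ^+ a]/(c ^ a%:Z) -expfzDr //.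
  by rewrite -[LHS]/(c ^ e%:Z) addrC; congr (c ^ _); rewrite /e gez0_abs // /a; lia.
by move: (c ^ k) (c ^+ _) => u w; ring.
Qed.

(** A point moved along a cocharacter describes a rational curve on which the product of an equation
    of [Z1] and one of [Z2] vanishes identically, so the curve cannot leave [Z1]. The translations
    that preserve [Z1] are then Zariski dense in the torus. *)
Theorem torus_connected M : P \in unitmx -> saturated_lattice M ->
  zariski_connected (torus_mx M).
Proof.
move=> Pu LM.
suff main (Z1 Z2 : set 'M[C]_n) : zariski_closed Z1 -> zariski_closed Z2 ->
    (torus_mx M `<=` Z1 `|` Z2)%classic -> (torus_mx M `&` Z1 `&` Z2 = set0)%classic ->
    Z1 1%:M -> (torus_mx M `&` Z2 = set0)%classic.
  move=> Z1 Z2 c1 c2 cov disj.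
  have T1 : torus_mx M 1%:M.
    exists (const_mx 1); first exact: in_torus1.
    by rewrite diag_const_mx mulmx1 mulVmx.
  case: (cov _ T1) => z; [right|left]; first exact: main c1 c2 cov disj z.
  apply: (main Z2 Z1) => //; first by rewrite setUC.
  by rewrite -setIA [(Z2 `&` Z1)%classic]setIC setIA.
move=> [I1 ->] [I2 ->] cov disj z1.
pose f t := invmx P *m diag_mx t *m P.
have step t l c : in_torus M t -> c != 0 -> (forall m, M m -> zdot m l = 0) ->
    zeros idfun I1 (f t) -> zeros idfun I1 (f (hadamard t (cochar l c))).
  move=> tM c0 lM zt; apply: contrapT => nz.
  have cM d : d != 0 -> in_torus M (hadamard t (cochar l d)).
    by move=> d0; apply: in_torusM => //; apply: cochar_in_torus.
  have [p1 Ip1 ev1] : exists2 p, I1 p & ev idfun p (f (hadamard t (cochar l c))) <> 0.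
    by apply: contrapT => no; apply: nz => p Ip; apply: contrapT => h; apply: no; exists p.
  have [p2 Ip2 ev2] : exists2 p, I2 p & ev idfun p (f t) <> 0.
    apply: contrapT => no; have : (set0 : set 'M[C]_n) (f t).
      rewrite -disj; split; first by split=> //; exists t.
      by move=> p Ip; apply: contrapT => h; apply: no; exists p.
    by [].
  have [s1 s1P] := charsum_ev (idfun : {rmorphism C -> C}) (invmx P) P p1.
  have [s2 s2P] := charsum_ev (idfun : {rmorphism C -> C}) (invmx P) P p2.
  have [q1 [N1 q1P]] := charsum_cochar s1 t l.
  have [q2 [N2 q2P]] := charsum_cochar s2 t l.
  have q12 : q1 * q2 = 0.
    apply: poly_eq0_infinite => d d0; rewrite hornerM q1P // q2P // -s1P -s2P.
    have [z|z] := cov (f (hadamard t (cochar l d))) (ex_intro2 _ _ _ (cM d d0) erefl).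
      by rewrite (z p1 Ip1) mulr0 mul0r.
    by rewrite (z p2 Ip2) !mulr0.
  move/eqP: q12; rewrite mulf_eq0 => /orP [/eqP q|/eqP q].
    have := q1P c c0; rewrite q horner0 -s1P => /esym/eqP.
    by rewrite mulf_eq0 expf_eq0 (negbTE c0) andbF /= => /eqP.
  have := q2P 1 (oner_neq0 _); rewrite q horner0 -s2P => /esym/eqP.
  rewrite expr1n mul1r => /eqP; congr (ev idfun p2 (f _) <> 0): ev2.
  by apply/rowP => i; rewrite !mxE exp1rz mulr1.
pose D t := in_torus M t /\ forall u, in_torus M u -> zeros idfun I1 (f u) ->
  zeros idfun I1 (f (hadamard u t)).
have sub : (torus_mx M `<=` zeros idfun I1)%classic.
  move=> _ [t0 tM0 <-] p Ip.
  have [s sP] := charsum_ev (idfun : {rmorphism C -> C}) (invmx P) P p.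
  rewrite sP; apply: (@torus_closure _ _ D) => [t u [tM ht] [uM hu]||t [[]]||m hm|t [tM ht]] //.
  - split=> [|w wM zw]; first exact: in_torusM.
    have -> : hadamard w (hadamard t u) = hadamard (hadamard w t) u.
      by apply/rowP => i; rewrite !mxE mulrA.
    by apply: hu; [exact: in_torusM|exact: ht].
  - split=> [|u uM]; first exact: in_torus1.
    congr (zeros _ _ (f _)); apply/rowP => i; rewrite !mxE mulr1 //.
  - by case: tM0.
  - have [_ h] := tM0; apply: h; apply: lattice_perp_perp LM _ => l lM.
    (* 2 is not a root of unity: a character trivial at [cochar l 2] is orthogonal to [l]. *)
    have c2 : 2%:R != 0 :> C by rewrite pnatr_eq0.
    have D2 : D (cochar l 2%:R).
      by split=> [|u uM zu]; [exact: cochar_in_torus|exact: step].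
    have := hm _ D2; rewrite zmono_cochar // => /eqP; rewrite pexprz_eq1 ?ler0n // => /orP [/eqP //|].
    by rewrite -subr_eq0 -[2%:R]/(1 + 1) addrK oner_eq0.
  - rewrite -sP; have := ht (const_mx 1) (in_torus1 M).
    have -> : hadamard (const_mx 1) t = t by apply/rowP => i; rewrite !mxE mul1r.
    by apply => //; rewrite /f diag_const_mx mulmx1 mulVmx.
apply/seteqP; split=> // x [Tx Z2x]; rewrite -disj; split=> //; split=> //.
exact: sub.
Qed.

End TorusConnected.

(** * Derived connectives and transfer of inclusions *)

Section DerivedFormulas.
Variables (K : rcfType) (n : nat).
Implicit Types (p : mxpoly K n) (t : mterm K n) (f g : mform K n).

Definition FTrue : mform K n := FNot (FPos 0 (MVar _ _ 0)).
Definition FImp f g := FNot (FAnd f (FNot g)).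
Definition FOr f g := FNot (FAnd (FNot f) (FNot g)).
Definition FAll j f := FNot (FEx j (FNot f)).
(** Equality is the absence of both strict signs, [FPos] being the only atom on a real matrix. *)
Definition FZero p t := FAnd (FNot (FPos p t)) (FNot (FPos (- p) t)).
Definition FConj (I : Type) (r : seq I) (f : I -> mform K n) :=
  foldr (fun i g => FAnd (f i) g) FTrue r.
Definition FZeros (s : seq (mxpoly K n)) t := FConj s (fun p => FZero p t).

Fixpoint FSa (D : sa_formula K n) t : mform K n :=
  match D with
  | SaPos p => FPos p t
  | SaNot D1 => FNot (FSa D1 t)
  | SaAnd D1 D2 => FAnd (FSa D1 t) (FSa D2 t)
  | SaOr D1 D2 => FOr (FSa D1 t) (FSa D2 t)
  end.

Variables (L : rcfType) (iota : {rmorphism K -> L}).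
Implicit Types (e : nat -> 'M[L]_n).

Lemma msatTrue e : msat iota e FTrue.
Proof. by rewrite /= ev0 ltxx. Qed.

Lemma msatImp e f g : msat iota e (FImp f g) <-> (msat iota e f -> msat iota e g).
Proof.
split=> /= [h hf|h [hf ng]]; last exact: ng (h hf).
by apply: contrapT => ng; apply: h.
Qed.

Lemma msatOr e f g : msat iota e (FOr f g) <-> (msat iota e f \/ msat iota e g).
Proof.
split=> /= [h|[h|h] []] //; apply: contrapT => no; apply: h.
by split=> h; apply: no; [left|right].
Qed.

Lemma msatAll e j f : msat iota e (FAll j f) <-> forall X, msat iota (upd e j X) f.
Proof.
split=> /= [h X|h [X]]; last exact.
by apply: contrapT => no; apply: h; exists X.
Qed.

Lemma msatZero e p t : msat iota e (FZero p t) <-> ev iota p (meval iota e t) = 0.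
Proof.
rewrite /= evN oppr_gt0; split=> [[/negP a /negP b]|->]; last by rewrite ltxx.
by apply/eqP; rewrite eq_le !leNgt a b.
Qed.

Lemma msatConj (I : eqType) (r : seq I) (f : I -> mform K n) e :
  msat iota e (FConj r f) <-> forall i, i \in r -> msat iota e (f i).
Proof.
elim: r => [|i r IH]; first by split=> // _; apply: msatTrue.
rewrite /=; split=> [[h1 /IH h2] j|h].
  by rewrite inE => /orP [/eqP ->|/h2].
split; first by apply: h; rewrite inE eqxx.
by apply/IH => j jr; apply: h; rewrite inE jr orbT.
Qed.

Lemma msatZeros s e t :
  msat iota e (FZeros s t) <-> (forall p, p \in s -> ev iota p (meval iota e t) = 0).
Proof.
rewrite /FZeros msatConj.
by split=> h p ps; [apply/msatZero|apply/msatZero]; apply: h.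
Qed.

Lemma msatSa D e t : msat iota e (FSa D t) <-> sa_set iota D (meval iota e t).
Proof.
elim: D => [p|D IH|D1 IH1 D2 IH2|D1 IH1 D2 IH2] //.
- by rewrite /= IH.
- by rewrite /= IH1 IH2.
- by rewrite [FSa _ _]/= msatOr IH1 IH2.
Qed.

End DerivedFormulas.

Definition msatE := (msatImp, msatOr, msatAll, msatZero, msatZeros, msatSa).

Section ZerosTransfer.
Variables (K L : rcfType) (iota : {rmorphism K -> L}) (n : nat).

Lemma transfer_closed (f : mform K n) :
  msat (idfun : {rmorphism K -> K}) (fun=> 0) f <-> msat iota (fun=> 0) f.
Proof.
have e0 : (fun k : nat => map_mx iota (0 : 'M[K]_n)) = (fun=> 0).
  by apply/funext => k; rewrite map_mx0.
by rewrite (msat_transfer iota) e0.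
Qed.

(** An inclusion of zero sets becomes first-order once both systems are replaced by finite ones. *)
Lemma zeros_sub_transfer (S1 S2 : set (mxpoly K n)) :
  (zeros idfun S1 `<=` zeros idfun S2)%classic ->
  (zeros iota S1 `<=` zeros iota S2)%classic.
Proof.
have [s1 s1P] := zeros_finite S1; have [s2 s2P] := zeros_finite S2.
pose f : mform K n := FAll 0 (FImp (FZeros s1 (MVar _ _ 0)) (FZeros s2 (MVar _ _ 0))).
move=> sub; have : msat iota (fun=> 0) f.
  apply/transfer_closed; rewrite msatE => X; rewrite msatE !msatE /= /upd /= => h.
  by apply/(s2P _ (idfun : {rmorphism K -> K})); apply: sub; apply/s1P.
rewrite msatE => h X /s1P X1; apply/s2P; have := h X.
by rewrite msatE !msatE /upd /=; apply.
Qed.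

Lemma sa_set_transfer (D1 D2 : sa_formula K n) :
  sa_set idfun D1 = sa_set idfun D2 -> sa_set iota D1 = sa_set iota D2.
Proof.
suff sub (E1 E2 : sa_formula K n) : (sa_set idfun E1 `<=` sa_set idfun E2)%classic ->
    (sa_set iota E1 `<=` sa_set iota E2)%classic.
  by move=> e; apply/seteqP; split; apply: sub; rewrite e.
pose f : mform K n := FAll 0 (FImp (FSa E1 (MVar _ _ 0)) (FSa E2 (MVar _ _ 0))).
move=> sb; have : msat iota (fun=> 0) f.
  by apply/transfer_closed; rewrite msatE => X; rewrite msatE !msatE /= /upd /= => /sb.
by rewrite msatE => h X X1; have := h X; rewrite msatE !msatE /upd /=; apply.
Qed.

End ZerosTransfer.

(** * Diagonalization of symmetric matrices over a real closed field *)

Section SymmetricDiagonalization.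
Variable K : rcfType.

Lemma real_mxP n (A : 'M[K[i]]_n) : A \is a mxOver Num.real ->
  exists B : 'M[K]_n, A = map_mx (real_complex K) B.
Proof.
move=> /mxOverP Ar; exists (\matrix_(i, j) complex.Re (A i j)).
by apply/matrixP => i j; rewrite !mxE RRe_real.
Qed.

Lemma map_mx_complexI n m (A B : 'M[K]_(n, m)) :
  map_mx (real_complex K) A = map_mx (real_complex K) B -> A = B.
Proof.
by move=> /matrixP e; apply/matrixP => i j; move: (e i j); rewrite !mxE => /complexI.
Qed.

(** Over K[i] the spectral theorem applies, and the eigenvalues are real because the matrix is
    hermitian; two matrices over K that are similar over K[i] are similar over K. *)
Lemma sym_diagonalizable n (w : 'M[K]_n) : w^T = w ->
  exists (P : 'M[K]_n) (d : 'rV[K]_n), P \in unitmx /\ w = invmx P *m diag_mx d *m P.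
Proof.
move=> wT; pose wC := map_mx (real_complex K) w.
have wr : wC \is a mxOver Num.real.
  by apply/mxOverP => i j; rewrite mxE complex_real.
have ws : wC \is symmetricmx.
  by apply/is_hermitianmxP; rewrite expr0 scale1r map_mx_id // /wC map_trmx wT.
have wh := realsym_hermsym ws wr.
have /orthomx_spectralP wE := hermitian_normalmx wh.
have dr := hermitian_spectral_diag_real wh.
have Dr : diag_mx (spectral_diag wC) \is a mxOver Num.real.
  apply/mxOverP => i j; rewrite mxE; case: eqP => _; rewrite ?mulr0n ?rpred0 // mulr1n.
  exact: (mxOverP dr).
have sim : similar_in unitmx wC (diag_mx (spectral_diag wC)).
  exists (spectralmx wC); first exact: spectral_unit.
  apply/similarP; rewrite ?spectral_unit // {2}wE.
  by rewrite !mulmxA mulmxV ?spectral_unit // mul1mx.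
have [PC /andP[PCr PCu] PCE] := real_similar sim wr Dr.
have [P PE] := real_mxP PCr.
have [D DE] := real_mxP Dr.
have Pu : P \in unitmx by rewrite -(map_unitmx (real_complex K)) -PE.
exists P, (\row_i D i i); split=> //.
have -> : diag_mx (\row_i D i i) = D.
  apply/matrixP => i j; rewrite !mxE; case: eqP => [->|ij]; rewrite ?mulr1n // mulr0n.
  have /matrixP/(_ i j) := DE; rewrite !mxE; case: eqP => // _.
  by rewrite mulr0n -(rmorph0 (real_complex K)) => /complexI.
have PwE : P *m w = D *m P.
  apply: map_mx_complexI; rewrite !map_mxM -/wC -PE -DE.
  by apply/similarP.
by rewrite -mulmxA -PwE mulKmx.
Qed.

End SymmetricDiagonalization.

(** * Diagonalizable groups and their characters *)

Lemma diag_mxM (A : comNzRingType) n (t u : 'rV[A]_n) :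
  diag_mx t *m diag_mx u = diag_mx (\row_i (t 0 i * u 0 i)).
Proof.
rewrite mul_mx_diag; apply/matrixP => i j; rewrite !mxE.
by case: eqP => [->|_]; rewrite ?mulr1n // !mulr0n mul0r.
Qed.

Lemma diag_mx_row (A : nzRingType) n (M : 'M[A]_n) :
  (forall i j, i != j -> M i j = 0) -> M = diag_mx (\row_i M i i).
Proof.
move=> h; apply/matrixP => i j; rewrite !mxE.
by case: eqVneq => [->|/h ->]; rewrite ?mulr1n ?mulr0n.
Qed.

Section Dconj.
Variables (A : fieldType) (n : nat) (P : 'M[A]_n).
Hypothesis Pu : P \in unitmx.
Implicit Types t u : 'rV[A]_n.

Definition dconj t : 'M[A]_n := invmx P *m diag_mx t *m P.

Lemma dconjM t u : dconj t *m dconj u = dconj (hadamard t u).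
Proof. by rewrite /dconj -diag_mxM !mulmxA mulmxK. Qed.

Lemma dconj1 : dconj (const_mx 1) = 1%:M.
Proof. by rewrite /dconj diag_const_mx mulmx1 mulVmx. Qed.

Lemma dconjK t : P *m dconj t *m invmx P = diag_mx t.
Proof. by rewrite /dconj !mulmxA mulmxV // mul1mx mulmxK. Qed.

Lemma dconj_inj : injective dconj.
Proof.
move=> t u /(congr1 (fun X => P *m X *m invmx P)); rewrite !dconjK.
by move=> /matrixP e; apply/rowP => i; move: (e i i); rewrite !mxE eqxx !mulr1n.
Qed.

Lemma dconj_diag (M : 'M[A]_n) : (forall i j, i != j -> (P *m M *m invmx P) i j = 0) ->
  M = dconj (\row_i (P *m M *m invmx P) i i).
Proof.
by move=> h; rewrite /dconj -diag_mx_row // !mulmxA mulVmx // mul1mx mulmxKV.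
Qed.

Lemma det_dconj t : \det (dconj t) = \prod_i t 0 i.
Proof. by rewrite /dconj !det_mulmx mulrAC -det_mulmx mulVmx // det1 mul1r det_diag. Qed.

Lemma dconj_unit t : (dconj t \in unitmx) = [forall i, t 0 i != 0].
Proof.
rewrite unitmxE det_dconj unitfE.
by apply/prodf_neq0/forallP => h i //; apply: h.
Qed.

Lemma dconjV t : unit_row t -> invmx (dconj t) = dconj (\row_i (t 0 i)^-1).
Proof.
move=> ut; have du : dconj t \in unitmx by rewrite dconj_unit; apply/forallP.
apply: (can_inj (mulKmx du)); rewrite mulmxV // dconjM -dconj1; congr dconj.
by apply/rowP => i; rewrite !mxE divff.
Qed.

End Dconj.

Lemma map_dconj (A B : fieldType) (f : {rmorphism A -> B}) n (P : 'M[A]_n) t :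
  map_mx f (dconj P t) = dconj (map_mx f P) (map_mx f t).
Proof. by rewrite /dconj !map_mxM map_invmx map_diag_mx. Qed.

Lemma map_zmono (A B : fieldType) (f : {rmorphism A -> B}) n (m : 'I_n -> int) t :
  f (zmono m t) = zmono m (map_mx f t).
Proof. by rewrite /zmono rmorph_prod; apply: eq_bigr => i _; rewrite mxE fmorphXz. Qed.

(** With [mneg], the positive and negative parts of an exponent vector: they turn [zmono m t = 1]
    into a polynomial equation. *)
Definition mpos n (m : 'I_n -> int) (i : 'I_n) : nat := if 0 <= m i then `|m i|%N else 0%N.
Definition mneg n (m : 'I_n -> int) (i : 'I_n) : nat := if 0 <= m i then 0%N else `|m i|%N.

Lemma zmono_pos_neg (A : fieldType) n (m : 'I_n -> int) (t : 'rV[A]_n) : unit_row t ->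
  zmono m t = mono (mpos m) t / mono (mneg m) t.
Proof.
move=> ut; rewrite -!zmono_nat -zmonoB //; congr (zmono _ t); apply/funext => i.
rewrite /mpos /mneg; case: ifP => h; first by rewrite subr0 gez0_abs.
by rewrite sub0r ltz0_abs ?opprK // ltNge h.
Qed.

Section TorusEquations.
Variables (K : fieldType) (n : nat) (P : 'M[K]_n).
Hypothesis Pu : P \in unitmx.

Definition conj_genmx : 'M[mpoly.mpoly (n * n) K]_n :=
  map_mx (@mpoly.mpolyC (n * n) K) P *m genmx K n *m
  map_mx (@mpoly.mpolyC (n * n) K) (invmx P).

Definition diag_poly (m : 'I_n -> nat) : mpoly.mpoly (n * n) K :=
  \prod_i conj_genmx i i ^+ m i.

(** The determinant equation is what makes the diagonal entries invertible; each character in [M]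
    contributes a binomial equation. *)
Definition torus_eqs (M : ('I_n -> int) -> Prop) : set (mpoly.mpoly (n * n) K) :=
  [set p | [\/ exists i j, i != j /\ p = conj_genmx i j, p = \det (genmx K n) - 1 |
    exists2 m, M m & p = diag_poly (mpos m) - diag_poly (mneg m)]].

Variables (A : fieldType) (iota : {rmorphism K -> A}).

Lemma ev_conj_genmx i j x :
  ev iota (conj_genmx i j) x = (map_mx iota P *m x *m invmx (map_mx iota P)) i j.
Proof.
have -> : ev iota (conj_genmx i j) x = map_mx (fun p => ev iota p x) conj_genmx i j.
  by rewrite [RHS]mxE.
by rewrite /conj_genmx !map_ev_mulmx !map_mpolyC_mx map_genmx map_invmx.
Qed.

Lemma ev_diag_poly m t : ev iota (diag_poly m) (dconj (map_mx iota P) t) = mono m t.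
Proof.
rewrite ev_prod /mono; apply: eq_bigr => i _; rewrite evXn ev_conj_genmx dconjK ?map_unitmx //.
by rewrite mxE eqxx mulr1n.
Qed.

Lemma torus_eqsP M x : zeros iota (torus_eqs M) x <->
  exists t, [/\ unit_row t, \prod_i t 0 i = 1, forall m, M m -> zmono m t = 1 &
    x = dconj (map_mx iota P) t].
Proof.
have PAu : map_mx iota P \in unitmx by rewrite map_unitmx.
split=> [zx|[t [ut t1 tM ->]] p].
  have xE : x = dconj (map_mx iota P) (\row_i (map_mx iota P *m x *m invmx (map_mx iota P)) i i).
    apply: dconj_diag => // i j ij; rewrite -ev_conj_genmx; apply: zx.
    by constructor 1; exists i, j.
  set t := \row_i _ in xE; exists t.
  have d1 : \prod_i t 0 i = 1.
    have : ev iota (\det (genmx K n) - 1) x = 0 by apply: zx; constructor 2.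
    rewrite evD evN ev1 ev_det map_genmx xE det_dconj // => /eqP.
    by rewrite subr_eq0 => /eqP.
  have ut : unit_row t.
    move=> i; apply: contraTneq (oner_neq0 A) => ti0.
    by rewrite negbK -d1; apply/eqP; rewrite (bigD1 i) //= ti0 mul0r.
  split=> // m Mm.
  have : ev iota (diag_poly (mpos m) - diag_poly (mneg m)) x = 0.
    by apply: zx; constructor 3; exists m.
  rewrite evD evN xE !ev_diag_poly => /eqP; rewrite subr_eq0 => /eqP e.
  by rewrite zmono_pos_neg // e divff // mono_neq0.
case=> [[i [j [ij ->]]]|->|[m Mm ->]].
- by rewrite ev_conj_genmx dconjK // mxE (negbTE ij) mulr0n.
- by rewrite evD evN ev1 ev_det map_genmx det_dconj // t1 subrr.
- rewrite evD evN !ev_diag_poly; apply/eqP; rewrite subr_eq0; apply/eqP.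
  by have := tM m Mm; rewrite zmono_pos_neg // => /(canRL (divfK (mono_neq0 _ ut))) ->; rewrite mul1r.
Qed.

End TorusEquations.

Lemma mx_group_torus (A : fieldType) n (P : 'M[A]_n) (T : 'rV[A]_n -> Prop) :
  P \in unitmx -> T (const_mx 1) -> (forall t, T t -> unit_row t) ->
  (forall t u, T t -> T u -> T (hadamard t u)) ->
  (forall t, T t -> T (\row_i (t 0 i)^-1)) ->
  mx_group [set dconj P t | t in T].
Proof.
move=> Pu T1 Tu TM TV; split.
- by move=> _ [t Tt <-] /=; rewrite dconj_unit //; apply/forallP; apply: Tu.
- by exists (const_mx 1); rewrite ?dconj1.
- by move=> _ _ [t Tt <-] [u Tu' <-]; rewrite dconjM //; exists (hadamard t u); auto.
- by move=> _ [t Tt <-]; rewrite dconjV //; [exists (\row_i (t 0 i)^-1); auto|apply: Tu].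
Qed.

Lemma zeros_torus_closure (K : comNzRingType) (A : fieldType) (iota : {rmorphism K -> A}) n
    (P : 'M[A]_n) (S : set (mpoly.mpoly (n * n) K)) (D : 'rV[A]_n -> Prop) t :
  (forall u w, D u -> D w -> D (hadamard u w)) -> D (const_mx 1) ->
  (forall u, D u -> unit_row u) -> unit_row t ->
  (forall m, (forall u, D u -> zmono m u = 1) -> zmono m t = 1) ->
  (forall u, D u -> zeros iota S (dconj P u)) -> zeros iota S (dconj P t).
Proof.
move=> DM D1 Du ut Dt DS p Sp.
have [s sP] := charsum_ev iota (invmx P) P p.
by rewrite sP; apply: (torus_closure DM D1 Du ut Dt) => u /DS /(_ _ Sp); rewrite -sP.
Qed.

Section SaturatedCharacters.
Variables (A : numFieldType) (n : nat) (P : 'M[A]_n) (T : set 'M[A]_n).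
Hypotheses (Pu : P \in unitmx) (T_conn : zariski_connected T) (T1 : T 1%:M)
  (T_diag : forall x, T x -> exists2 t, unit_row t & x = dconj P t).

(** With [x] and [y] the monomials of the positive and negative parts of [m], [x ^ k.+1 - y ^ k.+1]
    is [x - y] times a sum that equals [k.+1 * y ^ k], hence is nonzero, where [x = y]. The two
    factors cut T into disjoint closed pieces, and the identity lies on the first. *)
Lemma connected_char_torsion (m : 'I_n -> int) (k : nat) :
  (forall t, unit_row t -> T (dconj P t) -> zmono m t ^+ k.+1 = 1) ->
  forall t, unit_row t -> T (dconj P t) -> zmono m t = 1.
Proof.
move=> mk; pose f : {rmorphism A -> A} := idfun.
pose a := diag_poly P (mpos m); pose b := diag_poly P (mneg m).
pose c := \sum_(i < k.+1) a ^+ (k.+1.-1 - i) * b ^+ i.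
have fP : map_mx f P = P by rewrite map_mx_id.
have aE t : ev f a (dconj P t) = mono (mpos m) t by rewrite -{1}fP ev_diag_poly.
have bE t : ev f b (dconj P t) = mono (mneg m) t by rewrite -{1}fP ev_diag_poly.
have cE t : ev f c (dconj P t) =
    \sum_(i < k.+1) mono (mpos m) t ^+ (k.+1.-1 - i) * mono (mneg m) t ^+ i.
  by rewrite ev_sum; apply: eq_bigr => i _; rewrite evM !evXn aE bE.
have abE t : ev f (a - b) (dconj P t) = mono (mpos m) t - mono (mneg m) t.
  by rewrite evD evN aE bE.
pose Z1 := zeros f (fun p => p = a - b); pose Z2 := zeros f (fun p => p = c).
have cov : (T `<=` Z1 `|` Z2)%classic.
  move=> x Tx; have [t ut xE] := T_diag Tx.
  have : zmono m t ^+ k.+1 = 1 by apply: mk; rewrite // -xE.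
  rewrite zmono_pos_neg // expr_div_n => /(canRL (divfK (expf_neq0 _ (mono_neq0 _ ut)))).
  rewrite mul1r => /eqP; rewrite -subr_eq0 subrXX mulf_eq0 => /orP [/eqP h|/eqP h].
    by left=> _ ->; rewrite xE abE.
  by right=> _ ->; rewrite xE cE.
have disj : (T `&` Z1 `&` Z2 = set0)%classic.
  apply/seteqP; split=> // x [[Tx /(_ _ erefl) Z1x] /(_ _ erefl) Z2x].
  have [t ut xE] := T_diag Tx.
  move: Z1x Z2x; rewrite xE abE cE => /eqP; rewrite subr_eq0 => /eqP ->.
  rewrite (eq_bigr (fun=> mono (mneg m) t ^+ k)) => [|i _]; last first.
    by rewrite -exprD subnK // -ltnS.
  rewrite sumr_const card_ord => /eqP; rewrite mulrn_eq0 /= expf_eq0.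
  by rewrite (negbTE (mono_neq0 _ ut)) andbF.
have Z11 : Z1 1%:M.
  move=> _ ->; rewrite -(dconj1 Pu) abE /mono !big1 ?subrr // => i _; by rewrite mxE expr1n.
move=> t ut Tt; rewrite zmono_pos_neg //.
have [||/seteqP [TZ _]|/seteqP [TZ _]] := @T_conn Z1 Z2 _ _ cov disj.
- by exists (fun p => p = a - b).
- by exists (fun p => p = c).
- by case: (TZ 1%:M).
have [/(_ _ erefl)|Z2t] := cov _ Tt; last by case: (TZ (dconj P t)).
by rewrite abE => /eqP; rewrite subr_eq0 => /eqP ->; rewrite divff // mono_neq0.
Qed.

End SaturatedCharacters.

Lemma zeros_map (K A B : fieldType) (f : {rmorphism K -> A}) (g : {rmorphism A -> B}) n
    (I : set (mpoly.mpoly (n * n) K)) (x : 'M[A]_n) :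
  zeros (g \o f) I (map_mx g x) <-> zeros f I x.
Proof.
split=> h p Ip; have := h p Ip; first by rewrite ev_comp => /eqP; rewrite fmorph_eq0 => /eqP.
by rewrite ev_comp => ->; rewrite rmorph0.
Qed.

(* The algebraic closure K[i] enters only through an abstract field C over K. *)
Section TorusCharacters.
Variables (K : rcfType) (C : numFieldType) (jC : {rmorphism K -> C}) (n : nat).
Variables (S : set (mxpoly K n)) (P : 'M[K]_n).
Let PC := map_mx jC P.

Definition split_by (Q : 'M[K]_n) (T : set 'M[C]_n) : Prop :=
  forall s, T s -> is_diag_mx (map_mx jC Q *m s *m map_mx jC (invmx Q)).

Hypotheses (Pu : P \in unitmx) (S_grp : mx_group (zeros jC S))
  (S_det : (zeros jC S `<=` [set x | \det x = 1])%classic)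
  (S_conn : zariski_connected (zeros jC S)) (S_diag : split_by P (zeros jC S)).

Let PCu : PC \in unitmx. Proof. by rewrite map_unitmx. Qed.

Definition chars (m : 'I_n -> int) : Prop :=
  forall t, unit_row t -> zeros jC S (dconj PC t) -> zmono m t = 1.

Lemma zerosS_dconj x : zeros jC S x -> exists2 t, unit_row t & x = dconj PC t.
Proof.
move=> Sx; have xE : x = dconj PC (\row_i (PC *m x *m invmx PC) i i).
  apply: dconj_diag => // i j ij; have /is_diag_mxP := S_diag Sx.
  by rewrite map_invmx -/PC; apply.
exists (\row_i (PC *m x *m invmx PC) i i) => //.
have [xu _ _ _] := S_grp; have := xu _ Sx.
by rewrite /= {1}xE dconj_unit // => /forallP.
Qed.

(** A diagonalizable group given by equations is its own Zariski closure, so the characters trivial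
    on it cut it out. *)
Lemma zerosS_torus_mx : zeros jC S = torus_mx PC chars.
Proof.
apply/seteqP; split=> [x Sx|_ [t [ut tM] <-] p Sp].
  have [t ut xE] := zerosS_dconj Sx.
  by exists t => //; split=> // m; apply => //; rewrite -xE.
have [_ S1 SM _] := S_grp.
pose D (u : 'rV[C]_n) := unit_row u /\ zeros jC S (dconj PC u).
have DM u w : D u -> D w -> D (hadamard u w).
  move=> [uu Su] [uw Sw]; split=> [i|]; first by rewrite mxE mulf_neq0.
  by rewrite -dconjM //; apply: SM.
have D1 : D (const_mx 1) by split=> [i|]; rewrite ?mxE ?oner_neq0 // dconj1.
have Du u : D u -> unit_row u by case.
have Dt m : (forall u, D u -> zmono m u = 1) -> zmono m t = 1.
  by move=> h; apply: tM => u uu Su; apply: h.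
have DS u : D u -> zeros jC S (dconj PC u) by case.
exact: (zeros_torus_closure DM D1 Du ut Dt DS Sp).
Qed.

Lemma chars_saturated : saturated_lattice chars.
Proof.
have [_ S1 _ _] := S_grp.
split=> [t _ _|l m Cl Cm t ut St|m k Cmk].
- by rewrite /zmono big1.
- by rewrite zmonoB // Cl ?Cm ?divr1.
have C1 := connected_char_torsion PCu S_conn S1 zerosS_dconj.
by apply: (C1 m k) => t ut St; rewrite -zmonoX Cmk.
Qed.

Lemma zmono_det (t : 'rV[C]_n) : zmono (fun=> 1) t = \prod_i t 0 i.
Proof. by apply: eq_bigr => i _; rewrite expr1z. Qed.

Lemma chars_det : chars (fun=> 1).
Proof. by move=> t ut /S_det /=; rewrite det_dconj // zmono_det. Qed.

Lemma zerosS_torus_eqs : zeros jC S = zeros jC (torus_eqs P chars).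
Proof.
rewrite zerosS_torus_mx; apply/seteqP; split=> [_ [t [ut tM] <-]|x].
  apply/(torus_eqsP Pu jC); exists t; split=> //.
  by rewrite -zmono_det; apply: tM; apply: chars_det.
by move=> /(torus_eqsP Pu jC) [t [ut _ tM ->]]; exists t.
Qed.

(** Both descriptions are zero sets of polynomials over K, so their equality passes to all real
    closed extensions. *)
Lemma zerosS_torus (L : rcfType) (iota : {rmorphism K -> L}) x :
  zeros iota S x <-> exists t, [/\ unit_row t, forall m, chars m -> zmono m t = 1 &
    x = dconj (map_mx iota P) t].
Proof.
have e : zeros idfun S = zeros idfun (torus_eqs P chars).
  apply/seteqP; split=> y.
    by move=> /(zeros_map (idfun : {rmorphism K -> K}) jC) h;
      apply/(zeros_map (idfun : {rmorphism K -> K}) jC); move: h; rewrite /= zerosS_torus_eqs.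
  by move=> /(zeros_map (idfun : {rmorphism K -> K}) jC) h;
    apply/(zeros_map (idfun : {rmorphism K -> K}) jC); move: h; rewrite /= zerosS_torus_eqs.
have -> : zeros iota S x <-> zeros iota (torus_eqs P chars) x.
  by split; apply: zeros_sub_transfer; rewrite e.
rewrite (torus_eqsP Pu); split=> [[t [ut _ tM xE]]|[t [ut tM xE]]]; exists t; split=> //.
by rewrite -[RHS](tM _ chars_det); apply: eq_bigr => i _; rewrite expr1z.
Qed.

End TorusCharacters.

(** Exponent vector of the character [t_k / t_l]. *)
Definition delta_char n (k l : 'I_n) (i : 'I_n) : int := (i == k)%:Z - (i == l)%:Z.

Lemma zmono_delta (A : fieldType) n (t : 'rV[A]_n) k l : unit_row t ->
  zmono (delta_char k l) t = t 0 k / t 0 l.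
Proof.
move=> ut; have e (j : 'I_n) : zmono (fun i => (i == j)%:Z) t = t 0 j.
  by rewrite -[RHS]mono1; apply: eq_bigr => i _; case: (i == j).
by rewrite zmonoB // !e.
Qed.

Lemma zmonoV (A : fieldType) n (t : 'rV[A]_n) m :
  zmono m (\row_i (t 0 i)^-1) = (zmono m t)^-1.
Proof. by rewrite /zmono -prodfV; apply: eq_bigr => i _; rewrite mxE exprz_inv invr_expz. Qed.

Lemma in_torusV (A : numFieldType) n (M : ('I_n -> int) -> Prop) (t : 'rV[A]_n) :
  in_torus M t -> in_torus M (\row_i (t 0 i)^-1).
Proof.
move=> [ut tM]; split=> [i|m Mm]; first by rewrite mxE invr_neq0.
by rewrite zmonoV tM ?invr1.
Qed.

Lemma torus_mx_group (A : numFieldType) n (P : 'M[A]_n) (M : ('I_n -> int) -> Prop) :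
  P \in unitmx -> mx_group (torus_mx P M).
Proof.
move=> Pu; apply: mx_group_torus => //; first exact: in_torus1.
- by move=> t [].
- by move=> t u; apply: in_torusM.
- exact: in_torusV.
Qed.

Lemma torus_mx_eqs (K : fieldType) (C : numFieldType) (jC : {rmorphism K -> C}) n
    (P : 'M[K]_n) (M : ('I_n -> int) -> Prop) : P \in unitmx -> M (fun=> 1) ->
  torus_mx (map_mx jC P) M = zeros jC (torus_eqs P M).
Proof.
move=> Pu M1; apply/seteqP; split=> [_ [t [ut tM] <-]|x].
  apply/(torus_eqsP Pu jC); exists t; split=> //.
  by rewrite -[RHS](tM _ M1); apply: eq_bigr => i _; rewrite expr1z.
by move=> /(torus_eqsP Pu jC) [t [ut _ tM ->]]; exists t.
Qed.

(** * Symmetric elements centralizing a maximal split torus *)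

Section MaximalTorus.
Variables (K : rcfType) (C : numFieldType) (jC : {rmorphism K -> C}) (n : nat).
Variables (G S : set (mxpoly K n)).

Definition split_torus_over (T : set (mxpoly K n)) : Prop :=
  [/\ mx_group (zeros jC T), (zeros jC T `<=` [set x | \det x = 1])%classic,
      zariski_connected (zeros jC T) &
      exists2 P, P \in unitmx & split_by jC P (zeros jC T)].

Hypotheses (G_grp : mx_group (zeros jC G))
  (G_det : (zeros jC G `<=` [set x | \det x = 1])%classic)
  (SG : (zeros jC S `<=` zeros jC G)%classic) (S_split : split_torus_over S)
  (S_max : forall T, split_torus_over T -> (zeros jC T `<=` zeros jC G)%classic ->
     (zeros jC S `<=` zeros jC T)%classic -> zeros jC T = zeros jC S).

Variable P : 'M[K]_n.
Hypotheses (Pu : P \in unitmx) (S_diag : split_by jC P (zeros jC S)).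

Notation chr := (chars jC S P).
Let PC := map_mx jC P.
Let PCu : PC \in unitmx. Proof. by rewrite map_unitmx. Qed.
Let S_grp : mx_group (zeros jC S). Proof. by case: S_split. Qed.
Let S_det : (zeros jC S `<=` [set x | \det x = 1])%classic. Proof. by case: S_split. Qed.
Let S_conn : zariski_connected (zeros jC S). Proof. by case: S_split. Qed.
Let chr_sat : saturated_lattice chr. Proof. exact: chars_saturated. Qed.

Let zmap (I : set (mxpoly K n)) x : zeros jC I (map_mx jC x) <-> zeros idfun I x.
Proof. exact: (zeros_map (idfun : {rmorphism K -> K}) jC). Qed.

Lemma chars_delta_trans k l m :
  chr (delta_char k l) -> chr (delta_char l m) -> chr (delta_char k m).
Proof.
move=> kl lm; have := lattice_add chr_sat kl lm.
by congr chr; apply/funext => i; rewrite /delta_char addrA subrK.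
Qed.

Lemma chars_delta_sym k l : chr (delta_char k l) -> chr (delta_char l k).
Proof.
move=> kl; have := lattice_opp chr_sat kl.
by congr chr; apply/funext => i; rewrite /delta_char opprB.
Qed.

(** Two coordinates on which every element of S has the same eigenvalue. *)
Let sim k l : bool := `[< chr (delta_char k l) >].

Lemma sim_refl k : sim k k.
Proof.
apply/asboolP; have [c0 _ _] := chr_sat; move: c0; congr chr; apply/funext => i.
by rewrite /delta_char subrr.
Qed.

(** Projection onto the coordinates equivalent to [k]; the elements of S are linear combinations of
    these projections. *)
Let E k : 'M[K]_n := dconj P (\row_l (sim k l)%:R).

(** Being symmetric, [w] is diagonalizable, and it commutes with the projections [E k];
    diagonalizing all of them together diagonalizes S as well. *)
Lemma block_codiag (w : 'M[K]_n) : w^T = w ->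
  (forall k l, (P *m w *m invmx P) k l != 0 -> chr (delta_char k l)) ->
  exists Q, [/\ Q \in unitmx, is_diag_mx (Q *m w *m invmx Q) & split_by jC Q (zeros jC S)].
Proof.
move=> wT wb.
have simE k l m : sim k l -> sim m k = sim m l.
  move=> /asboolP kl; apply/asboolP/asboolP => h; first exact: chars_delta_trans kl.
  exact: chars_delta_trans (chars_delta_sym kl).
have simS k i : sim k i = sim i k by apply/asboolP/asboolP; apply: chars_delta_sym.
have EE k l : E k *m E l = E l *m E k.
  by rewrite !dconjM //; congr (dconj P _); apply/rowP => i; rewrite !mxE mulrC.
have wE k : w *m E k = E k *m w.
  have -> : w = invmx P *m (P *m w *m invmx P) *m P.
    by rewrite !mulmxA mulVmx // mul1mx mulmxKV.
  move: (P *m w *m invmx P) wb => W wb.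
  rewrite /E /dconj !mulmxA !mulmxK // -!mulmxA; congr (_ *m _); rewrite !mulmxA.
  congr (_ *m _); apply/matrixP => i j; rewrite mul_mx_diag mul_diag_mx !mxE.
  have [->|/wb ij] := eqVneq (W i j) 0; first by rewrite mulr0 mul0r.
  by rewrite mulrC (simE i j) //; apply/asboolP.
have Ed k : diagonalizable (E k).
  exists P => //; apply/diagonalizable_forPex; exists (\row_l (sim k l)%:R).
  by apply/simmxRL; rewrite // dconjK.
have wd : diagonalizable w.
  have [P0 [d [P0u wE0]]] := sym_diagonalizable wT.
  exists P0 => //; apply/diagonalizable_forPex; exists d.
  by apply/simmxRL; rewrite // wE0 (dconjK P0u).
have [Q Qu /allP Qd] : codiagonalizable (w :: [seq E k | k <- enum 'I_n]).
  apply/codiagonalizableP; split=> [A B|A].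
    rewrite !inE => /orP [/eqP ->|/mapP [k _ ->]] /orP [/eqP ->|/mapP [l _ ->]] //;
    exact: wE || exact: EE || exact/esym/wE.
  by rewrite inE => /orP [/eqP ->|/mapP [k _ ->]].
exists Q; split=> //.
  by have := Qd w (mem_head _ _); rewrite /= /similar_to conjumx.
move=> s Ss; have [t ut sE] := zerosS_dconj Pu S_grp S_diag Ss.
have Ss' : zeros jC S (dconj PC t) by rewrite -sE.
rewrite sE.
(* The size of the class of [k]: a sum over all [k] counts each projection once per member of its
   class. *)
pose c k : C := (\sum_l (sim k l : nat))%:R.
have c0 k : c k != 0.
  by rewrite pnatr_eq0 (bigD1 k) //= sim_refl.
have tsim k l : sim k l -> t 0 k = t 0 l.
  move=> /asboolP /(_ t ut Ss'); rewrite zmono_delta // => /(canRL (divfK (ut l))).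
  by rewrite mul1r.
have tE : t = \sum_k (t 0 k / c k) *: \row_l (sim k l)%:R.
  apply/rowP => l; rewrite summxE.
  transitivity (\sum_k (sim l k)%:R * (t 0 l / c l)).
    by rewrite -mulr_suml -natr_sum mulrC divfK.
  apply: eq_bigr => k _; rewrite !mxE mulrC.
  rewrite (simS l k); case: (boolP (sim k l)) => kl; rewrite ?mulr0 // (tsim _ _ kl).
  have -> // : c k = c l.
  by congr (_%:R); apply: eq_bigr => i _; rewrite !(simS _ i) (simE _ _ _ kl).
have -> : dconj PC t = \sum_k (t 0 k / c k) *: map_mx jC (E k).
  rewrite {1}tE /dconj linear_sum mulmx_sumr mulmx_suml; apply: eq_bigr => k _.
  rewrite linearZ -scalemxAr -scalemxAl /E map_dconj; congr (_ *: (_ *m diag_mx _ *m _)).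
  by apply/rowP => i; rewrite !mxE rmorph_nat.
apply/is_diag_mxP => i j ij.
rewrite mulmx_sumr mulmx_suml summxE big1 // => k _.
rewrite -scalemxAr -scalemxAl mxE -!map_mxM mxE.
have Ek : E k \in w :: [seq E k | k <- enum 'I_n].
  by rewrite inE; apply/orP; right; apply/mapP; exists k; rewrite ?mem_enum.
have := Qd _ Ek; rewrite /= /similar_to conjumx // => /is_diag_mxP -> //.
by rewrite rmorph0 mulr0.
Qed.

(** S and [w *m w] lie in a common split torus of G, which is S by maximality. Squaring makes the
    eigenvalues positive, so a character with a power trivial at [w *m w] is trivial there, and the
    lattice [M] is saturated. *)
Lemma symmetric_commuting (w : 'M[K]_n) : zeros idfun G w -> w^T = w ->
  (forall k l, (P *m w *m invmx P) k l != 0 -> chr (delta_char k l)) ->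
  zeros idfun S (w *m w) /\ forall i, 0 < (P *m (w *m w) *m invmx P) i i.
Proof.
move=> Gw wT wb; have [Q [Qu wd Sd]] := block_codiag wT wb.
have GwC : zeros jC G (map_mx jC w) by apply/zmap.
have wu : w \in unitmx.
  by rewrite -(map_unitmx jC); have [xu _ _ _] := G_grp; apply: xu.
pose QC := map_mx jC Q; have QCu : QC \in unitmx by rewrite map_unitmx.
have wE : w = dconj Q (\row_i (Q *m w *m invmx Q) i i).
  by apply: dconj_diag => // i j ij; have /is_diag_mxP := wd; apply.
set om := \row_i _ in wE.
have uom : unit_row om by move: wu; rewrite wE dconj_unit // => /forallP.
pose ze := hadamard om om; have wwE : w *m w = dconj Q ze by rewrite {1 2}wE dconjM.
have uze : unit_row ze by move=> i; rewrite mxE mulf_neq0.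
have zem m : 0 < zmono m ze.
  rewrite /zmono prodr_gt0 // => i _; rewrite exprz_gt0 // mxE -expr2.
  by rewrite lt_def sqr_ge0 sqrf_eq0 uom.
pose zeC := map_mx jC ze.
have GzeC : zeros jC G (dconj QC zeC).
  by rewrite -map_dconj -wwE map_mxM; have [_ _ GM _] := G_grp; apply: GM.
have uzeC : unit_row zeC by move=> i; rewrite mxE fmorph_eq0.
have wwdet : \prod_i ze 0 i = 1.
  by apply: (fmorph_inj jC); rewrite -(det_dconj Qu) rmorph1 -det_map_mx map_dconj; apply: G_det.
pose c' := chars jC S Q.
have c'sat : saturated_lattice c' := chars_saturated Qu S_grp S_conn Sd.
pose M m := c' m /\ zmono m ze = 1.
have M1 : M (fun=> 1).
  split; first exact: (chars_det Qu S_det).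
  by rewrite -[RHS]wwdet; apply: eq_bigr => i _; rewrite expr1z.
have Msat : saturated_lattice M.
  have [c0 cB cS] := c'sat; split.
  - by split=> //; rewrite /zmono big1.
  - by move=> l m [cl zl] [cm zm]; split; [exact: cB|rewrite zmonoB // zl zm divr1].
  - move=> m k [cm zm]; split; first exact: cS cm.
    have /eqP := zm; rewrite zmonoX pexprn_eq1 ?ltW // => /eqP //.
pose T := torus_eqs Q M.
have TE : zeros jC T = torus_mx QC M by rewrite -torus_mx_eqs.
have Tsplit : split_torus_over T.
  split; rewrite ?TE.
  - exact: torus_mx_group.
  - move=> _ [t [ut tM] <-] /=; rewrite (det_dconj QCu) -[RHS](tM _ M1).
    by apply: eq_bigr => i _; rewrite expr1z.
  - exact: torus_connected.
  - exists Q => // _ [t _ <-]; rewrite map_invmx dconjK //.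
have TG : (zeros jC T `<=` zeros jC G)%classic.
  rewrite TE => _ [t [ut tM] <-]; have [_ G1 GM _] := G_grp.
  apply: (@zeros_torus_closure _ _ jC n QC G (fun u => unit_row u /\ zeros jC G (dconj QC u))).
  - move=> u v [uu Gu] [uv Gv]; split=> [i|]; first by rewrite mxE mulf_neq0.
    by rewrite -dconjM //; apply: GM.
  - by split=> [i|]; rewrite ?mxE ?oner_neq0 // dconj1.
  - by move=> u [].
  - exact: ut.
  - move=> m hm; apply: tM; split; first by move=> u uu Su; apply: hm; split=> //; apply: SG.
    by apply: (fmorph_inj jC); rewrite rmorph1 map_zmono; apply: hm.
  - by move=> u [].
have ST : (zeros jC S `<=` zeros jC T)%classic.
  move=> s Ss; have [t ut sE] := zerosS_dconj Qu S_grp Sd Ss.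
  rewrite TE sE; exists t => //; split=> // m [cm _]; apply: cm => //.
  by rewrite -sE.
have Sww : zeros idfun S (w *m w).
  apply/zmap; rewrite -(S_max Tsplit TG ST) TE wwE map_dconj.
  exists zeC => //; split=> // m [_ zm].
  by rewrite -map_zmono zm rmorph1.
split=> // i.
have [t [ut _ wwP]] := (zerosS_torus Pu S_grp S_det S_diag (idfun : {rmorphism K -> K}) (w *m w)).1 Sww.
move: wwP; rewrite map_mx_id // => wwP; rewrite wwP dconjK // mxE eqxx mulr1n.
(* A row of [P] is a left eigenvector of [w *m w = w *m w^T], so its eigenvalue is a quotient of
   squared norms. *)
have e : row i P *m (w *m w) = t 0 i *: row i P.
  by rewrite wwP /dconj !mulmxA -row_mul mulmxV // row1 -rowE row_diag_mx -scalemxAl -rowE.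
have := congr1 (fun x => (x *m (row i P)^T) 0 0) e.
rewrite /= -scalemxAl [RHS]mxE mulmxA -mulmxA -{2}wT -trmx_mul => e2.
have sqE (v : 'rV[K]_n) : (v *m v^T) 0 0 = \sum_j v 0 j ^+ 2.
  by rewrite mxE; apply: eq_bigr => j _; rewrite mxE expr2.
have rn : 0 <= (row i P *m (row i P)^T) 0 0.
  by rewrite sqE; apply: sumr_ge0 => j _; apply: sqr_ge0.
have wn : 0 <= (row i P *m w *m (row i P *m w)^T) 0 0.
  by rewrite sqE; apply: sumr_ge0 => j _; apply: sqr_ge0.
rewrite lt_neqAle eq_sym ut /= leNgt; apply/negP => tneg.
move: wn; rewrite e2 => wn; have r0 : (row i P *m (row i P)^T) 0 0 = 0.
  apply/eqP; rewrite eq_le rn andbT -(nmulr_rge0 _ tneg) //.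
have : row i P = 0.
  apply/rowP => j; rewrite [RHS]mxE; move/eqP: r0; rewrite sqE psumr_eq0; last first.
    by move=> k _; apply: sqr_ge0.
  by move=> /allP /(_ j (mem_index_enum _)); rewrite sqrf_eq0 => /eqP.
move=> /(congr1 (fun v => v *m invmx P)); rewrite -row_mul mulmxV // mul0mx => /rowP /(_ i).
by rewrite !mxE eqxx => /eqP; rewrite oner_eq0.
Qed.

End MaximalTorus.

(** * Central tori of a semisimple group *)

Section CentralTorus.
Variables (K : rcfType) (C : numFieldType) (jC : {rmorphism K -> C}) (n : nat).
Variables (G S : set (mxpoly K n)) (P : 'M[K]_n).
Let PC := map_mx jC P.
Hypotheses (G_grp : mx_group (zeros jC G)) (G_ss : semisimple (zeros jC G))
  (SG : (zeros jC S `<=` zeros jC G)%classic)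
  (S_split : split_torus_over jC S) (Pu : P \in unitmx)
  (S_diag : split_by jC P (zeros jC S)).

Let PCu : PC \in unitmx. Proof. by rewrite map_unitmx. Qed.

(* The identity component of the central part of S is trivial since G is semisimple. *)
Lemma central_positive_torus (t : 'rV[K]_n) : (forall i, 0 < t 0 i) ->
  zeros idfun S (dconj P t) ->
  (forall g, zeros jC G g -> map_mx jC (dconj P t) *m g = g *m map_mx jC (dconj P t)) ->
  dconj P t = 1%:M.
Proof.
move=> t0 St tcent; have [S_grp S_det S_conn _] := S_split.
pose T1 (u : 'rV[C]_n) := [/\ unit_row u, zeros jC S (dconj PC u) &
  forall g, zeros jC G g -> dconj PC u *m g = g *m dconj PC u].
have T1M u w : T1 u -> T1 w -> T1 (hadamard u w).
  move=> [uu Su cu] [uw Sw cw]; split=> [i||g Gg]; first by rewrite mxE mulf_neq0.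
    by rewrite -dconjM //; have [_ _ SM _] := S_grp; apply: SM.
  by rewrite -dconjM // -mulmxA cw // (mulmxA _ g) (cu g) // (mulmxA g (dconj PC u)).
have T11 : T1 (const_mx 1).
  split=> [i||g _]; rewrite ?mxE ?oner_neq0 // dconj1 //; last by rewrite mul1mx mulmx1.
  by case: S_grp.
have T1u u : T1 u -> unit_row u by case.
pose M1 m := forall u, T1 u -> zmono m u = 1.
(* Characters with a multiple trivial on [T1] form a saturated lattice, which cuts out the identity
   component of the group [T1] of central points of S. *)
pose M m := exists k : nat, M1 (fun i => m i * k.+1%:Z).
have M1M m : M1 m -> M m.
  move=> h; exists 0%N => u Tu; rewrite -[RHS](h u Tu); congr (zmono _ u); apply/funext => i; by rewrite mulr1.
have MX m k u : zmono (fun i => m i * k.+1%:Z) u = zmono m u ^+ k.+1 by apply: zmonoX.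
have M1X m k : M1 m -> M1 (fun i => m i * k.+1%:Z).
  by move=> h u Tu; rewrite MX h // expr1n.
have Msat : saturated_lattice M.
  split.
  - by apply: M1M => u _; rewrite /zmono big1.
  - move=> l m [k hl] [k' hm]; exists (k.+1 * k'.+1).-1%N => u Tu.
    rewrite prednK ?muln_gt0 // -[LHS]/(zmono (fun i => (l i - m i) * (k.+1 * k'.+1)%N%:Z) u).
    have -> : (fun i => (l i - m i) * (k.+1 * k'.+1)%N%:Z) =
        (fun i => (l i * k.+1%:Z) * k'.+1%:Z - (m i * k'.+1%:Z) * k.+1%:Z).
      by apply/funext => i; rewrite PoszM; ring.
    by rewrite zmonoB ?M1X ?divr1 //; apply: T1u.
  - move=> m k [k' h]; exists (k.+1 * k'.+1).-1%N => u Tu; rewrite -[RHS](h u Tu).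
    congr zmono; apply/funext => i; rewrite prednK ?muln_gt0 //.
    by rewrite PoszM mulrA.
have T1clos u : in_torus M u -> T1 u.
  move=> [uu uM].
  have Dt m : (forall w, T1 w -> zmono m w = 1) -> zmono m u = 1.
    by move=> h; apply: uM; apply: M1M.
  split=> // [|g Gg].
    by apply: (zeros_torus_closure T1M T11 T1u uu Dt) => w [].
  pose f : {rmorphism C -> C} := idfun.
  pose gC := map_mx (@mpoly.mpolyC (n * n) C) g.
  pose q i j := (genmx C n *m gC - gC *m genmx C n) i j.
  have qE i j x : ev f (q i j) x = (x *m g - g *m x) i j.
    have -> : ev f (q i j) x = map_mx (fun p => ev f p x) (genmx C n *m gC - gC *m genmx C n) i j.
      by rewrite [RHS]mxE.
    have -> : map_mx (fun p => ev f p x) (genmx C n *m gC - gC *m genmx C n) =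
        map_mx (fun p => ev f p x) (genmx C n *m gC) -
        map_mx (fun p => ev f p x) (gC *m genmx C n).
      exact: (map_mxB (mpoly.mmap f _)).
    by rewrite !map_ev_mulmx map_genmx map_mpolyC_mx map_mx_id.
  have : zeros f (fun p => exists i j, p = q i j) (dconj PC u).
    apply: (zeros_torus_closure T1M T11 T1u uu Dt) => w [uw _ cw] _ [i [j ->]].
    by rewrite qE cw // subrr mxE.
  move=> h; apply/eqP; rewrite -subr_eq0; apply/eqP/matrixP => i j.
  by rewrite -qE h ?[RHS]mxE //; exists i, j.
pose Z := torus_mx PC M.
have Z1 : Z = [set 1%:M]%classic.
  apply: G_ss.
  - by move=> _ [u /T1clos [_ Su _] <-]; apply: SG.
  - exists (torus_eqs PC M).
    rewrite /Z -[in LHS](map_mx_id (frefl idfun) PC); apply: (torus_mx_eqs (idfun : {rmorphism C -> C}) PCu).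
    apply: M1M => u [uu /S_det /= hd _]; rewrite det_dconj // in hd; rewrite -[RHS]hd zmono_det.
  - exact: torus_mx_group.
  - exact: torus_connected.
  - move=> g z Gg Zz; have [u uM zE] := Zz; have [_ _ cu] := T1clos _ uM.
    have [gu _ _ _] := G_grp; have gU : g \in unitmx by apply: gu.
    by rewrite -zE -[invmx PC *m _ *m _]/(dconj PC u) -cu // mulmxK //; exists u.
  (* The torus is commutative, so its derived group is already trivial. *)
  - exists 1%N; rewrite /=; apply/seteqP; split=> [x h|_ ->].
      apply: (h [set 1%:M]%classic); split.
        split=> [_ ->|||_ ->] //=; rewrite ?unitmx1 ?invmx1 //.
        by move=> _ _ -> ->; rewrite mulmx1.
      move=> _ _ [u uM <-] [w wM <-] /=.
      rewrite -[invmx PC *m diag_mx u *m _]/(dconj PC u) -[invmx PC *m diag_mx w *m _]/(dconj PC w).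
      have uu := uM.1; have uw := wM.1; rewrite !dconjV // !dconjM // -(dconj1 PCu); congr dconj.
      by apply/rowP => i; rewrite !mxE; field; rewrite uu uw.
    by move=> H [[_ H1 _ _] _].
have Mall m : M m.
  apply: lattice_perp_perp Msat _ => l lM.
  have c2 : 2%:R != 0 :> C by rewrite pnatr_eq0.
  have : Z (dconj PC (cochar l 2%:R)).
    by exists (cochar l 2%:R) => //; apply: cochar_in_torus.
  rewrite Z1 /= -(dconj1 PCu) => /(dconj_inj PCu) /rowP e.
  rewrite /zdot big1 // => i _; have := e i; rewrite !mxE => /eqP.
  rewrite pexprz_eq1 ?ler0n // => /orP [/eqP ->|]; first by rewrite mulr0.
  by rewrite -subr_eq0 -[2%:R]/(1 + 1) addrK oner_eq0.
suff -> : t = const_mx 1 by rewrite dconj1.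
apply/rowP => i; rewrite [RHS]mxE.
(* A power of [t 0 i] equals 1, and [t 0 i] is positive. *)
have [k hk] := Mall (fun j => (j == i)%:Z).
have T1t : T1 (map_mx jC t).
  split=> [j||g Gg]; first by rewrite mxE fmorph_eq0 gt_eqF.
    by rewrite -map_dconj; apply/(zeros_map (idfun : {rmorphism K -> K}) jC).
  by rewrite -map_dconj; apply: tcent.
have := hk _ T1t; rewrite MX -map_zmono -rmorphXn -(rmorph1 jC) => /fmorph_inj /eqP.
have -> : zmono (fun j => (j == i)%:Z) t = t 0 i.
  by rewrite -[RHS]mono1; apply: eq_bigr => j _; case: (j == i).
by rewrite pexprn_eq1 ?ltW //= => /eqP.
Qed.

End CentralTorus.

(** * The matrix exponential *)

Lemma mxXS (A : pzRingType) n (X : 'M[A]_n) k : X ^+ k.+1 = X *m X ^+ k.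
Proof. exact: exprS. Qed.

Lemma mxXSr (A : pzRingType) n (X : 'M[A]_n) k : X ^+ k.+1 = X ^+ k *m X.
Proof. exact: exprSr. Qed.

Lemma mxX0 (A : pzRingType) n (X : 'M[A]_n) : X ^+ 0 = 1%:M.
Proof. exact: expr0. Qed.

Section MatrixNorm.
Variables (R : realFieldType).

(** The entrywise l^1 norm, which is submultiplicative for rectangular matrices too. *)
Definition nrm m n (A : 'M[R]_(m, n)) : R := \sum_i \sum_j `|A i j|.

Lemma nrm_ge0 m n (A : 'M[R]_(m, n)) : 0 <= nrm A.
Proof. by apply: sumr_ge0 => i _; apply: sumr_ge0. Qed.

Lemma nrm_entry m n (A : 'M[R]_(m, n)) i j : `|A i j| <= nrm A.
Proof.
rewrite /nrm (bigD1 i) //= (bigD1 j) //= -addrA lerDl addr_ge0 ?sumr_ge0 // => k _.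
by apply: sumr_ge0.
Qed.

Lemma nrmD m n (A B : 'M[R]_(m, n)) : nrm (A + B) <= nrm A + nrm B.
Proof.
rewrite /nrm -big_split; apply: ler_sum => i _; rewrite -big_split; apply: ler_sum => j _.
by rewrite mxE ler_normD.
Qed.

Lemma nrmZ m n c (A : 'M[R]_(m, n)) : nrm (c *: A) = `|c| * nrm A.
Proof.
rewrite /nrm mulr_sumr; apply: eq_bigr => i _; rewrite mulr_sumr; apply: eq_bigr => j _.
by rewrite mxE normrM.
Qed.

Lemma nrmN m n (A : 'M[R]_(m, n)) : nrm (- A) = nrm A.
Proof. by rewrite -scaleN1r nrmZ normrN1 mul1r. Qed.

Lemma nrmB m n (A B : 'M[R]_(m, n)) : nrm (A - B) <= nrm A + nrm B.
Proof. by rewrite -(nrmN B) nrmD. Qed.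

Lemma nrm0 m n : nrm (0 : 'M[R]_(m, n)) = 0.
Proof. by rewrite -(scale0r 0) nrmZ normr0 mul0r. Qed.

Lemma nrm_sum m n (I : Type) (r : seq I) (P : pred I) (F : I -> 'M[R]_(m, n)) :
  nrm (\sum_(i <- r | P i) F i) <= \sum_(i <- r | P i) nrm (F i).
Proof.
elim/big_rec2: _ => [|i a B _ h]; first by rewrite nrm0.
by rewrite (le_trans (nrmD _ _)) // lerD2l.
Qed.

Lemma nrmM m n p (A : 'M[R]_(m, n)) (B : 'M[R]_(n, p)) : nrm (A *m B) <= nrm A * nrm B.
Proof.
rewrite /nrm mulr_suml; apply: ler_sum => i _.
rewrite (@le_trans _ _ (\sum_j \sum_k `|A i k| * `|B k j|)) //.
  apply: ler_sum => j _; rewrite mxE (le_trans (ler_norm_sum _ _ _)) //.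
  by apply: ler_sum => k _; rewrite normrM.
rewrite exchange_big mulr_suml; apply: ler_sum => k _.
rewrite -mulr_sumr ler_wpM2l // (bigD1 k (P := xpredT)) //= lerDl.
by apply: sumr_ge0 => l _; apply: sumr_ge0.
Qed.

Lemma nrm_eq0 m n (A : 'M[R]_(m, n)) : nrm A = 0 -> A = 0.
Proof.
move=> A0; apply/matrixP => i j; rewrite [RHS]mxE; apply/eqP.
by rewrite -normr_le0 -A0 nrm_entry.
Qed.

(* Comparison with the identity is exact on products, unlike [nrmM]. *)
Lemma nrm_near1 n p (A : 'M[R]_n) (B : 'M[R]_(n, p)) e : nrm (A - 1%:M) <= e ->
  nrm (A *m B) <= (1 + e) * nrm B.
Proof.
move=> Ae; rewrite -[A](subrK 1%:M) mulmxDl mul1mx addrC mulrDl mul1r.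
rewrite (le_trans (nrmD _ _)) // lerD2l (le_trans (nrmM _ _)) // ler_wpM2r ?nrm_ge0 //.
Qed.

Lemma nrm_near1X n p (A : 'M[R]_n) (B : 'M[R]_(n, p)) e k : nrm (A - 1%:M) <= e ->
  nrm (A ^+ k *m B) <= (1 + e) ^+ k * nrm B.
Proof.
move=> Ae; have e0 : 0 <= e := le_trans (nrm_ge0 _) Ae.
elim: k => [|k IH]; first by rewrite !expr0 mul1mx mul1r.
rewrite exprS -mulmxA exprS -mulrA (le_trans (nrm_near1 _ Ae)) // ler_wpM2l //.
by rewrite addr_ge0.
Qed.

Lemma nrm_near1r n p (A : 'M[R]_n) (B : 'M[R]_(p, n)) e : nrm (A - 1%:M) <= e ->
  nrm (B *m A) <= nrm B * (1 + e).
Proof.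
move=> Ae; rewrite -[A](subrK 1%:M) mulmxDr mulmx1 addrC mulrDr mulr1.
rewrite (le_trans (nrmD _ _)) // lerD2l (le_trans (nrmM _ _)) // ler_wpM2l ?nrm_ge0 //.
Qed.

Lemma nrm_expB n (A B : 'M[R]_n) e k : nrm (A - 1%:M) <= e -> nrm (B - 1%:M) <= e ->
  nrm (A ^+ k - B ^+ k) <= k%:R * (1 + e) ^+ k * nrm (A - B).
Proof.
move=> Ae Be; have e0 : 0 <= e := le_trans (nrm_ge0 _) Ae.
elim: k => [|k IH]; first by rewrite !expr0 subrr nrm0 !mul0r.
have -> : A ^+ k.+1 - B ^+ k.+1 = A ^+ k *m (A - B) + (A ^+ k - B ^+ k) *m B.
  by rewrite mulmxBr mulmxBl !exprSr addrA subrK.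
rewrite (le_trans (nrmD _ _)) // -natr1 2!mulrDl mul1r addrC lerD //.
  rewrite (le_trans (nrm_near1r _ Be)) // exprSr mulrA [leRHS]mulrAC ler_wpM2r ?addr_ge0 //.
rewrite (le_trans (nrm_near1X _ _ Ae)) // ler_wpM2r ?nrm_ge0 // ler_weXn2l // lerDl //.
Qed.

Lemma nrmX n (A : 'M[R]_n) k : nrm (A ^+ k.+1) <= nrm A ^+ k.+1.
Proof.
elim: k => [|k IH]; first by rewrite !expr1.
by rewrite [A ^+ _]exprS [leRHS]exprS (le_trans (nrmM _ _)) // ler_wpM2l ?nrm_ge0.
Qed.

Lemma nrmXn n (A : 'M[R]_n) k : nrm (A ^+ k) <= (n%:R + 1) * nrm A ^+ k.
Proof.
case: k => [|k]; last first.
  by rewrite (le_trans (nrmX _ _)) // ler_peMl ?exprn_ge0 ?nrm_ge0 // lerDr.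
rewrite !expr0 mulr1 -[1]/(1%:M) /nrm (@le_trans _ _ (\sum_(i < n) 1)) //.
  apply: ler_sum => i _; rewrite (bigD1 i) //= big1 => [|j ji].
    by rewrite mxE eqxx normr1 addr0.
  by rewrite mxE eq_sym (negbTE ji) normr0.
by rewrite sumr_const card_ord lerDl.
Qed.

End MatrixNorm.

Section NormLimit.
Variable R : realType.

Lemma archi_eq0 (x C : R) (k0 : nat) :
  (forall k : nat, (k0 <= k)%N -> x <= C / k.+1%:R) -> x <= 0.
Proof.
move=> h; rewrite leNgt; apply/negP => x0.
pose k := maxn k0 (Num.bound (C / x)).
have := h k (leq_maxl _ _); rewrite leNgt => /negP; apply.
rewrite ltr_pdivrMr ?ltr0n // mulrC -ltr_pdivrMr //.
have [|C0] := leP 0 (C / x); last first.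
  by apply: lt_le_trans C0 _.
move=> /archi_boundP /lt_le_trans; apply; rewrite ler_nat.
by rewrite (leq_trans (leq_maxr k0 _)).
Qed.

Lemma nrm_limit_unique m n (A B : 'M[R]_(m, n)) (u : nat -> 'M[R]_(m, n)) (C D : R) (k0 : nat) :
  (forall k, (k0 <= k)%N -> nrm (u k - A) <= C / k.+1%:R) ->
  (forall k, (k0 <= k)%N -> nrm (u k - B) <= D / k.+1%:R) -> A = B.
Proof.
move=> uA uB; apply/eqP; rewrite -subr_eq0; apply/eqP/nrm_eq0/eqP.
rewrite eq_le nrm_ge0 andbT; apply: (@archi_eq0 _ (C + D) k0) => k kk.
have -> : A - B = (u k - B) - (u k - A) by rewrite opprB [RHS]addrC addrA subrK.
by rewrite (le_trans (nrmB _ _)) // mulrDl [leRHS]addrC lerD ?uA ?uB.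
Qed.

End NormLimit.

Section MatrixExponential.
Variables (R : realType) (n : nat).
Implicit Types (X Y Z : 'M[R]_n).

Definition expsum X m : 'M[R]_n := \sum_(k < m) k`!%:R^-1 *: X ^+ k.

Lemma expsum_le_expR (z : R) m : 0 <= z -> \sum_(k < m) z ^+ k / k`!%:R <= expR z.
Proof.
move=> z0; rewrite -(big_mkord xpredT (fun k => z ^+ k / k`!%:R)).
apply: (@nondecreasing_cvgn_le _ (series (exp_coeff z))).
  by apply: nondecreasing_series => k _ _; rewrite divr_ge0 ?exprn_ge0.
exact: is_cvg_series_exp_coeff.
Qed.

Lemma cvgn_sum (I : Type) (r : seq I) (f : I -> nat -> R) (l : I -> R) :
  (forall i, f i @ \oo --> l i) ->
  (fun m => \sum_(i <- r) f i m) @ \oo --> \sum_(i <- r) l i.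
Proof.
move=> fl; elim: r => [|i r IH].
  rewrite big_nil (_ : (fun m => _) = (fun=> 0)); first exact: cvg_cst.
  by apply/funext => m; rewrite big_nil.
rewrite big_cons (_ : (fun m => _) = (fun m => f i m + \sum_(i <- r) f i m)).
  by apply: cvgD => //; apply: fl.
by apply/funext => m; rewrite big_cons.
Qed.

(** Domination by the scalar exponential series; the factor [n%:R + 1] absorbs the norm of the
    zeroth power. *)
Lemma mx_exp_cvg X i j : (fun m => expsum X m i j) @ \oo --> mx_exp X i j.
Proof.
have cs : cvgn (series (fun k => k`!%:R^-1 * (X ^+ k) i j)).
  apply: normed_cvg; apply: (@series_le_cvg _ _ (fun k => (n%:R + 1) * exp_coeff (nrm X) k)).
  - by move=> k; apply: normr_ge0.
  - by move=> k; rewrite mulr_ge0 ?addr_ge0 // /exp_coeff /= divr_ge0 ?exprn_ge0 ?nrm_ge0.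
  - move=> k; rewrite /= normrM /exp_coeff /= [leRHS]mulrA [leRHS]mulrC.
    rewrite ger0_norm ?invr_ge0 // ler_wpM2l ?invr_ge0 //.
    by rewrite (le_trans (nrm_entry _ _ _)) // nrmXn.
  - have -> : series (fun k => (n%:R + 1) * exp_coeff (nrm X) k) =
        (fun m => (n%:R + 1) * series (exp_coeff (nrm X)) m).
      by apply/funext => m; rewrite /series /= mulr_sumr.
    by apply: is_cvgMr; apply: is_cvg_series_exp_coeff.
have e : series (fun k => k`!%:R^-1 * (X ^+ k) i j) = (fun m => expsum X m i j).
  apply/funext => m; rewrite /series /expsum /= big_mkord summxE.
  by apply: eq_bigr => k _; rewrite mxE.
by rewrite mxE; move: cs; rewrite e.
Qed.

Lemma mx_exp_bound X B b k0 :
  (forall m, (k0 <= m)%N -> nrm (expsum X m - B) <= b) -> nrm (mx_exp X - B) <= b.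
Proof.
move=> h; have cv : (fun m => nrm (expsum X m - B)) @ \oo --> nrm (mx_exp X - B).
  apply: cvgn_sum => i; apply: cvgn_sum => j; apply: cvg_norm.
  have -> : (fun m => (expsum X m - B) i j) = (fun m => expsum X m i j - B i j).
    by apply/funext => m; rewrite !mxE.
  rewrite [X in _ --> X](_ : _ = mx_exp X i j - B i j); last by rewrite [LHS]mxE [X in _ + X]mxE.
  by apply: cvgB; [exact: mx_exp_cvg|exact: cvg_cst].
apply: (cvgr_to_le cv); exists k0 => // m /= km; exact: h.
Qed.

Lemma mx_exp_eq X B k0 : (forall m, (k0 <= m)%N -> expsum X m = B) -> mx_exp X = B.
Proof.
move=> h; apply/eqP; rewrite -subr_eq0; apply/eqP/nrm_eq0/eqP.
rewrite eq_le nrm_ge0 andbT; apply: (@mx_exp_bound _ _ _ k0) => m km.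
by rewrite h // subrr nrm0.
Qed.

(** Meant for conjugation and transposition, which commute with the partial sums; the Lipschitz
    bound lets them pass to the limit. *)
Lemma mx_exp_linear X Y (f : 'M[R]_n -> 'M[R]_n) (c : R) :
  (forall m, expsum Y m = f (expsum X m)) ->
  (forall A B, nrm (f A - f B) <= c * nrm (A - B)) -> mx_exp Y = f (mx_exp X).
Proof.
move=> YX fc; apply/eqP; rewrite -subr_eq0; apply/eqP/nrm_eq0.
have cv : (fun m => nrm (expsum X m - mx_exp X)) @ \oo --> (0 : R).
  rewrite -(nrm0 R n n) -(subrr (mx_exp X)).
  apply: cvgn_sum => i; apply: cvgn_sum => j; apply: cvg_norm.
  have -> : (fun m => (expsum X m - mx_exp X) i j) = (fun m => expsum X m i j - mx_exp X i j).
    by apply/funext => m; rewrite mxE [X in _ + X]mxE.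
  rewrite [X in _ --> X](_ : _ = mx_exp X i j - mx_exp X i j); last by rewrite [LHS]mxE [X in _ + X]mxE.
  by apply: cvgB; [exact: mx_exp_cvg|exact: cvg_cst].
apply/eqP; rewrite eq_le nrm_ge0 andbT; apply/ler_addgt0Pl => e e0; rewrite addr0.
have c0 : 0 < `|c| + 1 by rewrite ltr_wpDl.
have [k0 _ h] : \forall m \near \oo, nrm (expsum X m - mx_exp X) <= e / (`|c| + 1).
  by apply: (cvgr_le _ cv); rewrite divr_gt0.
apply: (@mx_exp_bound _ _ _ k0) => m /h /= hm; rewrite YX (le_trans (fc _ _)) //.
rewrite (le_trans (ler_norm _)) // normrM (ger0_norm (nrm_ge0 _)).
rewrite (@le_trans _ _ ((`|c| + 1) * nrm (expsum X m - mx_exp X))) //.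
  by rewrite ler_wpM2r ?nrm_ge0 // lerDl.
by rewrite mulrC -ler_pdivlMr.
Qed.

Lemma mx_exp_conj (P X : 'M[R]_n) : P \in unitmx ->
  mx_exp (P *m X *m invmx P) = P *m mx_exp X *m invmx P.
Proof.
move=> Pu; apply: (@mx_exp_linear X _ (fun A => P *m A *m invmx P) (nrm P * nrm (invmx P))).
  move=> m; rewrite /expsum mulmx_sumr mulmx_suml; apply: eq_bigr => k _.
  rewrite -scalemxAr -scalemxAl; congr (_ *: _); elim: (k : nat) => [|l IH].
    by rewrite !mxX0 mulmx1 mulmxV.
  by rewrite !mxXSr IH !mulmxA mulmxKV.
move=> A B; rewrite -mulmxBl -mulmxBr (le_trans (nrmM _ _)) // mulrAC.
by rewrite ler_wpM2r ?nrm_ge0 // nrmM.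
Qed.

Lemma mx_exp_tr X : mx_exp X^T = (mx_exp X)^T.
Proof.
apply: (@mx_exp_linear X _ (fun A => A^T) 1) => [m|A B].
  rewrite /expsum linear_sum; apply: eq_bigr => k _; rewrite linearZ; congr (_ *: _).
  elim: (k : nat) => [|l IH]; first by rewrite !mxX0 /= trmx1.
  by rewrite mxXSr mxXS IH /= trmx_mul.
by rewrite mul1r -linearB /nrm exchange_big; under eq_bigr do under eq_bigr do rewrite mxE.
Qed.

Lemma mx_exp_diag (h : 'rV[R]_n) : mx_exp (diag_mx h) = diag_mx (\row_i expR (h 0 i)).
Proof.
have e m : expsum (diag_mx h) m = diag_mx (\row_i (series (exp_coeff (h 0 i)) m)).
  rewrite /expsum; apply/matrixP => i j; rewrite summxE !mxE.
  have X k : (diag_mx h ^+ k) i j = (h 0 j ^+ k) *+ (i == j).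
    elim: k => [|k IH]; first by rewrite mxX0 expr0 mxE.
    rewrite mxXSr mul_mx_diag mxE IH exprSr.
    by case: eqP => _; rewrite ?mulr1n // !mulr0n mul0r.
  under eq_bigr do rewrite mxE X.
  case: eqP => [->|_]; last by rewrite big1 // => k _; rewrite mulr0n mulr0.
  by rewrite mulr1n /series /= big_mkord; apply: eq_bigr => k _; rewrite mulr1n mulrC.
apply/matrixP => i j; have := @mx_exp_cvg (diag_mx h) i j.
move=> /(cvg_lim (@Rhausdorff R)) <-; under [X in limn X]funext do rewrite e mxE mxE.
rewrite !mxE; case: eqP => [->|_]; last by rewrite mulr0n; apply: (cvg_lim (@Rhausdorff R)); apply: cvg_cst.
by rewrite mulr1n.
Qed.

Lemma mx_exp_nilpotent X k : X ^+ k = 0 -> mx_exp X = expsum X k.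
Proof.
move=> Xk; apply: (@mx_exp_eq _ _ k) => m km.
rewrite /expsum (big_ord_widen _ (fun i => i`!%:R^-1 *: X ^+ i) km) [LHS](bigID (fun i : 'I_m => (i < k)%N)) /=.
rewrite [X in _ + X]big1 ?addr0 // => i; rewrite -leqNgt => ki.
by rewrite -(subnK ki) exprD Xk mulr0 scaler0.
Qed.

End MatrixExponential.

Lemma mxXZ (A : comNzRingType) n (c : A) (X : 'M[A]_n) k : (c *: X) ^+ k = c ^+ k *: X ^+ k.
Proof.
elim: k => [|k IH]; first by rewrite !mxX0 expr0 scale1r.
by rewrite !mxXS IH -scalemxAl -scalemxAr scalerA -exprS.
Qed.

Section Chernoff.
Variables (R : realType) (n : nat).
Implicit Types (X Y Z : 'M[R]_n).

Let fact_gt0R k : 0 < k`!%:R :> R. Proof. by rewrite ltr0n fact_gt0. Qed.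

Lemma mx_exp_order2 X :
  nrm (mx_exp X - (1%:M + X)) <= (n%:R + 1) * nrm X ^+ 2 * expR (nrm X).
Proof.
apply: (@mx_exp_bound _ _ _ _ _ 2) => -[|[|m]] // _.
have -> : expsum X m.+2 - (1%:M + X) = \sum_(k < m) k.+2`!%:R^-1 *: X ^+ k.+2.
  rewrite /expsum -(big_mkord xpredT (fun k => k`!%:R^-1 *: X ^+ k)) !big_nat_recl //.
  rewrite !factE mxX0 !invr1 !scale1r expr1 opprD addrACA subrr add0r addrAC subrr add0r.
  by rewrite big_mkord.
rewrite (le_trans (nrm_sum _ _ _)) // -mulrA mulrA.
rewrite (@le_trans _ _ (\sum_(k < m) (n%:R + 1) * nrm X ^+ 2 * (nrm X ^+ k / k`!%:R))) //; last first.
  by rewrite -mulr_sumr ler_wpM2l ?expsum_le_expR ?nrm_ge0 // mulr_ge0 ?addr_ge0 ?exprn_ge0 ?nrm_ge0.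
apply: ler_sum => k _; rewrite nrmZ ger0_norm ?invr_ge0 //.
rewrite mulrC (@le_trans _ _ ((n%:R + 1) * nrm X ^+ k.+2 / k.+2`!%:R)) //.
  by rewrite ler_wpM2r ?invr_ge0 // nrmXn.
rewrite -[k.+2]addn2 addnC exprD -!mulrA ler_wpM2l ?addr_ge0 // ler_wpM2l ?exprn_ge0 ?nrm_ge0 //.
rewrite ler_wpM2l ?nrm_ge0 // ler_wpM2l ?exprn_ge0 ?nrm_ge0 // lef_pV2 ?posrE // ler_nat.
by rewrite add2n !factS mulnA leq_pmull.
Qed.

(** Integer form of [1 - k ^_ i / k ^ i <= i ^ 2 / k], the estimate needed to compare the
    coefficients of [(1 + z / k) ^ k] with those of the exponential. *)
Lemma ffact_expn_bound k i : (k * k ^ i <= k * k ^_ i + i ^ 2 * k ^ i)%N.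
Proof.
elim: i => [|i IH]; first by rewrite ffactn0 expn0 addn0.
have [ki|ik] := leqP k i.
  apply: (leq_trans _ (leq_addl _ _)); rewrite leq_mul2r; apply/orP; right.
  by rewrite (leq_trans ki) // (leq_trans (leqnSn _)) // -mulnn leq_pmulr.
have h1 j : (k ^_ j <= k ^ j)%N.
  by elim: j => // j IHj; rewrite ffactnSr expnSr leq_mul // leq_subr.
have {}h1 := h1 i.
rewrite ffactnSr !expnS mulnA; move: (k ^ i)%N (k ^_ i)%N IH h1 => A B IH h1.
have [d kd] : exists d, k = (i + d)%N by exists (k - i)%N; rewrite subnKC // ltnW.
have -> : (k - i)%N = d by rewrite kd addKn.
have IH' : (k * (k * A) <= k * (k * B + i ^ 2 * A))%N by rewrite leq_mul2l IH orbT.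
have e : (k * (B * d) + i * (k * B) = k * (k * B))%N by rewrite kd; nia.
have h2 : (i * (k * B) <= i * (k * A))%N by rewrite leq_mul2l leq_mul2l h1 !orbT.
rewrite -!mulnn in IH' *.
have h3 : (i.+1 * i.+1 * (k * A) = k * (i * i * A) + 2 * (i * (k * A)) + k * A)%N by nia.
rewrite expn0 muln1 h3; lia.
Qed.

(** Coefficients are compared one by one; the factor [i ^ 2] from falling factorials is absorbed
    into [4 ^ i], whence the 4 in the bound. *)
Lemma mx_exp_euler Z k :
  nrm ((1%:M + k.+1%:R^-1 *: Z) ^+ k.+1 - mx_exp Z) <= (n%:R + 1) * expR (4%:R * nrm Z) / k.+1%:R.
Proof.
rewrite -nrmN opprB; apply: (@mx_exp_bound _ _ _ _ _ k.+2) => m km.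
pose a i : R := 'C(k.+1, i)%:R * k.+1%:R ^- i.
have k0 : k.+1%:R != 0 :> R by rewrite pnatr_eq0.
have -> : (1%:M + k.+1%:R^-1 *: Z) ^+ k.+1 = \sum_(i < m) a i *: Z ^+ i.
  rewrite -[1%:M]/(1 : 'M[R]_n) addrC exprD1n.
  rewrite (big_ord_widen _ (fun i => (k.+1%:R^-1 *: Z) ^+ i *+ 'C(k.+1, i)) km) big_mkcond.
  apply: eq_bigr => i _; rewrite /a; case: ltnP => ik; last by rewrite bin_small // mul0r scale0r.
  by rewrite mxXZ -exprVn -scaler_nat scalerA.
rewrite /expsum -sumrB (le_trans (nrm_sum _ _ _)) //.
under eq_bigr do rewrite -scalerBl nrmZ.
apply: (@le_trans _ _ (\sum_(i < m) (n%:R + 1) / k.+1%:R * ((4%:R * nrm Z) ^+ i / i`!%:R))); last first.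
  by rewrite -mulr_sumr [leRHS]mulrAC ler_wpM2l ?divr_ge0 ?addr_ge0 // expsum_le_expR // mulr_ge0 ?nrm_ge0.
apply: ler_sum => i _; rewrite /a distrC.
have -> : 'C(k.+1, i)%:R * k.+1%:R ^- i - i`!%:R^-1 =
    ((k.+1 ^_ i)%:R - (k.+1 ^ i)%:R) / (k.+1 ^ i)%:R / i`!%:R :> R.
  rewrite -bin_ffact natrM natrX; field.
  by rewrite gt_eqF ?ltr0n ?fact_gt0 //= expf_neq0 // nat1r.
rewrite !normrM !normfV !normr_nat distrC.
have d : (0 <= (k.+1 ^ i)%:R - (k.+1 ^_ i)%:R :> R) &&
    ((k.+1 ^ i)%:R - (k.+1 ^_ i)%:R <= (i ^ 2)%:R * (k.+1 ^ i)%:R / k.+1%:R :> R).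
  apply/andP; split.
    rewrite subr_ge0 ler_nat; elim: (nat_of_ord i) => // j IH.
    by rewrite ffactnSr expnSr leq_mul // leq_subr.
  rewrite ler_pdivlMr ?ltr0n // mulrC mulrBr lerBlDl -!natrM -natrD ler_nat.
  exact: ffact_expn_bound.
have /andP[d1 d2] := d; rewrite (ger0_norm d1).
have i4 : (i ^ 2 <= 4 ^ i)%N.
  elim: (nat_of_ord i) => // j IH; rewrite expnS; case: j IH => [|j] // IH.
  by rewrite (@leq_trans (4 * j.+1 ^ 2)) ?leq_mul2l ?IH ?orbT // -!mulnn; nia.
have k1 : 0 < (k.+1 ^ i)%:R :> R by rewrite ltr0n expn_gt0.
have d3 : ((k.+1 ^ i)%:R - (k.+1 ^_ i)%:R) / (k.+1 ^ i)%:R <= 4%:R ^+ i / k.+1%:R :> R.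
  rewrite ler_pdivrMr // (le_trans d2) // -natrX mulrAC ler_wpM2r // ler_wpM2r ?invr_ge0 //.
  by rewrite ler_nat.
rewrite exprMn.
apply: (@le_trans _ _ (4%:R ^+ i / k.+1%:R / i`!%:R * ((n%:R + 1) * nrm Z ^+ i))).
  apply: ler_pM; rewrite ?nrm_ge0 ?nrmXn //; first by rewrite !mulr_ge0 ?invr_ge0.
  by rewrite ler_wpM2r ?invr_ge0.
rewrite le_eqVlt; apply/orP; left; apply/eqP; move: (nrm Z ^+ i) (4%:R ^+ i) => u v.
by rewrite -!mulrA; field; rewrite gt_eqF ?ltr0n ?fact_gt0 //= nat1r pnatr_eq0.
Qed.

(** Chernoff's product formula with a rate: [g k] and [1 + Z / k.+1] are within [b / k.+1] of the
    identity, so all partial products in the telescoped difference of their powers are bounded by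
    [expR b]. *)
Lemma chernoff Z (g : nat -> 'M[R]_n) (c : R) k0 : (forall k, (k0 <= k)%N ->
    nrm (g k - (1%:M + k.+1%:R^-1 *: Z)) <= c / k.+1%:R ^+ 2) ->
  exists d, forall k, (k0 <= k)%N -> nrm (g k ^+ k.+1 - mx_exp Z) <= d / k.+1%:R.
Proof.
move=> gh; pose b := nrm Z + `|c|.
exists (`|c| * expR b + (n%:R + 1) * expR (4%:R * nrm Z)) => k kk.
have kp : 0 < k.+1%:R :> R by rewrite ltr0n.
have -> : g k ^+ k.+1 - mx_exp Z = (g k ^+ k.+1 - (1%:M + k.+1%:R^-1 *: Z) ^+ k.+1) +
    ((1%:M + k.+1%:R^-1 *: Z) ^+ k.+1 - mx_exp Z) by rewrite addrA subrK.
rewrite (le_trans (nrmD _ _)) // mulrDl lerD ?mx_exp_euler //.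
have gc : nrm (g k - (1%:M + k.+1%:R^-1 *: Z)) <= `|c| / k.+1%:R ^+ 2.
  by rewrite (le_trans (gh k kk)) // ler_wpM2r ?invr_ge0 ?exprn_ge0 // ler_norm.
have e1 : nrm (k.+1%:R^-1 *: Z) <= b / k.+1%:R.
  by rewrite nrmZ ger0_norm ?invr_ge0 // mulrC ler_wpM2r ?invr_ge0 // lerDl.
have e2 : nrm (g k - 1%:M) <= b / k.+1%:R.
  have -> : g k - 1%:M = (g k - (1%:M + k.+1%:R^-1 *: Z)) + k.+1%:R^-1 *: Z.
    by rewrite opprD addrA subrK.
  rewrite (le_trans (nrmD _ _)) // mulrDl addrC lerD //.
    by rewrite nrmZ ger0_norm ?invr_ge0 // mulrC.
  rewrite (le_trans gc) // ler_wpM2l // lef_pV2 ?posrE ?exprn_gt0 // ler_eXnr // ler1n //.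
have e3 : nrm ((1%:M + k.+1%:R^-1 *: Z) - 1%:M) <= b / k.+1%:R by rewrite addrC addKr.
have b0 : 0 <= b by rewrite addr_ge0 ?nrm_ge0.
rewrite (le_trans (nrm_expB _ e2 e3)) //.
rewrite (@le_trans _ _ (k.+1%:R * expR b * (`|c| / k.+1%:R ^+ 2))) //.
  rewrite ler_pM ?nrm_ge0 ?mulr_ge0 ?exprn_ge0 ?addr_ge0 ?divr_ge0 //.
  rewrite ler_wpM2l // -{2}[b](divfK (lt0r_neq0 kp)) expRM_natr lerXn2r ?nnegrE ?expR_ge0 //.
    by rewrite addr_ge0 ?divr_ge0.
  exact: expR_ge1Dx.
rewrite le_eqVlt; apply/orP; left; apply/eqP; move: (expR b) => u.
by field; rewrite nat1r pnatr_eq0.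
Qed.

End Chernoff.

(** * Velocities of curves in a closed matrix group *)

Section Tangent.
Variables (R : realType) (n : nat) (H : set 'M[R]_n).
Implicit Types (X Y Z : 'M[R]_n).

(** Closedness under limits with rate [1 / k], the form of convergence that the estimates
    deliver. *)
Definition seq_closed : Prop := forall (u : nat -> 'M[R]_n) X (c : R) k0,
  (forall k, (k0 <= k)%N -> H (u k) /\ nrm (u k - X) <= c / k.+1%:R) -> H X.

(* Z is the one-sided velocity at 1 of a curve in H. *)
Definition tangent Z : Prop := exists (c d : R) (g : R -> 'M[R]_n), 0 < d /\
  forall s, 0 < s <= d -> H (g s) /\ nrm (g s - (1%:M + s *: Z)) <= c * s ^+ 2.

Lemma tangentZ c Z : 0 < c -> tangent Z -> tangent (c *: Z).
Proof.
move=> c0 [b [d [g [d0 gh]]]]; exists (b * c ^+ 2), (d / c), (fun s => g (c * s)).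
split=> [|s /andP[s0 sd]]; first by rewrite divr_gt0.
have [|Hg gb] := gh (c * s); first by rewrite mulr_gt0 //= mulrC -ler_pdivlMr.
by split=> //; rewrite scalerA [s * c]mulrC -mulrA -exprMn.
Qed.

Hypotheses (HM : forall X Y, H X -> H Y -> H (X *m Y)) (H1 : H 1%:M).

(** Pointwise multiplication of the two curves; the cross term is of second order. *)
Lemma tangentD Y Z : tangent Y -> tangent Z -> tangent (Y + Z).
Proof.
move=> [c1 [d1 [g1 [d10 h1]]]] [c2 [d2 [g2 [d20 h2]]]].
pose b1 := `|c1| + nrm Y; pose b2 := `|c2| + nrm Z.
exists (`|c1| + `|c2| + b1 * b2), (Num.min 1 (Num.min d1 d2)), (fun s => g1 s *m g2 s).
split=> [|s /andP[s0]]; first by rewrite !lt_min ltr01 d10 d20.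
rewrite !le_min => /and3P[s1 sd1 sd2].
have s01 : 0 < s <= d1 by rewrite s0.
have s02 : 0 < s <= d2 by rewrite s0.
have [[Hg1 gb1] [Hg2 gb2]] := (h1 _ s01, h2 _ s02).
split; first exact: HM.
have s2 : s ^+ 2 <= s by rewrite expr2 ler_piMl // ltW.
have bd (c : R) (g W : 'M[R]_n) : nrm (g - (1%:M + s *: W)) <= c * s ^+ 2 ->
    nrm (g - 1%:M) <= (`|c| + nrm W) * s.
  move=> gW; have -> : g - 1%:M = (g - (1%:M + s *: W)) + s *: W.
    by rewrite opprD addrA subrK.
  rewrite (le_trans (nrmD _ _)) // mulrDl lerD //; last by rewrite nrmZ (ger0_norm (ltW s0)) mulrC.
  apply: (le_trans gW); apply: (@le_trans _ _ (`|c| * s ^+ 2)); first by rewrite ler_wpM2r ?ler_norm ?exprn_ge0 ?ltW.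
  by rewrite ler_wpM2l.
have sq0 : 0 <= s ^+ 2 by rewrite exprn_ge0 // ltW.
have -> : g1 s *m g2 s - (1%:M + s *: (Y + Z)) = (g1 s - (1%:M + s *: Y)) +
    (g2 s - (1%:M + s *: Z)) + (g1 s - 1%:M) *m (g2 s - 1%:M).
  rewrite mulmxBl !mulmxBr !mulmx1 !mul1mx scalerDr.
  by apply/matrixP => i j; rewrite ![in LHS]mxE ![in RHS]mxE; ring.
rewrite (le_trans (nrmD _ _)) // mulrDl lerD //.
  rewrite (le_trans (nrmD _ _)) // mulrDl lerD //.
    by rewrite (le_trans gb1) // ler_wpM2r ?ler_norm.
  by rewrite (le_trans gb2) // ler_wpM2r ?ler_norm.
rewrite (le_trans (nrmM _ _)) // expr2 mulrACA ler_pM ?nrm_ge0 ?bd //.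
Qed.

(** By Chernoff's formula the [k]-th powers of the points [g (1 / k)], which stay in the group,
    converge to the exponential. *)
Lemma tangent_exp Z : seq_closed -> tangent Z -> H (mx_exp Z).
Proof.
move=> Hc [c [d [g [d0 gh]]]].
have HX X k : H X -> H (X ^+ k).
  by move=> HX; elim: k => [|k IH]; [rewrite mxX0|rewrite mxXS; apply: HM].
pose k0 := Num.bound d^-1.
have sk k : (k0 <= k)%N -> 0 < (k.+1%:R^-1 : R) <= d.
  move=> kk; rewrite invr_gt0 ltr0n //= -[leRHS]invrK lef_pV2 ?posrE ?invr_gt0 ?ltr0n //.
  have dB : d^-1 < k0%:R by apply: archi_boundP; rewrite invr_ge0 ltW.
  by rewrite (le_trans (ltW dB)) // ler_nat (leq_trans kk).
have [|b bh] := @chernoff R n Z (fun k => g k.+1%:R^-1) c k0.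
  by move=> k /sk /gh [_]; rewrite exprVn.
apply: (Hc (fun k => g k.+1%:R^-1 ^+ k.+1) _ b k0) => k kk; split; last exact: bh.
by apply: HX; have [] := gh _ (sk k kk).
Qed.

Lemma exp_tangent Z : (forall s, 0 < s -> H (mx_exp (s *: Z))) -> tangent Z.
Proof.
move=> h; exists ((n%:R + 1) * nrm Z ^+ 2 * expR (nrm Z)), 1, (fun s => mx_exp (s *: Z)).
split=> // s /andP[s0 s1]; split; first exact: h.
rewrite (le_trans (mx_exp_order2 _)) // nrmZ (ger0_norm (ltW s0)) exprMn.
rewrite [s ^+ 2 * _]mulrC mulrA [leRHS]mulrAC ler_wpM2l ?ler_expR //.
  by rewrite !mulr_ge0 ?addr_ge0 ?exprn_ge0 ?nrm_ge0 // ltW.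
by rewrite ler_piMl ?nrm_ge0.
Qed.

End Tangent.

(** * The identity component of S is its positive part *)

Definition sa_conj (K : rcfType) n (s : seq (sa_formula K n)) : sa_formula K n :=
  foldr (@SaAnd K n) (SaNot (SaPos 0)) s.

Lemma sa_conj_map (K L : rcfType) (iota : {rmorphism K -> L}) n (T : eqType) (s : seq T)
    (f : T -> sa_formula K n) x :
  sa_set iota (sa_conj (map f s)) x <-> forall y, y \in s -> sa_set iota (f y) x.
Proof.
elim: s => [|y s IH] /=; first by rewrite ev0 ltxx; split.
rewrite IH; split=> [[h1 h2] z|h]; first by rewrite inE => /orP[/eqP ->|/h2].
by split=> [|z zs]; apply: h; rewrite inE ?eqxx // zs orbT.
Qed.

Lemma sa_set_map (K L M : rcfType) (f : {rmorphism K -> L}) (g : {rmorphism L -> M}) n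
    (D : sa_formula K n) x : sa_set (g \o f) D (map_mx g x) <-> sa_set f D x.
Proof.
elim: D => [p|D IH|D1 IH1 D2 IH2|D1 IH1 D2 IH2] /=.
- by rewrite ev_comp rcf_morph_gt0.
- by rewrite IH.
- by rewrite IH1 IH2.
- by rewrite IH1 IH2.
Qed.

Lemma msatAnd (K L : rcfType) (iota : {rmorphism K -> L}) n e (f g : mform K n) :
  msat iota e (FAnd f g) <-> msat iota e f /\ msat iota e g.
Proof. by []. Qed.

Lemma msatEx (K L : rcfType) (iota : {rmorphism K -> L}) n e j (f : mform K n) :
  msat iota e (FEx j f) <-> exists X, msat iota (upd e j X) f.
Proof. by []. Qed.

Section RelOpenTransfer.
Variables (K L : rcfType) (iota : {rmorphism K -> L}) (n : nat).

(** Only matrices can be quantified, so a radius is encoded by a matrix [E], closeness meaning that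
    the entries of [E (y - x)] are below 1 in absolute value. A radius [e] becomes the scalar matrix
    [e^-1]; conversely [E] yields the radius [1 / (1 + nrm E)]. *)
Definition FRelOpen (V U : sa_formula K n) : mform K n :=
  let x := MVar K n in
  FAll 0 (FImp (FAnd (FSa V (x 0%N)) (FSa U (x 0%N)))
    (FEx 1 (FAll 2 (FImp (FAnd (FSa V (x 2%N)) (FConj (enum {: 'I_n * 'I_n})
        (fun ij => FPos (1 - genmx K n ij.1 ij.2 ^+ 2)
           (MMul (x 1%N) (MAdd (x 2%N) (MMul (MConst (- 1%:M)) (x 0%N)))))))
      (FSa U (x 2%N)))))).

Lemma msatRelOpen (V U : sa_formula K n) :
  msat iota (fun=> 0) (FRelOpen V U) <-> rel_open (sa_set iota V) (sa_set iota U).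
Proof.
have step (x y E : 'M[L]_n) : (forall ij : 'I_n * 'I_n,
    0 < ev iota (1 - genmx K n ij.1 ij.2 ^+ 2) (E *m (y + map_mx iota (- 1%:M) *m x))) <->
    (forall i j, `|(E *m (y - x)) i j| < 1).
  have e ij : (0 < ev iota (1 - genmx K n ij.1 ij.2 ^+ 2) (E *m (y + map_mx iota (- 1%:M) *m x)))
      = (`|(E *m (y - x)) ij.1 ij.2| < 1).
    rewrite evD evN ev1 evXn ev_genmx map_mxN map_mx1 mulNmx mul1mx subr_gt0.
    rewrite -(real_normK (num_real _)) -{1}(expr1n L 2) ltr_sqr ?nnegrE //.
  by split=> [h i j|h [i j]]; [have := h (i, j); rewrite e|rewrite e; apply: h].
rewrite /FRelOpen msatE; split=> h x.
  move=> Vx Ux; have := h x; rewrite msatE msatAnd !msatSa msatEx => /(_ (conj Vx Ux)) [E hE].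
  exists (1 + nrm E)^-1; first by rewrite invr_gt0 ltr_pwDl ?nrm_ge0.
  move=> y Vy yx; have := hE; rewrite msatE => /(_ y); rewrite msatE msatAnd !msatSa /=; apply.
  split=> //; apply/msatConj => ij _; move: ij; apply/step => i j.
  have E1 : 0 < 1 + nrm E by rewrite ltr_pwDl ?nrm_ge0.
  rewrite mxE (le_lt_trans (ler_norm_sum _ _ _)) //.
  rewrite (@le_lt_trans _ _ (\sum_k `|E i k| * (1 + nrm E)^-1)) //.
    by apply: ler_sum => k _; rewrite normrM ler_wpM2l // !mxE ltW.
  rewrite -mulr_suml ltr_pdivrMr // mul1r (@le_lt_trans _ _ (nrm E)) ?ltrDr //.
  by rewrite [leRHS](bigD1 i) //= lerDl sumr_ge0 // => k _; rewrite sumr_ge0.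
rewrite msatE msatAnd !msatSa msatEx => -[Vx Ux]; have [e e0 he] := h x Vx Ux.
exists (e^-1)%:M; rewrite msatE => y; rewrite msatE msatAnd !msatSa /= => -[Vy /msatConj yx].
apply: he => // i j; have := (step x y (e^-1)%:M).1 (fun ij => yx ij (mem_enum _ _)) i j.
by rewrite mul_scalar_mx !mxE normrM gtr0_norm ?invr_gt0 // mulrC ltr_pdivrMr // mul1r.
Qed.

End RelOpenTransfer.

Definition pos_row (L : numDomainType) n (t : 'rV[L]_n) : Prop := forall i, 0 < t 0 i.

Section PositiveTorus.
Variables (K : rcfType) (C : numFieldType) (jC : {rmorphism K -> C}) (n : nat).
Variables (S : set (mxpoly K n)) (P : 'M[K]_n).
Hypotheses (Pu : P \in unitmx) (S_grp : mx_group (zeros jC S))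
  (S_det : (zeros jC S `<=` [set x | \det x = 1])%classic)
  (S_diag : split_by jC P (zeros jC S)).
Notation chr := (chars jC S P).

(** The points of S with positive eigenvalues in the coordinates [P]: the candidate for the identity
    component, definable over every extension. *)
Definition Spos (L : rcfType) (iota : {rmorphism K -> L}) : set 'M[L]_n :=
  [set x | zeros iota S x /\
    forall k, 0 < (map_mx iota P *m x *m invmx (map_mx iota P)) k k]%classic.

Lemma SposP (L : rcfType) (iota : {rmorphism K -> L}) x :
  Spos iota x <-> exists t, [/\ pos_row t, forall m, chr m -> zmono m t = 1 &
    x = dconj (map_mx iota P) t].
Proof.
have PLu : map_mx iota P \in unitmx by rewrite map_unitmx.
split=> [[/(zerosS_torus Pu S_grp S_det S_diag) [t [ut tm xE]] x0]|[t [t0 tm ->]]].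
  by exists t; split=> // i; have := x0 i; rewrite xE dconjK // mxE eqxx mulr1n.
split; last by move=> i; rewrite dconjK // mxE eqxx mulr1n.
by apply/(zerosS_torus Pu S_grp S_det S_diag); exists t; split=> // i; rewrite gt_eqF.
Qed.

Lemma Spos_formula : exists D, forall (L : rcfType) (iota : {rmorphism K -> L}),
  sa_set iota D = Spos iota.
Proof.
have [Sf SfP] := zeros_finite S.
exists (SaAnd (sa_conj [seq SaAnd (SaNot (SaPos p)) (SaNot (SaPos (- p))) | p <- Sf])
  (sa_conj [seq SaPos (conj_genmx P k k) | k <- enum 'I_n])) => L iota.
apply/seteqP; split=> x /=.
  move=> [/sa_conj_map h1 /sa_conj_map h2]; split.
    apply/SfP => p pS; have /= [] := h1 _ pS; rewrite evN oppr_gt0 => /negP a /negP b.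
    by apply/eqP; rewrite eq_le !leNgt a b.
  by move=> k; rewrite -ev_conj_genmx; apply: h2; rewrite mem_enum.
move=> [/SfP h1 h2]; split; apply/sa_conj_map; last by move=> k _ /=; rewrite ev_conj_genmx.
move=> p pS /=; by rewrite evN (h1 _ pS) oppr0 ltxx.
Qed.

Lemma Spos1 (L : rcfType) (iota : {rmorphism K -> L}) : Spos iota 1%:M.
Proof.
apply/SposP; exists (const_mx 1); split=> [i|m _|]; rewrite ?mxE ?ltr01 ?zmono1 //.
by rewrite dconj1 // map_unitmx.
Qed.

(** The eigenvalues do not vanish on S, so their signs are locally constant, and a connected subset
    through the identity keeps them positive. *)
Lemma sub_component_Spos : (identity_component S `<=` Spos (idfun : {rmorphism K -> K}))%classic.
Proof.
have [D DE] := Spos_formula.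
move=> x [V [[DV DVE] Vc VS V1] Vx].
pose dg (y : 'M[K]_n) k := (P *m y *m invmx P) k k.
pose B := 1 + nrm P * (n%:R * n%:R) * nrm (invmx P).
have B0 : 0 < B by rewrite ltr_pwDl // !mulr_ge0 ?nrm_ge0.
(* A radius within which no diagonal entry changes sign: [B] bounds the effect of conjugation by
   [P], and the product of truncated absolute values lies below each of them. *)
pose e y := (\prod_k Num.min 1 `|dg y k|) / B.
have dg0 y k : V y -> dg y k != 0.
  move=> /VS /(zerosS_torus Pu S_grp S_det S_diag (idfun : {rmorphism K -> K})) [t [ut _ ->]].
  by rewrite map_mx_id // /dg dconjK // mxE eqxx mulr1n.
have e0 y : V y -> 0 < e y.
  by move=> Vy; rewrite divr_gt0 // prodr_gt0 // => k _; rewrite lt_min ltr01 normr_gt0 dg0.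
have near (y z : 'M[K]_n) k : V y -> (forall i j, `|z i j - y i j| < e y) -> (0 < dg y k) = (0 < dg z k).
  move=> Vy zy; suff : `|dg z k - dg y k| < `|dg y k|.
    rewrite ltr_norml; case: (ltrgt0P (dg y k)) (dg0 y k Vy) => [p|p|_] //.
      by move=> _ /andP[h _]; symmetry; move: h; rewrite ltrBrDr addNr.
    by move=> _ /andP[_ h]; symmetry; apply/negbTE; rewrite -leNgt ltW //; move: h; rewrite ltrBlDr addNr.
  have -> : dg z k - dg y k = (P *m (z - y) *m invmx P) k k.
    by rewrite /dg mulmxBr mulmxBl [in RHS]mxE [X in _ = _ + X]mxE.
  rewrite (le_lt_trans (nrm_entry _ _ _)) // (le_lt_trans (nrmM _ _)) //.
  rewrite (@le_lt_trans _ _ (nrm P * (n%:R * n%:R * e y) * nrm (invmx P))) //.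
    rewrite ler_wpM2r ?nrm_ge0 // (le_trans (nrmM _ _)) // ler_wpM2l ?nrm_ge0 //.
    rewrite /nrm (@le_trans _ _ (\sum_(i < n) \sum_(j < n) e y)) //; last first.
      by rewrite !sumr_const card_ord -mulrnA -natrM mulr_natl.
    by apply: ler_sum => i _; apply: ler_sum => j _; rewrite mxE [X in _ + X]mxE; apply: ltW; apply: zy.
  rewrite (@lt_le_trans _ _ (B * e y)) //.
    by rewrite /B mulrDl mul1r [X in X * nrm (invmx P) < _]mulrA [X in X < _]mulrAC ltrDr e0.
  rewrite mulrC divfK ?gt_eqF // (bigD1 k) //= (@le_trans _ _ (Num.min 1 `|dg y k|)) //.
    rewrite ler_piMr ?le_min ?ler01 ?normr_ge0 // prodr_ile1 // => j _.
    by rewrite le_min ler01 normr_ge0 ge_min lexx.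
  by rewrite ge_min lexx orbT.
have DP y : V y -> sa_set idfun D y <-> forall k, 0 < dg y k.
  move=> Vy; rewrite (DE K (idfun : {rmorphism K -> K})) /Spos /= map_mx_id //.
  by split=> [[]|h] //; split=> //; apply: VS.
have DVx : sa_set idfun D x -> Spos (idfun : {rmorphism K -> K}) x by rewrite -DE.
have [||||||U1V|U2V] := Vc (V `&` sa_set idfun D)%classic (V `&` ~` sa_set idfun D)%classic.
- by exists (SaAnd DV D); rewrite /= DVE.
- by exists (SaAnd DV (SaNot D)); rewrite /= DVE.
- move=> y Vy [_ /DP Dy]; exists (e y) => [|z Vz zy]; first exact: e0.
  by split=> //; apply/DP => // k; rewrite -(near y) // Dy.
- move=> y Vy [_ Dy]; exists (e y) => [|z Vz zy]; first exact: e0.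
  by split=> // /DP Dz; apply: Dy; apply/DP => // k; rewrite (near y z) // Dz.
- by rewrite -setIUr setUv setIT.
- by rewrite setIACA setICr setI0.
- by apply: DVx; move: Vx; rewrite -{1}U1V => -[].
- by move: V1; rewrite -{1}U2V => -[_ []]; rewrite (DE K (idfun : {rmorphism K -> K})); apply: Spos1.
Qed.

End PositiveTorus.

Lemma real_line_connected (R : realType) (T : set R) a b :
  (forall s, T s -> \forall x \near s, T x) -> (forall s, ~ T s -> \forall x \near s, ~ T x) ->
  T a -> T b.
Proof.
move=> T1 T2 Ta; have To : open T by rewrite openE.
have Tc : closed T by rewrite -[T]setCK; apply: open_closedC; rewrite openE.
have : connected [set: R] by apply/connected_intervalP => x y _ _ z.
move=> /(_ T) -> //; first by exists a.
- by exists T; rewrite ?setTI.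
- by exists T; rewrite ?setTI.
Qed.

Lemma zmono_expR (R : realType) n (m : 'I_n -> int) (h : 'rV[R]_n) :
  zmono m (\row_i expR (h 0 i)) = expR (\sum_i (m i)%:~R * h 0 i).
Proof.
rewrite /zmono expR_sum; apply: eq_bigr => i _; rewrite mxE.
by case: (m i) => k; rewrite ?NegzE -?exprnP -?exprnN ?rmorphN /= ?mulNr ?expRN expRM_natl.
Qed.

Section PositiveTorusComponent.
Variables (K : rcfType) (C : numFieldType) (jC : {rmorphism K -> C}) (n : nat).
Variables (S : set (mxpoly K n)) (P : 'M[K]_n).
Hypotheses (Pu : P \in unitmx) (S_grp : mx_group (zeros jC S))
  (S_det : (zeros jC S `<=` [set x | \det x = 1])%classic)
  (S_diag : split_by jC P (zeros jC S)).
Notation chr := (chars jC S P).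
Variables (R : realType) (iR : {rmorphism K -> R}).
Let PR := map_mx iR P.

(** In logarithmic coordinates the positive torus is a real vector space, so segments join its
    points. *)
Lemma Spos_path_connected (U1 U2 : set 'M[R]_n) x y :
  rel_open (Spos S P iR) U1 -> rel_open (Spos S P iR) U2 ->
  U1 `|` U2 = Spos S P iR -> U1 `&` U2 = set0 -> U1 x -> U2 y -> False.
Proof.
move=> o1 o2 U12 U0 U1x U2y.
have SP z := @SposP K C jC n S P Pu S_grp S_det S_diag R iR z.
have [t [t0 tm xE]] : exists t, [/\ pos_row t, forall m, chr m -> zmono m t = 1 & x = dconj PR t].
  by apply/SP; rewrite -U12; left.
have [w [w0 wm yE]] : exists t, [/\ pos_row t, forall m, chr m -> zmono m t = 1 & y = dconj PR t].
  by apply/SP; rewrite -U12; right.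
pose h (s : R) : 'rV[R]_n := \row_i (ln (t 0 i) + s * (ln (w 0 i) - ln (t 0 i))).
pose g s := dconj PR (\row_i expR (h s 0 i)).
have lnm (u : 'rV[R]_n) m : pos_row u -> zmono m u = 1 -> \sum_i (m i)%:~R * ln (u 0 i) = 0.
  move=> u0 um; apply: expR_inj; rewrite expR0 -[RHS]um.
  have uE : u = \row_i expR ((\row_j ln (u 0 j)) 0 i).
    by apply/rowP => i; rewrite !mxE lnK ?posrE.
  by rewrite [in RHS]uE zmono_expR; congr expR; apply: eq_bigr => i _; rewrite !mxE.
have gS s : Spos S P iR (g s).
  apply/SP; exists (\row_i expR (h s 0 i)); split=> // [i|m cm]; first by rewrite mxE expR_gt0.
  rewrite zmono_expR (eq_bigr (fun i => (1 - s) * ((m i)%:~R * ln (t 0 i)) + s * ((m i)%:~R * ln (w 0 i)))).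
    by rewrite big_split -!mulr_sumr (lnm t m t0 (tm m cm)) (lnm w m w0 (wm m cm)) /= !mulr0 addr0 expR0.
  by move=> i _; rewrite mxE; ring.
have g0 : g 0 = x.
  rewrite xE; congr dconj; apply/rowP => i.
  by rewrite !mxE mul0r addr0 lnK ?posrE.
have g1 : g 1 = y.
  rewrite yE; congr dconj; apply/rowP => i.
  by rewrite !mxE mul1r addrC subrK lnK ?posrE.
have near_g (U : set 'M[R]_n) s : rel_open (Spos S P iR) U -> U (g s) ->
    \forall x \near s, U (g x).
  move=> oU Us; have [e e0 eU] := oU _ (gS s) Us.
  pose c := 1 + nrm (invmx PR) * nrm PR * n%:R.
  have c0 : 0 < c by rewrite ltr_pwDl // !mulr_ge0 ?nrm_ge0.
  have : \forall x \near s, forall k, `|expR (h s 0 k) - expR (h x 0 k)| < e / c.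
    apply: (@filter_forall R _ (fun k x => `|expR (h s 0 k) - expR (h x 0 k)| < e / c) (nbhs s) (nbhs_filter s)) => k.
    have hc : {for s, continuous (fun x => h x 0 k)}.
      have -> : (fun x => h x 0 k) = (fun x => ln (t 0 k) + x * (ln (w 0 k) - ln (t 0 k))).
        by apply/funext => z; rewrite mxE.
      by apply: cvgD; [exact: cvg_cst|apply: cvgMl; exact: cvg_id].
    have cc : {for s, continuous (expR \o (fun x => h x 0 k))}.
      by apply: continuous_comp => //; apply: continuous_expR.
    by have /cvgr_dist_lt /(_ _ (divr_gt0 e0 c0)) := cc.
  apply: filterS => z hz; apply: eU => // i j.
  have -> : g z i j - g s i j = (invmx PR *m diag_mx (\row_k (expR (h z 0 k) - expR (h s 0 k))) *m PR) i j.
    have -> : diag_mx (\row_k (expR (h z 0 k) - expR (h s 0 k))) =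
      diag_mx (\row_k expR (h z 0 k)) - diag_mx (\row_k expR (h s 0 k)).
      by rewrite -linearB; congr diag_mx; apply/rowP => k; rewrite !mxE.
    by rewrite mulmxBr mulmxBl [in RHS]mxE [X in _ = _ + X]mxE.
  rewrite (le_lt_trans (nrm_entry _ _ _)) // (le_lt_trans (nrmM _ _)) //.
  rewrite (@le_lt_trans _ _ (nrm (invmx PR) * (n%:R * (e / c)) * nrm PR)) //.
    rewrite ler_wpM2r ?nrm_ge0 // (le_trans (nrmM _ _)) // ler_wpM2l ?nrm_ge0 //.
    rewrite /nrm (@le_trans _ _ (\sum_(i < n) (e / c))) //; last by rewrite sumr_const card_ord mulr_natl.
    apply: ler_sum => k _; rewrite (bigD1 k) //= big1 => [|l lk].
      by rewrite addr0 [diag_mx _ _ _]mxE eqxx mulr1n mxE distrC; apply: ltW; apply: hz.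
    by rewrite mxE eq_sym (negbTE lk) mulr0n normr0.
  rewrite (_ : _ * _ * _ = (nrm (invmx PR) * nrm PR * n%:R) * e / c); last by ring.
  by rewrite ltr_pdivrMr // mulrC ltr_pM2l // ltrDr.
have nU s : U1 (g s) <-> ~ U2 (g s).
  split=> [a b|b]; first by have : (U1 `&` U2) (g s) by []; rewrite U0.
  by have := gS s; rewrite -U12 => -[].
have : U1 (g 1).
  apply: (@real_line_connected R (fun s => U1 (g s)) 0 1) => [s||]; first exact: near_g.
    move=> s ns; have : U2 (g s) by apply: contrapT => /nU.
    by move=> /(near_g _ _ o2); apply: filterS => z u2 /nU.
  by rewrite g0.
by move=> /nU; rewrite g1.
Qed.

(** A semialgebraic separation over K would extend to R by transfer of relative openness,
    contradicting path connectedness there. *)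
Lemma Spos_connected : sa_connected (Spos S P (idfun : {rmorphism K -> K})).
Proof.
have [D DE] := Spos_formula S P.
pose f : {rmorphism K -> K} := idfun.
rewrite -(DE K f) => U1 U2 [D1 ->] [D2 ->] o1 o2 U12 U0.
have [|n1] := pselect (sa_set idfun D1 = sa_set f D); first by left.
have [|n2] := pselect (sa_set idfun D2 = sa_set f D); first by right.
exfalso.
have ex (E1 E2 : sa_formula K n) : sa_set f E1 `|` sa_set f E2 = sa_set f D ->
    sa_set f E1 <> sa_set f D -> exists y, sa_set f E2 y.
  move=> E12 ne; apply: contrapT => nE; apply: ne; rewrite -E12.
  by apply/seteqP; split=> z; [left|case=> // h; case: nE; exists z].
have [y U2y] := ex D1 D2 U12 n1.
have [x U1x] : exists x, sa_set f D1 x by apply: (ex D2 D1) => //; rewrite setUC.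
have up z E : sa_set f E z -> sa_set iR E (map_mx iR z).
  by move=> /(sa_set_map f iR).
apply: (@Spos_path_connected (sa_set iR D1) (sa_set iR D2) (map_mx iR x) (map_mx iR y)).
- rewrite -DE; apply/msatRelOpen/transfer_closed; exact/msatRelOpen.
- rewrite -DE; apply/msatRelOpen/transfer_closed; exact/msatRelOpen.
- by rewrite -DE; apply: (@sa_set_transfer _ _ iR _ (SaOr D1 D2) D).
- have -> : set0 = sa_set iR (SaAnd D (SaNot D)) by rewrite /= setICr.
  by apply: (@sa_set_transfer _ _ iR _ (SaAnd D1 D2)); rewrite /= U0 setICr.
- exact: up.
- exact: up.
Qed.

Lemma identity_componentE : identity_component S = Spos S P (idfun : {rmorphism K -> K}).
Proof.
apply/seteqP; split; first exact: (sub_component_Spos Pu S_grp S_det S_diag).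
move=> x Sx; exists (Spos S P (idfun : {rmorphism K -> K})) => //; split.
- by have [D DE] := Spos_formula S P; exists D; rewrite (DE K (idfun : {rmorphism K -> K})).
- exact: Spos_connected.
- by move=> y [].
- exact: (Spos1 Pu S_grp S_det S_diag).
Qed.

Lemma A_extE (L : rcfType) (iL : {rmorphism K -> L}) : A_ext S iL = Spos S P iL.
Proof.
have [D DE] := Spos_formula S P.
rewrite /A_ext identity_componentE; apply/seteqP; split=> [x [D' [D'E D'x]]|x Sx].
  rewrite -DE; rewrite -(@sa_set_transfer _ _ iL _ D' D) //.
  by rewrite D'E (DE K (idfun : {rmorphism K -> K})).
by exists D; rewrite DE (DE K (idfun : {rmorphism K -> K})).
Qed.

End PositiveTorusComponent.

Lemma mx_exp_entry0 (R : realType) n (W : 'M[R]_n) k l : k != l ->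
  (forall s, 0 < s -> mx_exp (s *: W) k l = 0) -> W k l = 0.
Proof.
move=> kl h; apply/eqP; rewrite -normr_le0.
apply: (@archi_eq0 _ _ ((n%:R + 1) * nrm W ^+ 2 * expR (nrm W)) 0) => j _.
have j0 : 0 < j.+1%:R :> R by rewrite ltr0n.
have := nrm_entry (mx_exp (j.+1%:R^-1 *: W) - (1%:M + j.+1%:R^-1 *: W)) k l.
rewrite [X in `|X|]mxE h ?invr_gt0 // add0r [X in `|X|]mxE [X in - X]mxE [X in X + _]mxE (negbTE kl) add0r.
rewrite normrN [X in `|X|]mxE normrM (ger0_norm (ltW _)) ?invr_gt0 // => h1.
have {h1} := le_trans h1 (mx_exp_order2 _).
have -> : nrm (j.+1%:R^-1 *: W) = j.+1%:R^-1 * nrm W by rewrite nrmZ ger0_norm ?invr_ge0.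
rewrite exprMn ler_pdivrMl // => h1; apply: (le_trans h1).
set e := expR _; have e1 : e <= expR (nrm W).
  by rewrite ler_expR ler_piMl ?nrm_ge0 // invf_le1 // ler1n.
rewrite [leLHS](_ : _ = (n%:R + 1) * nrm W ^+ 2 * e / j.+1%:R); last by field; rewrite nat1r pnatr_eq0.
by rewrite ler_wpM2r ?invr_ge0 // ler_wpM2l // mulr_ge0 ?exprn_ge0 ?nrm_ge0 ?addr_ge0.
Qed.

(** * The Lie algebra of A and its weights *)

Section CartanSubspace.
Variables (K : rcfType) (C : numFieldType) (jC : {rmorphism K -> C}) (n : nat).
Variables (S : set (mxpoly K n)) (P : 'M[K]_n).
Hypotheses (Pu : P \in unitmx) (S_grp : mx_group (zeros jC S))
  (S_det : (zeros jC S `<=` [set x | \det x = 1])%classic)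
  (S_conn : zariski_connected (zeros jC S))
  (S_diag : split_by jC P (zeros jC S)).
Notation chr := (chars jC S P).
Variables (R : realType) (iR : {rmorphism K -> R}).
Let PR := map_mx iR P.
Let PRu : PR \in unitmx. Proof. by rewrite map_unitmx. Qed.

Lemma mx_exp_dconj (h : 'rV[R]_n) : mx_exp (dconj PR h) = dconj PR (\row_i expR (h 0 i)).
Proof.
rewrite /dconj -{2}[PR]invmxK mx_exp_conj ?unitmx_inv //.
by rewrite invmxK mx_exp_diag.
Qed.

Lemma dconjZ (c : R) h : c *: dconj PR h = dconj PR (c *: h).
Proof. by rewrite /dconj linearZ /= -scalemxAr -scalemxAl. Qed.

Lemma dconjD g h : dconj PR g + dconj PR h = dconj PR (g + h).
Proof. by rewrite /dconj linearD /= mulmxDr mulmxDl. Qed.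

(** Off-diagonal entries vanish by differentiation of those of [exp (s H)]; the linear relations are
    the logarithms of the character relations. *)
Lemma aRP H : aR iR S H <-> exists2 h : 'rV[R]_n,
  (forall m, chr m -> \sum_i (m i)%:~R * h 0 i = 0) & H = dconj PR h.
Proof.
rewrite /aR (A_extE Pu S_grp S_det S_diag iR).
have SP z := @SposP K C jC n S P Pu S_grp S_det S_diag R iR z.
split=> [aH|[h hm -> t]]; last first.
  apply/SP; rewrite dconjZ mx_exp_dconj; eexists; split; last by [].
    by move=> i; rewrite mxE expR_gt0.
  move=> m cm; rewrite zmono_expR; under eq_bigr do rewrite mxE mulrCA.
  by rewrite -mulr_sumr hm // mulr0 expR0.
have HE : H = dconj PR (\row_i (PR *m H *m invmx PR) i i).
  apply: dconj_diag => // i j ij; apply: mx_exp_entry0 => // s s0.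
  rewrite scalemxAl scalemxAr mx_exp_conj //.
  by have /SP [t [_ _ ->]] := aH s; rewrite dconjK // mxE (negbTE ij).
exists (\row_i (PR *m H *m invmx PR) i i) => // m cm; move: HE; set h := \row_i _ => HE.
have := aH 1; rewrite scale1r HE mx_exp_dconj => /SP [t [_ tm /(dconj_inj PRu) e]].
by apply: expR_inj; rewrite -zmono_expR e tm // expR0.
Qed.

(** The differential of [t_k / t_l], set to 0 outside [aR] as the encoding of functionals demands,
    so that equal weights are equal functions. *)
Definition wt k l : functional R n := fun H =>
  if `[< aR iR S H >] then (PR *m H *m invmx PR) k k - (PR *m H *m invmx PR) l l else 0.

Lemma wt_out k l H : ~ aR iR S H -> wt k l H = 0.
Proof. by move=> nH; rewrite /wt asboolF. Qed.

Lemma wt_dconj k l h : aR iR S (dconj PR h) -> wt k l (dconj PR h) = h 0 k - h 0 l.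
Proof. by move=> aH; rewrite /wt asboolT // dconjK // !mxE !eqxx. Qed.

Lemma aR_linear c X Y : aR iR S X -> aR iR S Y -> aR iR S (c *: X + Y).
Proof.
move=> /aRP [x xm ->] /aRP [y ym ->]; apply/aRP; exists (c *: x + y); last by rewrite -dconjD dconjZ.
move=> m cm; under eq_bigr do rewrite mxE mulrDr mxE mulrCA.
by rewrite big_split -mulr_sumr /= xm // ym // mulr0 addr0.
Qed.

Lemma wt_functional k l : is_functional iR S (wt k l).
Proof.
split=> [c X Y aX aY|X nX]; last exact: wt_out.
rewrite /wt !asboolT //; last exact: aR_linear.
by rewrite mulmxDr mulmxDl -scalemxAr -scalemxAl !mxE; ring.
Qed.

Lemma aR_cochar (la : 'I_n -> int) : (forall m, chr m -> zdot m la = 0) ->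
  aR iR S (dconj PR (\row_i (la i)%:~R)).
Proof.
move=> h; apply/aRP; exists (\row_i (la i)%:~R) => // m cm.
transitivity ((zdot m la)%:~R : R); last by rewrite h.
by rewrite rmorph_sum; apply: eq_bigr => i _; rewrite mxE rmorphM.
Qed.

Lemma sum_delta (h : 'rV[R]_n) k l : \sum_i (delta_char k l i)%:~R * h 0 i = h 0 k - h 0 l.
Proof.
have e (j : 'I_n) : \sum_i ((i == j)%:Z)%:~R * h 0 i = h 0 j.
  by rewrite (bigD1 j) //= eqxx mul1r big1 ?addr0 // => i /negbTE ->; rewrite mul0r.
by rewrite -[in RHS](e k) -[in RHS](e l) -sumrB; apply: eq_bigr => i _; rewrite -mulrBl -rmorphB.
Qed.

Lemma zdot_delta k l (la : 'I_n -> int) : zdot (delta_char k l) la = la k - la l.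
Proof.
have e (j : 'I_n) : \sum_i (i == j)%:Z * la i = la j.
  by rewrite (bigD1 j) //= eqxx mul1r big1 ?addr0 // => i /negbTE ->; rewrite mul0r.
by rewrite -[in RHS](e k) -[in RHS](e l) -sumrB; apply: eq_bigr => i _; rewrite -mulrBl.
Qed.

Lemma zdotBl l m (la : 'I_n -> int) : zdot (fun i => l i - m i) la = zdot l la - zdot m la.
Proof. by rewrite /zdot -sumrB; apply: eq_bigr => i _; rewrite mulrBl. Qed.

(** Integral vectors orthogonal to [chr] give elements of the Lie algebra of A, and by the double
    orthogonal they detect membership in [chr]. *)
Lemma wt_eq k l k' l' : wt k l = wt k' l' <->
  chr (fun i => delta_char k l i - delta_char k' l' i).
Proof.
split=> [e|c].
  apply: (lattice_perp_perp (chars_saturated Pu S_grp S_conn S_diag)) => la laM.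
  have /wt_dconj aw := aR_cochar laM.
  have := congr1 (fun f => f (dconj PR (\row_i (la i)%:~R))) e; rewrite !aw !mxE -!rmorphB => /intr_inj e'.
  by rewrite zdotBl !zdot_delta e' subrr.
apply/funext => H; have [aH|nH] := pselect (aR iR S H); last by rewrite !wt_out.
have /aRP [h hm HE] := aH; move: aH; rewrite HE => aH; rewrite !wt_dconj //.
apply/eqP; rewrite -subr_eq0 -!sum_delta -sumrB -[X in _ == X](hm _ c); apply/eqP.
by apply: eq_bigr => i _; rewrite -mulrBl -rmorphB.
Qed.

Lemma wt_eq0 k l : wt k l = (fun=> 0) <-> chr (delta_char k l).
Proof.
have <- : wt k k = (fun=> 0) by apply/funext => H; rewrite /wt subrr; case: ifP.
rewrite wt_eq; have -> : (fun i => delta_char k l i - delta_char k k i) = delta_char k l by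
  apply/funext => i; rewrite /delta_char [X in _ - X]subrr subr0.
by [].
Qed.

End CartanSubspace.

(** * Complex matrix groups as closed real matrix groups *)

Section LocallyLipschitz.
Variables (R : realType) (N : nat).
Implicit Types (f g : 'M[R]_N -> R) (X Y : 'M[R]_N).

(** Polynomial functions satisfy these bounds, and under them a zero passes to a limit taken with
    rate [1 / k]. *)
Definition lip f : Prop := forall X, exists c, forall Y,
  nrm (Y - X) <= 1 -> `|f Y - f X| <= c * nrm (Y - X).

Lemma lip_entry i j : lip (fun X => X i j).
Proof.
move=> X; exists 1 => Y _; rewrite mul1r.
by have := nrm_entry (Y - X) i j; rewrite [X in `|X|]mxE [X in `|_ + X|]mxE.
Qed.

Lemma lipD f g : lip f -> lip g -> lip (fun X => f X + g X).
Proof.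
move=> hf hg X; have [c hc] := hf X; have [d hd] := hg X; exists (c + d) => Y YX.
by rewrite opprD addrACA (le_trans (ler_normD _ _)) // mulrDl lerD ?hc ?hd.
Qed.

Lemma lipN f : lip f -> lip (fun X => - f X).
Proof.
move=> hf X; have [c hc] := hf X; exists c => Y YX.
by rewrite -opprD normrN hc.
Qed.

Lemma lipM f g : lip f -> lip g -> lip (fun X => f X * g X).
Proof.
move=> hf hg X; have [c hc] := hf X; have [d hd] := hg X.
exists (`|f X| * `|d| + `|c| * (`|g X| + `|d|)) => Y YX.
have e : f Y * g Y - f X * g X = f X * (g Y - g X) + (f Y - f X) * (g X + (g Y - g X)) by ring.
have hg' : `|g Y - g X| <= `|d| * nrm (Y - X).
  by rewrite (le_trans (hd Y YX)) // ler_wpM2r ?nrm_ge0 // ler_norm.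
have hf' : `|f Y - f X| <= `|c| * nrm (Y - X).
  by rewrite (le_trans (hc Y YX)) // ler_wpM2r ?nrm_ge0 // ler_norm.
rewrite e (le_trans (ler_normD _ _)) // [leRHS]mulrDl !normrM lerD //.
  by rewrite -mulrA ler_wpM2l.
rewrite [leRHS]mulrAC; apply: ler_pM => //; apply: (le_trans (ler_normD _ _)); rewrite lerD //.
by rewrite (le_trans hg') // ler_piMr.
Qed.

Lemma lip_zero f (u : nat -> 'M[R]_N) X (c : R) k0 : lip f ->
  (forall k, (k0 <= k)%N -> f (u k) = 0 /\ nrm (u k - X) <= c / k.+1%:R) -> f X = 0.
Proof.
move=> hf h; have [d hd] := hf X.
apply/eqP; rewrite -normr_le0; apply: (@archi_eq0 _ _ (`|d| * c) (maxn k0 (Num.bound `|c|))) => k.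
rewrite geq_max => /andP[/h [fk uk] kc].
have n1 : nrm (u k - X) <= 1.
  rewrite (le_trans uk) // ler_pdivrMr ?ltr0n // mul1r (le_trans (ler_norm _)) //.
  rewrite (le_trans (ltW (archi_boundP _))) ?normr_ge0 // ler_nat (leq_trans kc) //.
have := hd _ n1; rewrite fk sub0r normrN => /le_trans; apply.
rewrite -mulrA (@le_trans _ _ (`|d| * nrm (u k - X))) ?ler_wpM2l //.
by rewrite ler_wpM2r ?nrm_ge0 // ler_norm.
Qed.

End LocallyLipschitz.

Section RealForm.
(* C stands for R[i], accessed only through real and imaginary parts. *)
Variables (R : realType) (C : fieldType) (j : {rmorphism R -> C}) (i0 : C) (re im : C -> R).
Hypotheses (i0i0 : i0 * i0 = -1) (reim : forall z, z = j (re z) + i0 * j (im z))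
  (reE : forall a b, re (j a + i0 * j b) = a) (imE : forall a b, im (j a + i0 * j b) = b).
Variables (K : comNzRingType) (iota : {rmorphism K -> C}) (n : nat).
Variable I : set (mpoly.mpoly (n * n) K).
Implicit Types (W : 'M[R]_(n + n)) (Z : 'M[C]_n).

(** The usual embedding of complex matrices into real ones of double size; it makes the tangent
    argument available for complex points. *)
Definition realify Z : 'M[R]_(n + n) :=
  block_mx (map_mx re Z) (- map_mx im Z) (map_mx im Z) (map_mx re Z).

Definition cpx W : 'M[C]_n := map_mx j (ulsubmx W) + i0 *: map_mx j (dlsubmx W).

Lemma reimM z w : re (z * w) = re z * re w - im z * im w /\ im (z * w) = re z * im w + im z * re w.
Proof.
have -> : z * w = j (re z * re w - im z * im w) + i0 * j (re z * im w + im z * re w).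
  rewrite {1}[z]reim {1}[w]reim rmorphB rmorphD !rmorphM /=.
  rewrite (_ : _ - j (im z) * j (im w) = j (re z) * j (re w) + i0 * i0 * (j (im z) * j (im w))); first by ring.
  by rewrite i0i0 mulN1r.
by rewrite reE imE.
Qed.

Lemma reimD z w : re (z + w) = re z + re w /\ im (z + w) = im z + im w.
Proof.
have -> : z + w = j (re z + re w) + i0 * j (im z + im w).
  by rewrite {1}[z]reim {1}[w]reim !rmorphD /=; ring.
by rewrite reE imE.
Qed.

Lemma realifyK : cancel realify cpx.
Proof.
move=> Z; rewrite /cpx /realify block_mxKul block_mxKdl.
by apply/matrixP => a b; rewrite !mxE -reim.
Qed.

Lemma re_sum (T : Type) (r : seq T) (F : T -> C) : re (\sum_(i <- r) F i) = \sum_(i <- r) re (F i).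
Proof.
have re0 : re 0 = 0 by have := reE 0 0; rewrite rmorph0 mulr0 addr0.
by apply: (big_morph re) => // z w; have [] := reimD z w.
Qed.

Lemma im_sum (T : Type) (r : seq T) (F : T -> C) : im (\sum_(i <- r) F i) = \sum_(i <- r) im (F i).
Proof.
have im0 : im 0 = 0 by have := imE 0 0; rewrite rmorph0 mulr0 addr0.
by apply: (big_morph im) => // z w; have [] := reimD z w.
Qed.

Lemma realifyM Z Z' : realify (Z *m Z') = realify Z *m realify Z'.
Proof.
have reM : map_mx re (Z *m Z') = map_mx re Z *m map_mx re Z' - map_mx im Z *m map_mx im Z'.
  apply/matrixP => a b; rewrite !mxE re_sum -sumrB; apply: eq_bigr => k _.
  by rewrite !mxE; have [] := reimM (Z a k) (Z' k b).
have imM : map_mx im (Z *m Z') = map_mx re Z *m map_mx im Z' + map_mx im Z *m map_mx re Z'.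
  apply/matrixP => a b; rewrite !mxE im_sum -big_split; apply: eq_bigr => k _.
  by rewrite !mxE; have [] := reimM (Z a k) (Z' k b).
rewrite /realify mulmx_block reM imM !mulNmx !mulmxN opprD.
by rewrite [- (_ *m _) + map_mx re Z *m _]addrC [- (map_mx re Z *m _) - _]addrC
  [map_mx im Z *m _ + _]addrC.
Qed.

Lemma lip_ev p : lip (fun W => re (ev iota p (cpx W))) /\ lip (fun W => im (ev iota p (cpx W))).
Proof.
elim/mpoly_ring_ind: p => [c|k|p q [p1 p2] [q1 q2]|p q [p1 p2] [q1 q2]].
- by split=> X; exists 0 => Y _; rewrite !evC subrr normr0 mul0r.
- case/mxvec_indexP: k => a b.
  have e W : ev iota (mpoly.mpolyX K (mpoly.mnm1 (mxvec_index a b))) (cpx W) =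
     j (W (lshift n a) (lshift n b)) + i0 * j (W (rshift n a) (lshift n b)).
    by rewrite /ev mpoly.mmapX mpoly.mmap1U mxvecE !mxE.
  split=> X; [have [c hc] := lip_entry (lshift n a) (lshift n b) X
    |have [c hc] := lip_entry (rshift n a) (lshift n b) X]; exists c => Y YX;
    by rewrite !e ?reE ?imE; apply: hc.
- split=> X.
    have [c hc] := lipD p1 q1 X; exists c => Y YX; rewrite !evD.
    by rewrite !(proj1 (reimD _ _)); apply: hc.
  have [c hc] := lipD p2 q2 X; exists c => Y YX; rewrite !evD.
  by rewrite !(proj2 (reimD _ _)); apply: hc.
- split=> X.
    have [c hc] := lipD (lipM p1 q1) (lipN (lipM p2 q2)) X; exists c => Y YX; rewrite !evM.
    by rewrite !(proj1 (reimM _ _)); apply: hc.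
  have [c hc] := lipD (lipM p1 q2) (lipM p2 q1) X; exists c => Y YX; rewrite !evM.
  by rewrite !(proj2 (reimM _ _)); apply: hc.
Qed.

Definition real_form : set 'M[R]_(n + n) := [set W | exists2 Z, zeros iota I Z & W = realify Z]%classic.

Lemma real_formE W : real_form W <-> [/\ ulsubmx W = drsubmx W, ursubmx W = - dlsubmx W &
  zeros iota I (cpx W)].
Proof.
split=> [[Z IZ ->]|[h1 h2 h3]].
  by rewrite realifyK /realify block_mxKul block_mxKdr block_mxKur block_mxKdl.
exists (cpx W) => //; rewrite /realify -[LHS]submxK h2 -h1.
have -> : map_mx re (cpx W) = ulsubmx W by apply/matrixP => a b; rewrite !mxE reE.
by have -> : map_mx im (cpx W) = dlsubmx W by apply/matrixP => a b; rewrite !mxE imE.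
Qed.

Lemma real_form_closed : seq_closed real_form.
Proof.
move=> u X c k0 h; apply/real_formE; split.
- apply/matrixP => a b; apply/eqP; rewrite -subr_eq0 !mxE; apply/eqP.
  apply: (@lip_zero _ _ (fun W => W (lshift n a) (lshift n b) - W (rshift n a) (rshift n b)) u X c k0).
    by apply: lipD; [apply: lip_entry|apply: lipN; apply: lip_entry].
  move=> k /h [/real_formE [/matrixP e _ _] uk]; split=> //.
  by have := e a b; rewrite !mxE => ->; rewrite subrr.
- apply/matrixP => a b; apply/eqP; rewrite -subr_eq0 !mxE opprK; apply/eqP.
  apply: (@lip_zero _ _ (fun W => W (lshift n a) (rshift n b) + W (rshift n a) (lshift n b)) u X c k0).
    by apply: lipD; apply: lip_entry.
  move=> k /h [/real_formE [_ /matrixP e _] uk]; split=> //.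
  by have := e a b; rewrite !mxE => ->; rewrite addNr.
- move=> p Ip; have [l1 l2] := lip_ev p.
  have re0 : re 0 = 0 by have := reE 0 0; rewrite rmorph0 mulr0 addr0.
  have im0 : im 0 = 0 by have := imE 0 0; rewrite rmorph0 mulr0 addr0.
  rewrite [LHS]reim (lip_zero l1 (u := u) (c := c) (k0 := k0)) ?(lip_zero l2 (u := u) (c := c) (k0 := k0)).
  + by rewrite rmorph0 mulr0 addr0.
  + by move=> k /h [/real_formE [_ _ /(_ _ Ip) ->]].
  + by move=> k /h [/real_formE [_ _ /(_ _ Ip) ->]].
Qed.

End RealForm.

(** * Group laws over extensions of K *)

Section GroupTransfer.
Variables (K : rcfType) (n : nat) (G : set (mxpoly K n)).
Let f0 : {rmorphism K -> K} := idfun.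
Hypotheses (G_grp : mx_group (zeros f0 G))
  (G_det : (zeros f0 G `<=` [set x | \det x = 1])%classic).

Section Real.
Variables (L : rcfType) (iota : {rmorphism K -> L}).

Lemma det_transfer : (zeros iota G `<=` [set x | \det x = 1])%classic.
Proof.
pose T : set (mxpoly K n) := fun p => p = \det (genmx K n) - 1.
have TE (A : fieldType) (f : {rmorphism K -> A}) x : zeros f T x <-> \det x = 1.
  split=> [/(_ _ erefl)|d p ->]; rewrite evD evN ev1 ev_det map_genmx; last by rewrite d subrr.
  by move/eqP; rewrite subr_eq0 => /eqP.
move=> x Gx /=; apply/(TE L iota); move: x Gx; apply: zeros_sub_transfer => x Gx.
by apply/(TE K f0); apply: G_det.
Qed.

Let M (k : nat) := MVar K n k.

Lemma mx_group_transfer : mx_group (zeros iota G).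
Proof.
have [Gf GfP] := zeros_finite G; have [Gu G1 GM GV] := G_grp.
split=> [x Gx||x y Gx Gy|x Gx].
- by rewrite /= unitmxE (det_transfer Gx) unitr1.
- have := G1; rewrite -(map_mx1 iota) => G1'; apply/(zeros_map f0 iota); exact: G1'.
- pose f := FAll 0 (FAll 1 (FImp (FAnd (FZeros Gf (M 0)) (FZeros Gf (M 1)))
    (FZeros Gf (MMul (M 0) (M 1))))).
  have : msat iota (fun=> 0) f.
    apply/transfer_closed; rewrite /f msatE => X; rewrite msatE => Y.
    rewrite msatE msatAnd !msatZeros => -[/GfP hX /GfP hY]; apply/GfP.
    exact: (GM _ _ hX hY).
  rewrite /f msatE => /(_ x); rewrite msatE => /(_ y); rewrite msatE msatAnd !msatZeros => h.
  by apply/GfP; apply: h; split; apply/GfP.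
- pose T := [seq genmx K n ij.1 ij.2 | ij <- enum {: 'I_n * 'I_n}].
  have TP (L' : rcfType) (i' : {rmorphism K -> L'}) z :
      (forall p, p \in T -> ev i' p z = 0) <-> z = 0.
    split=> [h|-> p /mapP [ij _ ->]]; last by rewrite ev_genmx mxE.
    apply/matrixP => i j; rewrite -(ev_genmx i' i j z) [RHS]mxE; apply: h.
    by apply/mapP; exists (i, j); rewrite ?mem_enum.
  pose f := FAll 0 (FAll 1 (FImp (FAnd (FZeros Gf (M 0))
    (FZeros T (MAdd (MMul (M 0) (M 1)) (MConst (- 1%:M))))) (FZeros Gf (M 1)))).
  have xu : x \in unitmx by rewrite unitmxE (det_transfer Gx) unitr1.
  have : msat iota (fun=> 0) f.
    apply/transfer_closed; rewrite /f msatE => X; rewrite msatE => Y.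
    rewrite msatE msatAnd !msatZeros => -[/GfP hX /TP]; rewrite /= map_mx_id // => XY.
    apply/GfP; have := GV _ hX; suff -> : invmx X = Y by [].
    have Xu : X \in unitmx by apply: Gu.
    by apply: (can_inj (mulKmx Xu)); rewrite mulmxV //; apply/esym/eqP; rewrite -subr_eq0; apply/eqP.
  rewrite /f msatE => /(_ x); rewrite msatE => /(_ (invmx x)); rewrite msatE msatAnd !msatZeros => h.
  apply/GfP; apply: h; split; [exact/GfP|apply/TP].
  by rewrite /= mulmxV // map_mxN map_mx1 subrr.
Qed.

Lemma tr_transfer : (forall x, zeros f0 G x -> zeros f0 G x^T) ->
  forall x, zeros iota G x -> zeros iota G x^T.
Proof.
move=> GT x Gx; have [Gf GfP] := zeros_finite G.
pose f := FAll 0 (FImp (FZeros Gf (M 0)) (FZeros Gf (MTr (M 0)))).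
have : msat iota (fun=> 0) f.
  by apply/transfer_closed; rewrite /f msatE => X; rewrite msatE !msatZeros => /GfP /GT /GfP.
by rewrite /f msatE => /(_ x); rewrite msatE !msatZeros => h; apply/GfP; apply: h; apply/GfP.
Qed.

End Real.
End GroupTransfer.

Section ComplexGroupTransfer.
Variables (K : rcfType) (n : nat) (G : set (mxpoly K n)).
Hypothesis G_grp : mx_group (geom G).
Variables (L : rcfType) (iota : {rmorphism K -> L}).

(** Complex points are quantified as pairs of real matrices, multiplied by the rule for real and
    imaginary parts. *)
Lemma complex_mul_transfer (x y : 'M[L[i]]_n) : zeros (real_complex L \o iota) G x ->
  zeros (real_complex L \o iota) G y -> zeros (real_complex L \o iota) G (x *m y).
Proof.
move=> Gx Gy; have [Gf GfP] := zeros_finite G; have [_ _ GM _] := G_grp.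
have GfP' (L' : rcfType) (i' : {rmorphism K -> L'}) z :
  zeros (real_complex L' \o i') G z <-> forall p, p \in Gf -> ev (real_complex L' \o i') p z = 0.
  exact: (GfP _ (real_complex L' \o i' : {rmorphism K -> L'[i]})).
pose M (k : nat) := MVar K n k.
pose FZ t1 t2 := FConj Gf (fun p => FCZero p t1 t2).
have FZP (L' : rcfType) (i' : {rmorphism K -> L'}) e t1 t2 : msat i' e (FZ t1 t2) <->
  zeros (real_complex L' \o i') G (cmx (meval i' e t1) (meval i' e t2)).
  by rewrite msatConj GfP'.
pose Neg (t : mterm K n) := MMul (MConst (- 1%:M)) t.
pose f := FAll 0 (FAll 1 (FAll 2 (FAll 3 (FImp (FAnd (FZ (M 0) (M 1)) (FZ (M 2) (M 3)))
  (FZ (MAdd (MMul (M 0) (M 2)) (Neg (MMul (M 1) (M 3)))) (MAdd (MMul (M 0) (M 3)) (MMul (M 1) (M 2)))))))).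
have cmxM (L' : rcfType) (i' : {rmorphism K -> L'}) (a b c d : 'M[L']_n) :
    cmx (a *m c + map_mx i' (- 1%:M) *m (b *m d)) (a *m d + b *m c) = cmx a b *m cmx c d.
  rewrite map_mxN map_mx1 mulNmx mul1mx.
  apply/matrixP => i k; rewrite !mxE.
  have -> : \sum_j cmx a b i j * cmx c d j k =
     \sum_j ((a i j * c j k - b i j * d j k) +i* (a i j * d j k + b i j * c j k))%C.
    by apply: eq_bigr => j _; rewrite !mxE.
  rewrite -sumrB -big_split /=.
  elim/big_rec3: _ => // j [u1 u2] v w _ [-> ->] //.
have : msat iota (fun=> 0) f.
  apply/transfer_closed; rewrite /f msatE => a; rewrite msatE => b; rewrite msatE => c; rewrite msatE => d.
  rewrite msatE msatAnd !FZP => -[h1 h2].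
  have := GM _ _ h1 h2; rewrite /= -(cmxM K (idfun : {rmorphism K -> K})); exact.
rewrite /f msatE => /(_ (map_mx (@complex.Re L) x)); rewrite msatE => /(_ (map_mx (@complex.Im L) x)).
rewrite msatE => /(_ (map_mx (@complex.Re L) y)); rewrite msatE => /(_ (map_mx (@complex.Im L) y)).
rewrite msatE msatAnd !FZP /= cmxM.
have e (z : 'M[L[i]]_n) : cmx (map_mx (@complex.Re L) z) (map_mx (@complex.Im L) z) = z.
  by apply/matrixP => i k; rewrite !mxE; case: (z i k).
by rewrite /upd /= !e; apply.
Qed.

End ComplexGroupTransfer.

Lemma mx_exp0 (R : realType) n : mx_exp (0 : 'M[R]_n) = 1%:M.
Proof.
apply: (@mx_exp_eq _ _ _ _ 1) => -[|m] // _.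
rewrite /expsum big_ord_recl mxX0 fact0 invr1 scale1r big1 ?addr0 // => i _.
by rewrite mxXS mul0mx scaler0.
Qed.

Lemma mx_exp_block (R : realType) n (X : 'M[R]_n) :
  mx_exp (block_mx X 0 0 X) = block_mx (mx_exp X) 0 0 (mx_exp X).
Proof.
have e m : expsum (block_mx X 0 0 X) m = block_mx (expsum X m) 0 0 (expsum X m).
  have eX k : block_mx X 0 0 X ^+ k = block_mx (X ^+ k) 0 0 (X ^+ k).
    elim: k => [|k IH]; first by rewrite !mxX0 -scalar_mx_block.
    by rewrite !mxXS IH mulmx_block !mulmx0 !mul0mx !addr0 !add0r.
  elim: m => [|m IH]; first by rewrite /expsum !big_ord0 block_mx0.
  rewrite /expsum !big_ord_recr /= -!/(expsum _ _) IH eX scale_block_mx !scaler0.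
  by rewrite add_block_mx !addr0.
apply/matrixP => i j; rewrite mxE.
rewrite (_ : (fun m => _) = (fun m => block_mx (expsum X m) 0 0 (expsum X m) i j)); last first.
  by apply/funext => m; rewrite -e.
have lim0 (f : nat -> R) : (forall m, f m = 0) -> limn f = 0.
  by move=> f0; rewrite (_ : f = fun=> 0) ?lim_cst //; apply/funext.
have limE (f g : nat -> R) : (forall m, f m = g m) -> limn f = limn g.
  by move=> fg; congr (limn _); apply/funext.
have [a ->|a ->] := split_ordP i; have [b ->|b ->] := split_ordP j.
- by rewrite block_mxEul mxE; apply: limE => m; rewrite block_mxEul.
- by rewrite block_mxEur mxE; apply: lim0 => m; rewrite block_mxEur mxE.
- by rewrite block_mxEdl mxE; apply: lim0 => m; rewrite block_mxEdl mxE.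
- by rewrite block_mxEdr mxE; apply: limE => m; rewrite block_mxEdr.
Qed.

(** * Linear structure of the real Lie algebra *)

Section RealLieAlgebra.
Variables (R : realType) (C : fieldType) (j : {rmorphism R -> C}) (i0 : C) (re im : C -> R).
Hypotheses (i0i0 : i0 * i0 = -1) (reim : forall z, z = j (re z) + i0 * j (im z))
  (reE : forall a b, re (j a + i0 * j b) = a) (imE : forall a b, im (j a + i0 * j b) = b).
Variables (K : rcfType) (iR : {rmorphism K -> R}) (n : nat) (G : set (mxpoly K n)).
Hypotheses (GR_grp : mx_group (zeros iR G))
  (GC_mul : forall x y, zeros (j \o iR) G x -> zeros (j \o iR) G y -> zeros (j \o iR) G (x *m y)).

Notation HR := (real_form re im (j \o iR : {rmorphism K -> C}) G).

Implicit Types (X Y : 'M[R]_n) (Z : 'M[C]_n).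

Definition tgt (Z : 'M[C]_n) : Prop := tangent HR (realify re im Z).

Let reimj a : re (j a) = a /\ im (j a) = 0.
Proof.
by rewrite -[j a]addr0 -(mulr0 i0) -[X in j a + i0 * X](rmorph0 j) reE imE.
Qed.

Lemma realify_real X : realify re im (map_mx j X) = block_mx X 0 0 X.
Proof.
have e1 : map_mx re (map_mx j X) = X by apply/matrixP => a b; rewrite !mxE; case: (reimj (X a b)).
have e2 : map_mx im (map_mx j X) = 0 by apply/matrixP => a b; rewrite !mxE; case: (reimj (X a b)).
by rewrite /realify e1 e2 oppr0.
Qed.

Lemma realifyD Z Z' : realify re im (Z + Z') = realify re im Z + realify re im Z'.
Proof.
rewrite /realify add_block_mx -opprD.
have e1 : map_mx re (Z + Z') = map_mx re Z + map_mx re Z'.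
  by apply/matrixP => a b; rewrite !mxE; have [] := reimD reim reE imE (Z a b) (Z' a b).
have e2 : map_mx im (Z + Z') = map_mx im Z + map_mx im Z'.
  by apply/matrixP => a b; rewrite !mxE; have [] := reimD reim reE imE (Z a b) (Z' a b).
by rewrite e1 e2.
Qed.

Lemma realifyZ (c : R) Z : realify re im (j c *: Z) = c *: realify re im Z.
Proof.
rewrite /realify scale_block_mx scalerN.
have [c1 c2] := reimj c.
have e1 : map_mx re (j c *: Z) = c *: map_mx re Z.
  by apply/matrixP => a b; rewrite !mxE; have [-> _] := reimM i0i0 reim reE imE (j c) (Z a b);
    rewrite c1 c2 mul0r subr0.
have e2 : map_mx im (j c *: Z) = c *: map_mx im Z.
  by apply/matrixP => a b; rewrite !mxE; have [_ ->] := reimM i0i0 reim reE imE (j c) (Z a b);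
    rewrite c1 c2 mul0r addr0.
by rewrite e1 e2.
Qed.

Lemma realify1 : realify re im (1%:M : 'M_n) = 1%:M.
Proof. by rewrite -(map_mx1 j) realify_real -scalar_mx_block. Qed.

Lemma real_form_mul V W : HR V -> HR W -> HR (V *m W).
Proof.
move=> [x Gx ->] [y Gy ->]; exists (x *m y); first exact: GC_mul.
by rewrite (realifyM i0i0 reim reE imE).
Qed.

Lemma zerosRC X : zeros (j \o iR) G (map_mx j X) <-> zeros iR G X.
Proof. exact: zeros_map. Qed.

Lemma real_form1 : HR 1%:M.
Proof.
exists 1%:M; last by rewrite realify1.
by rewrite -(map_mx1 j) /=; apply/zerosRC; case: GR_grp.
Qed.

Lemma tgtD Z Z' : tgt Z -> tgt Z' -> tgt (Z + Z').
Proof.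
by rewrite /tgt realifyD; exact: (tangentD real_form_mul).
Qed.

Lemma tgtZ c Z : 0 < c -> tgt Z -> tgt (j c *: Z).
Proof. by move=> c0; rewrite /tgt realifyZ; apply: tangentZ. Qed.

Lemma tgt_exp X : tgt (map_mx j X) -> zeros iR G (mx_exp X).
Proof.
have HRc := real_form_closed i0i0 reim reE imE (iota := (j \o iR : {rmorphism K -> C})) (I := G).
move=> /(tangent_exp real_form_mul real_form1 HRc) [Z GZ].
rewrite realify_real mx_exp_block -realify_real => /(can_inj (@realifyK _ _ _ _ _ _ reim n)) e.
by apply/zerosRC; rewrite e.
Qed.

Notation gR := (gR iR G).

Lemma gRZ c X : gR X -> gR (c *: X).
Proof. by move=> gX t; rewrite scalerA. Qed.

(** Velocities are one-sided, so one hypothesis serves positive [t] and the other negative [t]. *)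
Lemma tgt_gR X : tgt (map_mx j X) -> tgt (map_mx j (- X)) -> gR X.
Proof.
move=> t1 t2 t; have [t0|t0|->] := ltrgt0P t.
- by apply: tgt_exp; rewrite map_mxZ; apply: tgtZ.
- by rewrite -[t]opprK scaleNr -scalerN; apply: tgt_exp; rewrite map_mxZ; apply: tgtZ; rewrite ?oppr_gt0.
- by rewrite scale0r mx_exp0; case: GR_grp.
Qed.

Lemma gR_tgt X : gR X -> tgt (map_mx j X).
Proof.
move=> gX; apply: exp_tangent => s _; rewrite -realifyZ -map_mxZ.
exists (map_mx j (mx_exp (s *: X))); first exact/zerosRC.
by rewrite !realify_real mx_exp_block.
Qed.

(** Addition goes through curves: velocities add, and each velocity has its exponential in the
    group. *)
Lemma gRD X Y : gR X -> gR Y -> gR (X + Y).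
Proof.
move=> gX gY; have gN X' : gR X' -> gR (- X') by rewrite -scaleN1r; apply: gRZ.
apply: tgt_gR; first by rewrite map_mxD; exact: tgtD (gR_tgt gX) (gR_tgt gY).
by rewrite opprD map_mxD; exact: tgtD (gR_tgt (gN _ gX)) (gR_tgt (gN _ gY)).
Qed.

Lemma gR_sum (I : Type) (r : seq I) (F : I -> 'M[R]_n) : (forall i, gR (F i)) ->
  gR (\sum_(i <- r) F i).
Proof.
move=> gF; elim: r => [|i r IH]; last by rewrite big_cons; exact: gRD (gF i) IH.
by rewrite big_nil => t; rewrite scaler0 mx_exp0; case: GR_grp.
Qed.

Lemma gR_conj x X : zeros iR G x -> gR X -> gR (x *m X *m invmx x).
Proof.
move=> Gx gX t; have [Gu _ GM GV] := GR_grp.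
rewrite scalemxAl scalemxAr mx_exp_conj; last exact: Gu.
by apply: (GM); [apply: (GM) => //; apply: gX|apply: GV].
Qed.

Lemma gR_tr X : (forall x, zeros iR G x -> zeros iR G x^T) -> gR X -> gR X^T.
Proof. by move=> GT gX t; rewrite -linearZ /= mx_exp_tr; apply: GT; apply: gX. Qed.

End RealLieAlgebra.

(** * Root spaces and roots as weights *)

Section WeightSpaces.
Variables (K : rcfType) (C : numFieldType) (jC : {rmorphism K -> C}) (n : nat).
Variables (G S : set (mxpoly K n)) (P : 'M[K]_n).
Hypotheses (Pu : P \in unitmx) (S_grp : mx_group (zeros jC S))
  (S_det : (zeros jC S `<=` [set x | \det x = 1])%classic)
  (S_conn : zariski_connected (zeros jC S))
  (S_diag : split_by jC P (zeros jC S)).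
Notation chr := (chars jC S P).
Variables (R : realType) (iR : {rmorphism K -> R}).
Let PR := map_mx iR P.
Let PRu : PR \in unitmx. Proof. by rewrite map_unitmx. Qed.
Notation aR := (aR iR S).
Notation gR := (gR iR G).
Notation wt := (wt S P iR).
Hypotheses (gD : forall X Y, gR X -> gR Y -> gR (X + Y))
  (gZ : forall c X, gR X -> gR (c *: X))
  (gAd : forall x X, Spos S P iR x -> gR X -> gR (x *m X *m invmx x)).
Implicit Types (X Y : 'M[R]_n) (al : functional R n).

Definition pcoord X := PR *m X *m invmx PR.
Definition of_pcoord X := invmx PR *m X *m PR.

Lemma pcoordK : cancel pcoord of_pcoord.
Proof. by move=> X; rewrite /pcoord /of_pcoord !mulmxA mulVmx // mul1mx mulmxKV. Qed.

Lemma of_pcoordK : cancel of_pcoord pcoord.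
Proof. by move=> X; rewrite /pcoord /of_pcoord !mulmxA mulmxV // mul1mx mulmxK. Qed.

Lemma Spos_expE x : Spos S P iR x <-> exists2 H, aR H & x = mx_exp H.
Proof.
have aP := aRP Pu S_grp S_det S_diag iR; have SP := @SposP _ _ _ _ _ _ Pu S_grp S_det S_diag _ iR.
split=> [/SP [t [t0 tm ->]]|[H aH ->]]; last first.
  by have := aH 1; rewrite scale1r (A_extE Pu S_grp S_det S_diag iR).
have tE : t = \row_i expR ((\row_k ln (t 0 k)) 0 i).
  by apply/rowP => i; rewrite !mxE lnK ?posrE.
exists (dconj PR (\row_k ln (t 0 k))); last by rewrite mx_exp_dconj // -tE.
apply/aP; exists (\row_k ln (t 0 k)) => // m cm.
by apply: expR_inj; rewrite -zmono_expR -tE tm // expR0.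
Qed.

Lemma aR_diag H : aR H -> H = dconj PR (\row_i pcoord H i i).
Proof.
move=> /(aRP Pu S_grp S_det S_diag iR) [h _ ->]; congr dconj; apply/rowP => i.
by rewrite /pcoord mxE dconjK // !mxE eqxx mulr1n.
Qed.

Lemma wtE p q H : aR H -> wt p q H = pcoord H p p - pcoord H q q.
Proof. by move=> aH; rewrite /wt asboolT. Qed.

Lemma pcoord_bracket H X p q : aR H ->
  pcoord (H *m X - X *m H) p q = wt p q H * pcoord X p q.
Proof.
move=> aH; rewrite wtE // (aR_diag aH); set d := \row_i _.
have -> : pcoord (dconj PR d *m X - X *m dconj PR d) = diag_mx d *m pcoord X - pcoord X *m diag_mx d.
  rewrite /pcoord mulmxBr mulmxBl -!(dconjK PRu d) !mulmxA mulmxKV //.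
  by rewrite -!mulmxA [invmx PR *m (PR *m _)]mulmxA mulVmx // mul1mx.
rewrite (_ : pcoord (dconj PR d) = diag_mx d); last exact: dconjK.
by move: (pcoord X) d => Y d; rewrite mul_diag_mx mul_mx_diag !mxE !eqxx !mulr1n; ring.
Qed.

Lemma pcoord_exp_conj H X p q : aR H ->
  pcoord (mx_exp H *m X *m invmx (mx_exp H)) p q = expR (wt p q H) * pcoord X p q.
Proof.
move=> aH; rewrite wtE // (aR_diag aH); set d := \row_i _.
rewrite mx_exp_dconj // dconjV //; last by move=> i; rewrite mxE gt_eqF ?expR_gt0.
set e := \row_i _; set e' := \row_i _.
have -> : pcoord (dconj PR e *m X *m dconj PR e') = diag_mx e *m pcoord X *m diag_mx e'.
  rewrite /pcoord -(dconjK PRu e) -(dconjK PRu e') !mulmxA mulmxKV //.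
  by rewrite -!mulmxA [invmx PR *m (PR *m _)]mulmxA mulVmx // mul1mx.
rewrite (_ : pcoord (dconj PR d) = diag_mx d); last exact: dconjK.
rewrite {}/e' {}/e; move: (pcoord X) d => Y d; rewrite mul_mx_diag mul_diag_mx !mxE !eqxx !mulr1n.
by rewrite expRD expRN mulrAC.
Qed.

(** Such a [psi] acts on the Lie algebra through the weights of the coordinates. The function
    [f |-> expR (f H)] is [Ad (exp H)], and indicator functions are the projections onto weight
    spaces. *)
Definition wt_stable (psi : functional R n -> R) : Prop := forall X, gR X ->
  gR (of_pcoord (\matrix_(p, q) (psi (wt p q) * pcoord X p q))).

Lemma wt_stable_ext psi psi' : (forall p q, psi (wt p q) = psi' (wt p q)) ->
  wt_stable psi -> wt_stable psi'.
Proof.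
move=> e h X gX; have := h X gX; congr (gR (of_pcoord _)).
by apply/matrixP => p q; rewrite !mxE e.
Qed.

Lemma wt_stable_cst c : wt_stable (fun=> c).
Proof.
move=> X gX; have := gZ c gX; congr gR; rewrite -[LHS]pcoordK; congr of_pcoord.
by apply/matrixP => p q; rewrite /pcoord -scalemxAr -scalemxAl !mxE.
Qed.

Lemma wt_stableD psi psi' : wt_stable psi -> wt_stable psi' ->
  wt_stable (fun f => psi f + psi' f).
Proof.
move=> h h' X gX; have := gD (h X gX) (h' X gX); congr gR.
rewrite /of_pcoord -mulmxDl -mulmxDr; congr (_ *m _ *m _).
by apply/matrixP => p q; rewrite !mxE mulrDl.
Qed.

Lemma wt_stableM psi psi' : wt_stable psi -> wt_stable psi' ->
  wt_stable (fun f => psi f * psi' f).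
Proof.
move=> h h' X gX; have := h _ (h' X gX); congr (gR (of_pcoord _)).
by apply/matrixP => p q; rewrite of_pcoordK !mxE mulrA.
Qed.

Lemma wt_stable_exp H : aR H -> wt_stable (fun f => expR (f H)).
Proof.
move=> aH X gX; have SH : Spos S P iR (mx_exp H) by apply/Spos_expE; exists H.
have := gAd SH gX; congr gR; rewrite -[LHS]pcoordK; congr of_pcoord.
by apply/matrixP => p q; rewrite pcoord_exp_conj // [RHS]mxE.
Qed.

Lemma wt_stable_sum (I : Type) (r : seq I) (psi : I -> functional R n -> R) :
  (forall i, wt_stable (psi i)) -> wt_stable (fun f => \sum_(i <- r) psi i f).
Proof.
move=> h; elim: r => [|i r IH].
  by apply: (wt_stable_ext _ (wt_stable_cst 0)) => p q; rewrite big_nil.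
by apply: (wt_stable_ext _ (wt_stableD (h i) IH)) => p q; rewrite big_cons.
Qed.

Lemma wt_stable_prod (I : Type) (r : seq I) (psi : I -> functional R n -> R) :
  (forall i, wt_stable (psi i)) -> wt_stable (fun f => \prod_(i <- r) psi i f).
Proof.
move=> h; elim: r => [|i r IH].
  by apply: (wt_stable_ext _ (wt_stable_cst 1)) => p q; rewrite big_nil.
by apply: (wt_stable_ext _ (wt_stableM (h i) IH)) => p q; rewrite big_cons.
Qed.

(* Lagrange interpolation in the operators Ad(exp H). *)
Lemma wt_stable_indicator k l : wt_stable (fun f => (`[< f = wt k l >])%:R).
Proof.
pose sep (ab : 'I_n * 'I_n) (H : 'M[R]_n) := aR H /\ wt ab.1 ab.2 H != wt k l H.
have sepP ab : wt ab.1 ab.2 <> wt k l -> exists H, sep ab H.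
  move=> ne; apply: contrapT => nH; apply: ne; apply/funext => H.
  have [aH|naH] := pselect (aR H); last by rewrite !wt_out.
  by apply/eqP; apply: contrapT => /negP ne; apply: nH; exists H.
pose Hab ab := xget 0 [set H | sep ab H]%classic.
pose psi ab f := if `[< wt ab.1 ab.2 = wt k l >] then 1 else
  (expR (f (Hab ab)) - expR (wt ab.1 ab.2 (Hab ab))) /
  (expR (wt k l (Hab ab)) - expR (wt ab.1 ab.2 (Hab ab))).
have HabP ab : wt ab.1 ab.2 <> wt k l -> sep ab (Hab ab).
  by move=> /sepP [H sH]; apply: (xgetPex 0 (P := [set H | sep ab H]%classic)); exists H.
apply: (@wt_stable_ext (fun f => \prod_(ab <- enum {: 'I_n * 'I_n}) psi ab f)).
  move=> p q; case: asboolP => [e|ne].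
    rewrite e big1_seq // => ab _; rewrite /psi; case: asboolP => // /HabP [_ nH].
    by rewrite divff // subr_eq0 (inj_eq (@expR_inj R)) eq_sym.
  apply/eqP; rewrite (big_rem (p, q)) ?mem_enum //= mulf_eq0 /psi asboolF //=.
  by rewrite subrr mul0r eqxx.
apply: wt_stable_prod => ab; rewrite /psi; case: asboolP => [_|/HabP [aH _]]; first exact: wt_stable_cst.
apply: (wt_stableM _ (wt_stable_cst _)); apply: (wt_stableD _ (wt_stable_cst _)).
exact: wt_stable_exp.
Qed.

(** Only the values at finitely many weights matter, so [psi] is a combination of indicators; [N]
    corrects for coordinate pairs that share a weight. *)
Lemma wt_stable_all psi : wt_stable psi.
Proof.
pose ind (ab pq : 'I_n * 'I_n) : R := (`[< wt pq.1 pq.2 = wt ab.1 ab.2 >])%:R.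
pose N ab := \sum_pq ind ab pq.
apply: (@wt_stable_ext (fun f => \sum_(ab <- enum {: 'I_n * 'I_n})
    (psi (wt ab.1 ab.2) / N ab) * (`[< f = wt ab.1 ab.2 >])%:R)).
  move=> p q; rewrite big_enum /=.
  have Npos : N (p, q) != 0.
    have i1 : ind (p, q) (p, q) = 1 by rewrite /ind asboolT.
    rewrite gt_eqF // /N (bigD1 (p, q)) // i1 ltr_pwDl ?ltr01 //.
    by apply: sumr_ge0 => i _; apply: ler0n.
  transitivity (\sum_ab psi (wt p q) / N (p, q) * ind (p, q) ab).
    apply: eq_bigr => ab _; rewrite /ind /=; case: asboolP => [e|ne]; last first.
      by rewrite asboolF ?mulr0 // => e; apply: ne.
    rewrite asboolT // e; congr (_ / _ * _).
    by apply: eq_bigr => pq _; rewrite /ind /= e.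
  by rewrite -mulr_sumr divfK.
apply: wt_stable_sum => ab; apply: (wt_stableM (wt_stable_cst _)).
exact: wt_stable_indicator.
Qed.

Lemma root_spaceP al X : is_functional iR S al ->
  (root_space iR G S al X <-> gR X /\ forall p q, pcoord X p q != 0 -> wt p q = al).
Proof.
move=> [_ al0]; split=> -[gX h]; split=> //.
  move=> p q Xpq; apply/funext => H; have [aH|naH] := pselect (aR H); last by rewrite wt_out ?al0.
  have := congr1 (fun Y => pcoord Y p q) (h H aH); rewrite /= pcoord_bracket //.
  have -> : pcoord (al H *: X) p q = al H * pcoord X p q.
    by rewrite /pcoord -scalemxAr -scalemxAl mxE.
  exact: (mulIf Xpq).
move=> H aH; apply: (can_inj pcoordK); apply/matrixP => p q.
rewrite pcoord_bracket // [in RHS]/pcoord -scalemxAr -scalemxAl [RHS]mxE -/(pcoord X).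
by have [->|/h ->] := eqVneq (pcoord X p q) 0; rewrite ?mulr0.
Qed.

(** If a nonzero weight occurs in an element of the Lie algebra, the projection of this element to
    the weight space is a root vector. *)
Lemma root_systemP al : root_system iR G S al <-> al <> (fun=> 0) /\
  exists X p q, [/\ gR X, pcoord X p q != 0 & al = wt p q].
Proof.
split=> [[fal al0 [X /(root_spaceP _ fal) [gX Xal] X0]]|[al0 [X [p [q [gX Xpq alE]]]]]].
  split=> //.
  have [p [q Xpq]] : exists p q, pcoord X p q != 0.
    apply: contrapT => nX; apply: X0; rewrite -[X]pcoordK (_ : pcoord X = 0) /of_pcoord ?mulmx0 ?mul0mx //.
    apply/matrixP => p q; rewrite [RHS]mxE; apply/eqP; apply: contrapT => /negP ne.
    by apply: nX; exists p, q.
  by exists X, p, q; split=> //; rewrite (Xal _ _ Xpq).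
have fal : is_functional iR S al by rewrite alE; apply: (wt_functional Pu S_grp S_det S_diag).
split=> //.
pose Y := of_pcoord (\matrix_(a, b) ((`[< wt a b = al >])%:R * pcoord X a b)).
have pY a b : pcoord Y a b = (`[< wt a b = al >])%:R * pcoord X a b.
  by rewrite /Y of_pcoordK mxE.
exists Y.
  apply/root_spaceP => //; split; first exact: (wt_stable_all (fun f => (`[< f = al >])%:R)).
  by move=> a b; rewrite pY; case: asboolP => // _; rewrite mul0r eqxx.
move=> Y0; have := pY p q; rewrite asboolT // mul1r Y0 /pcoord mulmx0 mul0mx mxE.
by move=> e; rewrite -e eqxx in Xpq.
Qed.

Lemma finite_root_system : finite_set (root_system iR G S).
Proof.
apply: (sub_finite_set (B := [set wt ab.1 ab.2 | ab in [set: 'I_n * 'I_n]]%classic)).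
  by move=> al /root_systemP [_ [X [p [q [_ _ ->]]]]]; exists (p, q).
by apply: finite_image; apply: finite_finset.
Qed.

End WeightSpaces.

(** * Algebraic characters attached to weights *)

Section RootCharacters.
Variables (K : rcfType) (C : numFieldType) (jC : {rmorphism K -> C}) (n : nat).
Variables (S : set (mxpoly K n)) (P : 'M[K]_n).
Hypotheses (Pu : P \in unitmx) (S_grp : mx_group (zeros jC S))
  (S_det : (zeros jC S `<=` [set x | \det x = 1])%classic)
  (S_diag : split_by jC P (zeros jC S)).

Definition conj_adjmx : 'M[mpoly.mpoly (n * n) K]_n :=
  map_mx (@mpoly.mpolyC (n * n) K) P *m \adj (genmx K n) *m
  map_mx (@mpoly.mpolyC (n * n) K) (invmx P).

Lemma ev_conj_adjmx (A : fieldType) (f : {rmorphism K -> A}) i j (x : 'M[A]_n) : \det x = 1 ->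
  ev f (conj_adjmx i j) x = (map_mx f P *m invmx x *m invmx (map_mx f P)) i j.
Proof.
move=> dx; have xu : x \in unitmx by rewrite unitmxE dx unitr1.
have -> : ev f (conj_adjmx i j) x = map_mx (fun p => ev f p x) conj_adjmx i j.
  by rewrite [RHS]mxE.
by rewrite /conj_adjmx !map_ev_mulmx !map_mpolyC_mx map_ev_adj map_genmx map_invmx
  /invmx xu dx invr1 scale1r.
Qed.

(** The character [t_k / t_l] as a polynomial: for determinant one the inverse is the adjugate. *)
Definition ratio_poly k l := conj_genmx P k k * conj_adjmx l l.

Lemma ev_ratio_dconj (A : fieldType) (f : {rmorphism K -> A}) k l (t : 'rV[A]_n) :
  unit_row t -> \prod_i t 0 i = 1 -> ev f (ratio_poly k l) (dconj (map_mx f P) t) = t 0 k / t 0 l.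
Proof.
move=> ut t1; have Pfu : map_mx f P \in unitmx by rewrite map_unitmx.
rewrite evM (ev_conj_genmx P) ev_conj_adjmx; last by rewrite det_dconj.
by rewrite dconjV // !dconjK // !mxE !eqxx.
Qed.

Lemma ratio_character k l :
  ev jC (ratio_poly k l) 1%:M = 1 /\ (forall s t, zeros jC S s -> zeros jC S t ->
    ev jC (ratio_poly k l) (s *m t) = ev jC (ratio_poly k l) s * ev jC (ratio_poly k l) t).
Proof.
have PCu : map_mx jC P \in unitmx by rewrite map_unitmx.
have dc s : zeros jC S s -> exists t, [/\ unit_row t, \prod_i t 0 i = 1 & s = dconj (map_mx jC P) t].
  move=> Ss; have [t ut sE] := zerosS_dconj Pu S_grp S_diag Ss; exists t; split=> //.
  by have := S_det Ss; rewrite /= sE det_dconj.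
split.
  rewrite -(dconj1 PCu) ev_ratio_dconj ?mxE ?divr1 //; first by move=> i; rewrite mxE oner_neq0.
  by rewrite big1 // => i _; rewrite mxE.
move=> _ _ /dc [t [ut t1 ->]] /dc [w [uw w1 ->]]; rewrite dconjM // !ev_ratio_dconj //.
- by rewrite !mxE invfM mulrACA.
- by move=> i; rewrite mxE mulf_neq0.
- by under eq_bigr do rewrite mxE; rewrite big_split /= t1 w1 mulr1.
Qed.

Variables (R : realType) (iR : {rmorphism K -> R}) (L : rcfType) (iL : {rmorphism K -> L}).
Let PR := map_mx iR P.
Let PL := map_mx iL P.

(** All real points of A are exponentials, so [p * t_l = t_k] holds on them; this identity is
    first-order and passes to L. *)
Lemma char_eq_ratio (p : mxpoly K n) k l : (forall H, aR iR S H ->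
    ev iR p (mx_exp H) = expR (wt S P iR k l H)) ->
  forall t, pos_row t -> (forall m, chars jC S P m -> zmono m t = 1) ->
    ev iL p (dconj PL t) = t 0 k / t 0 l.
Proof.
move=> pH t t0 tm; have [D DE] := Spos_formula S P.
have PRu : PR \in unitmx by rewrite map_unitmx.
have PLu : PL \in unitmx by rewrite map_unitmx.
pose f := FAll 0 (FImp (FSa D (MVar K n 0)) (FZero (p * conj_genmx P l l - conj_genmx P k k) (MVar K n 0))).
have : msat iR (fun=> 0) f.
  rewrite /f msatE => x; rewrite !msatE DE /= /upd /=.
  have Sx := @Spos_expE _ _ _ _ _ _ Pu S_grp S_det S_diag _ iR.
  move=> /Sx [H aH ->]; rewrite evD evN evM pH // !(ev_conj_genmx P).
  have /(aRP Pu S_grp S_det S_diag iR) [h _ HE] := aH; move: aH; rewrite HE => aH.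
  rewrite mx_exp_dconj // (wt_dconj Pu) // !dconjK // !mxE !eqxx.
  by rewrite expRD expRN divfK ?subrr // gt_eqF // expR_gt0.
move/(transfer_closed iR)/(transfer_closed iL); rewrite /f msatE => /(_ (dconj PL t)).
rewrite !msatE DE /= /upd /= evD evN evM !(ev_conj_genmx P) dconjK // !mxE !eqxx !mulr1n => h.
have : ev iL p (dconj PL t) * t 0 l - t 0 k = 0.
  by apply: h; apply/(SposP Pu S_grp S_det S_diag); exists t.
by move/eqP; rewrite subr_eq0 => /eqP <-; rewrite mulfK // gt_eqF.
Qed.

Lemma ev_ratio_exp k l H : aR iR S H ->
  ev iR (ratio_poly k l) (mx_exp H) = expR (wt S P iR k l H).
Proof.
have PRu : PR \in unitmx by rewrite map_unitmx.
move=> aH; have /(Spos_expE Pu S_grp S_det S_diag iR) : exists2 H', aR iR S H' & mx_exp H = mx_exp H'.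
  by exists H.
move=> [SH _]; move: SH => /(zerosS_torus Pu S_grp S_det S_diag) [t [ut tm tE]].
have /(aRP Pu S_grp S_det S_diag iR) [h _ HE] := aH; move: aH tE; rewrite HE => aH tE.
rewrite tE ev_ratio_dconj //; last by rewrite -(zmono_det t) tm //; apply: (chars_det Pu S_det).
move: tE; rewrite mx_exp_dconj // => /(dconj_inj PRu) <-.
by rewrite !mxE (wt_dconj Pu) // expRD expRN.
Qed.

End RootCharacters.

Section RootCharacterValue.
Variables (K : rcfType) (n : nat) (S : set (mxpoly K n)) (P : 'M[K]_n).
Hypotheses (Pu : P \in unitmx) (S_alg : algebraic_subgroup_SL S)
  (S_diag : split_by (real_complex K) P (geom S)).
Variables (R : realType) (F : rcfType) (iR : {rmorphism K -> R}) (iF : {rmorphism K -> F}).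

(** Every polynomial that [xget] may select takes this value, and [ratio_poly] shows that there is
    one to select. *)
Lemma chi_wt k l (t : 'rV[F]_n) : pos_row t ->
  (forall m, chars (real_complex K) S P m -> zmono m t = 1) ->
  chi iR iF S (wt S P iR k l) (dconj (map_mx iF P) t) = t 0 k / t 0 l.
Proof.
move=> t0 tm; have [S_grp S_det] := S_alg; rewrite /chi.
case: xgetP => [y _ [p [_ pH ->]]|/(_ (t 0 k / t 0 l)) []].
  exact: (@char_eq_ratio K K[i] (real_complex K) n S P Pu S_grp S_det S_diag R iR F iF p k l pH t t0 tm).
exists (ratio_poly P k l); split.
- exact: (ratio_character Pu S_grp S_det S_diag).
- by move=> H aH; apply: (ev_ratio_exp Pu S_grp S_det S_diag).
- rewrite ev_ratio_dconj // => [i|]; first by rewrite gt_eqF.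
  by rewrite -(zmono_det t) tm //; apply: (chars_det Pu S_det).
Qed.

End RootCharacterValue.

(** * Roots separate the cocharacters of S *)

Section TorusTangents.
Variables (R : realType) (C : fieldType) (j : {rmorphism R -> C}) (i0 : C) (re im : C -> R).
Hypotheses (i0i0 : i0 * i0 = -1) (reim : forall z, z = j (re z) + i0 * j (im z))
  (reE : forall a b, re (j a + i0 * j b) = a) (imE : forall a b, im (j a + i0 * j b) = b).
Variables (K : rcfType) (iR : {rmorphism K -> R}) (n : nat) (G : set (mxpoly K n)).
Implicit Types (phi psi b : R -> C).

Definition bdd b : Prop := exists c, forall s, 0 < s <= 1 -> `|re (b s)| <= c /\ `|im (b s)| <= c.

Lemma bdd_cst a : bdd (fun=> a).
Proof.
exists (`|re a| + `|im a|) => s _; split; first by rewrite lerDl.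
by rewrite lerDr.
Qed.

Lemma bddD b1 b2 : bdd b1 -> bdd b2 -> bdd (fun s => b1 s + b2 s).
Proof.
move=> [c hc] [d hd]; exists (c + d) => s s01; have [[c1 c2] [d1 d2]] := (hc s s01, hd s s01).
have [-> ->] := reimD reim reE imE (b1 s) (b2 s).
by split; rewrite (le_trans (ler_normD _ _)) // lerD.
Qed.

Lemma bddM b1 b2 : bdd b1 -> bdd b2 -> bdd (fun s => b1 s * b2 s).
Proof.
move=> [c hc] [d hd]; exists (c * d + c * d) => s s01.
have [[c1 c2] [d1 d2]] := (hc s s01, hd s s01).
have [-> ->] := reimM i0i0 reim reE imE (b1 s) (b2 s).
by split; rewrite (le_trans (ler_normD _ _)) // ?normrN !normrM lerD // ler_pM.
Qed.

Lemma bdd_real (f : R -> R) c : (forall s, 0 < s <= 1 -> `|f s| <= c) -> bdd (fun s => j (f s)).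
Proof.
move=> h; exists `|c| => s s01.
have -> : j (f s) = j (f s) + i0 * j 0 by rewrite rmorph0 mulr0 addr0.
by rewrite reE imE normr0 normr_ge0 (le_trans (h s s01)) // ler_norm.
Qed.

Lemma bdd_id : bdd j.
Proof. by apply: (@bdd_real id 1) => s /andP[s0 s1]; rewrite gtr0_norm. Qed.

Definition order1 a phi : Prop := exists2 b, bdd b &
  forall s, 0 < s <= 1 -> phi s = 1 + j s * a + j s ^+ 2 * b s.

Lemma order1_1 : order1 0 (fun=> 1).
Proof. by exists (fun=> 0) => [|s _]; [exact: bdd_cst|rewrite !mulr0 !addr0]. Qed.

Lemma order1M a c phi psi : order1 a phi -> order1 c psi -> order1 (a + c) (fun s => phi s * psi s).
Proof.
move=> [b bb h] [d bd h'].
exists (fun s => a * c + b s + d s + j s * (a * d s + c * b s) + j s * (j s * (b s * d s))).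
  by do ?[apply: bddD|apply: bddM|apply: bdd_id|apply: bdd_cst|assumption].
by move=> s s01; rewrite h // h' //; ring.
Qed.

Lemma order1X a phi k : order1 a phi -> order1 (a *+ k) (fun s => phi s ^+ k).
Proof.
move=> h; elim: k => [|k IH]; first exact: order1_1.
have [b bb e] := order1M h IH; exists b => // s s01.
by rewrite exprS e // mulrS.
Qed.

Lemma order1Z a phi (m : int) : order1 a phi -> order1 (- a) (fun s => (phi s)^-1) ->
  order1 (a *~ m) (fun s => phi s ^ m).
Proof.
move=> h h'; case: m => k; first exact: order1X.
have [b bb e] := order1X k.+1 h'; exists b => // s s01.
by rewrite NegzE -exprnN -exprVn e // mulNrn mulrNz.
Qed.

(** The inverse of [1 + s e] is expanded as well, so that negative exponents of a cocharacter are
    covered. *)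
Definition velocity e : Prop := [/\ order1 e (fun s => 1 + j s * e),
  order1 (- e) (fun s => (1 + j s * e)^-1) & forall s, 0 < s <= 1 -> 1 + j s * e != 0].

Lemma velocity_1 : velocity 1.
Proof.
have nz s : 0 < s <= 1 -> 1 + s != 0 :> R by move=> /andP[s0 _]; rewrite gt_eqF // addr_gt0.
have jE s : 1 + j s * 1 = j (1 + s) by rewrite mulr1 rmorphD rmorph1.
split.
- by exists (fun=> 0) => [|s _]; [exact: bdd_cst|rewrite mulr0 addr0].
- exists (fun s => j (1 + s)^-1) => [|s s01].
    apply: (@bdd_real (fun s => (1 + s)^-1) 1) => s /andP[s0 _].
    have s1 : 0 < 1 + s by rewrite addr_gt0.
    by rewrite gtr0_norm ?invr_gt0 // invf_le1 // lerDl ltW.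
  have := nz s s01; rewrite -(fmorph_eq0 j) fmorphV rmorphD rmorph1 mulr1 => x0.
  by field; exact: x0.
- by move=> s s01; rewrite jE fmorph_eq0 nz.
Qed.

Lemma velocity_i : velocity i0.
Proof.
pose w (s : R) : R := 1 + s ^+ 2; have w0 s : w s != 0 by rewrite /w gt_eqF // ltr_pwDl ?ltr01 ?sqr_ge0.
have wE s : (1 + j s * i0) * (1 - j s * i0) = j (w s).
  rewrite rmorphD rmorph1 rmorphXn /= (_ : (1 + _) * _ = 1 - (i0 * i0) * j s ^+ 2); last by ring.
  by rewrite i0i0 mulN1r opprK.
have nz s : 1 + j s * i0 != 0.
  by apply: contra_neq (w0 s) => e; apply: (fmorph_inj j); rewrite rmorph0 -wE e mul0r.
split.
- by exists (fun=> 0) => [|s _]; [exact: bdd_cst|rewrite mulr0 addr0].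
- exists (fun s => (i0 * i0) * (j (w s)^-1 * (1 + (- i0) * j s))) => [|s s01].
    apply: bddM; first exact: bdd_cst.
    apply: bddM; last by apply: bddD; [exact: bdd_cst|apply: bddM; [exact: bdd_cst|exact: bdd_id]].
    apply: (@bdd_real (fun s => (w s)^-1) 1) => s /andP[s0 _].
    have s1 : 0 < w s by rewrite ltr_pwDl ?sqr_ge0.
    by rewrite gtr0_norm ?invr_gt0 // invf_le1 // lerDl sqr_ge0.
  have -> : j (w s)^-1 * (1 + - i0 * j s) = (1 + j s * i0)^-1.
    apply: (mulfI (nz s)); rewrite mulfV // mulrCA [- i0 * _]mulrC mulrN wE fmorphV mulVf //.
    by rewrite fmorph_eq0.
  by field; exact: nz.
- by move=> s _; exact: nz.
Qed.

(** The curve is the cocharacter [la] evaluated at [1 + s e]. With [e = 1] and [e = i0] it makes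
    both a matrix and its multiple by [i0] tangent. *)
Lemma tgt_curve (V : 'M[C]_n) (la : 'I_n -> int) e : velocity e -> V \in unitmx ->
  (forall c, c != 0 -> zeros (j \o iR) G (dconj V (\row_i c ^ la i))) ->
  tgt j re im iR G (dconj V (\row_i (e *~ la i))).
Proof.
move=> [v1 v2 nz] Vu h.
have /choice [b bP] : forall i : 'I_n, exists b, bdd b /\ forall s, 0 < s <= 1 ->
    (1 + j s * e) ^ la i = 1 + j s * (e *~ la i) + j s ^+ 2 * b s.
  by move=> i; have [b bb bE] := order1Z (la i) v1 v2; exists b.
have /choice [c cP] : forall i : 'I_n, exists c, forall s, 0 < s <= 1 ->
    `|re (b i s)| <= c /\ `|im (b i s)| <= c by move=> i; have [] := bP i.
pose c0 := \sum_i `|c i|.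
have re0 : re 0 = 0 by have := reE 0 0; rewrite rmorph0 mulr0 addr0.
have im0 : im 0 = 0 by have := imE 0 0; rewrite rmorph0 mulr0 addr0.
have c0P i s : 0 < s <= 1 -> `|re (b i s)| <= c0 /\ `|im (b i s)| <= c0.
  move=> s01; have [h1 h2] := cP i s s01.
  have ci : c i <= c0.
    by rewrite (le_trans (ler_norm _)) // /c0 (bigD1 i) //= lerDl sumr_ge0.
  by split; [apply: le_trans h1 _|apply: le_trans h2 _].
pose D s := diag_mx (\row_i b i s).
have Db s : 0 < s <= 1 -> nrm (realify re im (D s)) <= (n + n)%:R * ((n + n)%:R * c0).
  move=> s01; have c00 : 0 <= c0 by apply: sumr_ge0.
  have DE a a' : `|re (D s a a')| <= c0 /\ `|im (D s a a')| <= c0.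
    by rewrite !mxE; case: eqP => _; rewrite ?mulr1n ?mulr0n ?re0 ?im0 ?normr0 //; apply: c0P.
  rewrite /nrm (@le_trans _ _ (\sum_(i < n + n) \sum_(k < n + n) c0)) //; last first.
    by rewrite !sumr_const card_ord -mulrnA mulrA -natrM mulr_natl.
  apply: ler_sum => i _; apply: ler_sum => k _; rewrite /realify.
  have [a ->|a ->] := split_ordP i; have [a' ->|a' ->] := split_ordP k;
    rewrite ?block_mxEul ?block_mxEur ?block_mxEdl ?block_mxEdr.
  - by rewrite mxE; have [] := DE a a'.
  - by rewrite mxE [X in - X]mxE normrN; have [] := DE a a'.
  - by rewrite mxE; have [] := DE a a'.
  - by rewrite mxE; have [] := DE a a'.
pose c1 := nrm (realify re im (invmx V)) * ((n + n)%:R * ((n + n)%:R * c0)) * nrm (realify re im V).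
exists c1, 1, (fun s => realify re im (dconj V (\row_i (1 + j s * e) ^ la i))).
split=> // s s01; split.
  by exists (dconj V (\row_i (1 + j s * e) ^ la i)) => //; apply: h; apply: nz.
have -> : dconj V (\row_i (1 + j s * e) ^ la i) = 1%:M +
    (j s *: dconj V (\row_i (e *~ la i)) + j (s ^+ 2) *: (invmx V *m D s *m V)).
  have -> : \row_i (1 + j s * e) ^ la i = const_mx 1 +
      (j s *: (\row_i (e *~ la i)) + j (s ^+ 2) *: (\row_i b i s)).
    by apply/rowP => i; rewrite !mxE; have [_ ->] := bP i; rewrite // rmorphXn addrA.
  have dD t u : dconj V (t + u) = dconj V t + dconj V u.
    by rewrite /dconj [diag_mx _]linearD mulmxDr mulmxDl.
  have dZ x t : dconj V (x *: t) = x *: dconj V t.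
    by rewrite /dconj [diag_mx _]linearZ /= -scalemxAr -scalemxAl.
  by rewrite !dD !dZ dconj1.
rewrite !(realifyD reim reE imE) !(realifyZ i0i0 reim reE imE) (realify1 reE imE).
rewrite addrA [X in nrm X]addrAC subrr add0r !(realifyM i0i0 reim reE imE) nrmZ (ger0_norm (sqr_ge0 _)) [leLHS]mulrC.
rewrite ler_wpM2r ?sqr_ge0 // (le_trans (nrmM _ _)) // ler_wpM2r ?nrm_ge0 //.
by rewrite (le_trans (nrmM _ _)) // ler_wpM2l ?nrm_ge0 // Db.
Qed.

End TorusTangents.

Local Notation ctr M := (map_mx Num.conj M^T).

(** The spectral theorem for a hermitian matrix; the eigenvalues are squared norms of the rows of
    [V *m g], nonzero by invertibility. *)
Lemma gram_spectral (C : numClosedFieldType) n (g : 'M[C]_n) : g \in unitmx ->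
  exists V d, [/\ V \in unitmx, pos_row d, invmx V = ctr V & g *m ctr g = dconj V d].
Proof.
move=> gu; have gn : (g *m ctr g) \is normalmx.
  by apply/normalmxP; rewrite trmx_mul map_mxM trmxCK.
have [[V d] /= Vu gE] := orthomx_spectral_subproof gn.
exists V, d; have Vu' := unitarymx_unit Vu.
split=> //; last by rewrite invmx_unitary.
move=> i; have dE : d 0 i = \sum_k (V *m g) i k * ((V *m g) i k)^*.
  have : (V *m (g *m ctr g) *m ctr V) i i = d 0 i.
    by rewrite gE -invmx_unitary // (dconjK Vu') mxE eqxx.
  move=> <-; rewrite -!mulmxA mulmxA -map_mxM -trmx_mul mxE; apply: eq_bigr => k _.
  by rewrite [X in _ * X = _]mxE [X in _ * (X)^* = _]mxE.
have Vg : V *m g \in unitmx by rewrite unitmx_mul Vu'.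
rewrite dE lt_neqAle sumr_ge0 ?andbT => [|k _]; last by rewrite -normCK exprn_ge0.
apply/eqP => /esym/eqP; rewrite psumr_eq0 => [|k _]; last by rewrite -normCK exprn_ge0.
move=> /allP h; have : row i (V *m g) = 0.
  apply/rowP => k; rewrite [LHS]mxE [RHS]mxE.
  by have := h k (mem_index_enum _); rewrite -normCK expf_eq0 /= normr_eq0 => /eqP.
move=> /(congr1 (fun v => v *m invmx (V *m g))); rewrite -row_mul mulmxV // mul0mx.
by move=> /rowP /(_ i); rewrite !mxE eqxx => /eqP; rewrite oner_eq0.
Qed.

Section CentralizerOfLie.
Variables (K : rcfType) (C : numClosedFieldType) (jC : {rmorphism K -> C}).
Variables (R : realType) (C' : fieldType) (j : {rmorphism R -> C'}) (i0 : C') (re im : C' -> R).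
Hypotheses (i0i0 : i0 * i0 = -1) (reim : forall z, z = j (re z) + i0 * j (im z))
  (reE : forall a b, re (j a + i0 * j b) = a) (imE : forall a b, im (j a + i0 * j b) = b).
Variables (iR : {rmorphism K -> R}) (th : {rmorphism C -> C'}).
Hypotheses (thj : forall x, th (jC x) = j (iR x))
  (thC : forall z, th z^* = j (re (th z)) - i0 * j (im (th z))).
Variables (n : nat) (G : set (mxpoly K n)).
Hypotheses (G_grp : mx_group (zeros jC G)) (GT : forall g, zeros jC G g -> zeros jC G g^T)
  (Gct : forall g, zeros jC G g -> zeros jC G (ctr g))
  (GR_grp : mx_group (zeros iR G))
  (GC_mul : forall x y, zeros (j \o iR) G x -> zeros (j \o iR) G y -> zeros (j \o iR) G (x *m y)).

(** The powers of [dconj V d] lie in G, hence so does their Zariski closure, which contains the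
    cocharacters orthogonal to all characters trivial at [d]. *)
Lemma torus_curve (V : 'M[C]_n) (d : 'rV[C]_n) la c : V \in unitmx -> pos_row d ->
  zeros jC G (dconj V d) -> (forall m, zmono m d = 1 -> zdot m la = 0) -> c != 0 ->
  zeros (j \o iR) G (dconj (map_mx th V) (\row_i c ^ la i)).
Proof.
move=> Vu d0 Gd laM c0; have [_ G1 GM _] := G_grp.
have e : (th \o jC : K -> C') = j \o iR by apply/funext => x; exact: thj.
pose D u := exists k : nat, u = map_mx th (\row_i (d 0 i ^+ k)).
apply: (@zeros_torus_closure _ _ (j \o iR : {rmorphism K -> C'}) _ (map_mx th V) G D).
- move=> _ _ [k ->] [l ->]; exists (k + l)%N; apply/rowP => i.
  by rewrite !mxE -rmorphM exprD.
- by exists 0%N; apply/rowP => i; rewrite !mxE expr0 rmorph1.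
- by move=> _ [k ->] i; rewrite !mxE fmorph_eq0 expf_neq0 // gt_eqF.
- by move=> i; rewrite mxE expfz_neq0.
- move=> m hm; have md : zmono m d = 1.
    apply: (fmorph_inj th); rewrite map_zmono rmorph1 -[RHS](hm (map_mx th d)) //.
    by exists 1%N; congr map_mx; apply/rowP => i; rewrite mxE.
  have -> : zmono m (\row_i c ^ la i) = c ^ zdot m la.
    rewrite /zmono /zdot (big_morph (fun k => c ^ k) (id1 := 1) (op1 := *%R)) //.
      by apply: eq_bigr => i _; rewrite mxE exprz_exp mulrC.
    by move=> x y; rewrite expfzDr.
  by rewrite laM.
- move=> _ [k ->]; rewrite -map_dconj /= -e.
  apply/(zeros_map jC th); elim: k => [|k IH].
    by rewrite (_ : \row_i _ = const_mx 1) ?dconj1 //; apply/rowP => i; rewrite !mxE expr0.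
  have -> : \row_i (d 0 i ^+ k.+1) = hadamard d (\row_i (d 0 i ^+ k)).
    by apply/rowP => i; rewrite !mxE exprS.
  by rewrite -dconjM //; apply: (GM _ _ Gd IH).
Qed.

Variable a : 'M[K]_n.
Hypothesis a_comm : forall X, gR iR G X -> map_mx iR a *m X = X *m map_mx iR a.

(** Diagonalize [g g^*] as [dconj V d]. For integral [la] orthogonal to the characters trivial at
    [d], the hermitian matrix [y = dconj V la] is tangent, as are [i y] and, G being stable under
    transposition, their transposes. So the real and imaginary parts of [y] lie in the real Lie
    algebra and commute with [a]. Coordinates linked by [a] therefore have equal [la] for all such
    [la], and by the double orthogonal equal [d]. *)
Lemma gram_commute g : zeros jC G g ->
  map_mx jC a *m (g *m ctr g) = (g *m ctr g) *m map_mx jC a.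
Proof.
move=> Gg; have [Gu _ GM _] := G_grp.
have [V [d [Vu d0 VV qE]]] := gram_spectral (Gu _ Gg).
have Gq : zeros jC G (dconj V d) by rewrite -qE; apply: (GM) => //; apply: Gct.
pose M m := zmono m d = 1.
have ud : unit_row d by move=> i; rewrite gt_eqF.
have Msat : saturated_lattice M.
  split=> [|l m Ml Mm|m k]; rewrite /M; first by rewrite /zmono big1.
    by rewrite zmonoB // Ml Mm divr1.
  have m0 : 0 <= zmono m d by apply: prodr_ge0 => i _; rewrite exprz_ge0 // ltW.
  by rewrite zmonoX => /eqP; rewrite pexpr_eq1 // => /eqP.
pose V1 := invmx V^T.
have V1u : V1 \in unitmx by rewrite unitmx_inv unitmx_tr.
have trE t : dconj V1 t = (dconj V t)^T.
  by rewrite /dconj /V1 invmxK !trmx_mul tr_diag_mx trmx_inv mulmxA.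
have Gq1 : zeros jC G (dconj V1 d) by rewrite trE; apply: GT.
have key la : (forall m, M m -> zdot m la = 0) ->
    map_mx jC a *m dconj V (\row_i (la i)%:~R) = dconj V (\row_i (la i)%:~R) *m map_mx jC a.
  move=> laM; set y := dconj V _.
  pose X := map_mx th y; pose S := map_mx re X; pose T := map_mx im X.
  have XE : X = map_mx j S + i0 *: map_mx j T by apply/matrixP => p q; rewrite !mxE -reim.
  have yT : y^T = map_mx Num.conj y.
    have yy : ctr y = y.
      rewrite /y /dconj !trmx_mul !map_mxM tr_diag_mx map_diag_mx VV trmxCK mulmxA -VV.
      congr (_ *m diag_mx _ *m _); apply/rowP => i; rewrite !mxE; apply/CrealP.
      exact: rpred_int.
    by rewrite -[in LHS]yy -map_trmx trmxK.
  have XTE : X^T = map_mx j S - i0 *: map_mx j T.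
    rewrite /X map_trmx yT; apply/matrixP => p q; rewrite !mxE thC //.
  have tg (W : 'M[C]_n) (ep : C') (mu : 'I_n -> int) : W \in unitmx -> zeros jC G (dconj W d) ->
      velocity j re im ep -> (forall m, M m -> zdot m mu = 0) ->
      tgt j re im iR G (ep *: map_mx th (dconj W (\row_i (mu i)%:~R))).
    move=> Wu GW vep muM.
    have := tgt_curve i0i0 reim reE imE (iR := iR) (G := G) (la := mu) vep (V := map_mx th W).
    rewrite map_unitmx => /(_ Wu (fun c => torus_curve Wu d0 GW muM (c := c))).
    congr tgt; rewrite map_dconj /dconj.
    rewrite scalemxAl scalemxAr; congr (_ *m _ *m _).
    apply/matrixP => p q; rewrite !mxE; case: eqP => _; last by rewrite !mulr0n mulr0.
    by rewrite !mulr1n rmorph_int -mulrzr.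
  have laN m : M m -> zdot m (fun i => - la i) = 0.
    move=> /laM e; rewrite /zdot; under eq_bigr do rewrite mulrN.
    by rewrite sumrN -[X in - X]/(zdot m la) e oppr0.
  have yN W : dconj W (\row_i (- la i)%:~R) = - dconj W (\row_i (la i)%:~R) :> 'M[C]_n.
    rewrite /dconj -mulNmx -mulmxN; congr (_ *m _ *m _).
    by apply/matrixP => p q; rewrite !mxE mulrNz mulNrn.
  have XT : map_mx th (dconj V1 (\row_i (la i)%:~R)) = X^T by rewrite trE /X map_trmx.
  have t1 ep : velocity j re im ep -> [/\ tgt j re im iR G (ep *: X), tgt j re im iR G (ep *: X^T),
      tgt j re im iR G (- (ep *: X)) & tgt j re im iR G (- (ep *: X^T))].
    move=> vep; split.
    - exact: (tg V ep _ Vu Gq vep laM).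
    - by have := tg V1 ep _ V1u Gq1 vep laM; rewrite XT.
    - by have := tg V ep _ Vu Gq vep laN; rewrite yN map_mxN scalerN.
    - by have := tg V1 ep _ V1u Gq1 vep laN; rewrite yN map_mxN scalerN XT.
  have [x1 x2 x3 x4] := t1 1 (velocity_1 reE imE).
  have [z1 z2 z3 z4] := t1 i0 (velocity_i i0i0 reim reE imE).
  rewrite !scale1r in x1 x2 x3 x4.
  (* As [y] is hermitian, transposition is complex conjugation: [X + X^T] and [i (X^T - X)] are
     twice the real and imaginary parts. *)
  have SE : map_mx j (S + S) = X + X^T.
    by rewrite map_mxD XTE {1}XE addrACA subrr addr0.
  have TE : map_mx j (T + T) = i0 *: X^T - i0 *: X.
    rewrite map_mxD XTE XE -scalerBr opprD addrACA subrr add0r -opprD scalerN scalerDr scalerA i0i0.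
    by rewrite !scaleN1r opprD !opprK.
  have tD Z Z' := tgtD i0i0 reim reE imE GC_mul (Z := Z) (Z' := Z').
  have gS : gR iR G (S + S).
    apply: (tgt_gR i0i0 reim reE imE GR_grp GC_mul); first by rewrite SE; exact: (tD _ _ x1 x2).
    by rewrite map_mxN SE opprD; exact: (tD _ _ x3 x4).
  have gT : gR iR G (T + T).
    apply: (tgt_gR i0i0 reim reE imE GR_grp GC_mul); first by rewrite TE; exact: (tD _ _ z2 z3).
    by rewrite map_mxN TE opprB; exact: (tD _ _ z1 z4).
  have half (U : 'M[R]_n) : gR iR G (U + U) -> map_mx iR a *m U = U *m map_mx iR a.
    move=> /a_comm; rewrite mulmxDr mulmxDl.
    move: (map_mx iR a *m U) (U *m map_mx iR a) => A B /matrixP e.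
    by apply/matrixP => p q; have := e p q; rewrite mxE [in RHS]mxE => h; lra.
  have [cS cT] := (half _ gS, half _ gT).
  have inj : injective (map_mx th : 'M[C]_n -> 'M[C']_n).
    by move=> A B /matrixP e; apply/matrixP => p q; move: (e p q); rewrite !mxE => /fmorph_inj.
  apply: inj; rewrite (map_mxM th (map_mx jC a) y) (map_mxM th y (map_mx jC a)) -/X.
  have -> : map_mx th (map_mx jC a) = map_mx j (map_mx iR a).
    by apply/matrixP => p q; rewrite !mxE.
  have cS' := congr1 (map_mx j) cS; have cT' := congr1 (map_mx j) cT.
  rewrite !map_mxM in cS' cT'.
  by rewrite XE mulmxDr mulmxDl -scalemxAr -scalemxAl cS' cT'.
pose W := V *m map_mx jC a *m invmx V.
have aE : map_mx jC a = invmx V *m W *m V by rewrite /W !mulmxA mulVmx // mul1mx mulmxKV.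
have Wd (t : 'rV[C]_n) : map_mx jC a *m dconj V t = dconj V t *m map_mx jC a <->
    W *m diag_mx t = diag_mx t *m W.
  have e1 : map_mx jC a *m dconj V t = invmx V *m (W *m diag_mx t) *m V.
    by rewrite aE /dconj !mulmxA mulmxK.
  have e2 : dconj V t *m map_mx jC a = invmx V *m (diag_mx t *m W) *m V.
    by rewrite aE /dconj !mulmxA mulmxK.
  rewrite e1 e2; split=> [e|-> //].
  have {}e := congr1 (fun Z => V *m Z *m invmx V) e.
  by move: e; rewrite /= !mulmxA !mulmxV // !mul1mx !mulmxK.
rewrite qE; apply/Wd; apply/matrixP => k l; rewrite mul_mx_diag mul_diag_mx [LHS]mxE [RHS]mxE.
have [->|Wkl] := eqVneq (W k l) 0; first by rewrite mulr0 mul0r.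
suff dE : d 0 l = d 0 k by rewrite dE mulrC.
have : M (delta_char k l).
  apply: (lattice_perp_perp Msat) => la laM; rewrite zdot_delta.
  have /Wd/matrixP/(_ k l) := key la laM; rewrite mul_mx_diag mul_diag_mx [LHS]mxE [RHS]mxE ![(\row__ _) _ _]mxE mulrC.
  by move/(mulIf Wkl)/intr_inj => ->; rewrite subrr.
by rewrite /M zmono_delta // => /divr1_eq ->.
Qed.

End CentralizerOfLie.

Section GramCentralizer.
Variables (C : numClosedFieldType) (n : nat) (H : set 'M[C]_n).
Hypotheses (H_grp : mx_group H)
  (H_det : (H `<=` [set x | \det x = 1])%classic)
  (H_conn : zariski_connected H) (Hct : forall g, H g -> H (map_mx Num.conj g^T)).
Variables (a b P : 'M[C]_n) (t : 'rV[C]_n).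
Hypotheses (Hb : H b) (ctb : map_mx Num.conj b^T = b) (ab : a = b *m b)
  (Pu : P \in unitmx) (t0 : pos_row t) (aE : a = dconj P t).
Hypothesis gram : forall g, H g ->
  a *m (g *m map_mx Num.conj g^T) = (g *m map_mx Num.conj g^T) *m a.

(** The hypothesis applied to [g *m b]: as [b] is hermitian with square [a], the Gram matrix is
    [g a g^*], and dividing by [g g^*] on the right gives [g a g^-1]. *)
Lemma conj_commute g : H g -> a *m (g *m a *m invmx g) = (g *m a *m invmx g) *m a.
Proof.
move=> Hg; have [Hu _ HM _] := H_grp; have gu := Hu _ Hg; have gcu := Hu _ (Hct Hg).
set gc := map_mx Num.conj g^T in gcu.
have h1 := gram Hg; rewrite -/gc in h1.
have h2 : a *m (g *m a *m gc) = (g *m a *m gc) *m a.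
  have := gram (HM _ _ Hg Hb).
  by rewrite trmx_mul map_mxM ctb -/gc ab !mulmxA.
set q := g *m gc in h1; have qu : q \in unitmx by rewrite unitmx_mul gu.
have -> : g *m a *m invmx g = (g *m a *m gc) *m invmx q.
  apply: (can_inj (mulmxK qu)); rewrite mulmxKV // /q !mulmxA mulmxKV //.
have qV : invmx q *m a = a *m invmx q.
  by apply: (can_inj (mulKmx qu)); rewrite mulKVmx // mulmxA -h1 mulmxK.
by rewrite -[RHS]mulmxA qV mulmxA h2 mulmxA.
Qed.

Let val (f : {ffun 'I_n -> 'I_n} * {ffun 'I_n -> 'I_n}) := \sum_i t 0 (f.1 i) * t 0 (f.2 i).

(** Commuting diagonalizable matrices have a common eigenbasis. Each diagonal entry is one of the
    [t 0 i], which one being recorded by [f], so the trace of the product has finitely many possible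
    values. *)
Lemma conj_codiag g : H g -> exists Q s s', [/\ Q \in unitmx, a = dconj Q s,
  g *m a *m invmx g = dconj Q s' &
  exists f : {ffun 'I_n -> 'I_n} * {ffun 'I_n -> 'I_n}, (forall i, s 0 i = t 0 (f.1 i)) /\ (forall i, s' 0 i = t 0 (f.2 i))
   /\ \sum_i s 0 i * s' 0 i = val f].
Proof.
move=> Hg; have [Hu _ _ _] := H_grp; have gu := Hu _ Hg.
have Pgu : P *m invmx g \in unitmx by rewrite unitmx_mul Pu unitmx_inv.
have a'E : g *m a *m invmx g = dconj (P *m invmx g) t.
  have Vg : invmx (P *m invmx g) = g *m invmx P.
    by apply: (can_inj (mulKmx Pgu)); rewrite mulmxV // mulmxA mulmxKV // mulmxV.
  by rewrite aE /dconj Vg !mulmxA.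
have [Q Qu /allP Qd] : codiagonalizable [:: a; g *m a *m invmx g].
  apply/codiagonalizableP; split=> [A B|A].
    rewrite !inE => /orP [/eqP ->|/eqP ->] /orP [/eqP ->|/eqP ->] //; first exact: conj_commute.
    by apply: esym; apply: conj_commute.
  rewrite !inE => /orP [/eqP ->|/eqP ->]; [exists P|exists (P *m invmx g)] => //.
    by apply/diagonalizable_forPex; exists t; apply/simmxRL; rewrite // aE (dconjK Pu).
  by apply/diagonalizable_forPex; exists t; apply/simmxRL; rewrite // a'E (dconjK Pgu).
have dg A : A \in [:: a; g *m a *m invmx g] -> A = dconj Q (\row_i (Q *m A *m invmx Q) i i).
  move=> Ain; apply: dconj_diag => // k l kl; have := Qd _ Ain.
  by rewrite /= /similar_to conjumx // => /is_diag_mxP; apply.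
have eig A (W : 'M[C]_n) s : W \in unitmx -> A = dconj W t -> A = dconj Q s ->
    forall i, exists k, s 0 i = t 0 k.
  move=> Wu AW AQ i; pose N := Q *m invmx W.
  have Nu : N \in unitmx by rewrite unitmx_mul Qu unitmx_inv.
  have e : N *m diag_mx t = diag_mx s *m N.
    by rewrite -(dconjK Wu t) -(dconjK Qu s) -AW -AQ /N !mulmxA !mulmxKV.
  have [k Nik] : exists k, N i k != 0.
    apply: contrapT => N0; have : row i N = 0.
      by apply/rowP => k; rewrite [LHS]mxE [RHS]mxE; apply/eqP; apply: contrapT => /negP ne; apply: N0; exists k.
    move=> /(congr1 (fun w => w *m invmx N)); rewrite -row_mul mulmxV // mul0mx.
    by move=> /rowP /(_ i); rewrite !mxE eqxx => /eqP; rewrite oner_eq0.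
  exists k; move/matrixP/(_ i k): e; rewrite mul_mx_diag mul_diag_mx [LHS]mxE [RHS]mxE mulrC.
  by move/(mulIf Nik).
have /choice [f1 f1P] := eig _ _ _ Pu aE (dg a (mem_head _ _)).
have /choice [f2 f2P] := eig _ _ _ Pgu a'E (dg _ (mem_last a [:: g *m a *m invmx g])).
exists Q, (\row_i (Q *m a *m invmx Q) i i), (\row_i (Q *m (g *m a *m invmx g) *m invmx Q) i i).
split=> //; [exact: (dg _ (mem_head _ _))|exact: (dg _ (mem_last a [:: g *m a *m invmx g]))|].
exists ([ffun i => f1 i], [ffun i => f2 i]); split=> [i|]; first by rewrite ffunE f1P.
split=> [i|]; first by rewrite ffunE f2P.
by apply: eq_bigr => i _; rewrite f1P f2P !ffunE.
Qed.

(** The trace of [a (g a g^-1)] is a polynomial function of [g] with finitely many values, hence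
    constant on the connected group and equal to the trace of [a ^ 2]. In the common eigenbasis the
    squared distance between the two real spectra is then 0. *)
Lemma conj_fixed g : H g -> g *m a *m invmx g = a.
Proof.
have [_ H1 _ _] := H_grp.
pose f0 : {rmorphism C -> C} := idfun.
pose aC := map_mx (@mpoly.mpolyC (n * n) C) a.
pose p := \tr (aC *m genmx C n *m aC *m \adj (genmx C n)).
have pE x : \det x = 1 -> ev f0 p x = \tr (a *m (x *m a *m invmx x)).
  move=> dx; have xu : x \in unitmx by rewrite unitmxE dx unitr1.
  rewrite ev_sum /mxtrace; apply: eq_bigr => i _.
  have -> : ev f0 ((aC *m genmx C n *m aC *m \adj (genmx C n)) i i) x =
      map_mx (fun q => ev f0 q x) (aC *m genmx C n *m aC *m \adj (genmx C n)) i i.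
    by rewrite [RHS]mxE.
  rewrite !map_ev_mulmx map_ev_adj map_genmx !map_mpolyC_mx !map_mx_id // /invmx xu dx invr1 scale1r.
  by rewrite !mulmxA.
pose v0 : C := \tr (a *m a).
pose vals := [seq val f | f <- enum {: {ffun 'I_n -> 'I_n} * {ffun 'I_n -> 'I_n}} & val f != v0].
pose Z1 : set (mpoly.mpoly (n * n) C) := fun q => q = p - mpoly.mpolyC _ v0.
pose Z2 : set (mpoly.mpoly (n * n) C) := fun q => q = \prod_(v <- vals) (p - mpoly.mpolyC _ v).
have Z1P x : zeros f0 Z1 x <-> ev f0 p x = v0.
  split=> [/(_ _ erefl)|e q ->]; rewrite evD evN evC /=; last by rewrite e subrr.
  by move/eqP; rewrite subr_eq0 => /eqP.
have Z2P x : zeros f0 Z2 x <-> ev f0 p x \in vals.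
  have e : ev f0 (\prod_(v <- vals) (p - mpoly.mpolyC _ v)) x = \prod_(v <- vals) (ev f0 p x - v).
    by rewrite ev_prod; apply: eq_bigr => v _; rewrite evD evN evC.
  split=> [/(_ _ erefl)|px q ->]; rewrite e.
    by move/eqP; rewrite prodf_seq_eq0 => /hasP [v vv]; rewrite subr_eq0 => /eqP ->.
  by apply/eqP; rewrite prodf_seq_eq0; apply/hasP; exists (ev f0 p x); rewrite ?subrr ?eqxx.
have tr_val x : H x -> exists f, \tr (a *m (x *m a *m invmx x)) = val f.
  move=> Hx; have [Q [s [s' [Qu a1 a2 [f [_ [_ fE]]]]]]] := conj_codiag Hx; exists f.
  rewrite a2 a1 dconjM // /dconj mxtrace_mulC mulmxA mulmxV // mul1mx mxtrace_diag -fE.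
  by apply: eq_bigr => i _; rewrite mxE.
have c1 : zariski_closed (zeros f0 Z1) by exists Z1.
have c2 : zariski_closed (zeros f0 Z2) by exists Z2.
have sub : (H `<=` zeros f0 Z1 `|` zeros f0 Z2)%classic.
  move=> x Hx; have [f fE] := tr_val x Hx; have px := pE _ (H_det Hx); rewrite fE in px.
  have [e|ne] := eqVneq (val f) v0; [by left; apply/Z1P; rewrite px e|right; apply/Z2P; rewrite px].
  by apply/mapP; exists f; rewrite // mem_filter ne mem_enum.
have dis : (H `&` zeros f0 Z1 `&` zeros f0 Z2 = set0)%classic.
  apply/seteqP; split=> // x [[_ /Z1P e] /Z2P]; rewrite e => /mapP [f].
  by rewrite mem_filter => /andP [/eqP ne _] e'; case: ne.
have in1 : (H `&` zeros f0 Z1)%classic 1%:M.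
  by split=> //; apply/Z1P; rewrite pE ?det1 // invmx1 mulmx1 mul1mx.
move=> Hg; have trg : \tr (a *m (g *m a *m invmx g)) = v0.
  have [e|e] := H_conn c1 c2 sub dis; first by have : (set0 : set 'M[C]_n) 1%:M by rewrite -e.
  rewrite -pE; last exact: H_det.
  have [/Z1P //|z2] := sub g Hg; by have : (set0 : set 'M[C]_n) g by rewrite -e.
have [Q [s [s' [Qu a1 a2 [f [sf [s'f _]]]]]]] := conj_codiag Hg.
have tr2 A u w : A = dconj Q u -> \tr (A *m dconj Q w) = \sum_i u 0 i * w 0 i.
  move=> ->; rewrite dconjM // /dconj mxtrace_mulC mulmxA mulmxV // mul1mx mxtrace_diag.
  by apply: eq_bigr => i _; rewrite mxE.
have gu : g \in unitmx by have [Hu _ _ _] := H_grp; apply: Hu.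
have tra : \tr (g *m a *m invmx g *m (g *m a *m invmx g)) = v0.
  by rewrite !mulmxA mulmxKV // mxtrace_mulC !mulmxA mulVmx // mul1mx.
have e1 : \sum_i s 0 i * s' 0 i = v0 by rewrite -(tr2 _ _ _ a1) -a2.
have e2 : \sum_i s 0 i * s 0 i = v0 by rewrite -(tr2 _ _ _ a1) -a1.
have e3 : \sum_i s' 0 i * s' 0 i = v0 by rewrite -(tr2 _ _ _ a2) -a2.
have sq0 : \sum_i (s 0 i - s' 0 i) ^+ 2 = 0.
  transitivity (\sum_i s 0 i * s 0 i - (\sum_i s 0 i * s' 0 i) *+ 2 + \sum_i s' 0 i * s' 0 i).
    by rewrite -sumrMnl -sumrB -big_split; apply: eq_bigr => i _; rewrite /=; ring.
  by rewrite e1 e2 e3 mulr2n opprD addrA subrr sub0r addNr.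
have rl i : s 0 i - s' 0 i \is Num.real.
  by rewrite sf s'f rpredB // ger0_real // ltW.
rewrite a2 a1; congr dconj; apply/rowP => i.
move/eqP: sq0; rewrite psumr_eq0 => [/allP /(_ i (mem_index_enum _))|k _].
  by rewrite sqrf_eq0 subr_eq0 => /eqP.
by rewrite real_exprn_even_ge0.
Qed.

End GramCentralizer.

Section RootsSeparate.
Variables (K : rcfType) (C : numClosedFieldType) (jC : {rmorphism K -> C}).
Variables (R : realType) (C' : fieldType) (j : {rmorphism R -> C'}) (i0 : C') (re im : C' -> R).
Hypotheses (i0i0 : i0 * i0 = -1) (reim : forall z, z = j (re z) + i0 * j (im z))
  (reE : forall a b, re (j a + i0 * j b) = a) (imE : forall a b, im (j a + i0 * j b) = b).
Variables (iR : {rmorphism K -> R}) (th : {rmorphism C -> C'}).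
Hypotheses (thj : forall x, th (jC x) = j (iR x))
  (thC : forall z, th z^* = j (re (th z)) - i0 * j (im (th z)))
  (jCr : forall x, (jC x)^* = jC x).
Variables (n : nat) (G S : set (mxpoly K n)) (P : 'M[K]_n).
Hypotheses (G_grp : mx_group (zeros jC G)) (GT : forall g, zeros jC G g -> zeros jC G g^T)
  (G_det : (zeros jC G `<=` [set x | \det x = 1])%classic)
  (G_conn : zariski_connected (zeros jC G)) (G_ss : semisimple (zeros jC G))
  (Gct : forall g, zeros jC G g -> zeros jC G (map_mx Num.conj g^T))
  (GR_grp : mx_group (zeros iR G))
  (GC_mul : forall x y, zeros (j \o iR) G x -> zeros (j \o iR) G y -> zeros (j \o iR) G (x *m y))
  (SG : (zeros jC S `<=` zeros jC G)%classic) (S_split : split_torus_over jC S)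
  (Pu : P \in unitmx) (S_diag : split_by jC P (zeros jC S))
  (S_sym : forall s, zeros jC S s -> s = s^T).

Lemma Spos_GR x : Spos S P iR x -> zeros iR G x.
Proof.
move=> [Sx _]; move: x Sx; apply: zeros_sub_transfer => x Sx.
apply/(zeros_map (idfun : {rmorphism K -> K}) jC); apply: SG.
exact/(zeros_map (idfun : {rmorphism K -> K}) jC).
Qed.

(* A cocharacter of S killed by all roots is central, and G has finite centre. *)
Lemma roots_separate (la : 'I_n -> int) :
  (forall m, chars jC S P m -> zdot m la = 0) ->
  (forall k l, root_system iR G S (wt S P iR k l) -> la k = la l) -> forall i, la i = 0.
Proof.
move=> laM laR; have [S_grp S_det S_conn _] := S_split.
have c0 (c : nat) : (0 < c)%N -> c%:R != 0 :> K by move=> cp; rewrite pnatr_eq0 -lt0n.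
have Szer (c : nat) : (0 < c)%N -> zeros idfun S (dconj P (\row_i (c%:R : K) ^ la i)).
  move=> cp; have := (zerosS_torus Pu S_grp S_det S_diag (idfun : {rmorphism K -> K}) (dconj P (\row_i (c%:R : K) ^ la i))).2.
  rewrite /= map_mx_id //; apply; exists (\row_i (c%:R : K) ^ la i); split=> //.
    by move=> i; rewrite mxE expfz_neq0 ?c0.
  move=> m cm; rewrite -[\row_i _]/(cochar la (c%:R : K)) zmono_cochar ?c0 //.
  by rewrite laM.
(* The base 4 makes [a] the square of the element [b] of S with base 2, as the Gram argument
   requires. *)
pose t : 'rV[K]_n := \row_i (4%:R : K) ^ la i; pose a := dconj P t.
pose b := dconj P (\row_i (2%:R : K) ^ la i).
have ab : a = b *m b.
  rewrite /b dconjM //; congr dconj; apply/rowP => i; rewrite !mxE.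
  by rewrite -expfzMl -natrM.
have t0 : pos_row t by move=> i; rewrite mxE exprz_gt0 // ltr0n.
have Sb := Szer 2 isT; have Sa := Szer 4 isT.
have SbC : zeros jC S (map_mx jC b) by apply/(zeros_map (idfun : {rmorphism K -> K}) jC).
have PRu : map_mx iR P \in unitmx by rewrite map_unitmx.
have a_comm X : gR iR G X -> map_mx iR a *m X = X *m map_mx iR a.
  move=> gX; have aE : map_mx iR a = dconj (map_mx iR P) (map_mx iR t) by rewrite map_dconj.
  have XE : X = invmx (map_mx iR P) *m pcoord P iR X *m map_mx iR P.
    by rewrite /pcoord !mulmxA mulVmx // mul1mx mulmxKV.
  rewrite aE [in LHS]XE [in RHS]XE /dconj.
  have -> : forall A B D E : 'M[R]_n, A *m B *m D *m (A *m E *m D) = A *m (B *m (D *m A) *m E) *m D.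
    by move=> A B D E; rewrite !mulmxA.
  have -> : forall A B D E : 'M[R]_n, A *m E *m D *m (A *m B *m D) = A *m (E *m (D *m A) *m B) *m D.
    by move=> A B D E; rewrite !mulmxA.
  rewrite mulmxV // !mulmx1; congr (_ *m _ *m _).
  apply/matrixP => p q; rewrite mul_diag_mx mul_mx_diag [LHS]mxE [RHS]mxE.
  have [->|Xpq] := eqVneq (pcoord P iR X p q) 0; first by rewrite mulr0 mul0r.
  suff -> : map_mx iR t 0 p = map_mx iR t 0 q by rewrite mulrC.
  rewrite !mxE; congr (iR (_ ^ _)).
  have [w0|w0] := pselect (wt S P iR p q = (fun=> 0)).
    have /laM := (wt_eq0 Pu S_grp S_det S_conn S_diag iR p q).1 w0.
    by rewrite zdot_delta => /eqP; rewrite subr_eq0 => /eqP.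
  apply: laR; apply/(root_systemP Pu S_grp S_det S_diag
    (gRD i0i0 reim reE imE GR_grp GC_mul) (@gRZ _ _ iR n G) _).
    by move=> x Y /Spos_GR Gx; apply: gR_conj.
  by split=> //; exists X, p, q.
have aCE : map_mx jC a = dconj (map_mx jC P) (map_mx jC t) by rewrite map_dconj.
have abC : map_mx jC a = map_mx jC b *m map_mx jC b by rewrite ab map_mxM.
have PCu : map_mx jC P \in unitmx by rewrite map_unitmx.
have tC0 : pos_row (map_mx jC t).
  by move=> i; rewrite !mxE fmorphXz rmorph_nat exprz_gt0 // ltr0n.
have ctb : map_mx Num.conj (map_mx jC b)^T = map_mx jC b.
  rewrite -(S_sym SbC); apply/matrixP => p q; rewrite [LHS]mxE mxE.
  exact: jCr.
have gram g := gram_commute i0i0 reim reE imE thj thC G_grp GT Gct GR_grp GC_mul a_comm (g := g).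
have a1 : a = 1%:M.
  apply: (central_positive_torus G_grp G_ss SG S_split Pu t0 Sa) => g Gg.
  have := conj_fixed G_grp G_det G_conn Gct (SG SbC) ctb abC PCu tC0 aCE gram Gg.
  have gu : g \in unitmx by case: G_grp => Hu _ _ _; apply: Hu.
  by move=> e; rewrite -{1}e mulmxKV.
move=> i; have : t = const_mx 1 by apply: (dconj_inj Pu); rewrite dconj1.
move=> /rowP /(_ i); rewrite !mxE -(expr0z (4%:R : K)); apply: ieexprIz; rewrite ?ltr0n //.
by rewrite pnatr_eq1.
Qed.

End RootsSeparate.

(** * Maxima on compact sets and variations to second order *)

Section PolynomialMaximum.
Variables (R : realType) (n : nat).

Definition cont_mx (f : 'M[R]_n -> R) : Prop := continuous (fun v : 'rV[R]_(n * n) => f (vec_mx v)).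

Lemma cont_mx_ev (K : comNzRingType) (iota : {rmorphism K -> R}) (p : mpoly.mpoly (n * n) K) :
  cont_mx (ev iota p).
Proof.
rewrite /cont_mx; elim/mpoly_ring_ind: p => [c|k|p q hp hq|p q hp hq].
- rewrite (_ : (fun v => _) = fun=> iota c); last by apply/funext => v; rewrite evC.
  exact: (@cst_continuous _ R).
- case/mxvec_indexP: k => i k; rewrite (_ : (fun v => _) = fun v : 'rV[R]_(n * n) => v 0 (mxvec_index i k)).
    exact: coord_continuous.
  by apply/funext => w; rewrite /ev mpoly.mmapX mpoly.mmap1U vec_mxK.
- rewrite (_ : (fun v => _) = fun v => ev iota p (vec_mx v) + ev iota q (vec_mx v)).
    by move=> v; exact: (cvgD (hp v) (hq v)).
  by apply/funext => v; rewrite evD.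
- rewrite (_ : (fun v => _) = fun v => ev iota p (vec_mx v) * ev iota q (vec_mx v)).
    by move=> v; exact: (cvgM (hp v) (hq v)).
  by apply/funext => v; rewrite evM.
Qed.

(** The constraints define a closed subset of a cube, hence a compact set on which a continuous
    function attains its maximum. *)
Lemma mx_bounded_max (T : Type) (I : set T) (F : T -> 'M[R]_n -> R) (f : 'M[R]_n -> R) X0 :
  (forall p, cont_mx (F p)) -> cont_mx f -> (forall p, I p -> F p X0 = 0) ->
  (forall X, (forall p, I p -> F p X = 0) -> forall i j, `|X i j| <= 1) ->
  exists2 X, (forall p, I p -> F p X = 0) & forall Y, (forall p, I p -> F p Y = 0) -> f Y <= f X.
Proof.
move=> Fc fc X0I bd.
pose A := [set v : 'rV[R]_(n * n) | forall p, I p -> F p (vec_mx v) = 0]%classic.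
pose B := [set v : 'rV[R]_(n * n) | forall i, `[-1, 1]%classic (v ord0 i)]%classic.
have cB : compact B := @rV_compact R (n * n) (fun=> `[-1, 1]%classic) (fun i => @segment_compact R (-1) 1).
have AE : A = (\bigcap_(p in I) [set v | F p (vec_mx v) = 0])%classic.
  by apply/seteqP; split=> v h p Ip; apply: h.
have cA : closed A.
  rewrite AE; apply: closed_bigI => p _.
  have -> : [set v | F p (vec_mx v) = 0]%classic =
      ((fun v : 'rV[R]_(n * n) => F p (vec_mx v)) @^-1` (fun x => x = 0))%classic by [].
  apply: closed_comp; first by move=> v _; apply: Fc.
  exact: closed_eq.
have AB : (A `<=` B)%classic.
  move=> v Av i /=; case/mxvec_indexP: i => i k; rewrite in_itv /=.
  by have := bd _ Av i k; rewrite mxE ler_norml.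
have Ac : compact A := subclosed_compact cA cB AB.
have [||v vA vmax] := @compact_EVT_max _ R (fun v => f (vec_mx v)) A _ Ac.
- by exists (mxvec X0) => p Ip; rewrite mxvecK; apply: X0I.
- by apply: continuous_subspaceT.
exists (vec_mx v); first by move: vA; rewrite inE.
move=> Y YI; have := vmax (mxvec Y); rewrite mxvecK; apply.
by rewrite inE => p Ip; rewrite mxvecK; apply: YI.
Qed.

End PolynomialMaximum.

(** Functional calculus is independent of the diagonalization, because the transition matrix links
    only equal eigenvalues. *)
Lemma dconj_map (A : fieldType) n (V W : 'M[A]_n) (d u : 'rV[A]_n) (f : A -> A) :
  V \in unitmx -> W \in unitmx -> dconj V d = dconj W u ->
  dconj V (\row_i f (d 0 i)) = dconj W (\row_i f (u 0 i)).
Proof.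
move=> Vu Wu e; pose N := V *m invmx W.
have key t s : dconj V t = dconj W s <-> diag_mx t *m N = N *m diag_mx s.
  have e1 : diag_mx t *m N = V *m dconj V t *m invmx W.
    by rewrite -(dconjK Vu t) /N (mulmxA _ V (invmx W)) mulmxKV.
  have e2 : N *m diag_mx s = V *m dconj W s *m invmx W.
    by rewrite -(dconjK Wu s) /N !(mulmxA (V *m invmx W)) mulmxKV.
  rewrite e1 e2; split=> [->//|h].
  by apply: (can_inj (mulKmx Vu)); apply: (can_inj (mulmxK (_ : invmx W \in unitmx))); rewrite ?unitmx_inv.
apply/key; move/key/matrixP: e => e; apply/matrixP => k l.
have := e k l; rewrite !mul_mx_diag !mul_diag_mx [LHS]mxE [RHS]mxE => e1; rewrite [LHS]mxE [RHS]mxE ![(\row__ _) _ _]mxE; move: e1; rewrite mulrC.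
have [->|Nkl] := eqVneq (N k l) 0; first by rewrite !mulr0 !mul0r.
by move=> /(mulfI Nkl) ->; rewrite mulrC.
Qed.

Section ExponentialExpansion.
Variables (R : realType) (n : nat).
Implicit Types (X Z W : 'M[R]_n).

Lemma mx_exp_order3 X : nrm (mx_exp X - (1%:M + X + 2^-1 *: (X *m X))) <=
  (n%:R + 1) * nrm X ^+ 3 * expR (nrm X).
Proof.
apply: (@mx_exp_bound _ _ _ _ _ 3) => -[|[|[|m]]] // _.
have -> : expsum X m.+3 - (1%:M + X + 2^-1 *: (X *m X)) = \sum_(k < m) k.+3`!%:R^-1 *: X ^+ k.+3.
  rewrite /expsum -(big_mkord xpredT (fun k => k`!%:R^-1 *: X ^+ k)) !big_nat_recl //.
  rewrite !factE mxX0 !invr1 !scale1r expr1 -[X ^+ 2]/(X *m X) !addrA.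
  by rewrite big_mkord [X in X - _]addrC addrK.
rewrite (le_trans (nrm_sum _ _ _)) // -mulrA mulrA.
rewrite (@le_trans _ _ (\sum_(k < m) (n%:R + 1) * nrm X ^+ 3 * (nrm X ^+ k / k`!%:R))) //; last first.
  by rewrite -mulr_sumr ler_wpM2l ?expsum_le_expR ?nrm_ge0 // mulr_ge0 ?addr_ge0 ?exprn_ge0 ?nrm_ge0.
apply: ler_sum => k _; rewrite nrmZ ger0_norm ?invr_ge0 //.
rewrite mulrC (@le_trans _ _ ((n%:R + 1) * nrm X ^+ k.+3 / k.+3`!%:R)) //.
  by rewrite ler_wpM2r ?invr_ge0 // nrmXn.
rewrite -[k.+3]addn3 addnC exprD -!mulrA ler_wpM2l ?addr_ge0 //.
do !rewrite ler_wpM2l ?exprn_ge0 ?nrm_ge0 //.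
rewrite lef_pV2 ?posrE ?ltr0n ?fact_gt0 // ler_nat.
by rewrite addnC addn3 !factS !mulnA leq_pmull ?fact_gt0.
Qed.

(** The Euler products for [Z] and [- Z] commute and multiply to [(1 - Z ^ 2 / k ^ 2) ^ k], which
    tends to the identity by Chernoff's formula with velocity 0. *)
Lemma mx_exp_invr Z : mx_exp Z *m mx_exp (- Z) = 1%:M.
Proof.
pose A k := (1%:M + k.+1%:R^-1 *: Z) ^+ k.+1; pose B k := (1%:M + k.+1%:R^-1 *: - Z) ^+ k.+1.
pose C (W : 'M[R]_n) := (n%:R + 1) * expR (4%:R * nrm W).
have hA k : nrm (A k - mx_exp Z) <= C Z / k.+1%:R by apply: mx_exp_euler.
have hB k : nrm (B k - mx_exp (- Z)) <= C (- Z) / k.+1%:R by apply: mx_exp_euler.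
have AB k : A k *m B k = (1%:M + (- (k.+1%:R^-1 ^+ 2)) *: (Z *m Z)) ^+ k.+1.
  have cm : GRing.comm (1%:M + k.+1%:R^-1 *: Z) (1%:M + k.+1%:R^-1 *: - Z).
    rewrite /GRing.comm -![_ * _]/(_ *m _) !mulmxDl !mulmxDr !mulmx1 !mul1mx.
    by rewrite -!scalemxAr -!scalemxAl mulmxN mulNmx addrACA addrC addrACA.
  rewrite /A /B -[LHS]/(_ * _) -exprMn_comm //; congr (_ ^+ _).
  rewrite -[_ * _]/(_ *m _) mulmxDl !mulmxDr mul1mx mulmx1 mul1mx addrA scalerN subrK.
  by rewrite -scalemxAl mulmxN -scalemxAr scalerN scalerA scaleNr expr2.
have C0 W : 0 <= C W by rewrite mulr_ge0 ?addr_ge0 ?expR_ge0.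
pose D := C Z * (nrm (mx_exp (- Z)) + C (- Z)) + nrm (mx_exp Z) * C (- Z).
have h1 k : (0 <= k)%N -> nrm (A k *m B k - mx_exp Z *m mx_exp (- Z)) <= D / k.+1%:R.
  move=> _; have -> : A k *m B k - mx_exp Z *m mx_exp (- Z) =
      (A k - mx_exp Z) *m B k + mx_exp Z *m (B k - mx_exp (- Z)).
    by rewrite mulmxBl mulmxBr addrA subrK.
  have Bk : nrm (B k) <= nrm (mx_exp (- Z)) + C (- Z).
    rewrite -[B k](subrK (mx_exp (- Z))) addrC (le_trans (nrmD _ _)) // lerD2l (le_trans (hB k)) //.
    by rewrite ler_pdivrMr ?ltr0n // ler_peMr // ler1n.
  rewrite (le_trans (nrmD _ _)) // /D mulrDl lerD // (le_trans (nrmM _ _)) //.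
    by rewrite mulrAC ler_pM ?nrm_ge0.
  by rewrite -mulrA ler_wpM2l ?nrm_ge0.
have [|d hd] := @chernoff R n 0 (fun k => 1%:M + (- (k.+1%:R^-1 ^+ 2)) *: (Z *m Z)) (nrm (Z *m Z)) 0.
  move=> k _; rewrite scaler0 addr0 addrC addKr nrmZ normrN ger0_norm ?exprn_ge0 ?invr_ge0 //.
  by rewrite mulrC exprVn.
have h2 k : (0 <= k)%N -> nrm (A k *m B k - 1%:M) <= d / k.+1%:R.
  by move=> kk; have := hd k kk; rewrite (mx_exp0 R n) (AB k).
exact: (nrm_limit_unique h1 h2).
Qed.

Lemma entry_tr X Y : \tr (X *m Y) <= nrm X * nrm Y.
Proof.
rewrite /mxtrace (le_trans _ (nrmM X Y)) // /nrm; apply: ler_sum => i _.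
by rewrite (bigD1 i) //= (le_trans (ler_norm _)) // lerDl sumr_ge0.
Qed.

(** Taylor expansion of [Ad (exp (s Z)) X] with cubic error; the simple and double brackets enter
    the first and second derivative tests at the maximum. *)
Lemma conj_expansion Z X : exists c, forall s, 0 < s <= 1 ->
  nrm (mx_exp (s *: Z) *m X *m mx_exp (- (s *: Z)) -
       (X + s *: (Z *m X - X *m Z) +
        (s ^+ 2 / 2) *: (Z *m (Z *m X - X *m Z) - (Z *m X - X *m Z) *m Z))) <= c * s ^+ 3.
Proof.
pose T s W := 1%:M + s *: W + (s ^+ 2 / 2) *: (W *m W) : 'M[R]_n.
pose e3 := (n%:R + 1) * nrm Z ^+ 3 * expR (nrm Z).
have e30 : 0 <= e3 by rewrite !mulr_ge0 ?addr_ge0 ?exprn_ge0 ?nrm_ge0 ?expR_ge0.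
have hT s W : 0 < s <= 1 -> nrm W = nrm Z -> nrm (mx_exp (s *: W) - T s W) <= e3 * s ^+ 3.
  move=> /andP[s0 s1] WZ; have := mx_exp_order3 (s *: W).
  have -> : 2^-1 *: ((s *: W) *m (s *: W)) = (s ^+ 2 / 2) *: (W *m W).
    by rewrite -scalemxAl -scalemxAr !scalerA -mulrA mulrC expr2.
  move=> /le_trans; apply; rewrite nrmZ WZ (ger0_norm (ltW s0)) exprMn.
  rewrite /e3 [leRHS]mulrAC [leLHS](_ : _ = (n%:R + 1) * nrm Z ^+ 3 * s ^+ 3 * expR (s * nrm Z)); last by ring.
  rewrite ler_wpM2l ?ler_expR ?ler_piMl ?nrm_ge0 //.
  by rewrite !mulr_ge0 ?addr_ge0 ?exprn_ge0 ?nrm_ge0 ?(ltW s0).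
have bT s W : 0 < s <= 1 -> nrm W = nrm Z ->
    nrm (T s W) <= nrm (1%:M : 'M[R]_n) + nrm Z + nrm Z * nrm Z.
  move=> /andP[s0 s1] WZ; rewrite /T (le_trans (nrmD _ _)) // lerD //.
    rewrite (le_trans (nrmD _ _)) // lerD2l nrmZ WZ (ger0_norm (ltW s0)) ler_piMl ?nrm_ge0 //.
  have s2 : 0 <= s ^+ 2 / 2 <= 1.
    rewrite divr_ge0 ?exprn_ge0 ?(ltW s0) //= ler_pdivrMr // mul1r (@le_trans _ _ 1) ?ler1n //.
    by rewrite exprn_ile1 ?(ltW s0).
  move/andP: s2 => [h0 h1]; rewrite nrmZ (ger0_norm h0) -WZ (@le_trans _ _ (nrm (W *m W))) ?nrmM //.
  by rewrite ler_piMl ?nrm_ge0.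
have bE s W : 0 < s <= 1 -> nrm W = nrm Z ->
    nrm (mx_exp (s *: W)) <= e3 + (nrm (1%:M : 'M[R]_n) + nrm Z + nrm Z * nrm Z).
  move=> s01 WZ; rewrite -[mx_exp _](subrK (T s W)) (le_trans (nrmD _ _)) // lerD ?bT //.
  rewrite (le_trans (hT s W s01 WZ)) // ler_piMr //.
  by move/andP: s01 => [s0 s1]; rewrite exprn_ile1 // ltW.
pose e0 := nrm (1%:M : 'M[R]_n) + nrm Z + nrm Z * nrm Z; pose e1 := e3 + e0.
pose Y := Z *m X - X *m Z.
(* The terms of order 3 and 4 in the product of the two quadratic truncations. *)
pose r3 := 2^-1 *: (Z *m (X *m (Z *m Z)) - Z *m (Z *m (X *m Z))).
pose r4 := 4^-1 *: (Z *m (Z *m (X *m (Z *m Z)))).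
have TT s : T s Z *m X *m T s (- Z) =
    X + s *: Y + (s ^+ 2 / 2) *: (Z *m Y - Y *m Z) + (s ^+ 3 *: r3 + s ^+ 4 *: r4).
  rewrite /T /Y /r3 /r4 !(mulmxDl, mulmxDr) ?mulmxBr ?mulmxBl !mul1mx !mulmx1 !mulmxN !mulNmx ?opprK.
  rewrite -?scalemxAl -?scalemxAr -?scalemxAl -!mulmxA ?mulmxN ?mulNmx -?mulmxA.
  move: (Z *m (Z *m (X *m (Z *m Z)))) (Z *m (Z *m (X *m Z))) (Z *m (X *m (Z *m Z))) => m1 m2 m3.
  move: (Z *m (X *m Z)) (Z *m (Z *m X)) (X *m (Z *m Z)) (X *m Z) (Z *m X) => m4 m5 m6 m7 m8.
  by apply/matrixP => i k; rewrite !mxE; field; rewrite ?pnatr_eq0.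
exists (e3 * nrm X * e1 + e0 * nrm X * e3 + nrm r3 + nrm r4) => s s01; have [/andP[s0 s1] s01'] := (s01, s01).
set E := mx_exp (s *: Z); set E' := mx_exp (- (s *: Z)).
have E'E : E' = mx_exp (s *: - Z) by rewrite scalerN.
have -> : E *m X *m E' - (X + s *: Y + (s ^+ 2 / 2) *: (Z *m Y - Y *m Z)) =
    (E - T s Z) *m X *m E' + T s Z *m X *m (E' - T s (- Z)) + (s ^+ 3 *: r3 + s ^+ 4 *: r4).
  rewrite [(E - _) *m X]mulmxBl [(_ - _) *m E']mulmxBl [T s Z *m X *m (_ - _)]mulmxBr TT.
  set u := E *m X *m E'; set w := T s Z *m X *m E'; set B := X + s *: Y + _; set r := s ^+ 3 *: r3 + _.
  by apply/matrixP => i k; move: u w B r => u w B r; rewrite !mxE; ring.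
have NZ : nrm (- Z) = nrm Z by rewrite nrmN.
have dist (a b c d x : R) : (a + b + c + d) * x = a * x + (b * x + (c * x + d * x)) by ring.
rewrite dist -[X in nrm X]addrA (le_trans (nrmD _ _)) // lerD //.
  rewrite (le_trans (nrmM _ _)) // [leRHS](_ : _ = e3 * s ^+ 3 * nrm X * e1); last by ring.
  rewrite ler_pM ?nrm_ge0 ?E'E ?bE // (le_trans (nrmM _ _)) // ler_wpM2r ?nrm_ge0 //; exact: hT.
rewrite (le_trans (nrmD _ _)) // lerD //.
  rewrite (le_trans (nrmM _ _)) // [leRHS](_ : _ = e0 * nrm X * (e3 * s ^+ 3)); last by ring.
  rewrite ler_pM ?nrm_ge0 ?E'E ?hT // (le_trans (nrmM _ _)) // ler_wpM2r ?nrm_ge0 //; exact: bT.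
have ps k : 0 <= s ^+ k by rewrite exprn_ge0 // ltW.
rewrite (le_trans (nrmD _ _)) // lerD //; first by rewrite nrmZ (ger0_norm (ps 3)) mulrC.
rewrite nrmZ (ger0_norm (ps 4)) mulrC ler_wpM2l ?nrm_ge0 //.
by rewrite [leLHS]exprS ler_piMl ?ps.
Qed.

End ExponentialExpansion.

Lemma mx_exp_dconj_gen (R : realType) n (V : 'M[R]_n) (h : 'rV[R]_n) : V \in unitmx ->
  mx_exp (dconj V h) = dconj V (\row_i expR (h 0 i)).
Proof.
move=> Vu; have := mx_exp_conj (P := invmx V) (diag_mx h).
by rewrite unitmx_inv invmxK /dconj mx_exp_diag => ->.
Qed.

(** Matrices supported on a preorder of the coordinates are closed under products, sums and
    limits. *)
Lemma mx_exp_support (R : realType) n (e : 'I_n -> 'I_n -> Prop) (Y : 'M[R]_n) :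
  (forall k, e k k) -> (forall k l m, e k l -> e l m -> e k m) ->
  (forall k l, Y k l != 0 -> e k l) -> forall k l, mx_exp Y k l != 0 -> e k l.
Proof.
move=> e1 eT Ye k l; apply: contra_neqP => nkl.
have X0 m : forall k l, (Y ^+ m) k l != 0 -> e k l.
  elim: m => [|m IH] p q.
    by rewrite mxX0 mxE; case: (eqVneq p q) => [->|_]; rewrite ?mulr0n ?eqxx.
  rewrite mxXS mxE => s0; apply: contrapT => npq; move/eqP: s0; apply.
  rewrite big1 // => u _; have [->|Yu] := eqVneq (Y p u) 0; first by rewrite mul0r.
  have [->|Xu] := eqVneq ((Y ^+ m) u q) 0; first by rewrite mulr0.
  by case: npq; apply: eT (Ye _ _ Yu) (IH _ _ Xu).
rewrite mxE (_ : (fun m => _) = fun=> 0) ?lim_cst //; apply/funext => m.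
rewrite summxE big1 // => i _; rewrite mxE.
by have [->|/X0] := eqVneq ((Y ^+ i) k l) 0; rewrite ?mulr0.
Qed.

(** Divide by [s], respectively by [s ^ 2 / 2], and let [s = 1 / k] tend to 0. *)
Lemma second_order_max (R : realType) (t1 t2 c : R) :
  (forall s, 0 < s <= 1 -> s * t1 + s ^+ 2 / 2 * t2 <= c * s ^+ 3) ->
  t1 <= 0 /\ (t1 = 0 -> t2 <= 0).
Proof.
move=> h; pose s k : R := k.+1%:R^-1.
have s01 k : 0 < s k <= 1 by rewrite invr_gt0 ltr0n /= invf_le1 ?ltr0n // ler1n.
split=> [|t10].
  apply: (@archi_eq0 _ _ (`|c| + `|t2|) 0) => k _; have /andP[k0 k1] := s01 k.
  have := h _ (s01 k); rewrite -[X in _ <= X / _]mulr1 -/(s k) => hk.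
  rewrite -(ler_pM2l k0) (@le_trans _ _ (c * s k ^+ 3 - s k ^+ 2 / 2 * t2)) ?lerBrDr //.
  have h1 : c * s k ^+ 3 <= `|c| * s k ^+ 2.
    rewrite (@le_trans _ _ (`|c| * s k ^+ 3)) ?ler_wpM2r ?ler_norm ?exprn_ge0 ?(ltW k0) //.
    by rewrite ler_wpM2l // exprS ler_piMl ?exprn_ge0 ?(ltW k0).
  have h2 : - (s k ^+ 2 / 2 * t2) <= `|t2| * s k ^+ 2.
    rewrite -mulrN (@le_trans _ _ (s k ^+ 2 / 2 * `|t2|)) //.
      by rewrite ler_wpM2l ?divr_ge0 ?exprn_ge0 ?(ltW k0) // -normrN ler_norm.
    rewrite mulrC ler_wpM2l // ler_pdivrMr // ler_peMr ?exprn_ge0 ?(ltW k0) //.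
    by rewrite ler1n.
  rewrite (le_trans (lerD h1 h2)) // -mulrDl mulrC -/(s k) mulrCA -expr2 mulrC mulr1 //.
apply: (@archi_eq0 _ _ (2%:R * c) 0) => k _; have /andP[k0 k1] := s01 k.
have := h _ (s01 k); rewrite t10 mulr0 add0r -/(s k) => hk.
have s2 : 0 < s k ^+ 2 / 2 by rewrite divr_gt0 ?exprn_gt0.
rewrite -(ler_pM2l s2) (le_trans hk) // le_eqVlt; apply/orP; left; apply/eqP; rewrite -/(s k).
by field.
Qed.

Section ContinuousTrace.
Variables (R : realType) (n : nat).

Let f0 : {rmorphism R -> R} := idfun.
Let g0 := genmx R n.

Let ev_mx (M : 'M[mpoly.mpoly (n * n) R]_n) (k : 'M[R]_n) i j :
  ev f0 (M i j) k = map_mx (fun p => ev f0 p k) M i j.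
Proof. by rewrite mxE. Qed.

Let map_ev_tr (M : 'M[mpoly.mpoly (n * n) R]_n) (k : 'M[R]_n) :
  map_mx (fun p => ev f0 p k) M^T = (map_mx (fun p => ev f0 p k) M)^T.
Proof. by rewrite map_trmx. Qed.

Lemma cont_mx_trace (A B : 'M[R]_n) : cont_mx (fun k => \tr (k *m A *m k^T *m B)).
Proof.
pose AC := map_mx (@mpoly.mpolyC (n * n) R) A; pose BC := map_mx (@mpoly.mpolyC (n * n) R) B.
rewrite (_ : (fun k => _) = ev f0 (\tr (g0 *m AC *m g0^T *m BC))); first exact: cont_mx_ev.
apply/funext => k; rewrite ev_sum /mxtrace; apply: eq_bigr => i _.
by rewrite ev_mx !map_ev_mulmx map_ev_tr map_genmx !map_mpolyC_mx !map_mx_id.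
Qed.

Lemma cont_mx_gram i j : cont_mx (fun k : 'M[R]_n => (k *m k^T) i j - (1%:M : 'M[R]_n) i j).
Proof.
rewrite (_ : (fun k => _) = ev f0 ((g0 *m g0^T) i j - mpoly.mpolyC (n * n) ((1%:M : 'M[R]_n) i j))).
  exact: cont_mx_ev.
by apply/funext => k; rewrite evD evN evC ev_mx map_ev_mulmx map_ev_tr map_genmx.
Qed.

End ContinuousTrace.

Section CartanVectors.
Variables (K : rcfType) (C : numFieldType) (jC : {rmorphism K -> C}) (n : nat).
Variables (G S : set (mxpoly K n)) (P : 'M[K]_n).
Hypotheses (Pu : P \in unitmx) (S_grp : mx_group (zeros jC S))
  (S_det : (zeros jC S `<=` [set x | \det x = 1])%classic)
  (S_conn : zariski_connected (zeros jC S))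
  (S_diag : split_by jC P (zeros jC S)).
Notation chr := (chars jC S P).
Variables (R : realType) (iR : {rmorphism K -> R}).
Let PR := map_mx iR P.
Let PRu : PR \in unitmx. Proof. by rewrite map_unitmx. Qed.
Notation aR := (aR iR S).
Notation wt := (wt S P iR).

(** Independence of the weights on the Lie algebra of A gives the evaluation map full rank, hence
    makes it onto. *)
Lemma comb_wt_prescribed r (k l : 'I_r -> 'I_n) :
  (forall c : 'I_r -> R, (fun H => \sum_i c i * wt (k i) (l i) H) = (fun=> 0) -> forall i, c i = 0) ->
  forall c : 'I_r -> R, exists2 H, aR H & forall i, wt (k i) (l i) H = c i.
Proof.
move=> free c; pose V (h : 'rV[R]_n) := forall m, chr m -> \sum_i (m i)%:~R * h 0 i = 0.
have [q [B [VB spB]]] := span_finite V.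
pose D : 'M[R]_(n, r) := \matrix_(a, i) ((a == k i)%:R - (a == l i)%:R).
have hD (h : 'rV[R]_n) i : (h *m D) 0 i = h 0 (k i) - h 0 (l i).
  rewrite mxE; under eq_bigr do rewrite mxE mulrBr.
  rewrite sumrB (bigD1 (k i)) //= eqxx mulr1 big1 ?addr0 => [|a /negbTE ->]; last by rewrite mulr0.
  by rewrite (bigD1 (l i)) //= eqxx mulr1 big1 ?addr0 // => a /negbTE ->; rewrite mulr0.
have aP := aRP Pu S_grp S_det S_diag iR.
have Vlin (x : 'rV[R]_q) : V (x *m B).
  move=> m cm; rewrite (eq_bigr (fun i => \sum_a x 0 a * ((m i)%:~R * B a i))); last first.
    by move=> i _; rewrite mxE mulr_sumr; apply: eq_bigr => a _; rewrite mulrCA.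
  rewrite exchange_big /= big1 // => a _; rewrite -mulr_sumr.
  have := VB a m cm; under eq_bigr do rewrite mxE.
  by move=> ->; rewrite mulr0.
have wV h i : V h -> wt (k i) (l i) (dconj PR h) = (h *m D) 0 i.
  move=> Vh; have aH : aR (dconj PR h) by apply/aP; exists h.
  by rewrite (wt_dconj Pu) // hD.
have full : row_free (B *m D)^T.
  apply: inj_row_free => v vM; apply/rowP => i; rewrite [RHS]mxE.
  apply: (free (fun i => v 0 i)); apply/funext => H.
  have [aH|naH] := pselect (aR H); last by rewrite big1 // => j _; rewrite wt_out ?mulr0.
  have /aP [h Vh ->] := aH; have /submxP [x xE] := spB h Vh.
  under eq_bigr do rewrite wV //.
  transitivity ((v *m (h *m D)^T) 0 0).
    by rewrite mxE; apply: eq_bigr => j _; rewrite [X in _ = _ * X]mxE.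
  by rewrite xE -mulmxA trmx_mul mulmxA vM mul0mx mxE.
have /row_fullP [M MBD] : row_full (B *m D).
  by rewrite /row_full -mxrank_tr.
pose x := (\row_i c i) *m M.
exists (dconj PR (x *m B)); first by apply/aP; exists (x *m B); first exact: Vlin.
by move=> i; rewrite wV // -mulmxA /x -mulmxA MBD mulmx1 mxE.
Qed.

End CartanVectors.

(** * The Cartan decomposition *)

Section WeightRelations.
Variables (K : rcfType) (n : nat) (S : set (mxpoly K n)) (P : 'M[K]_n) (R : realType).
Variable iR : {rmorphism K -> R}.

Lemma wt_diag a : wt S P iR a a = (fun=> 0).
Proof. by apply/funext => H; rewrite /wt subrr; case: ifP. Qed.

Lemma wt_chain a b c : wt S P iR a b = (fun=> 0) -> wt S P iR b c = (fun=> 0) ->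
  wt S P iR a c = (fun=> 0).
Proof.
move=> ab bc; apply/funext => H; have := congr1 (fun f => f H) ab; have := congr1 (fun f => f H) bc.
by rewrite /wt; case: ifP => // _ e1 e2; rewrite -[RHS](addr0 0) -{1}e1 -e2; ring.
Qed.

End WeightRelations.

Section RealCartanDecomposition.
Variables (K : rcfType) (C : numFieldType) (jC : {rmorphism K -> C}) (n : nat).
Variables (G S : set (mxpoly K n)) (P : 'M[K]_n).
Hypotheses (Pu : P \in unitmx) (S_grp : mx_group (zeros jC S))
  (S_det : (zeros jC S `<=` [set x | \det x = 1])%classic)
  (S_conn : zariski_connected (zeros jC S))
  (S_diag : split_by jC P (zeros jC S)).
Notation chr := (chars jC S P).
Variables (R : realType) (iR : {rmorphism K -> R}).
Let PR := map_mx iR P.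
Let PRu : PR \in unitmx. Proof. by rewrite map_unitmx. Qed.
Notation aR := (aR iR S).
Notation gR := (gR iR G).
Notation wt := (wt S P iR).
Notation GR := (zeros iR G).
Hypotheses (gD : forall X Y, gR X -> gR Y -> gR (X + Y))
  (gZ : forall c X, gR X -> gR (c *: X))
  (gconj : forall x X, GR x -> gR X -> gR (x *m X *m invmx x))
  (gtr : forall X, gR X -> gR X^T)
  (GR_grp : mx_group GR) (GT : forall x, GR x -> GR x^T)
  (SposG : forall x, Spos S P iR x -> GR x)
  (Spos_sym : forall x, Spos S P iR x -> x^T = x)
  (sym_comm : forall w, GR w -> w^T = w ->
     (forall k l, (PR *m w *m invmx PR) k l != 0 -> chr (delta_char k l)) -> Spos S P iR (w *m w)).

Let aP := aRP Pu S_grp S_det S_diag iR.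
Let gAd x X : Spos S P iR x -> gR X -> gR (x *m X *m invmx x).
Proof. by move=> Sx; apply: gconj; apply: SposG. Qed.
Let wt_all := wt_stable_all Pu S_grp S_det S_diag gD gZ gAd.
Let rootP := root_systemP Pu S_grp S_det S_diag gD gZ gAd.

Lemma gram_log g : GR g -> exists (V : 'M[R]_n) (d : 'rV[R]_n),
  [/\ V \in unitmx, pos_row d & g *m g^T = dconj V d].
Proof.
move=> Gg; have [Gu _ _ _] := GR_grp; have gu : g \in unitmx := Gu _ Gg.
have [V [d [Vu qE]]] : exists V d, V \in unitmx /\ g *m g^T = dconj V d.
  have /sym_diagonalizable [V [d [Vu qE]]] : (g *m g^T)^T = g *m g^T by rewrite trmx_mul trmxK.
  by exists V, d.
exists V, d; split=> // i.
have sq (v : 'rV[R]_n) : v != 0 -> 0 < (v *m v^T) 0 0.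
  move=> v0; rewrite lt_neqAle eq_sym mxE sumr_ge0 ?andbT => [|k _]; last first.
    by rewrite [X in _ * X]mxE -expr2 sqr_ge0.
  apply: contra v0; rewrite psumr_eq0 => [|k _]; last by rewrite [X in _ * X]mxE -expr2 sqr_ge0.
  move=> /allP h; apply/eqP/rowP => k; rewrite [RHS]mxE; have := h k (mem_index_enum _).
  by rewrite [X in _ * X]mxE -expr2 sqrf_eq0 => /eqP.
pose v := row i V.
have v0 : v != 0.
  apply/eqP => /(congr1 (fun w => w *m invmx V)); rewrite -row_mul mulmxV // mul0mx.
  by move=> /rowP /(_ i); rewrite !mxE eqxx => /eqP; rewrite oner_eq0.
have vg0 : v *m g != 0.
  apply: contra v0 => /eqP e; apply/eqP; have := congr1 (fun w => w *m invmx g) e.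
  by rewrite mulmxK // mul0mx.
have e : v *m (g *m g^T) = d 0 i *: v.
  rewrite qE /v -row_mul (_ : V *m dconj V d = diag_mx d *m V).
    by apply/rowP => k; rewrite mul_diag_mx !mxE.
  by rewrite -(dconjK Vu d) mulmxKV.
have := sq _ vg0; rewrite trmx_mul -mulmxA (mulmxA g) mulmxA e -scalemxAl mxE.
by rewrite pmulr_lgt0 // sq.
Qed.

(** A character trivial at the positive point [d] is trivial at all real powers of [d], so the
    Zariski closure of the integral powers contains the one-parameter group. *)
Lemma log_gR (V : 'M[R]_n) (d : 'rV[R]_n) : V \in unitmx -> pos_row d -> GR (dconj V d) ->
  gR (dconj V (\row_i ln (d 0 i))).
Proof.
move=> Vu d0 Gd s; have [_ G1 GM _] := GR_grp.
have -> : s *: dconj V (\row_i ln (d 0 i)) = dconj V (\row_i (s * ln (d 0 i))).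
  rewrite /dconj scalemxAl scalemxAr; congr (_ *m _ *m _).
  by apply/matrixP => i j; rewrite !mxE mulrnAr.
rewrite mx_exp_dconj_gen //.
pose D (u : 'rV[R]_n) := exists k : nat, u = \row_i (d 0 i ^+ k).
apply: (@zeros_torus_closure _ _ iR _ V G D).
- by move=> _ _ [k ->] [l ->]; exists (k + l)%N; apply/rowP => i; rewrite !mxE exprD.
- by exists 0%N; apply/rowP => i; rewrite !mxE expr0.
- by move=> _ [k ->] i; rewrite !mxE expf_neq0 // gt_eqF.
- by move=> i; rewrite mxE gt_eqF ?expR_gt0.
- move=> m hm; have md : zmono m d = 1.
    by apply: hm; exists 1%N; apply/rowP => i; rewrite mxE.
  have dE : d = \row_i expR ((\row_k ln (d 0 k)) 0 i).
    by apply/rowP => i; rewrite !mxE lnK ?posrE.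
  rewrite zmono_expR (_ : \sum_i _ = s * \sum_i (m i)%:~R * (\row_k ln (d 0 k)) 0 i); last first.
    by rewrite mulr_sumr; apply: eq_bigr => i _; rewrite !mxE mulrCA.
  have -> : \sum_i (m i)%:~R * (\row_k ln (d 0 k)) 0 i = 0.
    by apply: expR_inj; rewrite -zmono_expR -dE md expR0.
  by rewrite mulr0 expR0.
- move=> _ [k ->]; elim: k => [|k IH].
    by rewrite (_ : \row_i _ = const_mx 1) ?dconj1 //; apply/rowP => i; rewrite !mxE expr0.
  have -> : \row_i (d 0 i ^+ k.+1) = hadamard d (\row_i (d 0 i ^+ k)).
    by apply/rowP => i; rewrite !mxE exprS.
  by rewrite -dconjM //; apply: (GM _ _ Gd IH).
Qed.

(** The transpose is diagonalized by another matrix with the same eigenvalues, and functional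
    calculus does not see the difference. *)
Lemma dconj_sym (V : 'M[R]_n) (d : 'rV[R]_n) (f : R -> R) : V \in unitmx ->
  (dconj V d)^T = dconj V d -> (dconj V (\row_i f (d 0 i)))^T = dconj V (\row_i f (d 0 i)).
Proof.
move=> Vu sym; pose W := invmx V^T.
have Wu : W \in unitmx by rewrite unitmx_inv unitmx_tr.
have trE t : (dconj V t)^T = dconj W t.
  by rewrite /dconj /W invmxK !trmx_mul tr_diag_mx trmx_inv mulmxA.
by rewrite trE; symmetry; apply: dconj_map => //; rewrite -trE.
Qed.

Lemma aR_sym H : aR H -> H^T = H.
Proof.
move=> aH; have /aP [h _ HE] := aH.
have Se : Spos S P iR (mx_exp H) by apply/(Spos_expE Pu S_grp S_det S_diag); exists H.
have := Spos_sym Se; rewrite HE mx_exp_dconj_gen // => /(@dconj_sym _ _ (@ln R) PRu).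
rewrite (_ : (\row_i ln _) = h) //.
by apply/rowP => i; rewrite !mxE expRK.
Qed.

(** On weight spaces this bracket is multiplication by minus the weight at [H], a function of the
    weight. *)
Lemma bracket_gR X H : gR X -> aR H -> gR (X *m H - H *m X).
Proof.
move=> gX aH; have := wt_all (fun f => - f H) gX; congr gR.
rewrite -[RHS](pcoordK Pu iR); congr of_pcoord.
apply/matrixP => p q; rewrite [LHS]mxE.
have -> : X *m H - H *m X = - (H *m X - X *m H) by rewrite opprB.
rewrite mulNr -(pcoord_bracket Pu S_grp S_det S_diag) // /pcoord mulmxN mulNmx.
by rewrite [RHS]mxE.
Qed.

Variables (r : nat) (Delta : 'I_r -> functional R n).
Hypothesis basis : root_basis iR G S Delta.

Lemma root_basis_wt : exists k l : 'I_r -> 'I_n, forall i, Delta i = wt (k i) (l i).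
Proof.
have [dr _ _] := basis.
have /choice [kl klP] : forall i, exists kl : 'I_n * 'I_n, Delta i = wt kl.1 kl.2.
  by move=> i; have /rootP [_ [X [p [q [_ _ e]]]]] := dr i; exists (p, q).
by exists (fun i => (kl i).1), (fun i => (kl i).2).
Qed.

Lemma Delta_prescribed (c : 'I_r -> R) : exists2 H, aR H & forall i, Delta i H = c i.
Proof.
have [k [l E]] := root_basis_wt; have [_ free _] := basis.
have free' c' : (fun H => \sum_i c' i * wt (k i) (l i) H) = (fun=> 0) -> forall i, c' i = 0.
  move=> h; apply: free; rewrite -h; apply/funext => H.
  by apply: eq_bigr => i _; rewrite E.
have [H aH Hc] := comb_wt_prescribed Pu S_grp S_det S_diag free' c.
by exists H => // i; rewrite E.
Qed.

(** At [H0] a root takes, up to sign, the value of the sum of its coordinates in the basis; these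
    have one sign, so the value is nonzero and only zero weights can occur in an element commuting
    with [H0]. *)
Lemma regular_centralizer H0 X p q : (forall i, Delta i H0 = 1) -> aR H0 -> gR X ->
  X *m H0 = H0 *m X -> pcoord P iR X p q != 0 -> chr (delta_char p q).
Proof.
move=> H01 aH0 gX XH Xpq; apply/(wt_eq0 Pu S_grp S_det S_conn S_diag iR).
apply: contrapT => w0.
have [_ _ bs] := basis.
have /bs [m mE] : root_system iR G S (wt p q) by apply/rootP; split=> //; exists X, p, q.
have wH0 : wt p q H0 = 0.
  have := pcoord_bracket Pu S_grp S_det S_diag X p q aH0.
  rewrite XH subrr /pcoord mulmx0 mul0mx mxE => /esym/eqP; rewrite mulf_eq0 => /orP [/eqP //|e].
  by rewrite (eqP e) eqxx in Xpq.
have S0 : \sum_i (m i)%:R = 0 :> R.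
  case: mE wH0 => ->; rewrite /comb.
    by under eq_bigr do rewrite H01 mulr1.
  under eq_bigr do rewrite H01 mulr1.
  by rewrite sumrN => /eqP; rewrite oppr_eq0 => /eqP.
have m0 i : m i = 0%N.
  move/eqP: S0; rewrite psumr_eq0 => [/allP /(_ i (mem_index_enum _))|j _]; last exact: ler0n.
  by rewrite pnatr_eq0 => /eqP.
apply: w0; case: mE => ->; apply/funext => H; rewrite /comb big1 // => i _; rewrite m0 ?oppr0 mul0r //.
Qed.

Lemma trace_sq (Y : 'M[R]_n) : 0 <= \tr (Y^T *m Y) /\ (\tr (Y^T *m Y) <= 0 -> Y = 0).
Proof.
have e : \tr (Y^T *m Y) = \sum_i \sum_k Y k i ^+ 2.
  by apply: eq_bigr => i _; rewrite mxE; apply: eq_bigr => k _; rewrite mxE expr2.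
have p i : 0 <= \sum_k Y k i ^+ 2 by apply: sumr_ge0 => k _; apply: sqr_ge0.
split=> [|h]; first by rewrite e sumr_ge0.
have /eqP : \sum_i \sum_k Y k i ^+ 2 = 0 by apply/le_anti; rewrite -{1}e h sumr_ge0.
rewrite psumr_eq0 // => /allP h1; apply/matrixP => k i; rewrite [RHS]mxE.
have := h1 i (mem_index_enum _); rewrite psumr_eq0 => [/allP /(_ k (mem_index_enum _))|a _]; last exact: sqr_ge0.
by rewrite sqrf_eq0 => /eqP.
Qed.

Lemma tr_bracket (X Z H : 'M[R]_n) : \tr ((Z *m X - X *m Z) *m H) = \tr (Z *m (X *m H - H *m X)).
Proof.
rewrite mulmxBl mulmxBr !raddfB /= !mulmxA; congr (_ - _).
rewrite -(mulmxA X Z H); exact: mxtrace_mulC.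
Qed.

Lemma tr_bracket2 (H Z T : 'M[R]_n) : \tr ((Z *m T - T *m Z) *m H) = \tr ((H *m Z - Z *m H) *m T).
Proof.
rewrite !mulmxBl !raddfB /=; congr (_ - _); first by rewrite -(mulmxA H Z T); exact: mxtrace_mulC.
by rewrite -(mulmxA T Z H); exact: mxtrace_mulC.
Qed.

Lemma skew_zero (E A B : 'M[R]_n) : A - B = E -> - A + B = E -> E = 0.
Proof.
move=> h1 h2; have e : E + E = 0 by rewrite -{1}h1 -h2 addrACA subrr addNr addr0.
apply/matrixP => p q; have := congr1 (fun M : 'M[R]_n => M p q) e; rewrite !mxE; lra.
Qed.

Lemma tr_skew (X H : 'M[R]_n) : X^T = X -> H^T = H -> (X *m H - H *m X)^T = - (X *m H - H *m X).
Proof. by move=> XT HT; rewrite linearB /= !trmx_mul XT HT opprB. Qed.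

Lemma polar_product (k e g : 'M[R]_n) : e \in unitmx -> k^T *m k = 1%:M ->
  g = k^T *m e *m (invmx e *m k *m g).
Proof. by move=> eu kk; rewrite !mulmxA mulmxK // kk mul1mx. Qed.

Lemma bracket_antisym (H A B : 'M[R]_n) c : H *m A - A *m H = c *: A ->
  H *m B - B *m H = - c *: B -> H *m (A - B) - (A - B) *m H = c *: (A + B).
Proof.
move=> a b; rewrite scalerDr -a -[c *: B]opprK -scaleNr -b mulmxBr mulmxBl.
move: (H *m A) (H *m B) (A *m H) (B *m H) => V X Y Z; apply/matrixP => i j; rewrite !mxE; ring.
Qed.

Lemma tr_expand (A B Y1 Y2 H : 'M[R]_n) a b : \tr (A *m H) = \tr (B *m H) + a * \tr (Y1 *m H) +
  b * \tr (Y2 *m H) + \tr ((A - (B + a *: Y1 + b *: Y2)) *m H).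
Proof. rewrite [(A - _) *m H]mulmxBl !mulmxDl -!scalemxAl raddfB /= !mxtraceD !mxtraceZ; ring. Qed.

(** [X] is the logarithm of [g g^T] and [H0] is regular. At a maximum of the trace of [k X k^T H0],
    the first variation makes the conjugate [X'] commute with [H0], which brings it into the Lie
    algebra of A; the second variation makes the simple roots nonnegative on it. *)
Lemma cartan_decomposition_real g : GR g -> exists k k' H, [/\ GR k, GR k', k *m k^T = 1%:M,
  k' *m k'^T = 1%:M & [/\ aR H, forall i, 0 <= Delta i H & g = k *m mx_exp H *m k']].
Proof.
move=> Gg; have [Gu G1 GM GV] := GR_grp.
have [V [d [Vu d0 qE]]] := gram_log Gg.
have Gq : GR (dconj V d) by rewrite -qE; apply: (GM) => //; apply: GT.
pose h := \row_i ln (d 0 i) : 'rV[R]_n; pose X := dconj V h.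
have gX : gR X := log_gR Vu d0 Gq.
have XT : X^T = X by apply: dconj_sym => //; rewrite -qE trmx_mul trmxK.
have [H0 aH0 H01] := Delta_prescribed (fun=> 1).
pose Cst (p : mxpoly K n + 'I_n * 'I_n) (k : 'M[R]_n) : R :=
  match p with inl p => ev iR p k | inr ij => (k *m k^T) ij.1 ij.2 - (1%:M : 'M[R]_n) ij.1 ij.2 end.
pose Ix (p : mxpoly K n + 'I_n * 'I_n) := match p with inl p => G p | _ => True end.
have IxP k : (forall p, Ix p -> Cst p k = 0) <-> GR k /\ k *m k^T = 1%:M.
  split=> [hk|[Gk kk] [p Gp|[i j] _]]; [split=> [p Gp|]|exact: Gk|by rewrite /= kk subrr].
    exact: (hk (inl p) Gp).
  apply/matrixP => i j; apply/eqP; rewrite -subr_eq0; apply/eqP.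
  exact: (hk (inr (i, j)) I).
have orth_le1 (k : 'M[R]_n) : k *m k^T = 1%:M -> forall i j, `|k i j| <= 1.
  move=> kk i j; have sq u : k i u * k^T u i = k i u ^+ 2 by rewrite [k^T u i]mxE expr2.
  rewrite -(ler_pXn2r (n := 2)) ?nnegrE // expr1n (real_normK (num_real _)).
  have : (k *m k^T) i i = 1 by rewrite kk mxE eqxx.
  rewrite mxE => <-; rewrite (bigD1 j) //= sq lerDl sumr_ge0 // => u _.
  by rewrite sq sqr_ge0.
have [||||k0 /IxP [Gk0 kk0] kmax] := @mx_bounded_max R n _ Ix Cst (fun k => \tr (k *m X *m k^T *m H0)) 1%:M.
- by case=> [p|[i j]]; [exact: cont_mx_ev|exact: cont_mx_gram].
- exact: cont_mx_trace.
- by apply/IxP; split; rewrite // trmx1 mulmx1.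
- by move=> k /IxP [_ kk]; apply: orth_le1.
have k0u : k0 \in unitmx := Gu _ Gk0.
have k0V : invmx k0 = k0^T by apply: (can_inj (mulKmx k0u)); rewrite mulmxV.
pose X' := k0 *m X *m k0^T.
have gX' : gR X' by rewrite /X' -k0V; apply: gconj.
have X'T : X'^T = X' by rewrite /X' trmx_mul trmxK (trmx_mul k0 X) XT mulmxA.
have var Z : gR Z -> Z^T = - Z -> \tr ((Z *m X' - X' *m Z) *m H0) <= 0 /\
    (\tr ((Z *m X' - X' *m Z) *m H0) = 0 ->
     \tr ((Z *m (Z *m X' - X' *m Z) - (Z *m X' - X' *m Z) *m Z) *m H0) <= 0).
  move=> gZ' ZT; have [c hc] := conj_expansion Z X'.
  apply: (@second_order_max R _ _ (c * nrm H0)) => s s01.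
  have := hc s s01; set Y1 := Z *m X' - X' *m Z; set Y2 := Z *m Y1 - Y1 *m Z.
  set E := mx_exp (s *: Z) *m X' *m mx_exp (- (s *: Z)) => hE.
  have fE : \tr (E *m H0) <= \tr (X' *m H0).
    have ET : (mx_exp (s *: Z))^T = mx_exp (- (s *: Z)) by rewrite -mx_exp_tr linearZ /= ZT scalerN.
    have := kmax (mx_exp (s *: Z) *m k0); rewrite trmx_mul ET /E /X' !mulmxA; apply.
    apply/IxP; split; first by apply: (GM) => //; apply: gZ'.
    by rewrite trmx_mul mulmxA -[_ *m k0 *m _]mulmxA kk0 mulmx1 ET mx_exp_invr.
  have e1 : \tr (E *m H0) = \tr (X' *m H0) + s * \tr (Y1 *m H0) + s ^+ 2 / 2 * \tr (Y2 *m H0) +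
      \tr ((E - (X' + s *: Y1 + (s ^+ 2 / 2) *: Y2)) *m H0).
    exact: tr_expand.
  have e2 : - \tr ((E - (X' + s *: Y1 + (s ^+ 2 / 2) *: Y2)) *m H0) <= c * s ^+ 3 * nrm H0.
    have trN (A : 'M[R]_n) : - \tr A = \tr (- A) by rewrite raddfN.
    rewrite trN -mulNmx (le_trans (entry_tr _ _)) // nrmN ler_wpM2r ?nrm_ge0 //.
  by rewrite e1 in fE; rewrite [leRHS]mulrAC; lra.
pose Y := X' *m H0 - H0 *m X'.
have gY : gR Y by apply: bracket_gR.
have trY Z : \tr ((Z *m X' - X' *m Z) *m H0) = \tr (Z *m Y) by apply: tr_bracket.
have YT : Y^T = - Y by apply: tr_skew => //; apply: aR_sym.
have Y0 : Y = 0.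
  (* First variation along the skew matrix [- Y = Y^T], which yields [\tr (Y^T *m Y) <= 0]. *)
  have [] := var (- Y) _ _; first by rewrite -scaleN1r; apply: gZ.
    by rewrite linearN /= YT.
  by rewrite trY -YT => h0 _; have [_] := trace_sq Y; apply.
have XH : X' *m H0 = H0 *m X' by apply/eqP; rewrite -subr_eq0; apply/eqP.
have supp p q : pcoord P iR X' p q != 0 -> chr (delta_char p q) by apply: regular_centralizer XH.
pose V' := V *m k0^T.
have k0Tu : k0^T \in unitmx by rewrite unitmx_tr.
have V'u : V' \in unitmx by rewrite unitmx_mul Vu.
have V'V : invmx V' = k0 *m invmx V.
  by apply: (can_inj (mulKmx V'u)); rewrite mulmxV // /V' -k0V mulmxA mulmxKV // mulmxV.
have dV t : dconj V' t = k0 *m dconj V t *m k0^T by rewrite /dconj V'V !mulmxA.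
have X'E : X' = dconj V' h by rewrite dV.
pose ex c := dconj V' (\row_i expR (c * h 0 i)).
have exE c : mx_exp (c *: X') = ex c.
  have -> : c *: X' = dconj V' (c *: h).
    rewrite X'E /dconj scalemxAl scalemxAr; congr (_ *m _ *m _).
    by apply/matrixP => i j; rewrite !mxE mulrnAr.
  by rewrite mx_exp_dconj_gen //; congr dconj; apply/rowP => i; rewrite !mxE.
have exM a b : ex a *m ex b = ex (a + b).
  by rewrite dconjM //; congr dconj; apply/rowP => i; rewrite !mxE mulrDl expRD.
have exT c : (ex c)^T = ex c by rewrite -exE -mx_exp_tr linearZ /= X'T.
have exG c : GR (ex c) by rewrite -exE; apply: gX'.
have exS c p q : (PR *m ex c *m invmx PR) p q != 0 -> chr (delta_char p q).
  rewrite -exE -mx_exp_conj // => h0; apply/(wt_eq0 Pu S_grp S_det S_conn S_diag iR).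
  apply: (mx_exp_support (e := fun p q => wt p q = (fun=> 0))) h0 => [a|a b c' ab bc|a b].
  - exact: wt_diag.
  - exact: wt_chain ab bc.
  - rewrite -scalemxAr -scalemxAl mxE mulf_eq0 negb_or => /andP[_ /supp].
    by move/(wt_eq0 Pu S_grp S_det S_conn S_diag iR).
have Sa : Spos S P iR (ex 2^-1).
  (* [sym_comm] puts squares of symmetric elements into A, so [exp (X' / 2)] is written as the
     square of [exp (X' / 4)]. *)
  rewrite (_ : 2^-1 = 4^-1 + 4^-1 :> R); last by field.
  by rewrite -exM; apply: sym_comm (exG _) (exT _) (exS _).
have /(Spos_expE Pu S_grp S_det S_diag) [H aH aE] := Sa.
have HX : H = 2^-1 *: X'.
  have /aP [w _ HE] := aH; move: aE; rewrite {1}HE mx_exp_dconj_gen // => /(dconj_map (@ln R) V'u PRu).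
  rewrite (_ : \row_i ln ((\row_j expR (w 0 j)) 0 i) = w); last by apply/rowP => i; rewrite !mxE expRK.
  rewrite -HE => <-; rewrite X'E /dconj scalemxAl scalemxAr; congr (_ *m _ *m _).
  by apply/matrixP => i j; rewrite !mxE expRK mulrnAr.
have X'H : X' = 1 *: H + H.
  by rewrite HX scale1r -scalerDl (_ : 2^-1 + 2^-1 = 1 :> R) ?scale1r //; field.
have aX' : aR X' by rewrite X'H; apply: (aR_linear Pu S_grp S_det S_diag).
have [au aT aa] : [/\ ex 2^-1 \in unitmx, (ex 2^-1)^T = ex 2^-1 &
    ex 2^-1 *m ex 2^-1 = k0 *m (g *m g^T) *m k0^T].
  split; [exact: Gu|exact: exT|rewrite exM qE -dV].
  rewrite (_ : 2^-1 + 2^-1 = 1 :> R); last by field.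
  by congr dconj; apply/rowP => i; rewrite !mxE mul1r lnK ?posrE.
exists k0^T, (invmx (ex 2^-1) *m k0 *m g), H; split.
- exact: GT.
- by apply: (GM) => //; apply: (GM) => //; apply: GV.
- by rewrite trmxK -k0V mulVmx.
- rewrite !trmx_mul trmx_inv aT !mulmxA -(mulmxA _ g) -(mulmxA _ k0) -(mulmxA _ (k0 *m _)) -aa.
  by rewrite mulmxA mulVmx // mul1mx mulmxV.
split=> //; last by rewrite -aE; apply: polar_product => //; rewrite -k0V mulVmx.
(* For a root vector [E] of the simple root, [Z = E - E^T] is skew and [T = E + E^T] symmetric; the
   second variation along [Z] is [- x] times the squared norm of [T]. *)
move=> i; have [dr _ _] := basis; have [fal al0 [E [gE rE] E0]] := dr i.
pose x := Delta i X'; have xH : x = Delta i H *+ 2.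
  by rewrite /x X'H; have [-> //] := fal; rewrite mul1r mulr2n.
pose T := E + E^T; pose Z := E - E^T.
have rET H' : aR H' -> H' *m E^T - E^T *m H' = - (Delta i H') *: E^T.
  move=> aH'; have := congr1 trmx (rE H' aH'); rewrite linearB linearZ /= !trmx_mul (aR_sym aH').
  by rewrite scaleNr => <-; rewrite opprB.
have bZ H' : aR H' -> H' *m Z - Z *m H' = Delta i H' *: T.
  move=> aH'; apply: bracket_antisym; [exact: rE|exact: rET].
have gZ' : gR Z.
  by apply: gD => //; rewrite -scaleN1r; apply: gZ; apply: gtr.
have ZT : Z^T = - Z by rewrite /Z linearB /= trmxK opprB.
have TT : T^T = T by rewrite /T linearD /= trmxK addrC.
have B1 : Z *m X' - X' *m Z = - x *: T by rewrite scaleNr -bZ // opprB.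
have [_] := var Z gZ' ZT; rewrite trY Y0 mulmx0 linear0 => /(_ erefl).
rewrite B1 -scalemxAr -scalemxAl -scalerBr -scalemxAl mxtraceZ.
have -> : \tr ((Z *m T - T *m Z) *m H0) = \tr (T^T *m T).
  by rewrite TT tr_bracket2 bZ // H01 scale1r.
have [t0 tT] := trace_sq T; have tpos : 0 < \tr (T^T *m T).
  rewrite lt_neqAle t0 andbT eq_sym; apply/eqP => t00.
  have T0 : T = 0 by apply: tT; rewrite t00.
  have EE : E^T = - E by apply/eqP; rewrite -addr_eq0 addrC -/T T0.
  have h1 := rE H0 aH0; have h2 := rET H0 aH0; rewrite H01 scale1r in h1; rewrite H01 scaleN1r EE opprK in h2.
  rewrite mulmxN mulNmx opprK in h2; apply: E0; exact: skew_zero h1 h2.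
rewrite mulNr oppr_le0 pmulr_lge0 // xH => x0.
by move: x0; rewrite pmulrn_lge0.
Qed.

End RealCartanDecomposition.

(** * Integral matrices over the valuation ring *)

Section ConvexSubring.
Variables (F : rcfType) (O : convexSubring F).

Lemma csr1 : 1 \in O. Proof. by case: (csr_subring O). Qed.

Lemma csrB x y : x \in O -> y \in O -> x - y \in O.
Proof. by case: (csr_subring O) => _ h _; apply: h. Qed.

Lemma csrM x y : x \in O -> y \in O -> x * y \in O.
Proof. by case: (csr_subring O) => _ _; apply. Qed.

Lemma csr0 : 0 \in O. Proof. by rewrite -(subrr (1 : F)) csrB ?csr1. Qed.

Lemma csrN x : x \in O -> - x \in O.
Proof. by move=> Ox; rewrite -sub0r csrB ?csr0. Qed.

Lemma csrD x y : x \in O -> y \in O -> x + y \in O.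
Proof. by move=> Ox Oy; rewrite -[y]opprK csrB ?csrN. Qed.

Lemma csr_sum (I : Type) (r : seq I) (Q : pred I) (f : I -> F) :
  (forall i, Q i -> f i \in O) -> \sum_(i <- r | Q i) f i \in O.
Proof. by move=> h; apply: (big_ind (fun x => x \in O)) => //; [exact: csr0|exact: csrD]. Qed.

Lemma csr_prod (I : Type) (r : seq I) (Q : pred I) (f : I -> F) :
  (forall i, Q i -> f i \in O) -> \prod_(i <- r | Q i) f i \in O.
Proof. by move=> h; apply: (big_ind (fun x => x \in O)) => //; [exact: csr1|exact: csrM]. Qed.

Lemma csr_nat k : k%:R \in O.
Proof. by elim: k => [|k IH]; rewrite ?csr0 // -natr1 csrD ?csr1. Qed.

Lemma csrX x k : x \in O -> x ^+ k \in O.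
Proof. by move=> Ox; elim: k => [|k IH]; rewrite ?expr0 ?csr1 // exprS csrM. Qed.

Lemma csr_le x y : y \in O -> `|x| <= y -> x \in O.
Proof.
by move=> Oy; rewrite ler_norml; apply: (csr_convex (csrN Oy) Oy).
Qed.

Lemma csr_norm x : (`|x| \in O) = (x \in O).
Proof.
apply/idP/idP => [Ox|Ox]; first exact: csr_le Ox (lexx _).
by have [x0|/ltW x0] := leP 0 x; rewrite ?(ger0_norm x0) ?(ler0_norm x0) // csrN.
Qed.

(** An element above 1 in absolute value is dominated by its powers. *)
Lemma csr_rootX x k : x ^+ k.+1 \in O -> x \in O.
Proof.
move=> Oxk; have [x1|/ltW x1] := leP `|x| 1; first exact: csr_le csr1 x1.
apply: (@csr_le _ `|x ^+ k.+1|); first by rewrite csr_norm.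
by rewrite normrX ler_eXnr.
Qed.

Lemma csr_invn k : (k%:R)^-1 \in O.
Proof.
case: k => [|k]; first by rewrite invr0 csr0.
by apply: csr_le csr1 _; rewrite ger0_norm ?invr_ge0 // invf_le1 ?ltr0n // ler1n.
Qed.

(** K embeds in the archimedean field R, so its elements lie between integers; O contains the
    integers and is convex. *)
Lemma csr_map (K : rcfType) (R : realType) (iR : {rmorphism K -> R}) (iF : {rmorphism K -> F}) x :
  iF x \in O.
Proof.
have [k kx] : exists k : nat, - k%:R <= x <= k%:R.
  exists (Num.bound `|iR x|).
  have h : `|iR x| < (Num.bound `|iR x|)%:R by apply: archi_boundP; apply: normr_ge0.
  by move: (ltW h); rewrite ler_norml -(rmorph_nat iR) -rmorphN !(rcf_morph_le iR).
apply: (@csr_le _ k%:R); first exact: csr_nat.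
by rewrite ler_norml -(rmorph_nat iF) -rmorphN !(rcf_morph_le iF).
Qed.

Let cl (x : {x : F | x != 0}) : Lambda O := \pi_(Lambda O)%qT x.

Let clP (x y : {x : F | x != 0}) : nz_eqv O x y -> cl x = cl y.
Proof. by move=> h; apply/eqmodP. Qed.

Let clE (x y : {x : F | x != 0}) : cl x = cl y -> nz_eqv O x y.
Proof. by move/eqmodP. Qed.

Let rep (x : {x : F | x != 0}) : nz_eqv O (repr (cl x)) x.
Proof. by apply: clE; rewrite /cl reprK. Qed.

Let nz (x : {x : F | x != 0}) : val x != 0. Proof. by case: x. Qed.

Let div_trans (y x z : F) : y != 0 -> x / y \in O -> y / z \in O -> x / z \in O.
Proof. by move=> y0 xy yz; have := csrM xy yz; rewrite mulrA divfK. Qed.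

Let clM (x y z : {x : F | x != 0}) : val z = val x * val y -> cl x + cl y = cl z.
Proof.
move=> zE; rewrite -[LHS]/(Lambda_add (cl x) (cl y)) /Lambda_add; apply: clP.
have /andP[a b] := rep x; have /andP[c d] := rep y.
by apply/andP; rewrite /= zE; split; rewrite invfM mulrACA csrM.
Qed.

Let clV (x z : {x : F | x != 0}) : val z = (val x)^-1 -> - cl x = cl z.
Proof.
move=> zE; rewrite -[LHS]/(Lambda_opp (cl x)) /Lambda_opp; apply: clP.
have /andP[a b] := rep x.
by apply/andP; rewrite /= zE; split; rewrite invrK mulrC.
Qed.

Let cl_le (x y : {x : F | x != 0}) : (cl x <= cl y) = (val y / val x \in O).
Proof.
move: (rep x) (rep y); rewrite -[LHS]/(Lambda_le (cl x) (cl y)) /Lambda_le.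
move=> /andP[a b] /andP[c d].
apply/idP/idP => h.
  by apply: (div_trans (nz (repr (cl y)))) => //; apply: (div_trans (nz (repr (cl x)))).
by apply: (div_trans (nz y)) => //; apply: (div_trans (nz x)).
Qed.

Let nzVp (x : F) : x != 0 -> x^-1 != 0. Proof. by rewrite invr_eq0. Qed.

Let negvE (x : F) (x0 : x != 0) : negv O x = Some (cl (exist _ x^-1 (nzVp x0))).
Proof.
rewrite /negv; case: insubP => [y _ yx|]; last by rewrite x0.
by congr Some; apply: (clV (x := y)); rewrite /= yx.
Qed.

Let cl_surj (l : Lambda O) : exists2 x, x != 0 & negv O x = Some l.
Proof.
exists (val (repr l))^-1; first by rewrite invr_eq0 nz.
rewrite (negvE (nzVp (nz (repr l)))); congr Some; rewrite -[RHS]reprK; congr (\pi_(Lambda O)%qT _).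
by apply: val_inj; rewrite /= invrK.
Qed.

Lemma negv0 : negv O 0 = None.
Proof. by rewrite /negv; case: insubP => // x; rewrite eqxx. Qed.

Lemma negv_le x y : y != 0 -> leN (negv O x) (negv O y) = (x / y \in O).
Proof.
move=> y0; have [->|x0] := eqVneq x 0; first by rewrite negv0 mul0r csr0.
by rewrite !negvE [LHS]cl_le /= invrK mulrC.
Qed.

Lemma negv_eq0 x : x != 0 -> x \in O -> x^-1 \in O -> negv O x = Some 0.
Proof.
move=> x0 Ox OV; rewrite (negvE x0); congr Some.
transitivity (cl (exist _ 1 (oner_neq0 F))); last by [].
by apply: clP; apply/andP; rewrite /= invrK divr1 mul1r.
Qed.

Lemma negv_eq0P x : negv O x = Some 0 -> x \in O.
Proof. by move=> e; rewrite mem_csrE e /leN lexx. Qed.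

Lemma leN_total (k l : LambdaN O) : leN k l || leN l k.
Proof. by case: k l => [x|] [y|] //=; apply: le_total. Qed.

Lemma leN_trans (l k m : LambdaN O) : leN k l -> leN l m -> leN k m.
Proof. by case: k l m => [x|] [y|] [z|] //=; apply: le_trans. Qed.

Lemma maxN_le (k l m : LambdaN O) : leN (maxN k l) m <-> leN k m /\ leN l m.
Proof.
rewrite /maxN; case: ifP => kl; split=> [h|[]//]; split=> //; first exact: leN_trans kl h.
by apply: leN_trans h; move: (leN_total k l); rewrite kl.
Qed.

Lemma big_maxN_le (I : finType) (f : I -> LambdaN O) m :
  leN (\big[@maxN F O/None]_i f i) m <-> forall i, leN (f i) m.
Proof.
have h (r : seq I) : leN (\big[@maxN F O/None]_(i <- r) f i) m <-> forall i, i \in r -> leN (f i) m.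
  elim: r => [|i r IH]; first by rewrite big_nil; split.
  rewrite big_cons maxN_le IH; split=> [[h1 h2] j|h].
    by rewrite inE => /orP[/eqP ->|/h2].
  by split=> [|j jr]; apply: h; rewrite inE ?eqxx ?jr ?orbT.
rewrite h; split=> h' i; first by apply: h'; rewrite mem_index_enum.
by move=> _; apply: h'.
Qed.

Definition intmx m n (X : 'M[F]_(m, n)) : Prop := forall i j, X i j \in O.

Lemma mx_negv_le n (X : 'M[F]_n) y : y != 0 ->
  leN (mx_negv O X) (negv O y) <-> intmx (y^-1 *: X).
Proof.
move=> y0; rewrite /mx_negv big_maxN_le; split=> h i.
  by move=> j; have /big_maxN_le /(_ j) := h i; rewrite negv_le // mxE mulrC.
by apply/big_maxN_le => j; rewrite negv_le // mulrC; have := h i j; rewrite mxE.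
Qed.

(** Halves in the value group exist because F has square roots of positive elements; after replacing
    the half by the value of some [z], the comparison is between squares, and O contains an element
    as soon as it contains its square. *)
Lemma halfN_le (k : LambdaN O) y : y != 0 -> leN (halfN k) (negv O y) = leN k (negv O (y ^+ 2)).
Proof.
case: k => // l y0.
pose Q := [set m : Lambda O | m *+ 2 = l]%classic.
have dbl x (x0 : x != 0) m : negv O x = Some m -> negv O (x ^+ 2) = Some (m *+ 2).
  rewrite (negvE x0) (negvE (expf_neq0 2 x0)) => -[<-]; congr Some; symmetry.
  by apply: clM; rewrite /= expr2 invfM.
have [x x0 xl] := cl_surj l.
have Qex : exists m, Q m.
  pose s := Num.sqrt `|x|; have s0 : s != 0 by rewrite gt_eqF // sqrtr_gt0 normr_gt0.
  have := negvE s0; set m := cl _ => sm; exists m; rewrite /Q /=.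
  have := dbl s s0 m sm; rewrite sqr_sqrtr ?normr_ge0 // => e.
  have : negv O `|x| = negv O x; last by rewrite e xl => -[].
  have nx0 : `|x| != 0 by rewrite normr_eq0.
  rewrite (negvE nx0) (negvE x0); congr Some; apply: clP; apply/andP => /=.
  have [p|p] := leP 0 x; first by rewrite !(ger0_norm p) divff ?nzVp ?csr1.
  by rewrite !(ltr0_norm p) invrN mulNr divff ?nzVp // invrN mulrN divff ?nzVp // csrN ?csr1.
pose m := xget 0 Q; have Qm : Q m by apply: xgetPex.
have -> : halfN (Some l) = Some m by [].
have [z z0 zm] := cl_surj m.
have zl : negv O (z ^+ 2) = Some l by rewrite (dbl z z0 m zm) Qm.
rewrite -zm -zl !negv_le ?expf_neq0 // -expr_div_n.
by apply/idP/idP => [|/csr_rootX //]; apply: csrX.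
Qed.

Lemma intmxM m n p (X : 'M[F]_(m, n)) (Y : 'M[F]_(n, p)) : intmx X -> intmx Y -> intmx (X *m Y).
Proof. by move=> hX hY i j; rewrite mxE; apply: csr_sum => k _; apply: csrM. Qed.

Lemma intmxD m n (X Y : 'M[F]_(m, n)) : intmx X -> intmx Y -> intmx (X + Y).
Proof. by move=> hX hY i j; rewrite mxE; apply: csrD. Qed.

Lemma intmxZ m n c (X : 'M[F]_(m, n)) : c \in O -> intmx X -> intmx (c *: X).
Proof. by move=> Oc hX i j; rewrite mxE; apply: csrM. Qed.

Lemma intmx1 n : intmx (1%:M : 'M[F]_n).
Proof. by move=> i j; rewrite mxE; case: eqP => _; rewrite ?csr1 ?csr0. Qed.

Lemma intmxT m n (X : 'M[F]_(m, n)) : intmx X -> intmx X^T.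
Proof. by move=> h i j; rewrite mxE. Qed.

Lemma intmx_sum m n (I : Type) (r : seq I) (f : I -> 'M[F]_(m, n)) :
  (forall i, intmx (f i)) -> intmx (\sum_(i <- r) f i).
Proof. by move=> h i j; rewrite summxE; apply: csr_sum => k _; apply: h. Qed.

Lemma intmx_det n (X : 'M[F]_n) : intmx X -> \det X \in O.
Proof.
move=> h; apply: csr_sum => s _; apply: csrM; last by apply: csr_prod => i _.
by case: (perm.odd_perm s); rewrite ?expr0 ?expr1 ?csrN ?csr1.
Qed.

Lemma intmx_inv n (X : 'M[F]_n) : \det X = 1 -> intmx X -> intmx (invmx X).
Proof.
move=> d1 h; have Xu : X \in unitmx by rewrite unitmxE d1 unitr1.
rewrite /invmx Xu d1 invr1 scale1r => i j; rewrite mxE /cofactor.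
apply: csrM; first by apply: csrX; apply: csrN; apply: csr1.
by apply: intmx_det => a b; rewrite !mxE.
Qed.

(** A diagonal entry of [X *m X^T] is a sum of squares and dominates each of them. *)
Lemma intmx_gram n (X : 'M[F]_n) : intmx (X *m X^T) -> intmx X.
Proof.
move=> h i j; apply: (@csr_rootX _ 1); apply: (csr_le (h i i)).
rewrite ger0_norm ?sqr_ge0 // mxE (bigD1 j) //= [X^T j i]mxE -expr2 lerDl sumr_ge0 // => k _.
by rewrite [X^T k i]mxE -expr2 sqr_ge0.
Qed.

Lemma intmx_orth n (k : 'M[F]_n) : k *m k^T = 1%:M -> intmx k.
Proof. by move=> kk; apply: intmx_gram; rewrite kk; apply: intmx1. Qed.

End ConvexSubring.

(** * Exponentials of graded nilpotent matrices *)

Section GradedNilpotent.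
Variables (F : rcfType) (O : convexSubring F) (R : realType) (n : nat) (gr : 'I_n -> R).
Implicit Types (X Y N : 'M[F]_n).
Local Notation intmx := (intmx O).

(** The inequality is strict: matrices graded by 0 are strictly triangular once the coordinates are
    sorted by grade. *)
Definition graded (e : R) N : Prop := forall k l, N k l != 0 -> e < gr k - gr l.

(** Grade differences take finitely many values; the measure counts the pairs of smaller
    difference. *)
Lemma grade_ind (Q : 'I_n -> 'I_n -> Prop) :
  (forall k l, (forall p q, gr p - gr q < gr k - gr l -> Q p q) -> Q k l) -> forall k l, Q k l.
Proof.
move=> h k l; pose c (kl : 'I_n * 'I_n) := #|[pred pq : 'I_n * 'I_n | gr pq.1 - gr pq.2 < gr kl.1 - gr kl.2]|.
have [m] := ubnP (c (k, l)); elim: m => // m IH in k l *; rewrite ltnS => cm.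
apply: h => p q pq; apply: IH; apply: leq_trans cm; apply: proper_card.
apply/properP; split.
  by apply/fintype.subsetP => -[a b]; rewrite !inE /= => /lt_trans; apply.
by exists (p, q); rewrite !inE //= ltxx.
Qed.

Lemma gradedM d e X Y : graded d X -> graded e Y -> graded (d + e) (X *m Y).
Proof.
move=> hX hY k l; rewrite mxE => s0; rewrite ltNge; apply/negP => le.
move/eqP: s0; apply; apply: big1 => p _; apply/eqP; apply: contraLR le.
rewrite mulf_eq0 negb_or -ltNge => /andP[/hX a /hY b].
by rewrite (lt_le_trans (ltrD a b)) // addrA subrK.
Qed.

Lemma graded_wk d e X : d <= e -> graded e X -> graded d X.
Proof. by move=> de h k l /h; apply: le_lt_trans. Qed.

Lemma gradedX e N k : 0 <= e -> graded e N -> graded e (N ^+ k.+1).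
Proof.
move=> e0 h; elim: k => [|k IH]; first by rewrite expr1.
by rewrite mxXS; apply: (@graded_wk _ (e + e)); [rewrite lerDl|exact: gradedM].
Qed.

Lemma gradedX2 e N k : 0 <= e -> graded e N -> graded (e + e) (N ^+ k.+2).
Proof. by move=> e0 h; rewrite mxXS; apply: gradedM => //; apply: gradedX. Qed.

Lemma gradedD e X Y : graded e X -> graded e Y -> graded e (X + Y).
Proof.
move=> hX hY k l; rewrite mxE => h; have [X0|/hX //] := eqVneq (X k l) 0.
by apply: hY; rewrite X0 add0r in h.
Qed.

Lemma gradedZ e c X : graded e X -> graded e (c *: X).
Proof. by move=> h k l; rewrite mxE mulf_eq0 negb_or => /andP[_ /h]. Qed.

Lemma graded0 e : graded e 0.
Proof. by move=> k l; rewrite mxE eqxx. Qed.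

Lemma graded_sum e (I : Type) (r : seq I) (f : I -> 'M[F]_n) :
  (forall i, graded e (f i)) -> graded e (\sum_(i <- r) f i).
Proof.
move=> h; elim: r => [|i r IH]; first by rewrite big_nil; apply: graded0.
by rewrite big_cons; apply: gradedD.
Qed.

Lemma nilp_expE Y : (0 < n)%N ->
  nilp_exp Y = 1%:M + \sum_(i < n.-1) i.+1`!%:R^-1 *: Y ^+ i.+1.
Proof.
move=> n0; rewrite /nilp_exp; case: n n0 Y => // m _ Y.
by rewrite big_ord_recl /= fact0 invr1 scale1r mxX0.
Qed.

(** For [n = 1] the truncated exponential has no linear term, whence the second alternative. *)
Lemma nilp_exp_tail Y : (0 < n)%N -> nilp_exp Y = 1%:M + Y + 
   (\sum_(i < n.-2) i.+2`!%:R^-1 *: Y ^+ i.+2) \/ n = 1%N.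
Proof.
move=> n0; rewrite nilp_expE //; case: n n0 Y => [//|[|m]] _ Y; [by right|left].
by rewrite big_ord_recl /= invr1 scale1r expr1 addrA.
Qed.

Lemma graded_diag e Y k : 0 <= e -> graded e Y -> Y k k = 0.
Proof.
move=> e0 h; apply/eqP; apply: contraT => /h; rewrite subrr => e1.
by have := le_lt_trans e0 e1; rewrite ltxx.
Qed.

Lemma nilp_exp_graded e Y : 0 <= e -> graded e Y -> graded e (nilp_exp Y - 1%:M).
Proof.
move=> e0 h k l; have n0 : (0 < n)%N by case: (n) k => // -[].
rewrite nilp_expE // addrC addKr; move: k l; apply: graded_sum => i.
by apply: gradedZ; apply: gradedX.
Qed.

(** Powers of exponent at least 2 live in grades above [e + e]. *)
Lemma nilp_exp_first e Y k l : 0 <= e -> graded e Y -> gr k - gr l <= e + e ->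
  (nilp_exp Y - 1%:M) k l = Y k l.
Proof.
move=> e0 h kl; have n0 : (0 < n)%N by case: (n) k {kl} => // -[].
have [->|n1] := nilp_exp_tail Y n0.
  rewrite -[1%:M + Y + _]addrA [X in X - 1%:M]addrC addrK mxE summxE big1 ?addr0 // => i _.
  have := @gradedZ _ (i.+2`!%:R^-1) _ (@gradedX2 e Y i e0 h) k l.
  by case: eqP => // _ /(_ isT); rewrite ltNge kl.
have kl1 : k = l by move: (k) (l); rewrite n1 => a b; rewrite !ord1.
rewrite kl1 (graded_diag _ e0 h); apply: (@graded_diag e) => //; exact: nilp_exp_graded.
Qed.

Lemma intmxX (Z : 'M[F]_n) k : intmx Z -> intmx (Z ^+ k).
Proof. by move=> hZ; elim: k => [|k IH]; [rewrite mxX0; apply: intmx1|rewrite mxXS; apply: intmxM]. Qed.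

(* Only the entries of exp Y on the support of Y matter: by induction on the grade. *)
Lemma intmx_nilp_exp_support Y : graded 0 Y ->
  (forall k l, Y k l != 0 -> nilp_exp Y k l \in O) -> intmx Y.
Proof.
move=> h hE; apply: grade_ind => k l IH; have n0 : (0 < n)%N by case: (n) k {IH} => // -[].
pose Yr := \matrix_(p, q) (if gr p - gr q < gr k - gr l then Y p q else 0).
have Yri : intmx Yr by move=> p q; rewrite mxE; case: ifP => [/IH //|_]; exact: csr0.
(* In a product path of length at least 2 from [k] to [l] that contributes, every step has a smaller
   grade difference than the pair itself; so [Y] may be replaced by its truncation [Yr], which is
   integral by induction. *)
have pw j : (Y ^+ j.+2) k l = (Yr ^+ j.+2) k l.
  have gen i p q : gr p - gr q < gr k - gr l -> (Y ^+ i.+1) p q = (Yr ^+ i.+1) p q.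
    elim: i p q => [|i IHi] p q pq; first by rewrite !expr1 mxE pq.
    rewrite !(mxXS _ i.+1) !mxE; apply: eq_bigr => a _.
    have [Ypa|Ypa] := eqVneq (Y p a) 0; first by rewrite mxE Ypa if_same !mul0r.
    have g1 := h _ _ Ypa.
    have aq : gr a - gr q < gr k - gr l.
      by apply: le_lt_trans pq; rewrite lerD2r; move: g1; rewrite subr_gt0 => /ltW.
    rewrite (IHi _ _ aq) mxE; case: ifP => // /negbT; rewrite -leNgt => kpa.
    have [->|Yaq] := eqVneq ((Yr ^+ i.+1) a q) 0; first by rewrite !mulr0.
    have gYr : graded 0 (Yr ^+ i.+1).
      by apply: gradedX => // u v; rewrite mxE; case: ifP => // _; [apply: h|rewrite eqxx].
    have := gYr _ _ Yaq; rewrite subr_gt0 => qa.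
    by have := le_lt_trans kpa (lt_trans _ pq); rewrite ltrD2l ltrN2 qa ltxx => /(_ isT).
  rewrite !(mxXS _ j.+1) !mxE; apply: eq_bigr => a _.
  have [Yka|Yka] := eqVneq (Y k a) 0; first by rewrite mxE Yka if_same !mul0r.
  have g1 := h _ _ Yka; rewrite subr_gt0 in g1.
  rewrite gen ?ltrD2r // mxE; case: ifP => // /negbT; rewrite -leNgt lerD2l lerN2 => la.
  have [->|Yal] := eqVneq ((Yr ^+ j.+1) a l) 0; first by rewrite !mulr0.
  have gYr : graded 0 (Yr ^+ j.+1).
    by apply: gradedX => // u v; rewrite mxE; case: ifP => // _; [apply: h|rewrite eqxx].
  by have := gYr _ _ Yal; rewrite subr_gt0 ltNge la.
have [E|n1] := nilp_exp_tail Y n0; last first.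
  have kl1 : k = l by move: (k) (l); rewrite n1 => a b; rewrite !ord1.
  by rewrite kl1 (graded_diag _ (lexx 0) h) csr0.
have [->|Ykl] := eqVneq (Y k l) 0; first exact: csr0.
have := hE k l Ykl; rewrite E !mxE summxE => Ot.
have -> : Y k l = (1%:M : 'M[F]_n) k l + Y k l + \sum_(i < n.-2) (i.+2`!%:R^-1 *: Y ^+ i.+2) k l
   - ((1%:M : 'M[F]_n) k l + \sum_(i < n.-2) (i.+2`!%:R^-1 *: Y ^+ i.+2) k l) by ring.
apply: csrB; first by rewrite mxE.
apply: csrD; first exact: intmx1.
apply: csr_sum => i _; rewrite mxE pw; apply: csrM; first exact: csr_invn.
exact: intmxX.
Qed.

Lemma intmx_nilp_exp Y : graded 0 Y -> intmx (nilp_exp Y) <-> intmx Y.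
Proof.
move=> h; split=> [hE|hY]; first by apply: intmx_nilp_exp_support => // k l _; apply: hE.
by apply: intmx_sum => i; apply: intmxZ; [apply: csr_invn|apply: intmxX].
Qed.

Lemma nilp_exp_wgraded eta Y : 0 < eta -> (forall k l, Y k l != 0 -> eta <= gr k - gr l) ->
  forall k l, (nilp_exp Y - 1%:M) k l != 0 -> eta <= gr k - gr l.
Proof.
move=> e0 hY k l v0; rewrite leNgt; apply/negP => lt.
have gY e : e < eta -> graded e Y by move=> ee p q /hY; apply: lt_le_trans.
have g0 : 0 < gr k - gr l.
  by apply: (nilp_exp_graded (lexx 0) (gY _ e0)).
by have := nilp_exp_graded (ltW g0) (gY _ lt) v0; rewrite ltxx.
Qed.

(** Cross terms between the deviations from 1 have grade above [e + e]; up to that grade the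
    deviation of a product is the sum of the deviations. *)
Lemma graded_prod e (I : Type) (q : seq I) (v : I -> 'M[F]_n) : 0 <= e ->
  (forall i, graded e (v i - 1%:M)) -> graded e (\prod_(i <- q) v i - 1%:M) /\
  forall k l, gr k - gr l <= e + e -> (forall i, (v i - 1%:M) k l = 0) ->
    (\prod_(i <- q) v i - 1%:M) k l = 0.
Proof.
move=> e0 hv; elim: q => [|i q [IH1 IH2]].
  by rewrite big_nil subrr; split=> [|k l _ _]; [exact: graded0|rewrite mxE].
have E : \prod_(j <- i :: q) v j - 1%:M = (v i - 1%:M) + ((\prod_(j <- q) v j - 1%:M) +
    (v i - 1%:M) *m (\prod_(j <- q) v j - 1%:M)).
  rewrite big_cons; move: (\prod_(j <- q) v j) => B.
  rewrite mulmxBl !mulmxBr !mul1mx mulmx1 -/(v i * B).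
  by apply/matrixP => a b; rewrite !mxE; ring.
have g2 : graded (e + e) ((v i - 1%:M) *m (\prod_(j <- q) v j - 1%:M)) by apply: gradedM.
rewrite E; split=> [|k l kl h0].
  by do 2?apply: gradedD => //; apply: graded_wk g2; rewrite lerDl.
rewrite [LHS]mxE h0 add0r [LHS]mxE (IH2 _ _ kl h0) add0r; apply/eqP; apply: contraTT kl => /g2.
by rewrite -ltNge.
Qed.

Lemma nilp_exp0 : nilp_exp 0 = 1%:M :> 'M[F]_n.
Proof.
apply/matrixP => k l; apply/eqP; rewrite -subr_eq0; apply: contraT => h.
have : (nilp_exp 0 - 1%:M : 'M[F]_n) k l != 0 by rewrite mxE [X in _ + X]mxE.
move/(@nilp_exp_graded `|gr k - gr l| 0 (normr_ge0 _) (graded0 _) k l).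
by move/lt_le_trans/(_ (ler_norm _)); rewrite ltxx.
Qed.

(** A nonzero entry of [N ^+ m] gives a chain of [m] strict descents of the grade among [n]
    indices. *)
Lemma graded_nilpotent N : graded 0 N -> N ^+ n = 0.
Proof.
move=> h; have gen m k l : (N ^+ m) k l != 0 -> (m <= #|[pred p : 'I_n | (gr p < gr k)%R]|)%N.
  elim: m k l => [//|m IH] k l; rewrite mxXS mxE => s0.
  have [a] : exists a, N k a * (N ^+ m) a l != 0.
    apply: contrapT => /forallNP h0; move/eqP: s0; apply; apply: big1 => a _.
    by apply/eqP; apply: contraT => h1; case: (h0 a).
  rewrite mulf_eq0 negb_or => /andP[/h]; rewrite subr_gt0 => ak /IH cm.
  apply: leq_ltn_trans cm _; apply: proper_card; apply/properP; split.
    by apply/fintype.subsetP => p; rewrite !inE => /lt_trans; apply.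
  by exists a; rewrite !inE ?ltxx.
apply/matrixP => k l; rewrite [RHS]mxE; apply/eqP; apply: contraT => /gen.
rewrite -{1}(card_ord n) leqNgt => /negP []; apply: proper_card.
by apply/properP; split; [apply/fintype.subsetP|exists k; rewrite ?inE ?ltxx].
Qed.

Lemma nilp_exp_conj (Q X : 'M[F]_n) : Q \in unitmx ->
  nilp_exp (Q *m X *m invmx Q) = Q *m nilp_exp X *m invmx Q.
Proof.
move=> Qu; have eX k : (Q *m X *m invmx Q) ^+ k = Q *m X ^+ k *m invmx Q.
  elim: k => [|k IH]; first by rewrite !mxX0 mulmx1 mulmxV.
  by rewrite !mxXS IH !mulmxA mulmxKV.
rewrite /nilp_exp mulmx_sumr mulmx_suml; apply: eq_bigr => k _.
by rewrite eX -scalemxAr -scalemxAl.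
Qed.

End GradedNilpotent.

(** * Root spaces and the Cartan decomposition over F *)

Section TransferToF.
Variables (K : rcfType) (C : numFieldType) (jC : {rmorphism K -> C}) (n : nat).
Variables (G S : set (mxpoly K n)) (P : 'M[K]_n).
Hypotheses (Pu : P \in unitmx) (S_grp : mx_group (zeros jC S))
  (S_det : (zeros jC S `<=` [set x | \det x = 1])%classic)
  (S_conn : zariski_connected (zeros jC S))
  (S_diag : split_by jC P (zeros jC S)).
Variables (R : realType) (F : rcfType) (iR : {rmorphism K -> R}) (iF : {rmorphism K -> F}).
Notation wt := (wt S P iR).
Let PF := map_mx iF P.

(** The support of a root space in the coordinates [P] is a first-order condition, so the
    F-extension inherits it. *)
Lemma gF_support al X k l : is_functional iR S al -> gF iR iF G S al X ->
  (PF *m X *m invmx PF) k l != 0 -> wt k l = al.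
Proof.
move=> fal [D [DE DX]]; apply: contra_neqP => ne.
pose f := FAll 0 (FImp (FSa D (MVar K n 0)) (FZero (conj_genmx P k l) (MVar K n 0))).
have : msat iR (fun=> 0) f.
  rewrite /f msatE => Y; rewrite !msatE DE /= => rY; rewrite ev_conj_genmx.
  have [_ h] := (root_spaceP G Pu S_grp S_det S_diag Y fal).1 rY.
  by apply/eqP; apply: contraT => /h.
move/(transfer_closed iR)/(transfer_closed iF); rewrite /f msatE => /(_ X).
by rewrite !msatE /= ev_conj_genmx; apply.
Qed.

(** The exponential of [H] is not a first-order expression; the element of A is quantified in its
    place, and nonnegativity of a weight at [H] becomes an inequality between two diagonal
    entries. *)
Lemma cartan_decomposition_transfer r (kk ll : 'I_r -> 'I_n) :
  (forall g, zeros iR G g -> exists k k' H, [/\ zeros iR G k, zeros iR G k', k *m k^T = 1%:M,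
    k' *m k'^T = 1%:M & [/\ aR iR S H, forall i, 0 <= wt (kk i) (ll i) H & g = k *m mx_exp H *m k']]) ->
  forall g, zeros iF G g -> exists k k' t, [/\ zeros iF G k, zeros iF G k', k *m k^T = 1%:M,
    k' *m k'^T = 1%:M & [/\ pos_row t, forall m, chars jC S P m -> zmono m t = 1,
      forall i, t 0 (ll i) <= t 0 (kk i) & g = k *m dconj PF t *m k']].
Proof.
move=> kak g Gg; have [Gf GfP] := zeros_finite G; have [D DE] := Spos_formula S P.
pose M (k : nat) := MVar K n k; pose Neg (t : mterm K n) := MMul (MConst (- 1%:M)) t.
pose T := [seq genmx K n ij.1 ij.2 | ij <- enum {: 'I_n * 'I_n}].
have TP (L : rcfType) (i' : {rmorphism K -> L}) (z : 'M[L]_n) :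
    (forall p, p \in T -> ev i' p z = 0) <-> z = 0.
  split=> [h|-> p /mapP [ij _ ->]]; last by rewrite ev_genmx mxE.
  apply/matrixP => i j; rewrite -(ev_genmx i' i j z) [RHS]mxE; apply: h.
  by apply/mapP; exists (i, j); rewrite ?mem_enum.
have NegP (L : rcfType) (i' : {rmorphism K -> L}) (x y : 'M[L]_n) :
    x + map_mx i' (- 1%:M) *m y = 0 <-> x = y.
  rewrite map_mxN map_mx1 mulNmx mul1mx; split=> [/eqP|->]; last by rewrite subrr.
  by rewrite subr_eq0 => /eqP.
pose f := FAll 0 (FImp (FZeros Gf (M 0)) (FEx 1 (FEx 2 (FEx 3
  (FAnd (FAnd (FZeros Gf (M 1)) (FZeros Gf (M 2)))
  (FAnd (FAnd (FZeros T (MAdd (MMul (M 1) (MTr (M 1))) (Neg (MConst 1%:M))))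
              (FZeros T (MAdd (MMul (M 2) (MTr (M 2))) (Neg (MConst 1%:M)))))
  (FAnd (FAnd (FSa D (M 3)) (FConj (enum 'I_r)
           (fun i => FNot (FPos (conj_genmx P (ll i) (ll i) - conj_genmx P (kk i) (kk i)) (M 3)))))
        (FZeros T (MAdd (M 0) (Neg (MMul (MMul (M 1) (M 3)) (M 2)))))))))))) : mform K n.
have fP (L : rcfType) (i' : {rmorphism K -> L}) : msat i' (fun=> 0) f <->
   forall x, zeros i' G x -> exists k k' a, [/\ zeros i' G k, zeros i' G k', k *m k^T = 1%:M,
    k' *m k'^T = 1%:M & [/\ Spos S P i' a, forall i,
       (map_mx i' P *m a *m invmx (map_mx i' P)) (ll i) (ll i) <= (map_mx i' P *m a *m invmx (map_mx i' P)) (kk i) (kk i)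
       & x = k *m a *m k']].
  have bodyP x k k' a : msat i' (upd (upd (upd (upd (fun=> 0) 0 x) 1 k) 2 k') 3 a)
    (FAnd (FAnd (FZeros Gf (M 1%N)) (FZeros Gf (M 2%N)))
    (FAnd (FAnd (FZeros T (MAdd (MMul (M 1%N) (MTr (M 1%N))) (Neg (MConst 1%:M))))
              (FZeros T (MAdd (MMul (M 2%N) (MTr (M 2%N))) (Neg (MConst 1%:M)))))
    (FAnd (FAnd (FSa D (M 3%N)) (FConj (enum 'I_r)
           (fun i => FNot (FPos (conj_genmx P (ll i) (ll i) - conj_genmx P (kk i) (kk i)) (M 3%N)))))
        (FZeros T (MAdd (M 0%N) (Neg (MMul (MMul (M 1%N) (M 3%N)) (M 2%N)))))))) <->
    [/\ zeros i' G k, zeros i' G k', k *m k^T = 1%:M,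
    k' *m k'^T = 1%:M & [/\ Spos S P i' a, forall i,
       (map_mx i' P *m a *m invmx (map_mx i' P)) (ll i) (ll i) <= (map_mx i' P *m a *m invmx (map_mx i' P)) (kk i) (kk i)
       & x = k *m a *m k']].
    rewrite !msatAnd !msatZeros msatSa msatConj DE !TP -!GfP /= !map_mx1 !NegP.
    have e i : ev i' (conj_genmx P (ll i) (ll i) - conj_genmx P (kk i) (kk i)) a =
      (map_mx i' P *m a *m invmx (map_mx i' P)) (ll i) (ll i) - (map_mx i' P *m a *m invmx (map_mx i' P)) (kk i) (kk i).
      by rewrite evD evN !ev_conj_genmx.
    split.
      move=> [[h1 h2] [[h3 h4] [[h5 h6] h7]]]; split=> //; split=> // i.
      have := h6 i (mem_enum _ _); rewrite /upd /= e subr_gt0 => /negP.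
      by rewrite -leNgt.
    move=> [h1 h2 h3 h4 [h5 h6 h7]]; do !split=> //.
    by move=> i _; rewrite /upd /= e subr_gt0; apply/negP; rewrite -leNgt.
  rewrite /f msatE; split=> h x.
    move=> /GfP Gx; have := h x; rewrite msatE !msatZeros => /(_ Gx).
    rewrite msatEx => -[k]; rewrite msatEx => -[k']; rewrite msatEx => -[a] /bodyP hb.
    by exists k, k', a.
  rewrite msatE !msatZeros => /GfP Gx; have [k [k' [a hb]]] := h x Gx.
  rewrite msatEx; exists k; rewrite msatEx; exists k'; rewrite msatEx; exists a.
  exact/bodyP.
have SP := @Spos_expE _ _ _ _ _ _ Pu S_grp S_det S_diag _ iR.
have : msat iR (fun=> 0) f.
  apply/fP => x /kak [k [k' [H [h1 h2 h3 h4 [aH h5 h6]]]]].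
  exists k, k', (mx_exp H); split=> //; split=> //; first by apply/SP; exists H.
  move=> i; have PRu : map_mx iR P \in unitmx by rewrite map_unitmx.
  have /(aRP Pu S_grp S_det S_diag iR) [h _ HE] := aH; have := h5 i.
  move: aH; rewrite HE => aH; rewrite (wt_dconj Pu) // mx_exp_dconj // !(dconjK PRu) !mxE !eqxx !mulr1n.
  by rewrite ler_expR subr_ge0.
move/(transfer_closed iR)/(transfer_closed iF)/fP/(_ g Gg) => [k [k' [a [h1 h2 h3 h4 [Sa h5 h6]]]]].
have PFu : PF \in unitmx by rewrite map_unitmx.
have /(SposP Pu S_grp S_det S_diag) [t [t0 tm aE]] := Sa.
exists k, k', t; split=> //; split=> //; last by rewrite -aE.
by move=> i; have := h5 i; rewrite aE !(dconjK PFu) !mxE !eqxx !mulr1n.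
Qed.

End TransferToF.

Lemma fsbig_ge1_factor (F : rcfType) (T : choiceType) (A : set T) (f : T -> F) x :
  finite_set A -> (forall y, A y -> 1 <= f y) -> A x -> f x <= \big[*%R/1]_(y \in A) f y.
Proof.
move=> fA f1 Ax; rewrite fsbig_finite //= (big_rem x) /=; last by rewrite in_fset_set // inE.
rewrite ler_peMr ?(le_trans ler01) ?f1 // big_seq.
elim/big_ind: _ => [//|a b a1 b1|y yA]; first by rewrite -[1]mulr1 ler_pM ?ler01.
by apply: f1; move/mem_rem: yA; rewrite in_fset_set // inE.
Qed.

(** * The stabilizer of the base point *)

Section BasePoint.
Variables (K : rcfType) (C : numFieldType) (jC : {rmorphism K -> C}) (n : nat).
Variables (G S : set (mxpoly K n)) (P : 'M[K]_n).
Hypotheses (Pu : P \in unitmx) (S_grp : mx_group (zeros jC S))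
  (S_det : (zeros jC S `<=` [set x | \det x = 1])%classic)
  (S_conn : zariski_connected (zeros jC S))
  (S_diag : split_by jC P (zeros jC S)).
Variables (R : realType) (F : rcfType) (iR : {rmorphism K -> R}) (iF : {rmorphism K -> F}).
Variables (O : convexSubring F) (r : nat) (Delta : 'I_r -> functional R n).
Notation wt := (wt S P iR).
Notation chr := (chars jC S P).
Let PF := map_mx iF P.
Let PFu : PF \in unitmx. Proof. by rewrite map_unitmx. Qed.
Notation GF := (zeros iF G).
Notation intmx := (intmx O).

Definition Tor (t : 'rV[F]_n) : Prop := pos_row t /\ forall m, chr m -> zmono m t = 1.

Variables (kk ll : 'I_r -> 'I_n).
Hypotheses (GF_grp : mx_group GF) (GF_det : (GF `<=` [set x | \det x = 1])%classic)
  (AG : forall t, Tor t -> GF (dconj PF t)) (A_sym : forall t, Tor t -> (dconj PF t)^T = dconj PF t)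
  (chiE : forall k l t, Tor t -> chi iR iF S (wt k l) (dconj PF t) = t 0 k / t 0 l)
  (rootE : forall al, root_system iR G S al -> exists k l, al = wt k l)
  (root_fin : finite_set (root_system iR G S))
  (DeltaE : forall i, Delta i = wt (kk i) (ll i))
  (kak : forall g, GF g -> exists k k' t, [/\ GF k, GF k', k *m k^T = 1%:M, k' *m k'^T = 1%:M &
    [/\ Tor t, forall i, t 0 (ll i) <= t 0 (kk i) & g = k *m dconj PF t *m k']])
  (separate : forall la : 'I_n -> int, (forall m, chr m -> zdot m la = 0) ->
    (forall k l, root_system iR G S (wt k l) -> la k = la l) -> forall i, la i = 0).

Lemma AF_Tor a : AF iF S a <-> exists2 t, Tor t & a = dconj PF t.
Proof.
rewrite /AF (A_extE Pu S_grp S_det S_diag iR) (SposP Pu S_grp S_det S_diag).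
by split=> [[t [t0 tm aE]]|[t [t0 tm] aE]]; exists t.
Qed.

Lemma Tor_det t : Tor t -> \prod_i t 0 i = 1.
Proof. by move=> [_ tm]; rewrite -zmono_det; apply: tm; apply: chars_det. Qed.

Lemma PF_int : intmx PF /\ intmx (invmx PF).
Proof.
split; first by move=> i j; rewrite mxE; apply: csr_map iR _ _.
by rewrite -map_invmx => i j; rewrite mxE; apply: csr_map iR _ _.
Qed.

Lemma intmx_pf X : intmx X <-> intmx (PF *m X *m invmx PF).
Proof.
have [h1 h2] := PF_int; split=> h; first by apply: intmxM => //; apply: intmxM.
have -> : X = invmx PF *m (PF *m X *m invmx PF) *m PF by rewrite !mulmxA mulVmx // mul1mx mulmxKV.
by apply: intmxM => //; apply: intmxM.
Qed.

Lemma intmx_dconj t : intmx (dconj PF t) <-> forall i, t 0 i \in O.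
Proof.
rewrite intmx_pf dconjK //; split=> h i; first by have := h i i; rewrite mxE eqxx.
by move=> j; rewrite mxE; case: eqP => _; rewrite ?mulr1n ?mulr0n ?csr0.
Qed.

(** The coordinates have product 1, so the inverse of one is the product of the others. *)
Lemma Tor_inv t : Tor t -> (forall i, t 0 i \in O) -> forall i, (t 0 i)^-1 \in O.
Proof.
move=> Tt Ot i; have := Tor_det Tt; rewrite (bigD1 i) //= => e.
have ti : t 0 i != 0 by rewrite gt_eqF //; case: Tt.
suff -> : (t 0 i)^-1 = \prod_(j < n | j != i) t 0 j by apply: csr_prod.
by apply: (mulfI ti); rewrite divff.
Qed.

(** The exponents [m] for which [zmono m t] is a unit of O form a saturated lattice [M]. A vector
    orthogonal to [M] kills the characters trivial on S and all roots, hence is 0 by [separate]; so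
    the double orthogonal of [M] is everything. *)
Lemma units_of_roots t : Tor t -> (forall k l, root_system iR G S (wt k l) ->
    t 0 k / t 0 l \in O /\ t 0 l / t 0 k \in O) -> forall i, t 0 i \in O.
Proof.
move=> Tt h i; have [t0 tm] := Tt; have ut : unit_row t by move=> k; rewrite gt_eqF.
pose M m := zmono m t \in O /\ (zmono m t)^-1 \in O.
have Msat : saturated_lattice M.
  split=> [|l m [l1 l2] [m1 m2]|m k]; rewrite /M.
  - by rewrite /zmono big1 // invr1 csr1.
  - by rewrite zmonoB // invf_div mulrC; split; apply: csrM; rewrite // mulrC.
  - by rewrite zmonoX -exprVn => -[/csr_rootX a /csr_rootX b].
have [] : M (fun j => (j == i)%:Z); last first.
  by rewrite (zmono_nat (fun j => nat_of_bool (j == i))) mono1.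
apply: (lattice_perp_perp Msat) => la laM.
have la0 : forall j, la j = 0.
  apply: separate => [m cm|k l rkl].
    by apply: laM; rewrite /M tm // invr1 csr1.
  have : M (delta_char k l) by rewrite /M zmono_delta // invf_div; apply: h.
  by move/laM; rewrite zdot_delta => /eqP; rewrite subr_eq0 => /eqP.
by rewrite /zdot big1 // => j _; rewrite la0 mulr0.
Qed.

(** All factors of [NF] are at least 1, so the product lies in O only if each factor does, and then
    roots take unit values. *)
Lemma NF_unit t : Tor t -> negv O (NF iR iF G S (dconj PF t)) = Some 0 <-> forall i, t 0 i \in O.
Proof.
move=> Tt; have [t0 _] := Tt; set N := NF _ _ _ _ _.
pose f al := Num.max (chi iR iF S al (dconj PF t)) (chi iR iF S al (dconj PF t))^-1.
have fE k l : f (wt k l) = Num.max (t 0 k / t 0 l) (t 0 l / t 0 k) by rewrite /f chiE // invf_div.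
have f1 al : root_system iR G S al -> 1 <= f al.
  move=> /rootE [k [l ->]]; rewrite fE le_max; have [h|h] := leP (t 0 l) (t 0 k).
    by rewrite ler_pdivlMr // mul1r h.
  by rewrite [X in _ || X]ler_pdivlMr // mul1r (ltW h) orbT.
have N1 : 1 <= N.
  rewrite /N /NF fsbig_finite //= big_seq; elim/big_ind: _ => [//|a b a1 b1|al].
    by rewrite -[1]mulr1 ler_pM ?ler01.
  by rewrite in_fset_set // inE => /f1.
split=> [/negv_eq0P NO|Ot].
  apply: units_of_roots => // k l rkl.
  have fO : f (wt k l) \in O.
    apply: (csr_le NO); rewrite ger0_norm ?(le_trans ler01) ?f1 //.
    exact: (fsbig_ge1_factor (f := f)).
  have p a b : 0 <= t 0 a / t 0 b by rewrite divr_ge0 ?ltW.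
  by split; apply: (csr_le fO); rewrite ger0_norm // fE le_max lexx ?orbT.
apply: negv_eq0; first by rewrite gt_eqF // (lt_le_trans ltr01).
  rewrite /N /NF fsbig_finite //= big_seq; apply: csr_prod => al.
  rewrite in_fset_set // inE => /rootE [k [l ->]]; rewrite -/(f _) fE.
  by rewrite maxEle; case: ifP => _; apply: csrM => //; apply: Tor_inv.
by apply: (csr_le (@csr1 _ O)); rewrite ger0_norm ?invr_ge0 ?(le_trans ler01) // invf_le1 // (lt_le_trans ltr01).
Qed.

Notation bp := (base_point iR iF G S Delta O).

(** Whatever Cartan component [delta] selects, [y] is conjugate to its square by an orthogonal
    matrix, and orthogonal matrices are integral together with their inverses. *)
Lemma base_pointE y : bp y <-> XF iF G y /\ intmx y.
Proof.
suff h : XF iF G y -> (dist iR iF G S Delta O 1%:M y = Some 0 <-> intmx y).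
  by split=> -[Xy hy]; split=> //; apply/h.
move=> [g Gg yE]; rewrite /dist /delta; set Q := (X in xget _ X).
have [Gu G1 GM GV] := GF_grp.
have [a] : Q !=set0.
  have [k [k' [t [Gk Gk' kT k'T [Tt tD gE]]]]] := kak Gg.
  exists (dconj PF t); split.
    split; first by apply/AF_Tor; exists t.
    by move=> i; rewrite DeltaE chiE // ler_pdivlMr ?mul1r ?tD //; case: Tt.
  exists 1%:M, g; split=> //; first by rewrite /act trmx1 !mulmx1.
  exists k, k'; split; try by split=> //; apply: GF_det.
  by rewrite invmx1 mul1mx.
move=> Qa; have := xgetI 1%:M Qa; set a' := xget _ _.
move=> [[/AF_Tor [t Tt ->] _] [g1 [h [_ _ g11 yh [k [k' [[Gk kT _] [_ k'T _] hE]]]]]]].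
have g1u : g1 \in unitmx.
  have /mulmx1_unit [] // : g1 *m g1^T = 1%:M by rewrite g11 /act mulmx1.
have yE' : y = (g1 *m k) *m (dconj PF t *m dconj PF t) *m (g1 *m k)^T.
  have -> : y = h *m h^T by rewrite yh /act mulmx1.
  have -> : h = g1 *m k *m dconj PF t *m k' by rewrite -[LHS](mulKVmx g1u) hE !mulmxA.
  have gen (A B D E : 'M[F]_n) : D^T = D -> E *m E^T = 1%:M ->
      A *m B *m D *m E *m (A *m B *m D *m E)^T = A *m B *m (D *m D) *m (A *m B)^T.
    by move=> DT EE; rewrite !trmx_mul DT !mulmxA -(mulmxA _ E) EE mulmx1.
  by apply: gen => //; apply: A_sym.
pose o := g1 *m k; have oT : o *m o^T = 1%:M.
  by rewrite /o trmx_mul mulmxA -(mulmxA g1) kT mulmx1 g11 /act mulmx1.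
have oT' : o^T *m o = 1%:M by apply: mulmx1C.
have oi : intmx o by apply: intmx_orth oT.
have oTi := intmxT oi.
rewrite NF_unit // yE' dconjM // -/o.
have -> : intmx (o *m dconj PF (hadamard t t) *m o^T) <-> intmx (dconj PF (hadamard t t)).
  split=> h'; last by apply: intmxM => //; apply: intmxM.
  have -> : dconj PF (hadamard t t) = o^T *m (o *m dconj PF (hadamard t t) *m o^T) *m o.
    have gen (o' Z : 'M[F]_n) : o'^T *m o' = 1%:M -> Z = o'^T *m (o' *m Z *m o'^T) *m o'.
      by move=> oo; rewrite !mulmxA oo mul1mx -mulmxA oo mulmx1.
    exact: gen.
  by apply: intmxM => //; apply: intmxM.
rewrite intmx_dconj; split=> Ot i; first by rewrite mxE csrM.
by apply: (@csr_rootX _ _ _ 1); have := Ot i; rewrite mxE -expr2.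
Qed.

Lemma actBM x y (p : bpoint F n) : actB (x *m y) p = actB x (actB y p).
Proof.
have e : act (x *m y) = act x \o act y by apply/funext => z; rewrite /act /= trmx_mul !mulmxA.
by rewrite /actB e ?image_comp.
Qed.

Lemma actB1 (p : bpoint F n) : actB 1%:M p = p.
Proof.
have e : act (1%:M : 'M[F]_n) = id by apply/funext => z; rewrite /act trmx1 mul1mx mulmx1.
by rewrite /actB e image_id.
Qed.

Lemma act_int h y : GF h -> intmx h -> bp y -> bp (act h y).
Proof.
move=> Gh hi /base_pointE [[g Gg yE] yi]; apply/base_pointE; have [_ _ GM _] := GF_grp.
split; last by apply: intmxM; [apply: intmxM|apply: intmxT].
exists (h *m g); first exact: GM.
by rewrite yE /act trmx_mul !mulmxA.
Qed.

Lemma actB_base h : GF h -> (actB h bp = bp <-> intmx h).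
Proof.
move=> Gh; have [Gu G1 _ GV] := GF_grp; have hu := Gu _ Gh.
split=> [e|hi].
  have b1 : bp 1%:M.
    by apply/base_pointE; split; [exists 1%:M => //; rewrite /act trmx1 !mulmx1|exact: intmx1].
  have : bp (act h 1%:M) by rewrite -e; exists 1%:M.
  by move=> /base_pointE [_]; rewrite /act mulmx1 => /intmx_gram.
have hVi : intmx (invmx h) by apply: intmx_inv => //; apply: GF_det.
apply/seteqP; split=> [_ [y By <-]|y By]; first exact: act_int.
exists (act (invmx h) y); first by apply: act_int => //; apply: GV.
by rewrite /act trmx_inv !mulmxA mulmxV // mul1mx mulmxKV // unitmx_tr.
Qed.

Lemma actB_eq g h : GF g -> GF h -> (actB g bp = actB h bp <-> intmx (invmx h *m g)).
Proof.
move=> Gg Gh; have [Gu G1 GM GV] := GF_grp; have hu := Gu _ Gh.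
rewrite -actB_base; last by apply: GM => //; apply: GV.
rewrite actBM; split=> [->|e]; first by rewrite -actBM mulVmx // actB1.
by rewrite -[LHS]actB1 -(mulmxV hu) actBM e.
Qed.

End BasePoint.

(** * Unipotent elements as points of G over F *)

Lemma fsum_list (T : choiceType) (A : set T) : finite_set A -> exists s : seq T,
  [/\ uniq s, forall x, x \in s <-> A x &
      forall (V : nmodType) (f : T -> V), \sum_(x \in A) f x = \sum_(x <- s) f x].
Proof.
move=> fA; exists (finmap.enum_fset (fset_set A)); split; first exact: finmap.fset_uniq.
  move=> x; have h := in_fset_set fA x; split=> [xs|Ax]; first by apply: set_mem; rewrite -h; exact: xs.
  by have : x \in A := mem_set Ax; rewrite -h.
by move=> V f; rewrite fsbig_finite.
Qed.

Lemma sum_masks (L : comNzRingType) n (s : seq ('I_n * 'I_n)) (W : 'M[L]_n) : uniq s ->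
  \sum_(kl <- s) diag_mx (delta_mx 0 kl.1) *m W *m diag_mx (delta_mx 0 kl.2) =
  \matrix_(k, l) (if (k, l) \in s then W k l else 0).
Proof.
move=> us; apply/matrixP => k l; rewrite summxE [RHS]mxE.
have e (kl : 'I_n * 'I_n) : (diag_mx (delta_mx 0 kl.1) *m W *m diag_mx (delta_mx 0 kl.2)) k l =
    if kl == (k, l) then W k l else 0.
  case: kl => a b; rewrite mul_mx_diag mxE mul_diag_mx mxE !mxE xpair_eqE /=.
  by rewrite (eq_sym k) (eq_sym l); case: eqP => _; case: eqP => _; rewrite ?(mul1r, mulr1, mul0r, mulr0).
rewrite (eq_bigr _ (fun kl _ => e kl)).
case: ifP => kls; last by rewrite big_seq big1 // => kl h; case: eqP => // e1; rewrite -e1 h in kls.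
by rewrite (bigD1_seq (k, l)) //= eqxx big1 ?addr0 // => kl /negbTE ->.
Qed.

Section SumTerms.
Variables (K : rcfType) (n : nat).
Implicit Types t : mterm K n.

Definition tsum (I : Type) (s : seq I) (f : I -> mterm K n) : mterm K n :=
  foldr (fun i t => MAdd (f i) t) (MConst 0) s.

Definition tnexp t : mterm K n := tsum (enum 'I_n)
  (fun k => MMul (MConst ((k`!%:R : K)^-1)%:M) (iter k (MMul t) (MConst 1%:M))).

(** Selects the entries at the positions [s] in the coordinates [P], using only products with
    constant matrices; root components of a matrix thereby become terms of the language. *)
Definition tmask (P : 'M[K]_n) (s : seq ('I_n * 'I_n)) t : mterm K n := tsum s (fun kl =>
  MMul (MMul (MConst (invmx P *m diag_mx (delta_mx 0 kl.1) *m P)) t)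
       (MConst (invmx P *m diag_mx (delta_mx 0 kl.2) *m P))).

Variables (L : rcfType) (iota : {rmorphism K -> L}) (e : nat -> 'M[L]_n).

Lemma meval_tsum (I : Type) (s : seq I) f :
  meval iota e (tsum s f) = \sum_(i <- s) meval iota e (f i).
Proof. by elim: s => [|i s IH]; [rewrite big_nil /= map_mx0|rewrite big_cons /= IH]. Qed.

Lemma meval_tnexp t : meval iota e (tnexp t) = nilp_exp (meval iota e t).
Proof.
rewrite /tnexp meval_tsum big_enum /=; apply: eq_bigr => k _ /=.
rewrite map_scalar_mx mul_scalar_mx fmorphV rmorph_nat; congr (_ *: _).
by elim: (nat_of_ord k) => [|m IH] /=; [rewrite map_mx1 mxX0|rewrite IH mxXS].
Qed.

Lemma meval_tmask P s t : P \in unitmx -> uniq s ->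
  map_mx iota P *m meval iota e (tmask P s t) *m invmx (map_mx iota P) =
  \matrix_(k, l) (if (k, l) \in s then
    (map_mx iota P *m meval iota e t *m invmx (map_mx iota P)) k l else 0).
Proof.
move=> Pu us; have PLu : map_mx iota P \in unitmx by rewrite map_unitmx.
rewrite -sum_masks // /tmask meval_tsum mulmx_sumr mulmx_suml; apply: eq_bigr => kl _ /=.
rewrite !map_mxM map_invmx !map_diag_mx !map_delta_mx.
by rewrite !mulmxA mulmxV // mul1mx -[RHS]mulmxA mulmxK // !mulmxA.
Qed.

End SumTerms.

Section UnipotentTransfer.
Variables (K : rcfType) (C : numFieldType) (jC : {rmorphism K -> C}) (n : nat).
Variables (G S : set (mxpoly K n)) (P : 'M[K]_n).
Hypotheses (Pu : P \in unitmx) (S_grp : mx_group (zeros jC S))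
  (S_det : (zeros jC S `<=` [set x | \det x = 1])%classic)
  (S_diag : split_by jC P (zeros jC S)).
Variables (R : realType) (F : rcfType) (iR : {rmorphism K -> R}) (iF : {rmorphism K -> F}).
Notation wt := (wt S P iR).
Notation gR := (gR iR G).
Hypothesis gRsum : forall (I : Type) (s : seq I) (f : I -> 'M[R]_n),
  (forall i, gR (f i)) -> gR (\sum_(i <- s) f i).
Variables (r : nat) (Delta : 'I_r -> functional R n) (gr : 'I_n -> R).
Notation pos := (pos_roots iR G S Delta).
Hypotheses (gr_pos : forall k l, pos (wt k l) -> gr l < gr k) (pos_fin : finite_set pos).

(** Positive roots raise the grade, so the sum is nilpotent and its truncated exponential is the
    exponential of an element of the Lie algebra. *)
Lemma nilp_exp_real (Z : functional R n -> 'M[R]_n) :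
  (forall al, pos al -> root_space iR G S al (Z al)) ->
  zeros iR G (nilp_exp (\sum_(al \in pos) Z al)).
Proof.
move=> hZ; set N := \sum_(_ \in _) _.
have PRu : map_mx iR P \in unitmx by rewrite map_unitmx.
have [sq [_ sqP sqE]] := fsum_list pos_fin.
have NE : N = \sum_(al <- sq) (if `[< pos al >] then Z al else 0).
  rewrite /N sqE [LHS]big_seq [RHS]big_seq; apply: eq_bigr => al /sqP h.
  by rewrite asboolT.
have gN : gR N.
  rewrite NE; apply: gRsum => al; case: asboolP => [/hZ [] //|_].
  have := @gRsum 'I_0 [::] (fun=> 0); rewrite big_nil; apply; case=> //.
have sN : graded gr 0 (pcoord P iR N).
  move=> k l; rewrite subr_gt0 /pcoord NE mulmx_sumr mulmx_suml summxE => s0.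
  have [al] : exists al, (map_mx iR P *m (if `[< pos al >] then Z al else 0) *m invmx (map_mx iR P)) k l != 0.
    apply: contrapT => /forallNP h0; move/eqP: s0; apply; apply: big1 => al _.
    by apply/eqP; apply: contraT => h1; case: (h0 al).
  case: asboolP => [pal|_]; last by rewrite mulmx0 mul0mx mxE eqxx.
  have fal : is_functional iR S al by case: pal => -[].
  have [_ h] := (root_spaceP G Pu S_grp S_det S_diag (Z al) fal).1 (hZ _ pal).
  by move/h => e; apply: gr_pos; rewrite e.
have Nn : N ^+ n = 0.
  have eX k : pcoord P iR N ^+ k = map_mx iR P *m N ^+ k *m invmx (map_mx iR P).
    elim: k => [|k IH]; first by rewrite !mxX0 mulmx1 mulmxV.
    by rewrite !mxXS IH /pcoord !mulmxA mulmxKV.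
  have := eX n; rewrite (graded_nilpotent sN) => /(congr1 (fun M => invmx (map_mx iR P) *m M *m map_mx iR P)).
  by rewrite !mulmxA mulmxKV // mulVmx // mul1mx mulmx0 mul0mx.
have := gN 1; rewrite scale1r (mx_exp_nilpotent Nn); exact.
Qed.

Hypothesis gFsupp : forall al X k l, is_functional iR S al -> gF iR iF G S al X ->
  (map_mx iF P *m X *m invmx (map_mx iF P)) k l != 0 -> wt k l = al.

(** A single matrix variable holds the sum; as distinct roots have disjoint supports, masks recover
    the root components from it. *)
Lemma nilp_exp_transfer (X : functional R n -> 'M[F]_n) :
  (forall al, pos al -> gF iR iF G S al (X al)) ->
  zeros iF G (nilp_exp (\sum_(al \in pos) X al)).
Proof.
move=> hX; have [Gf GfP] := zeros_finite G.
have PFu : map_mx iF P \in unitmx by rewrite map_unitmx.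
have PVu : invmx (map_mx iF P) \in unitmx by rewrite unitmx_inv.
have /choice [D DP] : forall al, exists D, pos al ->
    sa_set iR D = root_space iR G S al /\ sa_set iF D (X al).
  move=> al; have [/hX [D hD]|np] := pselect (pos al); first by exists D.
  by exists (SaPos 0).
have [sq [sqU sqP' sqE]] := fsum_list pos_fin.
have sqP al : al \in sq -> pos al by move/sqP'.
pose kls (al : functional R n) := [seq kl <- enum {: 'I_n * 'I_n} | `[< wt kl.1 kl.2 = al >]].
have klsU al : uniq (kls al) by rewrite filter_uniq ?enum_uniq.
pose M al : mterm K n := tmask P (kls al) (MVar K n 0).
pose f := FAll 0 (FImp (FConj sq (fun al => FSa (D al) (M al)))
  (FZeros Gf (tnexp (tsum sq M)))) : mform K n.
have fsE (L : rcfType) (Z : functional R n -> 'M[L]_n) : \sum_(al \in pos) Z al = \sum_(al <- sq) Z al.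
  exact: sqE.
have : msat iR (fun=> 0) f.
  rewrite /f msatE => Y; rewrite !msatE msatConj => h; apply/GfP.
  rewrite meval_tnexp meval_tsum -fsE; apply: nilp_exp_real => al pal.
  have [<- _] := DP al pal; have := h al; rewrite msatSa; apply; exact/sqP'.
move/(transfer_closed iR)/(transfer_closed iF); rewrite /f msatE => /(_ (\sum_(al <- sq) X al)).
set e := upd _ _ _; have ME al : al \in sq -> meval iF e (M al) = X al.
  move=> sal; apply: (can_inj (mulKmx PFu)); apply: (can_inj (mulmxK PVu)).
  rewrite /M meval_tmask // /= /e /upd eqxx; apply/matrixP => k l; rewrite [LHS]mxE.
  have fn be : be \in sq -> is_functional iR S be by move/sqP; case=> -[].
  rewrite mem_filter mem_enum andbT /=; case: asboolP => [kl|kl]; last first.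
    by apply/eqP; rewrite eq_sym; apply: contra_notT kl; apply: gFsupp (fn _ sal) (hX _ (sqP _ sal)).
  rewrite mulmx_sumr mulmx_suml summxE (bigD1_seq al) //= big_seq_cond big1 ?addr0 // => be /andP[sbe ba].
  apply/eqP; apply: contraNT ba => /(gFsupp (fn _ sbe) (hX _ (sqP _ sbe))); rewrite kl => ->.
  exact: eqxx.
rewrite !msatE msatConj meval_tnexp meval_tsum fsE => h; apply/GfP.
have -> : \sum_(al <- sq) X al = \sum_(al <- sq) meval iF e (M al).
  by rewrite [LHS]big_seq [RHS]big_seq; apply: eq_bigr => al /ME ->.
by apply: h => al sal; rewrite msatSa ME //; have [] := DP al (sqP _ sal).
Qed.

End UnipotentTransfer.

(** * Fixed points of unipotent elements *)

Lemma twice_functional (K : rcfType) (R : realType) (iR : {rmorphism K -> R}) n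
    (S : set (mxpoly K n)) (al : functional R n) :
  is_functional iR S al -> is_functional iR S (twice al).
Proof.
case=> f1 f2; split=> [c X Y aX aY|X nX]; rewrite /twice; last by rewrite f2 // mul0rn.
by rewrite f1 // mulrnDl -mulrnAr.
Qed.

Section WeightArithmetic.
Variables (K : rcfType) (C : numFieldType) (jC : {rmorphism K -> C}) (n : nat).
Variables (S : set (mxpoly K n)) (P : 'M[K]_n).
Hypotheses (Pu : P \in unitmx) (S_grp : mx_group (zeros jC S))
  (S_det : (zeros jC S `<=` [set x | \det x = 1])%classic)
  (S_conn : zariski_connected (zeros jC S))
  (S_diag : split_by jC P (zeros jC S)).
Variables (R : realType) (iR : {rmorphism K -> R}).
Notation chr := (chars jC S P).
Notation wt := (wt S P iR).
Let PR := map_mx iR P.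
Let PRu : PR \in unitmx. Proof. by rewrite map_unitmx. Qed.

Lemma wt_prescribed (la : 'I_n -> int) : (forall m, chr m -> zdot m la = 0) ->
  exists H, forall k l, wt k l H = (la k - la l)%:~R.
Proof.
move=> laM; exists (dconj PR (\row_i (la i)%:~R)) => k l; rewrite (wt_dconj Pu) ?mxE ?rmorphB //.
apply/(aRP Pu S_grp S_det S_diag iR); exists (\row_i (la i)%:~R) => // m /laM e0.
rewrite (_ : \sum_i _ = (zdot m la)%:~R); first by rewrite e0.
by rewrite /zdot rmorph_sum /=; apply: eq_bigr => i _; rewrite mxE rmorphM.
Qed.

(** Tested on integral cocharacters, the relation between weights becomes one between exponents,
    valid at torus points over any field. *)
Lemma wt_twice (A : fieldType) (t : 'rV[A]_n) k l p q : unit_row t -> (forall m, chr m -> zmono m t = 1) ->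
  wt k l = twice (wt p q) -> t 0 k / t 0 l = (t 0 p / t 0 q) ^+ 2.
Proof.
move=> ut tm e; pose m i := delta_char k l i - delta_char p q i - delta_char p q i.
have cm : chr m.
  apply: (lattice_perp_perp (chars_saturated Pu S_grp S_conn S_diag)) => la laM.
  have [H HE] := wt_prescribed laM; have := congr1 (fun f => f H) e; rewrite /twice !HE mulr2n -rmorphD => /intr_inj e'.
  rewrite /m (zdotBl (fun i => delta_char k l i - delta_char p q i) (delta_char p q)).
  by rewrite (zdotBl (delta_char k l) (delta_char p q)) !zdot_delta e'; ring.
have := tm _ cm; rewrite /m (@zmonoB _ _ (fun i => delta_char k l i - delta_char p q i)) // zmonoB // !zmono_delta //.
have pq0 : t 0 p / t 0 q != 0 by rewrite mulf_neq0 ?invr_eq0.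
by move/(congr1 (fun x => x * (t 0 p / t 0 q) * (t 0 p / t 0 q))); rewrite mul1r !divfK // expr2.
Qed.

Lemma wt_separate k l : wt k l <> (fun=> 0) ->
  exists2 la : 'I_n -> int, (forall m, chr m -> zdot m la = 0) & la k < la l.
Proof.
move=> w0; apply: contrapT => h; apply: w0; apply/(wt_eq0 Pu S_grp S_det S_conn S_diag iR).
apply: (lattice_perp_perp (chars_saturated Pu S_grp S_conn S_diag)) => la laM; rewrite zdot_delta.
apply/eqP; rewrite subr_eq0; apply: contrapT => /negP; rewrite neq_lt => /orP [lt|lt]; apply: h.
  by exists la.
exists (fun i => - la i); last by rewrite ltrN2.
move=> m /laM; rewrite /zdot => e; under eq_bigr do rewrite mulrN.
by rewrite sumrN e oppr0.
Qed.

End WeightArithmetic.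

(* Small powers of one parameter realize finitely many lexicographic inequalities at once. *)
Lemma lex_pos_eval (R : realFieldType) r (I : eqType) (s : seq I) (c : I -> 'I_r -> R) :
  (forall x, x \in s -> exists2 i, 0 < c x i & forall j : 'I_r, (j < i)%N -> c x j = 0) ->
  exists2 e : R, 0 < e & forall x, x \in s -> 0 < \sum_i c x i * e ^+ i.
Proof.
move=> h; have one (x : I) : exists2 d : R, 0 < d <= 1 & x \in s -> forall e, 0 < e <= d -> 0 < \sum_i c x i * e ^+ i.
  have [xs|xs] := boolP (x \in s); last by exists 1; rewrite ?ltr01 ?lexx.
  have [i ci c0] := h x xs; pose N := 1 + \sum_j `|c x j|.
  have N1 : 1 <= N by rewrite lerDl sumr_ge0.
  have N0 : 0 < N := lt_le_trans ltr01 N1.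
  (* Below this bound the leading term [c x i * e ^+ i] exceeds the sum of the later ones, which is
     less than [N * e ^+ i.+1]. *)
  pose d := Num.min 1 (c x i / (N + N)).
  have NN : 0 < N + N by rewrite addr_gt0.
  have d0 : 0 < d by rewrite lt_min ltr01 divr_gt0.
  exists d => [|_ e /andP[e0 ed]]; first by rewrite d0 ge_min lexx.
  have [e1 e2] : e <= 1 /\ e * (N + N) <= c x i.
    by move: ed; rewrite le_min ler_pdivlMr // => /andP[].
  have low j : - (e ^+ i.+1 * `|c x j|) <= (if j == i then 0 else c x j * e ^+ j).
    have [->|ji] := eqVneq j i; first by rewrite oppr_le0 mulr_ge0 // exprn_ge0 // ltW.
    have [/c0 ->|] := ltnP j i; first by rewrite normr0 mulr0 oppr0 mul0r.
    rewrite leq_eqVlt eq_sym (negbTE (_ : j != i :> nat)) //= => ij.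
    rewrite lerNl -mulNr (le_trans (ler_wpM2r _ (ler_norm _))) ?exprn_ge0 ?(ltW e0) // normrN mulrC.
    by rewrite ler_wpM2r // ler_wiXn2l // ltW.
  rewrite (bigD1 i) //= (_ : \sum_(j | j != i) _ = \sum_j (if j == i then 0 else c x j * e ^+ j)); last first.
    by rewrite big_mkcond; apply: eq_bigr => j _; case: eqP.
  apply: lt_le_trans (lerD (lexx _) (ler_sum _ (fun j _ => low j))).
  rewrite sumrN -mulr_sumr subr_gt0 exprSr -mulrA mulrC ltr_pM2r ?exprn_gt0 //.
  apply: lt_le_trans e2; rewrite ltr_pM2l // ltr_pwDl // /N lerDr // ler01 //.
have /choice [d dP] : forall x, exists d : R, 0 < d <= 1 /\ (x \in s -> forall e, 0 < e <= d -> 0 < \sum_i c x i * e ^+ i).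
  by move=> x; have [d h1 h2] := one x; exists d.
have [e e0 eP] : exists2 e : R, 0 < e & forall x, x \in s -> e <= d x.
  elim: s {h one dP} (fun x => (dP x).1) => [|x s IH] h; first by exists 1; rewrite ?ltr01.
  have [e e0 eP] := IH h; have /andP[dx _] := h x.
  exists (Num.min e (d x)) => [|y]; first by rewrite lt_min e0.
  by rewrite inE => /orP [/eqP ->|/eP ey]; rewrite ge_min ?lexx ?orbT // ey.
by exists e => // x xs; apply: (dP x).2 => //; rewrite e0 eP.
Qed.

(** The inverse is a finite geometric series in the nilpotent matrix [1 - v]. *)
Lemma intmx_unip_inv (F : rcfType) (O : convexSubring F) (R : realType) n (gr : 'I_n -> R)
    (v : 'M[F]_n) : graded gr 0 (v - 1%:M) -> intmx O v ->
  exists2 w, intmx O w & v *m w = 1%:M.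
Proof.
move=> gv vi; pose N := 1%:M - v; have gN : graded gr 0 N.
  by move=> k l h; apply: gv; rewrite -opprB mxE oppr_eq0.
have Ni : intmx O N by move=> k l; rewrite mxE [X in _ + X]mxE; apply: csrB; [exact: intmx1|exact: vi].
have tel m : v *m (\sum_(i < m) N ^+ i) = 1%:M - N ^+ m.
  have vE : v = 1%:M - N by rewrite /N subKr.
  elim: m => [|m IH]; first by rewrite big_ord0 mulmx0 mxX0 subrr.
  rewrite big_ord_recr /= mulmxDr IH {1}vE mulmxBl mul1mx -mxXS.
  by rewrite addrA subrK.
exists (\sum_(i < n) N ^+ i); last by rewrite tel (graded_nilpotent gN) subr0.
by apply: intmx_sum => i; apply: intmxX.
Qed.

Section RootLoci.
Variables (K : rcfType) (C : numFieldType) (jC : {rmorphism K -> C}) (n : nat).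
Variables (G S : set (mxpoly K n)) (P : 'M[K]_n) (Pu : P \in unitmx).
Variables (R : realType) (F : rcfType) (iR : {rmorphism K -> R}) (iF : {rmorphism K -> F}).
Variables (O : convexSubring F) (r : nat) (Delta : 'I_r -> functional R n).
Notation wt := (wt S P iR).
Notation chr := (chars jC S P).
Notation GF := (zeros iF G).
Notation intmx := (intmx O).
Notation Tor := (Tor jC S P).
Notation PF := (map_mx iF P).
Notation bp := (base_point iR iF G S Delta O).
Notation AA := (apartment iR iF G S Delta O).
Notation pos := (pos_roots iR G S Delta).
Notation gF := (gF iR iF G S).
Notation nv := (negv O).
Let PFu : PF \in unitmx. Proof. by rewrite map_unitmx. Qed.

Hypotheses (GF_grp : mx_group GF) (AG : forall t : 'rV[F]_n, Tor t -> GF (dconj PF t))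
  (AFP : forall a, AF iF S a <-> exists2 t, Tor t & a = dconj PF t)
  (actE : forall g h, GF g -> GF h -> (actB g bp = actB h bp <-> intmx (invmx h *m g)))
  (chiE : forall k l (t : 'rV[F]_n), Tor t -> chi iR iF S (wt k l) (dconj PF t) = t 0 k / t 0 l)
  (rootE : forall al, root_system iR G S al -> exists k l, al = wt k l)
  (gFsupp : forall al X k l, is_functional iR S al -> gF al X -> (PF *m X *m invmx PF) k l != 0 -> wt k l = al)
  (gradingH : forall c : 'I_r -> R, exists H (gr : 'I_n -> R),
     (forall i, Delta i H = c i) /\ forall k l, wt k l H = gr k - gr l)
  (posG : forall X, (forall al, pos al -> gF al (X al)) -> GF (nilp_exp (\sum_(al \in pos) X al)))
  (pos_fin : finite_set pos)
  (ipf : forall X : 'M[F]_n, intmx X <-> intmx (PF *m X *m invmx PF))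
  (Tor_inv : forall t : 'rV[F]_n, Tor t -> (forall i, t 0 i \in O) -> forall i, (t 0 i)^-1 \in O)
  (twice_tor : forall (t : 'rV[F]_n) k l p q, Tor t -> wt k l = twice (wt p q) -> t 0 k / t 0 l = (t 0 p / t 0 q) ^+ 2)
  (wt_sep : forall k l, wt k l <> (fun=> 0) ->
     exists2 la : 'I_n -> int, (forall m, chr m -> zdot m la = 0) & la k < la l).

Let actBM x y (p : bpoint F n) : actB (x *m y) p = actB x (actB y p) := @actBM _ _ x y p.

Lemma pos_ge0 al H : pos al -> (forall i, 0 < Delta i H) -> 0 < al H.
Proof.
move=> [[_ al0 _] [m mE]] DH.
have [i mi] : exists i, m i != 0%N.
  apply: contrapT => /forallNP h; apply: al0; rewrite mE; apply/funext => H'.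
  by rewrite /comb big1 // => i _; have /negP := h i; rewrite negbK => /eqP ->; rewrite mul0r.
rewrite mE /comb (bigD1 i) //= ltr_pwDl ?mulr_gt0 ?ltr0n ?lt0n // sumr_ge0 // => j _.
by rewrite mulr_ge0 ?ler0n // ltW.
Qed.

(** The matrix of [a^-1 M a] in the coordinates [P], where [a] is [dconj PF t]: entries are rescaled
    by [t_l / t_k]. *)
Definition cj (t : 'rV[F]_n) (M : 'M[F]_n) : 'M[F]_n :=
  diag_mx (\row_i (t 0 i)^-1) *m (PF *m M *m invmx PF) *m diag_mx t.

Lemma cjmE t M k l : cj t M k l = (t 0 k)^-1 * (PF *m M *m invmx PF) k l * t 0 l.
Proof. by rewrite /cj mul_mx_diag mxE mul_diag_mx mxE !mxE. Qed.

Section Tor1.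
Variables (t : 'rV[F]_n) (Tt : Tor t).
Let t0 i : t 0 i != 0. Proof. by rewrite gt_eqF //; case: Tt. Qed.

Let dd : diag_mx t *m diag_mx (\row_i (t 0 i)^-1) = 1%:M.
Proof.
rewrite mulmx_diag -[RHS]diag_const_mx; congr diag_mx; apply/rowP => i.
by rewrite !mxE divff.
Qed.

Let Q := diag_mx (\row_i (t 0 i)^-1) *m PF.
Let Qu : Q \in unitmx.
Proof. by rewrite unitmx_mul PFu andbT; have /mulmx1_unit [] := dd. Qed.

Let cjQ M : cj t M = Q *m M *m invmx Q.
Proof.
suff -> : invmx Q = invmx PF *m diag_mx t by rewrite /cj /Q !mulmxA.
apply: (can_inj (mulKmx Qu)); rewrite mulmxV // /Q !mulmxA.
rewrite -(mulmxA (diag_mx (\row_i (t 0 i)^-1)) PF) mulmxV // mulmx1.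
by apply/esym/mulmx1C.
Qed.

Lemma cjD M N : cj t (M + N) = cj t M + cj t N.
Proof. by rewrite !cjQ mulmxDr mulmxDl. Qed.

Lemma cjB M N : cj t (M - N) = cj t M - cj t N.
Proof. by rewrite !cjQ mulmxBr mulmxBl. Qed.

Lemma cj1 : cj t 1%:M = 1%:M.
Proof. by rewrite cjQ mulmx1 mulmxV. Qed.

Lemma cjM M N : cj t (M *m N) = cj t M *m cj t N.
Proof.
have gen (Q' U V : 'M[F]_n) : Q' \in unitmx ->
    Q' *m (U *m V) *m invmx Q' = Q' *m U *m invmx Q' *m (Q' *m V *m invmx Q').
  by move=> Q'u; rewrite !mulmxA mulmxKV.
by rewrite !cjQ; apply: gen.
Qed.

Lemma cj_prod (I : Type) (s : seq I) (us : I -> 'M[F]_n) :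
  cj t (\prod_(i <- s) us i) = \prod_(i <- s) cj t (us i).
Proof.
elim: s => [|i s IH]; first by rewrite !big_nil; apply: cj1.
by rewrite !big_cons -IH; exact: cjM.
Qed.

Lemma cj_exp X : cj t (nilp_exp X) = nilp_exp (cj t X).
Proof. by rewrite !cjQ nilp_exp_conj. Qed.

Lemma cj_supp al X k l : is_functional iR S al -> gF al X -> cj t X k l != 0 -> wt k l = al.
Proof.
move=> fal gX; rewrite cjmE !mulf_eq0 !negb_or => /andP[/andP[_ h] _].
exact: gFsupp h.
Qed.

(** On the support of a single weight the rescaling is by one constant, the inverse of the character
    value. *)
Lemma int_cj c al X : c != 0 -> is_functional iR S al -> gF al X ->
  (forall k l, wt k l = al -> t 0 k / t 0 l = c) -> intmx (c^-1 *: X) <-> intmx (cj t X).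
Proof.
move=> c0 fal gX hc; rewrite ipf.
have e k l : (PF *m (c^-1 *: X) *m invmx PF) k l = cj t X k l.
  rewrite -scalemxAr -scalemxAl mxE cjmE.
  have [e0|/(gFsupp fal gX) /hc <-] := eqVneq ((PF *m X *m invmx PF) k l) 0; first by rewrite e0 !(mulr0, mul0r).
  by rewrite invf_div; ring.
by split=> h k l; have := h k l; rewrite e.
Qed.

Lemma int_cj_root al X : root_system iR G S al -> gF al X ->
  leN (mx_negv O X) (nv (chi iR iF S al (dconj PF t))) <-> intmx (cj t X).
Proof.
move=> ral gX; have fal : is_functional iR S al by case: ral.
have [p [q alE]] := rootE ral; set c := chi _ _ _ _ _.
have cE k l : wt k l = al -> t 0 k / t 0 l = c by move=> e; rewrite /c -e chiE.
have c0 : c != 0 by rewrite -(cE p q) // mulf_neq0 ?invr_eq0.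
by rewrite mx_negv_le //; apply: int_cj gX _.
Qed.

Lemma int_cj_twice al X : root_system iR G S al -> gF (twice al) X ->
  leN (halfN (mx_negv O X)) (nv (chi iR iF S al (dconj PF t))) <-> intmx (cj t X).
Proof.
move=> ral gX; have fal : is_functional iR S al by case: ral.
have [p [q alE]] := rootE ral; set c := chi _ _ _ _ _.
have cE : t 0 p / t 0 q = c by rewrite /c alE chiE.
have c0 : c != 0 by rewrite -cE mulf_neq0 ?invr_eq0.
rewrite halfN_le // mx_negv_le ?expf_neq0 //; apply: (@int_cj _ (twice al)) => //.
- by rewrite expf_neq0.
- exact: twice_functional.
- by move=> k l e; rewrite -cE; apply: twice_tor; rewrite // -alE.
Qed.

(** If [u] sends the point of [t] to that of [s], the unit diagonal of [u] gives [t_i / s_i] in O;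
    these quotients have product 1, so they are units and the two points coincide. *)
Lemma apt_fix (gr : 'I_n -> R) u : GF u -> graded gr 0 (PF *m u *m invmx PF - 1%:M) ->
  [/\ AA (actB u (actB (dconj PF t) bp)) <-> intmx (cj t u) &
      intmx (cj t u) -> actB u (actB (dconj PF t) bp) = actB (dconj PF t) bp].
Proof.
move=> Gu gu; have [_ _ GM GV] := GF_grp.
have Ga := AG Tt; have Gua : GF (u *m dconj PF t) by apply: GM.
have entry (s : 'rV[F]_n) : unit_row s -> forall k l,
    (PF *m (invmx (dconj PF s) *m (u *m dconj PF t)) *m invmx PF) k l =
    (s 0 k)^-1 * (PF *m u *m invmx PF) k l * t 0 l.
  move=> us k l; rewrite dconjV //.
  have -> : PF *m (dconj PF (\row_i (s 0 i)^-1) *m (u *m dconj PF t)) *m invmx PF =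
    diag_mx (\row_i (s 0 i)^-1) *m (PF *m u *m invmx PF) *m diag_mx t.
    rewrite -(dconjK PFu (\row_i (s 0 i)^-1)) -(dconjK PFu t); move: (dconj _ _) (dconj _ _) => a b.
    by rewrite !mulmxA mulmxKV // mulmxKV.
  by rewrite mul_mx_diag mxE mul_diag_mx mxE !mxE.
have diag1 k : (PF *m u *m invmx PF) k k = 1.
  have := graded_diag k (lexx 0) gu; rewrite mxE [X in _ + X]mxE [X in _ - X]mxE eqxx => /eqP.
  by rewrite subr_eq0 => /eqP.
have fixI : intmx (cj t u) -> actB u (actB (dconj PF t) bp) = actB (dconj PF t) bp.
  move=> h; rewrite -actBM; apply/(actE Gua Ga)/ipf => k l; rewrite entry // -cjmE.
  exact: h.
split=> //; split=> [[b /AFP [s Ts ->]]|h]; last first.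
  by rewrite fixI //; exists (dconj PF t) => //; apply/AFP; exists t.
have s0 i : s 0 i != 0 by rewrite gt_eqF //; case: Ts.
rewrite -actBM => /(actE Gua (AG Ts)) /ipf h.
have hts i : t 0 i / s 0 i \in O.
  by have := h i i; rewrite entry // diag1 mulr1 mulrC.
pose w : 'rV[F]_n := \row_i (t 0 i / s 0 i).
have Tw : Tor w.
  split=> [i|m cm]; first by rewrite mxE divr_gt0 //; [case: Tt|case: Ts].
  have [_ tm] := Tt; have [_ sm] := Ts.
  have -> : w = hadamard t (\row_i (s 0 i)^-1) by apply/rowP => i; rewrite !mxE.
  rewrite zmonoM tm // mul1r; have e : hadamard s (\row_i (s 0 i)^-1) = const_mx 1.
    by apply/rowP => i; rewrite !mxE divff.
  by have := congr1 (zmono m) e; rewrite zmonoM zmono1 sm // mul1r.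
have hst i : s 0 i / t 0 i \in O.
  by have := Tor_inv Tw _ i; rewrite mxE invf_div; apply=> j; rewrite mxE.
move=> k l; have := h k l; rewrite entry // cjmE => /(csrM (hst k)).
by rewrite !mulrA (mulrC (s 0 k)) mulfK.
Qed.

End Tor1.

(** Half-apartments are described through some representative of a point; root values agree on all
    representatives. *)
Lemma chi_rep al t s : root_system iR G S al -> Tor t -> Tor s ->
  actB (dconj PF t) bp = actB (dconj PF s) bp ->
  leN (nv (chi iR iF S al (dconj PF t))) (nv (chi iR iF S al (dconj PF s))).
Proof.
move=> /rootE [k [l ->]] Tt Ts /(actE (AG Tt) (AG Ts)) /ipf h.
have s0 i : s 0 i != 0 by rewrite gt_eqF //; case: Ts.
have t0 i : t 0 i != 0 by rewrite gt_eqF //; case: Tt.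
pose w : 'rV[F]_n := \row_i (t 0 i / s 0 i).
have wE : invmx (dconj PF s) *m dconj PF t = dconj PF w.
  by rewrite dconjV // dconjM //; congr dconj; apply/rowP => i; rewrite !mxE mulrC.
have Ow i : w 0 i \in O by have := h i i; rewrite wE dconjK // mxE eqxx.
have Tw : Tor w.
  split=> [i|m cm]; first by rewrite mxE divr_gt0 //; [case: Tt|case: Ts].
  have [_ tm] := Tt; have [_ sm] := Ts.
  have : zmono m (hadamard s w) = zmono m t.
    by congr zmono; apply/rowP => i; rewrite !mxE mulrC divfK.
  by rewrite zmonoM sm // mul1r tm.
rewrite !chiE // negv_le ?mulf_neq0 ?invr_eq0 //.
have -> : t 0 k / t 0 l / (s 0 k / s 0 l) = w 0 k * (w 0 l)^-1.
  by rewrite !mxE; field; rewrite ?s0 ?t0.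
by apply: csrM; [exact: Ow|exact: Tor_inv].
Qed.

Section Unipotent.
Variables (X : functional R n -> 'M[F]_n) (hX : forall al, pos al -> gF al (X al)).
Let N := \sum_(al \in pos) X al.
Let u := nilp_exp N.

Let fun_pos al : pos al -> is_functional iR S al. Proof. by case=> -[]. Qed.

(** Distinct roots have disjoint supports, so each entry of the sum sees one root only. *)
Lemma sum_entry t k l : Tor t -> (pos (wt k l) -> cj t N k l = cj t (X (wt k l)) k l) /\
  (~ pos (wt k l) -> cj t N k l = 0).
Proof.
move=> Tt; have [sq [sqU sqP sqE]] := fsum_list pos_fin.
have cjN : cj t N = \sum_(al <- sq) cj t (X al).
  rewrite /N sqE; elim: (sq) => [|al s IH]; last by rewrite !big_cons cjD // IH.
  by rewrite !big_nil; have := cjB Tt 0 0; rewrite !subrr.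
have vanish al : al \in sq -> wt k l <> al -> cj t (X al) k l = 0.
  move=> /sqP pal ne; apply/eqP; apply: contra_notT ne => h.
  exact: cj_supp (fun_pos pal) (hX pal) h.
rewrite cjN summxE; split=> h; last first.
  by rewrite big_seq big1 // => al sal; apply: vanish => // e; apply: h; rewrite e; apply/sqP.
rewrite (bigD1_seq (wt k l)) //=; last exact/sqP.
by rewrite big_seq_cond big1 ?addr0 // => al /andP[sal ne]; apply: vanish => // e; rewrite e eqxx in ne.
Qed.

(** An [H] on which all simple roots equal 1 supplies the grading; positive roots are positive on
    it. *)
Lemma graded_unip : exists gr : 'I_n -> R, forall t, Tor t -> graded gr 0 (cj t N).
Proof.
have [H [gr [DH wH]]] := gradingH (fun=> 1); exists gr => t Tt k l h.
rewrite -wH; apply: pos_ge0 => [|i]; last by rewrite DH ltr01.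
by apply: contrapT => np; have [_ e] := sum_entry k l Tt; rewrite e ?eqxx in h.
Qed.

Let Tor1 : Tor (const_mx 1 : 'rV[F]_n).
Proof. by split=> [i|m _]; [rewrite mxE ltr01|exact: zmono1]. Qed.

Let cj_const M : cj (const_mx 1) M = PF *m M *m invmx PF.
Proof. by apply/matrixP => k l; rewrite cjmE !mxE invr1 mul1r mulr1. Qed.

Lemma unip_apt t : Tor t -> 
  [/\ AA (actB u (actB (dconj PF t) bp)) <-> intmx (cj t u),
      intmx (cj t u) -> actB u (actB (dconj PF t) bp) = actB (dconj PF t) bp &
      intmx (cj t u) <-> forall al, pos al -> intmx (cj t (X al))].
Proof.
move=> Tt; have [gr grN] := graded_unip.
have [] := @apt_fix t Tt gr u (posG hX).
  by rewrite -cj_const cj_exp //; apply: nilp_exp_graded => //; apply: grN.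
split=> //; rewrite cj_exp // intmx_nilp_exp; last exact: grN.
split=> h.
  move=> al pal k l; have [e|/eqP ne] := pselect (wt k l = al); last first.
    suff -> : cj t (X al) k l = 0 by exact: csr0.
    by apply/eqP; apply: contraNT ne => /(cj_supp (fun_pos pal) (hX pal)) ->.
  by have [e1 _] := sum_entry k l Tt; rewrite -e -e1 ?e.
move=> k l; have [e1 e2] := sum_entry k l Tt; have [p|np] := pselect (pos (wt k l)).
  by rewrite e1 //; apply: h.
by rewrite e2 //; exact: csr0.
Qed.

Lemma locusE (k : functional R n -> LambdaN O) :
  (forall t, Tor t -> intmx (cj t u) <->
     forall al, pos al -> leN (k al) (nv (chi iR iF S al (dconj PF t)))) ->
  [set p | AA p /\ AA (actB u p)]%classic = root_locus iR iF G S Delta k.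
Proof.
move=> h; apply/seteqP; split=> p.
  move=> [[_ /AFP [t Tt ->] ->] up]; exists (dconj PF t); split=> //; first by apply/AFP; exists t.
  by apply/(h _ Tt); have [[e _] _ _] := unip_apt Tt; apply: e.
move=> [_ [/AFP [t Tt ->] -> hk]]; have [[_ e] _ _] := unip_apt Tt; split.
  by exists (dconj PF t) => //; apply/AFP; exists t.
by apply: e; apply/(h _ Tt).
Qed.

Lemma fixed_locus : exists k : functional R n -> LambdaN O, [set p | AA p /\ AA (actB u p)]%classic = root_locus iR iF G S Delta k.
Proof.
exists (fun al => mx_negv O (X al)); apply: locusE => t Tt; have [_ _ ->] := unip_apt Tt.
by split=> h al pal; [apply/(int_cj_root Tt (proj1 pal) (hX pal))|apply/(int_cj_root Tt (proj1 pal) (hX pal))]; apply: h.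
Qed.

Lemma fixed_half_apartments : exists (m : nat) (be : 'I_m -> functional R n) (l : 'I_m -> Lambda O),
  (forall i, root_system iR G S (be i)) /\
  [set p | AA p /\ actB u p = p]%classic = [set p | AA p /\
    forall i, half_apartment iR iF G S Delta (be i) (l i) p]%classic.
Proof.
have [sq0 [_ sqP0 _]] := fsum_list pos_fin.
(* Roots whose component is 0 have value minus infinity and impose no condition, so they are
   dropped. *)
pose sq := [seq al <- sq0 | mx_negv O (X al) != None].
exists (size sq), (fun i => nth (fun=> 0) sq i), (fun i => odflt 0 (mx_negv O (X (nth (fun=> 0) sq i)))).
have sqP i : (i < size sq)%N -> pos (nth (fun=> 0) sq i) /\
    mx_negv O (X (nth (fun=> 0) sq i)) = Some (odflt 0 (mx_negv O (X (nth (fun=> 0) sq i)))).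
  move=> /(mem_nth (fun=> 0)); rewrite mem_filter => /andP[h /sqP0]; split=> //.
  by case: (mx_negv _ _) h.
split=> [i|]; first by have [[]] := sqP i (ltn_ord i).
apply/seteqP; split=> p [Ap hp]; split=> //.
  move=> i; have [pal e] := sqP i (ltn_ord i); move: hp; have [_ /AFP [t Tt ->] ->] := Ap => hp.
  exists (dconj PF t); split=> //; first by apply/AFP; exists t.
  rewrite -e; apply/(int_cj_root Tt (proj1 pal) (hX pal)).
  have [[+ _] _ [+ _]] := unip_apt Tt; move=> e1 e2; apply: e2 pal; apply: e1; rewrite hp.
  by exists (dconj PF t) => //; apply/AFP; exists t.
move: hp; have [_ /AFP [t Tt ->] ->] := Ap => hp.
have [_ fixu [_ iu]] := unip_apt Tt; apply: fixu; apply: iu => al pal.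
apply/(int_cj_root Tt (proj1 pal) (hX pal)); case E : (mx_negv O (X al)) => [v|] //.
have sal : al \in sq by rewrite mem_filter E /=; apply/sqP0.
have lt : (index al sq < size sq)%N by rewrite index_mem.
have ie : nth (fun=> 0) sq (Ordinal lt) = al by exact: nth_index.
have [_ [/AFP [s Ts ->] pE]] := hp (Ordinal lt); rewrite ie E => le.
exact: (leN_trans le (chi_rep (proj1 pal) Ts Tt (esym pE))).
Qed.

(** A torus element [c ^ la] with [la k < la l] multiplies a nonzero entry of [N] by a positive
    power of [c]; for [c] large the result leaves the proper subring O. *)
Lemma faithful_unip : (forall p, AA p -> actB u p = p) -> u = 1%:M.
Proof.
move=> hfix; suff N0 : N = 0 by rewrite /u N0 (@nilp_exp0 F R n (fun=> 0)).
have all t : Tor t -> forall k l, cj t N k l \in O.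
  move=> Tt k l; have At : AA (actB (dconj PF t) bp) by exists (dconj PF t) => //; apply/AFP; exists t.
  have [[e _] _ _] := unip_apt Tt; have [gr grN] := graded_unip.
  suff : intmx (cj t N) by [].
  by rewrite -(intmx_nilp_exp _ (grN _ Tt)) -cj_exp //; apply: e; rewrite hfix.
suff c0 : PF *m N *m invmx PF = 0.
  have := congr1 (fun M => invmx PF *m M *m PF) c0.
  by rewrite !mulmxA mulmxKV // mulVmx // mul1mx mulmx0 mul0mx.
apply/matrixP => k l; rewrite [RHS]mxE; apply/eqP; apply: contraT => Nkl.
have [pw|npw] := pselect (pos (wt k l)); last first.
  by have [_ e] := sum_entry k l Tor1; move: Nkl; rewrite -cj_const e ?eqxx.
have [la laM lakl] : exists2 la : 'I_n -> int, (forall m, chr m -> zdot m la = 0) & la k < la l.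
  by apply: wt_sep; case: pw => -[].
have [y yO] := csr_proper O.
(* [c] is at least 1, so its positive powers dominate it, and [c] times the norm of [x] is at least
   that of [y], which is outside O. *)
set x := _ k l in Nkl; pose c := `|y / x| + 1.
have c1 : 1 <= c by rewrite lerDr.
have cgt : 0 < c := lt_le_trans ltr01 c1.
pose t := cochar la c; have Tt : Tor t.
  split=> [i|m cm]; first by rewrite mxE exprz_gt0.
  by rewrite zmono_cochar ?gt_eqF // laM.
have := all t Tt k l; rewrite cjmE -/x => h; case/negP: yO.
have eE : (t 0 k)^-1 * x * t 0 l = c ^ (la l - la k) * x.
  by rewrite !mxE expfzDr ?gt_eqF // -invr_expz; ring.
have [e eN] : exists e : nat, la l - la k = e.+1%:Z.
  have d0 : 0 < la l - la k by rewrite subr_gt0.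
  by case E : (la l - la k) d0 => [[|e]|e] // _; exists e.
rewrite eE eN -csr_norm -exprnP in h; apply: csr_le h _.
rewrite normrM ger0_norm ?exprn_ge0 ?(ltW cgt) //.
have x0 : 0 < `|x| by rewrite normr_gt0.
rewrite -ler_pdivrMr // -normf_div; apply: le_trans (_ : c <= _); first by rewrite lerDl.
by rewrite -[leLHS]expr1 ler_weXn2l.
Qed.

Section Factors.
Variables (m : nat) (al : 'I_m -> functional R n) (us : 'I_m -> 'M[F]_n).
Hypothesis dec : root_decomposition iR iF G S Delta u al us.

Let alpos i : pos (al i). Proof. by have [-> _ _ _ _] := dec; exists i. Qed.
Let ralpos i : root_system iR G S (al i). Proof. exact: (proj1 (alpos i)). Qed.
Let fal i : is_functional iR S (al i). Proof. exact: fun_pos. Qed.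
Let f2al i : is_functional iR S (twice (al i)).
Proof. exact: twice_functional. Qed.

(** The lexicographic order is realized by real values: simple roots take the values [e ^+ i] for a
    small [e]. *)
Lemma sep_element : exists H (gr : 'I_n -> R), [/\ forall k l, wt k l H = gr k - gr l,
  forall i, 0 < al i H & forall i j : 'I_m, (i < j)%N -> al j H < al i H].
Proof.
have [_ gt _ _ _] := dec.
have /choice [c cP] : forall ij : 'I_m * 'I_m, exists c, (ij.1 < ij.2)%N ->
    (fun H => al ij.1 H - al ij.2 H) = comb Delta c /\
    exists2 i, 0 < c i & forall j : 'I_r, (j < i)%N -> c j = 0.
  by move=> [i j] /=; case: (ltnP i j) => [/gt [c hc]|_]; [exists c|exists (fun=> 0)].
pose s := [seq ij : 'I_m * 'I_m <- enum {: 'I_m * 'I_m} | (ij.1 < ij.2)%N].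
have [ij|e e0 eP] := @lex_pos_eval R r _ s c.
  by rewrite mem_filter => /andP[/cP []].
have [H [gr [DH wH]]] := gradingH (fun i => e ^+ i).
exists H, gr; split=> // [i|i j ij]; first by apply: pos_ge0 => // k; rewrite DH exprn_gt0.
have ijs : (i, j) \in s by rewrite mem_filter mem_enum ij.
have [/(congr1 (fun f => f H)) /= cE _] := cP (i, j) ij.
rewrite -subr_gt0 cE /comb; have := eP _ ijs; congr (0 < _); apply: eq_bigr => k _.
by rewrite DH.
Qed.

(** The parts of weight [al i] and [twice (al i)] have disjoint supports, so integrality of their
    sum splits. *)
Lemma factor_int t i (X1 X2 : 'M[F]_n) : Tor t -> gF (al i) X1 -> gF (twice (al i)) X2 ->
  intmx (cj t (nilp_exp (X1 + X2))) <->
  leN (maxN (mx_negv O X1) (halfN (mx_negv O X2))) (nv (chi iR iF S (al i) (dconj PF t))).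
Proof.
move=> Tt g1 g2; rewrite maxN_le (int_cj_root Tt (ralpos i) g1) (int_cj_twice Tt (ralpos i) g2).
have [H [gr [wH aH _]]] := sep_element.
have supp k l : cj t (X1 + X2) k l != 0 -> wt k l = al i \/ wt k l = twice (al i).
  rewrite cjD // mxE => h; have [c0|/(cj_supp (fal i) g1)] := eqVneq (cj t X1 k l) 0; last by left.
  by right; rewrite c0 add0r in h; apply: (cj_supp (f2al i) g2 h).
have gX : graded gr 0 (cj t (X1 + X2)).
  move=> k l /supp; rewrite -wH => -[] ->; first exact: aH.
  by rewrite /twice pmulrn_lgt0.
rewrite cj_exp // (intmx_nilp_exp _ gX) cjD //; split=> [h|[h1 h2]]; last exact: intmxD.
have ne : al i <> twice (al i).
  move=> e; have := congr1 (fun f => f H) e; rewrite /twice mulr2n => e'; have := aH i; lra.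
split=> k l; have := h k l; rewrite mxE.
  have [-> _|c0] := eqVneq (cj t X1 k l) 0; first exact: csr0.
  have [->|c1] := eqVneq (cj t X2 k l) 0; first by rewrite addr0.
  by case: ne; exact: etrans (esym (cj_supp (fal i) g1 c0)) (cj_supp (f2al i) g2 c1).
have [-> _|c0] := eqVneq (cj t X2 k l) 0; first exact: csr0.
have [->|c1] := eqVneq (cj t X1 k l) 0; first by rewrite add0r.
by case: ne; exact: etrans (esym (cj_supp (fal i) g1 c1)) (cj_supp (f2al i) g2 c0).
Qed.

(** [phi] is read off from a representation selected by [xget]; the integrality criterion holds for
    each representation. *)
Lemma factor_phi t i : Tor t -> intmx (cj t (us i)) <->
  leN (phi iR iF G S O (al i) (us i)) (nv (chi iR iF S (al i) (dconj PF t))).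
Proof.
move=> Tt; have [_ _ /(_ i) [X1 [X2 [g1 g2 uE]]] _ _] := dec.
rewrite /phi; set A := (X in xget _ X).
have : A !=set0 by exists (maxN (mx_negv O X1) (halfN (mx_negv O X2))); exists X1, X2.
move=> [a Aa]; have := xgetI None Aa; set b := xget _ _ => -[Z1 [Z2 [h1 h2 e ->]]].
by rewrite [in X in X <-> _]e; apply: factor_int.
Qed.

(** The last factor [V] of the list has the least grade [eta], and the product [B] of the others
    differs from 1 only in grades above [eta]. On the support of the logarithm of [V], integrality
    of [B V] then forces that of [V]; an integral unipotent [V] has an integral inverse, so [B] is
    integral and induction applies. *)
Lemma factors_int t (q : seq 'I_m) : Tor t -> pairwise (fun i j : 'I_m => (i < j)%N) q ->
  intmx (cj t (\prod_(i <- q) us i)) <-> forall i, i \in q -> intmx (cj t (us i)).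
Proof.
move=> Tt; have [_ _ Uus _ nocancel] := dec; have [H [gr [wH aH aHlt]]] := sep_element.
have int_prod (s : seq 'I_m) : (forall i, i \in s -> intmx (cj t (us i))) -> intmx (cj t (\prod_(i <- s) us i)).
  rewrite cj_prod // => h; rewrite big_seq; elim/big_ind: _ => //; first exact: intmx1.
  by move=> x y; apply: intmxM.
move=> pq; split=> [|h]; last exact: int_prod.
elim/last_ind: q pq => [//|q j IH]; rewrite pairwise_rcons => /andP[/allP qj pq].
set eta := al j H; have eta0 : 0 < eta := aH j.
pose v i : 'M[F]_n := if i \in q then cj t (us i) else 1%:M.
have BE : cj t (\prod_(i <- q) us i) = \prod_(i <- q) v i.
  by rewrite cj_prod // big_seq [RHS]big_seq; apply: eq_bigr => i iq; rewrite /v iq.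
have -> : cj t (\prod_(i <- rcons q j) us i) = \prod_(i <- q) v i *m cj t (us j).
  by rewrite -BE !cj_prod // -cats1 big_cat big_seq1.
have supp i X1 X2 : gF (al i) X1 -> gF (twice (al i)) X2 -> forall k l,
    cj t (X1 + X2) k l != 0 -> wt k l = al i \/ wt k l = twice (al i).
  move=> g1 g2 k l; rewrite cjD // mxE => h.
  have [c0|/(cj_supp (fal i) g1)] := eqVneq (cj t X1 k l) 0; last by left.
  by right; rewrite c0 add0r in h; apply: (cj_supp (f2al i) g2 h).
have grE k l i : wt k l = al i \/ wt k l = twice (al i) ->
    gr k - gr l = al i H \/ gr k - gr l = al i H + al i H.
  by rewrite -wH => -[] ->; [left|right; rewrite /twice mulr2n].
have rep i : i \in q -> exists X1 X2, [/\ gF (al i) X1, gF (twice (al i)) X2,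
    v i = nilp_exp (cj t (X1 + X2)) & graded gr eta (cj t (X1 + X2))].
  move=> iq; have [X1 [X2 [g1 g2 uE]]] := Uus i; exists X1, X2; split=> //.
    by rewrite /v iq uE cj_exp.
  move=> k l /(supp _ _ _ g1 g2) /grE; have lt := aHlt _ _ (qj _ iq).
  by case=> -> //; rewrite (lt_le_trans lt) // lerDl ltW.
have gv i : graded gr eta (v i - 1%:M).
  have [/rep [X1 [X2 [_ _ -> gX]]]|nq] := boolP (i \in q); last by rewrite /v (negbTE nq) subrr; apply: graded0.
  exact: nilp_exp_graded (ltW eta0) gX.
have [gB B0] := graded_prod q (ltW eta0) gv.
(* Grade [eta + eta] is the delicate case: an earlier factor reaches the weight [twice (al j)] only
   if this is its own root, and by the last clause of [root_decomposition] that factor is then 1, or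
   the last factor has no part of weight [twice (al j)]. *)
have [X1 [X2 [g1 uE BW]]] : exists X1 X2, [/\ forall k l, cj t (X1 + X2) k l != 0 ->
      gr k - gr l = eta \/ gr k - gr l = eta + eta, us j = nilp_exp (X1 + X2) &
    forall k l, cj t (X1 + X2) k l != 0 -> (\prod_(i <- q) v i - 1%:M) k l = 0].
  have [[X1 g1 uE]|no] := pselect (exists2 X1, gF (al j) X1 & us j = nilp_exp X1).
    have d1 k l : cj t (X1 + 0) k l != 0 -> gr k - gr l = eta.
      by rewrite addr0 => /(cj_supp (fal j) g1) e; rewrite -wH e.
    exists X1, 0; split=> [k l /d1|//|k l /d1 e]; [by left|by rewrite addr0|].
    by apply/eqP; apply: contraT => /gB; rewrite e ltxx.
  have [X1 [X2 [g1 g2 uE]]] := Uus j; exists X1, X2; split=> // [k l /(supp _ _ _ g1 g2) /grE //|k l h].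
  have [w1|w2] := supp _ _ _ g1 g2 k l h.
    by apply/eqP; apply: contraT => /gB; rewrite -wH w1 ltxx.
  have kl : gr k - gr l = eta + eta by rewrite -wH w2 /twice mulr2n.
  apply: B0 => [|i]; first by rewrite kl.
  have [iq|nq] := boolP (i \in q); last by rewrite /v (negbTE nq) subrr mxE.
  have [Z1 [Z2 [z1 z2 vE gZ]]] := rep i iq.
  have lt := aHlt _ _ (qj _ iq).
  rewrite vE (nilp_exp_first (ltW eta0) gZ) ?kl //; apply/eqP; apply: contraT => h0.
  have [e|e] := supp _ _ _ z1 z2 k l h0; last first.
    have := ltrD lt lt; rewrite -/eta -kl -wH e /twice mulr2n ltxx //.
  have [u1|] := nocancel j i (etrans (esym e) w2); last by [].
  have : (v i - 1%:M) k l = cj t (Z1 + Z2) k l by rewrite vE (nilp_exp_first (ltW eta0) gZ) ?kl.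
  by rewrite /v iq u1 cj1 // subrr mxE => e0; move: h0; rewrite -e0 eqxx.
have W0 : graded gr 0 (cj t (X1 + X2)).
  by move=> k l /g1 [] ->; rewrite ?addr_gt0.
have Wge k l : cj t (X1 + X2) k l != 0 -> eta <= gr k - gr l.
  by move=> /g1 [] ->; rewrite // lerDl ltW.
set B := \prod_(i <- q) v i in gB B0 BW BE *; set V := cj t (us j).
have VE : V = nilp_exp (cj t (X1 + X2)) by rewrite /V uE cj_exp.
move=> BV; have Vi : intmx V.
  rewrite VE; apply/(intmx_nilp_exp O W0); apply: (intmx_nilp_exp_support W0) => k l kl.
  (* On this support the entry of [B - 1] vanishes, and so does that of [(B - 1) (V - 1)], whose
     grades exceed [eta + eta]. *)
  rewrite -VE; have E : V = B *m V - ((B - 1%:M) + (B - 1%:M) *m (V - 1%:M)).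
    rewrite mulmxBl !mulmxBr !mul1mx !mulmx1; apply/matrixP => a b; rewrite !mxE; ring.
  have -> : V k l = (B *m V) k l - ((B - 1%:M) k l + ((B - 1%:M) *m (V - 1%:M)) k l).
    by rewrite [in LHS]E mxE [X in _ + X]mxE [X in _ - X]mxE.
  rewrite BW // add0r; apply: csrB; first exact: BV.
  rewrite mxE big1 ?csr0 // => p _.
  apply/eqP; apply: contraT; rewrite mulf_eq0 negb_or => /andP[/gB lt1].
  rewrite VE => /(nilp_exp_wgraded eta0 Wge) le2.
  have := ltr_leD lt1 le2; rewrite addrA subrK => lt3.
  have lt4 : gr k - gr l <= eta + eta by have [->|->] := g1 k l kl; rewrite // lerDl ltW.
  by move: (lt_le_trans lt3 lt4); rewrite ltxx.
have [w wi Vw] : exists2 w, intmx w & V *m w = 1%:M.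
  by apply: (intmx_unip_inv (gr := gr)) Vi; rewrite VE; apply: nilp_exp_graded.
have Bi : intmx B by rewrite -[B]mulmx1 -Vw mulmxA; apply: intmxM.
move=> i; rewrite mem_rcons inE => /orP [/eqP -> //|iq].
by apply: IH => //; rewrite BE.
Qed.

Lemma factor_locus (k : functional R n -> LambdaN O) :
  (forall i, k (al i) = phi iR iF G S O (al i) (us i)) ->
  [set p | AA p /\ AA (actB u p)]%classic = root_locus iR iF G S Delta k.
Proof.
move=> kE; apply: locusE => t Tt; have [posE _ _ uE _] := dec.
have ie : index_enum 'I_m = enum 'I_m by rewrite [index_enum _]unlock -enumT.
have -> : cj t u = cj t (\prod_(i <- enum 'I_m) us i) by rewrite uE ie.
rewrite factors_int //; last first.
  have := sorted_pairwise (leT := ltn) ltn_trans (iota 0 m); rewrite iota_ltn_sorted -val_enum_ord pairwise_map.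
  by move=> /esym ->.
split=> h; last by move=> i _; apply/(factor_phi i Tt); rewrite -kE; apply: h.
move=> be; rewrite posE => -[i _ <-]; rewrite kE; apply/(factor_phi i Tt); apply: h.
by rewrite mem_enum.
Qed.

End Factors.
End Unipotent.
End RootLoci.

(** * From the hypotheses over K to the building over F *)

Section Assembly.
Variables (K : rcfType) (C : numClosedFieldType) (jC : {rmorphism K -> C}).
Variables (R : realType) (C' : fieldType) (j : {rmorphism R -> C'}) (i0 : C') (re im : C' -> R).
Hypotheses (i0i0 : i0 * i0 = -1) (reim : forall z, z = j (re z) + i0 * j (im z))
  (reE : forall a b, re (j a + i0 * j b) = a) (imE : forall a b, im (j a + i0 * j b) = b).
Variables (iR : {rmorphism K -> R}) (th : {rmorphism C -> C'}).
Hypotheses (thj : forall x, th (jC x) = j (iR x))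
  (thC : forall z, th z^* = j (re (th z)) - i0 * j (im (th z)))
  (jCr : forall x, (jC x)^* = jC x).
Variables (F : rcfType) (iF : {rmorphism K -> F}) (O : convexSubring F).
Variables (n : nat) (G S : set (mxpoly K n)) (P : 'M[K]_n).
Hypotheses (G_grp : mx_group (zeros jC G)) (GT : forall g, zeros jC G g -> zeros jC G g^T)
  (G_det : (zeros jC G `<=` [set x | \det x = 1])%classic)
  (G_conn : zariski_connected (zeros jC G)) (G_ss : semisimple (zeros jC G))
  (GC_mul : forall x y, zeros (j \o iR) G x -> zeros (j \o iR) G y -> zeros (j \o iR) G (x *m y))
  (SG : (zeros jC S `<=` zeros jC G)%classic) (S_split : split_torus_over jC S)
  (S_max : forall T, split_torus_over jC T -> (zeros jC T `<=` zeros jC G)%classic ->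
     (zeros jC S `<=` zeros jC T)%classic -> zeros jC T = zeros jC S)
  (Pu : P \in unitmx) (S_diag : split_by jC P (zeros jC S))
  (S_sym : forall s, zeros jC S s -> s = s^T).
Notation wt := (wt S P iR).
Notation chr := (chars jC S P).
Notation PF := (map_mx iF P).
Hypothesis chiH : forall k l (t : 'rV[F]_n), Tor jC S P t ->
  chi iR iF S (wt k l) (dconj PF t) = t 0 k / t 0 l.
Variables (r : nat) (Delta : 'I_r -> functional R n).
Hypothesis basis : root_basis iR G S Delta.

Let S_grp : mx_group (zeros jC S). Proof. by case: S_split. Qed.
Let S_det : (zeros jC S `<=` [set x | \det x = 1])%classic. Proof. by case: S_split. Qed.
Let S_conn : zariski_connected (zeros jC S). Proof. by case: S_split. Qed.
Let id0 : {rmorphism K -> K} := idfun.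

Let zm (I : set (mxpoly K n)) (x : 'M[K]_n) : zeros jC I (map_mx jC x) <-> zeros id0 I x.
Proof. exact: (zeros_map id0 jC I x). Qed.

Let GK_det : (zeros id0 G `<=` [set x | \det x = 1])%classic.
Proof.
move=> x /zm /G_det /=; rewrite det_map_mx -[RHS](rmorph1 jC) => /fmorph_inj; exact.
Qed.

Let GK_grp : mx_group (zeros id0 G).
Proof.
have [Gu G1 GM GV] := G_grp; split=> [x /zm /Gu /=|||].
- by rewrite map_unitmx.
- by apply/zm; rewrite map_mx1.
- by move=> x y /zm hx /zm hy; apply/zm; rewrite map_mxM; apply: GM.
- by move=> x /zm hx; apply/zm; rewrite map_invmx; apply: GV.
Qed.

Let GK_tr x : zeros id0 G x -> zeros id0 G x^T.
Proof. by move=> /zm hx; apply/zm; rewrite -map_trmx; apply: GT. Qed.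

Let GR_grp := mx_group_transfer GK_grp GK_det iR.
Let GF_grp := mx_group_transfer GK_grp GK_det iF.

(** Complex conjugation fixes the coefficients of the equations, which lie in K. *)
Let Gct g : zeros jC G g -> zeros jC G (map_mx Num.conj g^T).
Proof.
move=> /GT Gg; have := (zeros_map jC (Num.conj : {rmorphism C -> C}) G g^T).2 Gg.
by have -> : (Num.conj \o jC : K -> C) = jC by apply/funext => x; exact: jCr.
Qed.

Let gD X Y (gX : gR iR G X) (gY : gR iR G Y) : gR iR G (X + Y) :=
  gRD i0i0 reim reE imE GR_grp GC_mul gX gY.
Let gZ (c : R) X (gX : gR iR G X) : gR iR G (c *: X) := gRZ c gX.
Let gconj x X (Gx : zeros iR G x) (gX : gR iR G X) : gR iR G (x *m X *m invmx x) := gR_conj GR_grp Gx gX.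
Let GTR x (Gx : zeros iR G x) : zeros iR G x^T := tr_transfer GK_tr Gx.
Let gtr X (gX : gR iR G X) : gR iR G X^T := gR_tr GTR gX.

Let SposG (L : rcfType) (iL : {rmorphism K -> L}) x : Spos S P iL x -> zeros iL G x.
Proof.
move=> [Sx _]; move: x Sx; apply: zeros_sub_transfer => x Sx.
by apply/zm; apply: SG; apply/zm.
Qed.

Let Spos_sym (L : rcfType) (iL : {rmorphism K -> L}) x : Spos S P iL x -> x^T = x.
Proof.
move=> [Sx _]; pose T : set (mxpoly K n) := [set p | exists i k, p = genmx K n i k - genmx K n k i]%classic.
have TE (A : fieldType) (f : {rmorphism K -> A}) (y : 'M[A]_n) : zeros f T y <-> y^T = y.
  split=> [h|e p [i [k ->]]]; last by rewrite evD evN !ev_genmx -[in X in X - _]e mxE subrr.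
  apply/matrixP => i k; rewrite mxE; apply/eqP; rewrite -subr_eq0 -!(ev_genmx f) -evN -evD.
  by apply/eqP; apply: h; exists k, i.
apply/(TE L iL); move: x Sx; apply: zeros_sub_transfer => x Sx; apply/(TE K id0).
have /zm/S_sym := Sx; rewrite map_trmx => /map_mx_inj <- //.
Qed.

(** Maximality of S is known over K; its consequence for symmetric elements is first-order and moves
    to R. The list [bad] holds the coordinate pairs at which an entry has to vanish. *)
Let sym_comm w : zeros iR G w -> w^T = w ->
  (forall k l, (map_mx iR P *m w *m invmx (map_mx iR P)) k l != 0 -> chr (delta_char k l)) ->
  Spos S P iR (w *m w).
Proof.
move=> Gw wT wc; have [Gf GfP] := zeros_finite G; have [D DE] := Spos_formula S P.
pose M (k : nat) := MVar K n k; pose Neg (t : mterm K n) := MMul (MConst (- 1%:M)) t.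
pose T := [seq genmx K n ij.1 ij.2 | ij <- enum {: 'I_n * 'I_n}].
have TP (L : rcfType) (i' : {rmorphism K -> L}) (z : 'M[L]_n) :
    (forall p, p \in T -> ev i' p z = 0) <-> z = 0.
  split=> [h|-> p /mapP [ij _ ->]]; last by rewrite ev_genmx mxE.
  apply/matrixP => i k; rewrite -(ev_genmx i' i k z) [RHS]mxE; apply: h.
  by apply/mapP; exists (i, k); rewrite ?mem_enum.
pose bad := [seq kl : 'I_n * 'I_n <- enum {: 'I_n * 'I_n} | ~~ `[< chr (delta_char kl.1 kl.2) >]].
pose f := FAll 0 (FImp (FAnd (FZeros Gf (M 0)) (FAnd (FZeros T (MAdd (MTr (M 0)) (Neg (M 0))))
   (FConj bad (fun kl => FZero (conj_genmx P kl.1 kl.2) (M 0))))) (FSa D (MMul (M 0) (M 0)))) : mform K n.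
have fP (L : rcfType) (i' : {rmorphism K -> L}) : msat i' (fun=> 0) f <-> forall x, zeros i' G x -> x^T = x ->
    (forall k l, (map_mx i' P *m x *m invmx (map_mx i' P)) k l != 0 -> chr (delta_char k l)) -> Spos S P i' (x *m x).
  have badP x : msat i' (upd (fun=> 0) 0 x) (FConj bad (fun kl => FZero (conj_genmx P kl.1 kl.2) (M 0%N))) <->
      forall k l, (map_mx i' P *m x *m invmx (map_mx i' P)) k l != 0 -> chr (delta_char k l).
    rewrite msatConj; split=> [h k l kl|h [k l]].
      apply: contrapT => nc; move/eqP: kl; apply.
      have := h (k, l); rewrite msatE /= ev_conj_genmx; apply.
      by rewrite mem_filter mem_enum andbT; apply/asboolPn.
    rewrite mem_filter => /andP[/asboolPn nc _]; rewrite msatE /= ev_conj_genmx.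
    by apply/eqP; apply: contraT => /h.
  have symP (x : 'M[L]_n) : x^T + map_mx i' (- 1%:M) *m x = 0 <-> x^T = x.
    rewrite map_mxN map_mx1 mulNmx mul1mx; split=> [/eqP|->]; last by rewrite subrr.
    by rewrite subr_eq0 => /eqP.
  rewrite /f msatE; split=> h x.
    move=> Gx xT xc; have := h x; rewrite msatE !msatAnd badP !msatZeros TP -GfP msatSa DE; apply.
    by split=> //; split=> //; apply/symP.
  rewrite msatE !msatAnd badP !msatZeros TP -GfP msatSa DE => -[Gx [/symP xT xc]].
  exact: h.
have : msat id0 (fun=> 0) f.
  apply/fP => x Gx xT xc; have := xc; rewrite map_mx_id // => xc'.
  have [Sx px] := symmetric_commuting G_grp G_det SG S_split S_max Pu S_diag Gx xT xc'.
  by split=> // k; rewrite map_mx_id.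
by move/(transfer_closed iR)/fP; apply.
Qed.

Let gAd x X (Sx : Spos S P iR x) (gX : gR iR G X) : gR iR G (x *m X *m invmx x) := gconj (SposG Sx) gX.

Lemma unipotent_fixators (X : functional R n -> 'M[F]_n) (u := nilp_exp (\sum_(al \in pos_roots iR G S Delta) X al))
    (AA := apartment iR iF G S Delta O) :
  (forall al, pos_roots iR G S Delta al -> gF iR iF G S al (X al)) ->
  [/\ exists k : functional R n -> LambdaN O,
        [set p | AA p /\ AA (actB u p)]%classic = root_locus iR iF G S Delta k,
      exists (m : nat) (be : 'I_m -> functional R n) (l : 'I_m -> Lambda O),
        (forall i, root_system iR G S (be i)) /\
        [set p | AA p /\ actB u p = p]%classic = [set p | AA p /\
                  forall i, half_apartment iR iF G S Delta (be i) (l i) p]%classic,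
      forall (m : nat) (al : 'I_m -> functional R n) (us : 'I_m -> 'M[F]_n)
             (k : functional R n -> LambdaN O),
        root_decomposition iR iF G S Delta u al us ->
        (forall i, k (al i) = phi iR iF G S O (al i) (us i)) ->
        [set p | AA p /\ AA (actB u p)]%classic = root_locus iR iF G S Delta k &
      (forall p, AA p -> actB u p = p) -> u = 1%:M].
Proof.
move=> hX.
have root_fin := finite_root_system Pu S_grp S_det S_diag gD gZ gAd.
have rootE al : root_system iR G S al -> exists k l, al = wt k l.
  by move/(root_systemP Pu S_grp S_det S_diag gD gZ gAd) => [_ [Y [p [q [_ _ e]]]]]; exists p, q.
have [kk [ll DE]] := root_basis_wt Pu S_grp S_det S_diag gD gZ gconj (@SposG R iR) basis.
have kakR g : zeros iR G g -> exists k k' H, [/\ zeros iR G k, zeros iR G k', k *m k^T = 1%:M,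
    k' *m k'^T = 1%:M & [/\ aR iR S H, forall i, 0 <= wt (kk i) (ll i) H & g = k *m mx_exp H *m k']].
  move=> Gg; have [k [k' [H [h1 h2 h3 h4 [h5 h6 h7]]]]] := cartan_decomposition_real Pu S_grp S_det S_conn S_diag
     gD gZ gconj gtr GR_grp GTR (@SposG R iR) (@Spos_sym R iR) sym_comm basis Gg.
  by exists k, k', H; split=> //; split=> // i; rewrite -DE.
have kak g : zeros iF G g -> exists k k' t, [/\ zeros iF G k, zeros iF G k', k *m k^T = 1%:M, k' *m k'^T = 1%:M &
    [/\ Tor jC S P t, forall i, t 0 (ll i) <= t 0 (kk i) & g = k *m dconj PF t *m k']].
  move=> Gg; have [k [k' [t [h1 h2 h3 h4 [h5 h6 h7 h8]]]]] :=
    cartan_decomposition_transfer Pu S_grp S_det S_diag kakR Gg.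
  by exists k, k', t.
have ToP t : Tor jC S P t -> Spos S P iF (dconj PF t).
  by move=> [t0 tm]; apply/(SposP Pu S_grp S_det S_diag); exists t.
have AG t (Tt : Tor jC S P t) := SposG (ToP t Tt).
have A_sym t (Tt : Tor jC S P t) := Spos_sym (ToP t Tt).
have separate := roots_separate i0i0 reim reE imE thj thC jCr G_grp GT G_det G_conn G_ss Gct GR_grp GC_mul SG
  S_split Pu S_diag S_sym.
have GF_det : (zeros iF G `<=` [set x | \det x = 1])%classic 
  by move=> x Gx; exact: (det_transfer GK_det Gx).
have actE := actB_eq Pu S_grp S_det S_diag O GF_grp GF_det A_sym chiH rootE root_fin DE kak separate.
have AFP := AF_Tor Pu S_grp S_det S_diag iR iF.
have gFsupp al Y k l := @gF_support K C jC n G S P Pu S_grp S_det S_diag R F iR iF al Y k l.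
have gradingH (c : 'I_r -> R) : exists H (gr : 'I_n -> R),
     (forall i, Delta i H = c i) /\ forall k l, wt k l H = gr k - gr l.
  have [H aH HD] := Delta_prescribed Pu S_grp S_det S_diag gD gZ gconj (@SposG R iR) basis c.
  have /(aRP Pu S_grp S_det S_diag iR) [h _ HE] := aH.
  exists H, (fun k => h 0 k); split=> // k l.
  by move: aH; rewrite HE => aH; rewrite (wt_dconj Pu).
have pos_fin : finite_set (pos_roots iR G S Delta) by apply: sub_finite_set root_fin => al [].
have gRsum (I : Type) (s : seq I) (f : I -> 'M[R]_n) : (forall i, gR iR G (f i)) -> gR iR G (\sum_(i <- s) f i).
  by move=> h; apply: (gR_sum i0i0 reim reE imE GR_grp GC_mul).
have posG Y : (forall al, pos_roots iR G S Delta al -> gF iR iF G S al (Y al)) ->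
    zeros iF G (nilp_exp (\sum_(al \in pos_roots iR G S Delta) Y al)).
  have [H [gr [HD wH]]] := gradingH (fun=> 1).
  apply: (nilp_exp_transfer Pu S_grp S_det S_diag gRsum (gr := gr) _ pos_fin gFsupp) => k l p.
  by rewrite -subr_gt0 -wH; apply: (pos_ge0 p) => i; rewrite HD ltr01.
have ipf := intmx_pf Pu iR iF O.
have Ti (t : 'rV[F]_n) (Tt : Tor jC S P t) := Tor_inv Pu S_det (O := O) Tt.
have twice_tor (t : 'rV[F]_n) k l p q : Tor jC S P t -> wt k l = twice (wt p q) ->
    t 0 k / t 0 l = (t 0 p / t 0 q) ^+ 2.
  move=> [t0 tm]; apply: (wt_twice Pu S_grp S_det S_conn S_diag _ tm) => i.
  by rewrite gt_eqF.
have wt_sep k l := @wt_separate K C jC n S P Pu S_grp S_det S_conn S_diag R iR k l.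
split.
- exact: (fixed_locus Pu GF_grp AG AFP actE chiH rootE gFsupp gradingH posG pos_fin ipf Ti hX).
- exact: (fixed_half_apartments Pu GF_grp AG AFP actE chiH rootE gFsupp gradingH posG pos_fin ipf Ti hX).
- move=> m al us k dec kE; exact: (factor_locus Pu GF_grp AG AFP actE chiH rootE gFsupp gradingH posG pos_fin ipf Ti twice_tor hX dec kE).
- exact: (faithful_unip Pu GF_grp AG AFP actE gFsupp gradingH posG pos_fin ipf Ti wt_sep hX).
Qed.

End Assembly.

(** * The embedding of K[i] into R[i] *)

Section ComplexMap.
Variables (K : rcfType) (R : rcfType) (f : {rmorphism K -> R}).

Definition complex_map (z : K[i]) : R[i] := (f (complex.Re z) +i* f (complex.Im z))%C.

Fact complex_map_zmod : zmod_morphism complex_map.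
Proof.
move=> [a b] [c d]; apply/eqP; rewrite eq_complex /complex_map /=.
by rewrite !rmorphB !eqxx.
Qed.

Fact complex_map_monoid : monoid_morphism complex_map.
Proof.
split=> [|[a b] [c d]]; apply/eqP; rewrite eq_complex /complex_map /=; first by rewrite rmorph1 rmorph0 !eqxx.
by rewrite !(rmorphB, rmorphD, rmorphM) !eqxx.
Qed.

HB.instance Definition _ := GRing.isZmodMorphism.Build K[i] R[i] complex_map complex_map_zmod.
HB.instance Definition _ := GRing.isMonoidMorphism.Build K[i] R[i] complex_map complex_map_monoid.

Lemma complex_mulii : ('i%C : R[i]) * 'i%C = -1.
Proof. by rewrite -expr2 sqr_i. Qed.

Lemma complex_split (z : R[i]) : z = real_complex R (complex.Re z) + 'i%C * real_complex R (complex.Im z).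
Proof. by case: z => a b; apply/eqP; rewrite eq_complex /= !(mul0r, mul1r, mulr0, subr0, add0r, addr0) !eqxx. Qed.

Lemma complex_ReE (a b : R) : complex.Re (real_complex R a + 'i%C * real_complex R b) = a.
Proof. by rewrite /= !(mul0r, mul1r, mulr0, subr0, add0r, addr0). Qed.

Lemma complex_ImE (a b : R) : complex.Im (real_complex R a + 'i%C * real_complex R b) = b.
Proof. by rewrite /= !(mul0r, mul1r, mulr0, subr0, add0r, addr0). Qed.

Lemma complex_map_real x : complex_map (real_complex K x) = real_complex R (f x).
Proof. by apply/eqP; rewrite eq_complex /= rmorph0 !eqxx. Qed.

Lemma conj_real_complex (x : K) : (real_complex K x)^* = real_complex K x.
Proof. by apply/eqP; rewrite eq_complex /= oppr0 !eqxx. Qed.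

Lemma complex_map_conj (z : K[i]) : complex_map z^* =
  real_complex R (complex.Re (complex_map z)) - 'i%C * real_complex R (complex.Im (complex_map z)).
Proof.
case: z => a b; apply/eqP; rewrite eq_complex /=.
by rewrite rmorphN; apply/andP; split; apply/eqP; ring.
Qed.

End ComplexMap.

Theorem proposition5p10
  (K : rcfType) (R : realType) (F : rcfType)
  (iR : {rmorphism K -> R}) (iF : {rmorphism K -> F})
  (F_nonarch : non_archimedean F) (O : convexSubring F)
  (n : nat) (G S : set (mxpoly K n))
  (G_alg : algebraic_subgroup_SL G)
  (G_connected : zariski_connected (geom G))
  (G_semisimple : semisimple (geom G))
  (G_self_adjoint : self_adjoint G)
  (S_max_split : maximal_split_torus G S)
  (S_symmetric : forall s, geom S s -> s = s^T)
  (r : nat) (Delta : 'I_r -> functional R n)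
  (Delta_basis : root_basis iR G S Delta)
  (u : 'M[F]_n) (u_UF : UF iR iF G S Delta u) :
  let AA := apartment iR iF G S Delta O in
  let fixed := [set p | AA p /\ actB u p = p] in
  [/\
      exists k : functional R n -> LambdaN O,
        [set p | AA p /\ AA (actB u p)] = root_locus iR iF G S Delta k,
      exists (m : nat) (be : 'I_m -> functional R n) (l : 'I_m -> Lambda O),
        (forall i, root_system iR G S (be i)) /\
        fixed = [set p | AA p /\
                  forall i, half_apartment iR iF G S Delta (be i) (l i) p],
      forall (m : nat) (al : 'I_m -> functional R n) (us : 'I_m -> 'M[F]_n)
             (k : functional R n -> LambdaN O),
        root_decomposition iR iF G S Delta u al us ->
        (forall i, k (al i) = phi iR iF G S O (al i) (us i)) ->
        [set p | AA p /\ AA (actB u p)] = root_locus iR iF G S Delta k &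
      (forall p, AA p -> actB u p = p) -> u = 1%:M].
Proof.
have [[S_alg S_conn [P Pu S_diag]] SG S_max] := S_max_split.
have [G_grp G_det] := G_alg; have [S_grp S_det] := S_alg.
have S_split : split_torus_over (real_complex K) S by split=> //; exists P.
have Smax T : split_torus_over (real_complex K) T -> zeros (real_complex K) T `<=` zeros (real_complex K) G ->
    zeros (real_complex K) S `<=` zeros (real_complex K) T -> zeros (real_complex K) T = zeros (real_complex K) S.
  by move=> [h1 h2 h3 h4]; apply: S_max.
have [X [hX ->]] := u_UF.
have chiH k l (t : 'rV[F]_n) : Tor (real_complex K) S P t ->
    chi iR iF S (wt S P iR k l) (dconj (map_mx iF P) t) = t 0 k / t 0 l.
  by move=> [t0 tm]; exact: (chi_wt Pu S_alg S_diag).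
exact: (@unipotent_fixators K K[i] (real_complex K) R R[i] (real_complex R) 'i%C (@complex.Re R) (@complex.Im R)
  (@complex_mulii R) (@complex_split R) (@complex_ReE R) (@complex_ImE R) iR (complex_map iR : {rmorphism K[i] -> R[i]})
  (complex_map_real iR) (complex_map_conj iR) (@conj_real_complex K) F iF O n G S P
  G_grp G_self_adjoint G_det G_connected G_semisimple (complex_mul_transfer G_grp (iota := iR))
  SG S_split Smax Pu S_diag S_symmetric chiH r Delta Delta_basis X hX).
Qed.
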